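(* Let $\lambda\in\mathbb{R}$ and $0<m<\infty$ be constants and let $(M^3,g)$ be a complete, connected Riemannian manifold. If there exists a positive function $u\in\mathcal{W}_{\lambda,3+m}(M,g)$ and $(M^3,g)$ is not Einstein, then $$\dim\mathcal{W}_{\lambda,3+m}(M,g)\le 2 .$$ Moreover, if equality holds, then $$M=B^2/\Gamma\times_f F^1,$$ where (1) $B$ is a manifold possibly with boundary, $\Gamma=\pi_1(M)$, and $f$ is a nonnegative function in $\mathcal{W}_{\lambda,2+(m+1)}(B/\Gamma,g_{B/\Gamma})$ with $f^{-1}(0)=\partial(B/\Gamma)$; (2) $f$ spans $\mathcal{W}_{\lambda,2+(m+1)}(B/\Gamma,g_{B/\Gamma})$; (3) $F^1$ is a space form with $\dim\mathcal{W}_{\mu_{B/\Gamma}(f),1+m}(F,g_F)=2$; (4) $\mathcal{W}_{\lambda,3+m}(M,g)=\{fv:\ v\in\mathcal{W}_{\mu_{B/\Gamma}(f),1+m}(F,g_F)\}$.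
   Context: For a Riemannian manifold $(N^k,h)$ of dimension $k$ and constants $\kappa\in\mathbb{R}$, $0<q<\infty$, set $$\mathcal{W}_{\kappa,k+q}(N,h)=\left\{w\in C^\infty(N):\ \nabla^2w=\frac{w}{q}(Ric-\kappa h)\right\},$$ a vector space of functions (which may change sign), where the Hessian $\nabla^2$ and the Ricci tensor $Ric$ are those of $h$ (so $Ric=0$ if $k=1$). In the subscript $k+q$, the first summand is the dimension and the second is the parameter $q$; thus $\mathcal{W}_{\lambda,2+(m+1)}$ on a surface uses $q=m+1$, and $\mathcal{W}_{\mu,1+m}$ on a $1$-manifold uses $q=m$. For $w\in\mathcal{W}_{\kappa,k+q}(N,h)$ the quantity $\mu_N(w)=w\Delta w+(q-1)|\nabla w|^2+\kappa w^2$ is constant. In particular, for $f\in\mathcal{W}_{\lambda,2+(m+1)}(B/\Gamma,g_{B/\Gamma})$, $\mu_{B/\Gamma}(f)=f\Delta f+m|\nabla f|^2+\lambda f^2$. The notation $N\times_f F$ denotes the warped product with metric $g_N+f^2g_F$. Superscripts on manifolds denote dimensions. *)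

(* Defs.v *)
From HB Require Import structures.
From mathcomp Require Import all_boot all_order all_algebra.
From mathcomp Require Import all_classical all_reals all_analysis.

Set Implicit Arguments.
Unset Strict Implicit.
Unset Printing Implicit Defensive.

Import Order.TTheory GRing.Theory Num.Theory.
Import numFieldNormedType.Exports.

Local Open Scope classical_set_scope.
Local Open Scope ring_scope.

Section LocalCalculus.
Context {R : realType}.

(* One-sided at boundary points: only increments staying in A count.  For A
   open this is the usual partial derivative 'D_(delta_mx 0 i) f x. *)
Definition pderiv n (A : set 'rV[R]_n) (i : 'I_n) (f : 'rV[R]_n -> R)
    (x : 'rV[R]_n) : R :=
  lim ((fun h : R => h^-1 * (f (x + h *: delta_mx 0 i) - f x)) @
       within [set h : R | A (x + h *: delta_mx 0 i)] 0^').

Definition iter_partial n (s : seq 'I_n) (f : 'rV[R]_n -> R)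
    : 'rV[R]_n -> R :=
  foldr (fun i g x => 'D_(delta_mx 0 i) g x) f s.

(* C^oo on a possibly non-open set: local existence of C^oo extensions. *)
Definition smooth_on n (A : set 'rV[R]_n) (f : 'rV[R]_n -> R) : Prop :=
  forall x, A x -> exists (U : set 'rV[R]_n) (g : 'rV[R]_n -> R),
    [/\ open U, U x,
        forall s y, U y -> differentiable (iter_partial s g) y &
        forall y, U y -> A y -> g y = f y].

Definition jacobian_in k n (A : set 'rV[R]_k) (phi : 'rV[R]_k -> 'rV[R]_n)
    (x : 'rV[R]_k) : 'M[R]_(k, n) :=
  \matrix_(i, j) pderiv A i (fun y => phi y 0 j) x.

(* phi is smooth and pulls the metric G' back to the metric G on A. *)
Definition isometric_in k n (A : set 'rV[R]_k) (phi : 'rV[R]_k -> 'rV[R]_n)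
    (G : 'rV[R]_k -> 'M[R]_k) (G' : 'rV[R]_n -> 'M[R]_n) : Prop :=
  (forall j, smooth_on A (fun x => phi x 0 j)) /\
  (forall x, A x ->
     jacobian_in A phi x *m G' (phi x) *m (jacobian_in A phi x)^T = G x).

Section Tensors.
Context {n : nat} (A : set 'rV[R]_n) (G : 'rV[R]_n -> 'M[R]_n).

(* Gamma^k_{ij} *)
Definition christoffel (k i j : 'I_n) (x : 'rV[R]_n) : R :=
  2^-1 * \sum_(l < n) invmx (G x) k l *
    (pderiv A i (fun y => G y j l) x + pderiv A j (fun y => G y i l) x
     - pderiv A l (fun y => G y i j) x).

(* R^l_{kij}, with R(d_i, d_j) d_k = sum_l R^l_{kij} d_l and
   R(X,Y) = [nabla_X, nabla_Y] - nabla_[X,Y]. *)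
Definition riemann (l k i j : 'I_n) (x : 'rV[R]_n) : R :=
  pderiv A i (christoffel l j k) x - pderiv A j (christoffel l i k) x
  + \sum_(a < n) (christoffel l i a x * christoffel a j k x
                  - christoffel l j a x * christoffel a i k x).

(* Ric(Y,Z) = tr (X |-> R(X,Y)Z); positive on round spheres. *)
Definition ricci (x : 'rV[R]_n) : 'M[R]_n :=
  \matrix_(j, k) \sum_(i < n) riemann i k i j x.

Definition hessian (w : 'rV[R]_n -> R) (x : 'rV[R]_n) : 'M[R]_n :=
  \matrix_(i, j) (pderiv A i (pderiv A j w) x
                  - \sum_(k < n) christoffel k i j x * pderiv A k w x).

Definition laplacian (w : 'rV[R]_n -> R) (x : 'rV[R]_n) : R :=
  \tr (invmx (G x) *m hessian w x).

Definition grad_sqnorm (w : 'rV[R]_n -> R) (x : 'rV[R]_n) : R :=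
  let dw := \row_i pderiv A i w x in (dw *m invmx (G x) *m dw^T) 0 0.

Definition metric_tensor (x : 'rV[R]_n) : Prop :=
  (G x)^T = G x /\
  forall v : 'rV[R]_n, v != 0 -> 0 < (v *m G x *m v^T) 0 0.

End Tensors.

(* { x | 0 <= x_0 } (for n = 0 there is no coordinate x_0). *)
Definition half_space n : set 'rV[R]_n :=
  [set x | forall i : 'I_n, i = 0%N :> nat -> 0 <= x 0 i].

End LocalCalculus.

Arguments half_space {R} n.

(* Only the values of cmap on cdom and of cinv on ccod are meaningful. *)
Record chart (R : realType) (M : topologicalType) (n : nat) := Chart {
  cdom : set M;
  ccod : set 'rV[R]_n;
  cmap : M -> 'rV[R]_n;
  cinv : 'rV[R]_n -> M }.

Record is_chart (R : realType) (M : topologicalType) (n : nat)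
    (c : chart R M n) : Prop := IsChart {
  chart_open_dom : open (cdom c);
  chart_cod : exists2 O : set 'rV[R]_n, open O &
    ccod c = O \/ ccod c = O `&` half_space n;
  chart_map : forall p, cdom c p -> ccod c (cmap c p);
  chart_inv : forall x, ccod c x -> cdom c (cinv c x);
  chart_mapK : forall p, cdom c p -> cinv c (cmap c p) = p;
  chart_invK : forall x, ccod c x -> cmap c (cinv c x) = x;
  chart_map_cts : {within cdom c, continuous (cmap c)};
  chart_inv_cts : {within ccod c, continuous (cinv c)} }.

(* Riemannian n-manifold, possibly with boundary; [metric c x] is the matrix
   (g_ij) at the point with coordinates x in the chart c.  Taking the isometry
   condition on coordinate changes includes their smoothness and the
   transformation law of the g_ij. *)
Record rmanifold (R : realType) (n : nat) := RManifold {
  space :> topologicalType;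
  atlas : set (chart R space n);
  metric : chart R space n -> 'rV[R]_n -> 'M[R]_n;
  rm_hausdorff : hausdorff_space space;
  rm_second_countable : @second_countable space;
  rm_chart : forall c, atlas c -> is_chart c;
  rm_cover : forall p : space, exists2 c, atlas c & cdom c p;
  rm_metric : forall c, atlas c ->
    forall x, ccod c x -> metric_tensor (metric c) x;
  rm_metric_smooth : forall c, atlas c ->
    forall i j, smooth_on (ccod c) (fun x => metric c x i j);
  rm_transition : forall c c', atlas c -> atlas c' ->
    isometric_in [set x | ccod c x /\ cdom c' (cinv c x)]
      (fun x => cmap c' (cinv c x)) (metric c) (metric c') }.

Section Geometry.
Context {R : realType}.

Definition boundary n (N : rmanifold R n) : set N :=
  [set p | exists2 c, atlas c & cdom c p /\ ~ (ccod c)° (cmap c p)].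
Arguments boundary {n} N.

Definition smooth_fun n (N : rmanifold R n) (w : N -> R) : Prop :=
  forall c, atlas c -> smooth_on (ccod c) (w \o cinv c).

(* p is joined to q by a piecewise C^1 curve of length L; the curve is a
   concatenation of pieces each of which lies in one chart. *)
Inductive curve_length n (N : rmanifold R n) : N -> N -> R -> Prop :=
| curve_length0 p : curve_length p p 0
| curve_lengthS p L (c : chart R N n) (g : R -> 'rV[R]_n) :
    atlas c ->
    (forall t, 0 <= t <= 1 -> ccod c (g t)) ->
    (forall t, derivable g t 1) -> continuous (derive1 g) ->
    curve_length p (cinv c (g 0)) L ->
    curve_length p (cinv c (g 1))
      (L + \int[lebesgue_measure]_(t in `[0, 1])
             Num.sqrt ((derive1 g t *m metric c (g t) *m (derive1 g t)^T) 0 0)).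

(* +oo when p and q lie in different components. *)
Definition rdist n (N : rmanifold R n) (p q : N) : \bar R :=
  ereal_inf [set L%:E | L in [set L | curve_length p q L]].

Definition rcomplete n (N : rmanifold R n) : Prop :=
  forall x : nat -> N,
    (forall e : R, 0 < e -> exists n0 : nat, forall i j : nat,
       (n0 <= i)%N -> (n0 <= j)%N -> (rdist (x i) (x j) < e%:E)%E) ->
    exists l : N, forall e : R, 0 < e -> exists n0 : nat, forall i : nat,
       (n0 <= i)%N -> (rdist (x i) l < e%:E)%E.

Definition einstein n (N : rmanifold R n) : Prop :=
  exists rho : R, forall c, atlas c -> forall x, ccod c x ->
    ricci (ccod c) (@metric R n N c) x = rho *: metric c x.

(* R(X,Y)Z = K (<Y,Z> X - <X,Z> Y); void for n = 1. *)
Definition constant_curvature n (N : rmanifold R n) : Prop :=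
  exists K : R, forall c, atlas c -> forall x, ccod c x ->
    forall l k i j : 'I_n,
      riemann (ccod c) (@metric R n N c) l k i j x =
      K * (metric c x j k * (l == i)%:R - metric c x i k * (l == j)%:R).

Definition space_form n (N : rmanifold R n) : Prop :=
  [/\ boundary N = set0, connected [set: N], rcomplete N &
      constant_curvature N].

(* The space W_{kappa, n+q}(N). *)
Definition Wspace n (N : rmanifold R n) (kappa q : R) : set (N -> R) :=
  [set w | smooth_fun w /\
    forall c, atlas c -> forall x, ccod c x ->
      hessian (ccod c) (@metric R n N c) (w \o cinv c) x =
      (w (cinv c x) / q) *:
        (ricci (ccod c) (@metric R n N c) x - kappa *: metric c x)].
Arguments Wspace {n} N kappa q.

(* w Delta w + (q - 1) |grad w|^2 + kappa w^2 is the constant mu. *)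
Definition mu_const n (N : rmanifold R n) (kappa q : R) (w : N -> R) (mu : R)
    : Prop :=
  forall c, atlas c -> forall x, ccod c x ->
    w (cinv c x) * laplacian (ccod c) (@metric R n N c) (w \o cinv c) x
    + (q - 1) * grad_sqnorm (ccod c) (@metric R n N c) (w \o cinv c) x
    + kappa * w (cinv c x) ^+ 2 = mu.

(* The linear subspace V of T -> R has a basis with d elements. *)
Definition has_dim (T : Type) (V : set (T -> R)) (d : nat) : Prop :=
  exists b : 'I_d -> T -> R,
    [/\ forall i, V (b i),
        forall a : 'I_d -> R,
          (forall t, \sum_(i < d) a i * b i t = 0) -> forall i, a i = 0 &
        forall w, V w -> exists a : 'I_d -> R,
          forall t, w t = \sum_(i < d) a i * b i t].

(* Smooth, metric preserving; a local isometry when k = n. *)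
Definition isometric_map k n (N : rmanifold R k) (M : rmanifold R n)
    (phi : N -> M) : Prop :=
  continuous phi /\
  forall c c', atlas c -> atlas c' ->
    isometric_in [set x | ccod c x /\ cdom c' (phi (cinv c x))]
      (fun x => cmap c' (phi (cinv c x)))
      (@metric R k N c) (@metric R n M c').

Definition quotient_map (S T : topologicalType) (phi : S -> T) : Prop :=
  (forall y, exists x, phi x = y) /\
  (forall V : set T, open V <-> open (phi @^-1` V)).

(* M = N x_f F through Phi: the fibre over a zero of f is collapsed to a
   point, and elsewhere Phi pulls g_M back to g_N + f^2 g_F. *)
Definition warped_product k l (N : rmanifold R k) (f : N -> R)
    (F : rmanifold R l) (M : rmanifold R (k + l)) (Phi : N * F -> M) : Prop :=
  [/\ quotient_map Phi,
      forall b y b' y', Phi (b, y) = Phi (b', y') <->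
        b = b' /\ (f b = 0 \/ y = y') &
      forall (c : chart R N k) (d : chart R F l) (e : chart R M (k + l)),
        atlas c -> atlas d -> atlas e ->
        isometric_in
          [set z | [/\ ccod c (lsubmx z), ccod d (rsubmx z),
                       f (cinv c (lsubmx z)) != 0 &
                       cdom e (Phi (cinv c (lsubmx z), cinv d (rsubmx z)))]]
          (fun z => cmap e (Phi (cinv c (lsubmx z), cinv d (rsubmx z))))
          (fun z => block_mx (metric c (lsubmx z)) 0
             0 (f (cinv c (lsubmx z)) ^+ 2 *: metric d (rsubmx z)))
          (metric e)].

(* Loops are functions R -> M of which only the restriction to [0, 1]
   matters. *)
Definition is_loop (M : topologicalType) (x0 : M) (a : R -> M) : Prop :=
  [/\ {within `[0, 1], continuous a}, a 0 = x0 & a 1 = x0].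

Definition loop_homotopic (M : topologicalType) (x0 : M) (a b : R -> M)
    : Prop :=
  exists H : R * R -> M,
    [/\ {within `[0, 1] `*` `[0, 1], continuous H},
        forall t, 0 <= t <= 1 -> H (0, t) = a t /\ H (1, t) = b t &
        forall s, 0 <= s <= 1 -> H (s, 0) = x0 /\ H (s, 1) = x0].

Definition loop_concat (M : topologicalType) (a b : R -> M) : R -> M :=
  fun t => if t <= 2^-1 then a (2 * t) else b (2 * t - 1).

(* An action of the group pi_1(M, x0) on X, given on representatives: it is
   constant on homotopy classes of loops. *)
Definition pi1_action (M : topologicalType) (x0 : M) (X : Type)
    (act : (R -> M) -> X -> X) : Prop :=
  [/\ forall a b, is_loop x0 a -> is_loop x0 b -> loop_homotopic x0 a b ->
        forall x, act a x = act b x,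
      forall x, act (fun=> x0) x = x &
      forall a b, is_loop x0 a -> is_loop x0 b ->
        forall x, act (loop_concat a b) x = act a (act b x)].

(* N = B / pi_1(M, x0) as Riemannian manifolds, with projection p, for a free
   and properly discontinuous action by isometries. *)
Definition pi1_quotient (M : topologicalType) (x0 : M) n (B N : rmanifold R n)
    (act : (R -> M) -> B -> B) (p : B -> N) : Prop :=
  [/\ pi1_action x0 act /\
      (forall a, is_loop x0 a -> isometric_map (act a)),
      forall x : B, exists U : set B, [/\ open U, U x &
        forall a, is_loop x0 a -> (exists2 y, U y & U (act a y)) ->
          loop_homotopic x0 a (fun=> x0)],
      quotient_map p,
      forall x y, p x = p y <-> exists2 a, is_loop x0 a & act a x = y &
      isometric_map p].

End Geometry.

Arguments boundary {R n} N.
Arguments Wspace {R n} N kappa q.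

(* Main.v *)
(* Two solutions a, b of the equation give the field a grad b - b grad a, which
   is Killing because Hess a and Hess b are multiples of one symmetric tensor.
   (w, dw) solves a linear ODE along curves, so a solution is determined by its
   1-jet at a point; if a k-manifold carries k independent solutions and a
   positive one, then those vanishing at a point have gradients in k - 1
   independent directions, and the integrability conditions force the metric to
   be Einstein.  Hence the dimension bound, and, applied to a surface with m + 1
   in place of m, the fact that W is spanned by f.

   If the dimension is 2, the Killing field X of a basis is complete, has no
   zeros and preserves the Wronskian, so it acts on W with square kappa;
   kappa >= 0 since some solution is positive, and there are solutions w, u with
   Xw = u > 0 and Xu = kappa w.  The flow of X sweeps out M from the zero set N
   of w, so M = N x_f R with f = u on N, the fibre R being the flow time.

   N is a deformation retract of M, so pi_1(M) = pi_1(N), and B is the universal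
   covering of N, built from homotopy classes of paths of M. *)
Require Import Defs.
From HB Require Import structures.
From mathcomp Require Import all_boot all_order all_algebra.
From mathcomp Require Import all_classical all_reals all_analysis.
From mathcomp Require Import perm ring lra.

Set Implicit Arguments.
Unset Strict Implicit.
Unset Printing Implicit Defensive.

Import Order.TTheory GRing.Theory Num.Theory.
Import numFieldNormedType.Exports.

Local Open Scope classical_set_scope.
Local Open Scope ring_scope.

(** * Smooth functions and matrices of functions *)

(** One identity carries the case of dimension 2: the Wronskian of a basis along the flow of X is
    [|X|^2], because X is dual to [a db - b da]. Hence it is positive and constant on flow lines, X
    acts on W without trace, and its square is a scalar by Cayley-Hamilton. Completeness of X rests
    on the constant speed of its integral curves: over a bounded time they are Cauchy, and near the
    limit all integral curves live for a common time. Charts of N and the splitting are both read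
    off from flows, so flows have to be smooth in time and point together; this is obtained order by
    order from the flow of the linearised system. On the slice at time t both u and w are multiples
    of f, so X is orthogonal to the slice, and its length is f by [ch^2 - kappa sh^2 = 1]. The fibre
    equation is [v'' = kappa v], that is [mu = - m kappa]. As f is the restriction of a positive
    function, no fibre collapses, and the zero set of f and the boundary of N are both empty. A
    second independent solution on N would give N exactly the Einstein constant for which the warped
    product M is Einstein. *)

Section LinearEntries.
Context {R : pzRingType} {m n : nat}.
Implicit Types (A B : 'M[R]_(m, n)).
Lemma addmxE A B i j : (A + B) i j = A i j + B i j. Proof. by rewrite mxE. Qed.
Lemma oppmxE A i j : (- A) i j = - A i j. Proof. by rewrite mxE. Qed.
Lemma scalemxE c A i j : (c *: A) i j = c * A i j. Proof. by rewrite mxE. Qed.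
Lemma trmxE A i j : A^T i j = A j i. Proof. by rewrite mxE. Qed.
End LinearEntries.
Lemma trmxD (R : pzRingType) m n (A B : 'M[R]_(m, n)) : (A + B)^T = A^T + B^T.
Proof. by apply/matrixP => i j; rewrite !mxE. Qed.
Lemma trmxZ (R : pzRingType) m n c (A : 'M[R]_(m, n)) : (c *: A)^T = c *: A^T.
Proof. by apply/matrixP => i j; rewrite !mxE. Qed.
Lemma trmx_sum (R : pzRingType) m n I (r : seq I) (P : pred I) (F : I -> 'M[R]_(m, n)) :
  (\sum_(i <- r | P i) F i)^T = \sum_(i <- r | P i) (F i)^T.
Proof. by apply/matrixP => i j; rewrite mxE !summxE; apply: eq_bigr => k _; rewrite mxE. Qed.
Lemma trmxN (R : pzRingType) m n (A : 'M[R]_(m, n)) : (- A)^T = - A^T.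
Proof. by apply/matrixP => i j; rewrite !mxE. Qed.

(* Locking the differential operators keeps unification from unfolding limits. *)
Fact lkey : unit. Proof. exact: tt. Qed.

Section Differentiability.
Context {R : realType}.

(** The library speaks of the chosen differential ['d f x]; [diff_unique] identifies it with any
    continuous linear map satisfying the estimate, so that a candidate can be supplied by hand. *)
Lemma differentiable_eps (V W : normedModType R) (f : V -> W) (L : {linear V -> W}) x :
  continuous L ->
  (forall e : R, 0 < e -> \forall h \near (0 : V), `|f (h + x) - f x - L h| <= e * `|h|) ->
  differentiable f x.
Proof.
move=> cL H.
have E : f \o shift x = cst (f x) + L +o_ 0 id.
  apply/eqaddoP => e e0; near=> h => /=.
  have -> : (f \o shift x - (cst (f x) + L)) h = f (h + x) - f x - L h.
    by rewrite opprD addrA.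
  by near: h; exact: H.
by apply/diff_locallyP; rewrite (diff_unique cL E).
Unshelve. all: by end_near. Qed.

Lemma differentiable_near (V W : normedModType R) (f g : V -> W) x :
  (\forall y \near x, f y = g y) -> differentiable f x -> differentiable g x.
Proof.
move=> fg df; apply: (@differentiable_eps _ _ g ('d f x)).
  by have [] := (diff_locallyP x f).1 df.
move=> e e0.
have [_ /eqaddoP /(_ e e0)] := (diff_locallyP x f).1 df.
rewrite !near_simpl => H.
have fgx : f x = g x by exact: nbhs_singleton fg.
have fg' : \forall h \near 0, f (h + x) = g (h + x).
  have c : {for 0, continuous (fun h => h + x)}.
    by apply: continuousD => //; exact: cst_continuous.
  have fgx' : nbhs (0 + x) [set y | f y = g y] by rewrite add0r.
  exact: (c _ fgx').
near=> h.
have -> : g (h + x) - g x - 'd f x h = (f \o shift x - (cst (f x) + 'd f x)) h.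
  rewrite !fctE /= opprD addrA -fgx; congr (_ - _ - _).
  by rewrite (near fg' h).
by near: h.
Unshelve. all: by end_near. Qed.

Section Pd.
Variable n : nat.
Implicit Types (i j : 'I_n) (f g : 'rV[R]_n -> R) (A : set 'rV[R]_n).

Definition pd_def i f (x : 'rV[R]_n) : R := 'D_(delta_mx 0 i) f x.
Definition pd := locked_with lkey pd_def.
Lemma pd_unlock i f x : pd i f x = 'D_(delta_mx 0 i) f x.
Proof. by rewrite /pd unlock. Qed.
Lemma pd_funE i f : pd i f = (fun x => 'D_(delta_mx 0 i) f x).
Proof. by apply/funext => x; rewrite pd_unlock. Qed.

(* k + 1 times differentiable at x *)
Fixpoint dk (k : nat) f x : Prop :=
  differentiable f x /\
  if k is k'.+1 then forall i, dk k' (pd i f) x else True.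

Definition ck k A f := forall x, A x -> dk k f x.
Definition smo A f := forall k, ck k A f.

Lemma dk_diff k f x : dk k f x -> differentiable f x.
Proof. by case: k => [|k] []. Qed.

Lemma ck_diff k A f x : ck k A f -> A x -> differentiable f x.
Proof. by move=> H /H /dk_diff. Qed.

Lemma smo_diff A f x : smo A f -> A x -> differentiable f x.
Proof. by move=> /(_ 0%N) H /H /dk_diff. Qed.

Lemma smo_continuous A f x : smo A f -> A x -> {for x, continuous f}.
Proof. by move=> sf Ax; apply: differentiable_continuous; exact: smo_diff sf Ax. Qed.

Lemma ckS k A f : ck k.+1 A f <->
  (forall x, A x -> differentiable f x) /\ forall i, ck k A (pd i f).
Proof.
split => [H|[H1 H2] x Ax].
  by split=> [x Ax|i x Ax]; have [H1 H2] := H x Ax; [exact: H1|exact: H2].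
by split; [exact: H1|move=> i; exact: H2].
Qed.

Lemma ck0 A f : ck 0 A f <-> (forall x, A x -> differentiable f x).
Proof. by split => H x Ax; [case: (H x Ax)|split=> //; exact: H]. Qed.

Lemma dkW k f x : dk k.+1 f x -> dk k f x.
Proof.
elim: k f => [|k IH] f; first by move=> [].
by move=> [d H]; split=> // i; apply/IH/H.
Qed.

Lemma ckW k A f : ck k.+1 A f -> ck k A f.
Proof. by move=> H x /H /dkW. Qed.

Lemma smo_pd A f i : smo A f -> smo A (pd i f).
Proof. by move=> H k x Ax; have [_ ] := H k.+1 x Ax; exact. Qed.

Lemma smo_sub A B f : B `<=` A -> smo A f -> smo B f.
Proof. by move=> BA H k x /BA; exact: H. Qed.

Lemma pd_near i f g x : (\forall y \near x, f y = g y) -> pd i f x = pd i g x.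
Proof. by rewrite !pd_unlock; exact: near_eq_derive. Qed.

Lemma dk_near k f g x : (\forall y \near x, f y = g y) -> dk k f x -> dk k g x.
Proof.
elim: k f g => [|k IH] f g fg [df H]; split; try exact: differentiable_near df.
  by [].
move=> i; apply: IH (H i).
have := nbhs_interior fg.
apply: filterS => y yfg; exact: pd_near.
Qed.

Lemma open_near A (P : 'rV[R]_n -> Prop) x : open A -> A x -> (forall y, A y -> P y) ->
  \forall y \near x, P y.
Proof.
move=> oA Ax H; apply: (filterS H); exact: open_nbhs_nbhs.
Qed.

Lemma ck_ext k A f g : open A -> (forall x, A x -> f x = g x) ->
  ck k A f -> ck k A g.
Proof. by move=> oA fg H x Ax; apply: dk_near (H x Ax); exact: open_near fg. Qed.

Lemma smo_ext A f g : open A -> (forall x, A x -> f x = g x) -> smo A f -> smo A g.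
Proof. by move=> oA fg H k; apply: ck_ext (H k). Qed.

Lemma pd_ext A i f g x : open A -> A x -> (forall x, A x -> f x = g x) ->
  pd i f x = pd i g x.
Proof. by move=> oA Ax fg; apply: pd_near; exact: open_near fg. Qed.

Lemma pdE i f x : differentiable f x -> pd i f x = 'd f x (delta_mx 0 i).
Proof. by move=> d; rewrite pd_unlock deriveE. Qed.

Lemma pd_cst i c x : pd i (fun=> c) x = 0.
Proof. by rewrite pd_unlock derive_cst. Qed.

Lemma pdD i f g x : differentiable f x -> differentiable g x ->
  pd i (fun y => f y + g y) x = pd i f x + pd i g x.
Proof. by move=> df dg; rewrite !pd_unlock [LHS]deriveD //; exact: diff_derivable. Qed.

Lemma pdN i f x : differentiable f x -> pd i (fun y => - f y) x = - pd i f x.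
Proof. by move=> df; rewrite !pd_unlock [LHS]deriveN //; exact: diff_derivable. Qed.

Lemma pdM i f g x : differentiable f x -> differentiable g x ->
  pd i (fun y => f y * g y) x = pd i f x * g x + f x * pd i g x.
Proof.
move=> df dg; rewrite !pd_unlock [LHS]deriveM; [|exact: diff_derivable..].
by rewrite addrC mulrC.
Qed.

Lemma pdZ i f c x : differentiable f x ->
  pd i (fun y => c * f y) x = c * pd i f x.
Proof. by move=> df; rewrite pdM // pd_cst mul0r add0r. Qed.

Lemma pdV i f x : f x != 0 -> differentiable f x ->
  pd i (fun y => (f y)^-1) x = - pd i f x / f x ^+ 2.
Proof.
move=> f0 df; rewrite !pd_unlock deriveV //; last exact: diff_derivable.
by rewrite /GRing.scale /= mulrC mulrN mulNr.
Qed.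

Lemma differentiable_big (I : Type) (r : seq I) (P : pred I) (F : I -> 'rV[R]_n -> R) x :
  (forall k, P k -> differentiable (F k) x) ->
  differentiable (fun y => \sum_(k <- r | P k) F k y) x.
Proof.
move=> H; elim: r => [|k r IH].
  by under eq_fun do rewrite big_nil.
under eq_fun do rewrite big_cons; case: (boolP (P k)) => // Pk.
by apply: differentiableD => //; exact: H.
Qed.

Lemma pd_sum i (I : Type) (r : seq I) (P : pred I) (F : I -> 'rV[R]_n -> R) x :
  (forall k, P k -> differentiable (F k) x) ->
  pd i (fun y => \sum_(k <- r | P k) F k y) x = \sum_(k <- r | P k) pd i (F k) x.
Proof.
move=> H; elim: r => [|k r IH].
  by rewrite big_nil; under eq_fun do rewrite big_nil; rewrite pd_cst.
rewrite big_cons; under eq_fun do rewrite big_cons; case: (boolP (P k)) => // Pk.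
by rewrite pdD ?IH //; [exact: H|exact: differentiable_big].
Qed.

Lemma dk_cst k c x : dk k (fun=> c) x.
Proof.
elim: k c => [|k IH] c; split=> //; try exact: differentiable_cst.
move=> i; have -> : pd i (fun=> c) = fun=> 0 by apply/funext => y; rewrite pd_cst.
exact: IH.
Qed.

Lemma ckD k A f g : open A -> ck k A f -> ck k A g -> ck k A (fun x => f x + g x).
Proof.
move=> oA; elim: k f g => [|k IH] f g.
  by move=> /ck0 H /ck0 K; apply/ck0 => x Ax; apply: differentiableD; [exact: H|exact: K].
move=> /ckS[H1 H2] /ckS[K1 K2]; apply/ckS; split => [x Ax|i].
  by apply: differentiableD; [exact: H1|exact: K1].
apply: (@ck_ext _ _ (fun x => pd i f x + pd i g x)) => //; last exact: IH.
by move=> x Ax; rewrite pdD //; [exact: H1|exact: K1].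
Qed.

Lemma ckM k A f g : open A -> ck k A f -> ck k A g -> ck k A (fun x => f x * g x).
Proof.
move=> oA; elim: k f g => [|k IH] f g.
  by move=> /ck0 H /ck0 K; apply/ck0 => x Ax; apply: differentiableM; [exact: H|exact: K].
move=> Hf Hg; have /ckS[H1 H2] := Hf; have /ckS[K1 K2] := Hg.
apply/ckS; split => [x Ax|i].
  by apply: differentiableM; [exact: H1|exact: K1].
apply: (@ck_ext _ _ (fun x => pd i f x * g x + f x * pd i g x)) => //.
  by move=> x Ax; rewrite pdM //; [exact: H1|exact: K1].
by apply: ckD => //; apply: IH => //; exact: ckW.
Qed.

Lemma ckZ k A f c : open A -> ck k A f -> ck k A (fun x => c * f x).
Proof. by move=> oA H; apply: ckM => // x _; exact: dk_cst. Qed.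

Lemma ckN k A f : open A -> ck k A f -> ck k A (fun x => - f x).
Proof.
move=> oA H; apply: (@ck_ext _ _ (fun x => -1 * f x)) => //; last exact: ckZ.
by move=> x _; rewrite mulN1r.
Qed.

Lemma ckB k A f g : open A -> ck k A f -> ck k A g -> ck k A (fun x => f x - g x).
Proof. by move=> oA Hf Hg; apply: ckD => //; exact: ckN. Qed.

Lemma ckV k A f : open A -> (forall x, A x -> f x != 0) -> ck k A f ->
  ck k A (fun x => (f x)^-1).
Proof.
move=> oA f0; elim: k => [|k IH].
  by move=> /ck0 H; apply/ck0 => x Ax; apply: differentiableV; [exact: H|exact: f0].
move=> Hf; have /ckS[H1 H2] := Hf.
apply/ckS; split => [x Ax|i].
  by apply: differentiableV; [exact: H1|exact: f0].
have IH' := IH (ckW Hf).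
apply: (@ck_ext _ _ (fun x => - (pd i f x * ((f x)^-1 * (f x)^-1)))) => //.
  by move=> x Ax; rewrite (pdV i (f0 x Ax) (H1 x Ax)); field; exact: f0.
by apply: ckN => //; apply: ckM => //; apply: ckM.
Qed.

Lemma ck_big (op : R -> R -> R) idx k A (I : Type) (r : seq I) (P : pred I) (F : I -> 'rV[R]_n -> R) :
  (forall f g, ck k A f -> ck k A g -> ck k A (fun x => op (f x) (g x))) -> (forall a, P a -> ck k A (F a)) ->
  ck k A (fun x => \big[op/idx]_(a <- r | P a) F a x).
Proof.
move=> opk H; elim: r => [|a r IH].
  by under eq_fun do rewrite big_nil; move=> x _; exact: dk_cst.
by under eq_fun do rewrite big_cons; case: (boolP (P a)) => // Pa; apply: opk => //; exact: H.
Qed.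

Lemma diff_coordE j (x : 'rV[R]_n) :
  'd (fun y : 'rV[R]_n => y 0 j) x = (fun y => y 0 j) :> ('rV[R]_n -> R).
Proof.
pose f : 'rV[R]_n -> R := fun N => N 0 j.
have lf : linear f by move=> a u v; rewrite /f !mxE.
pose Lf : {linear 'rV[R]_n -> R} := HB.pack f (GRing.isLinear.Build _ _ _ _ f lf).
rewrite -[RHS]/(Lf : _ -> _) -(@diff_lin _ _ _ Lf x) //.
exact: coord_continuous.
Qed.

Lemma pd_coord i j x : pd i (fun y : 'rV[R]_n => y 0 j) x = (i == j)%:R.
Proof.
rewrite pdE; last exact: differentiable_coord.
by rewrite diff_coordE mxE eq_sym.
Qed.

Lemma dk_coord k j x : dk k (fun y : 'rV[R]_n => y 0 j) x.
Proof.
case: k => [|k]; split=> //; try exact: differentiable_coord.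
move=> i; have -> : pd i (fun y => y 0 j) = fun=> (i == j)%:R.
  by apply/funext => y; rewrite pd_coord.
exact: dk_cst.
Qed.

(** [iter_partial] applies the last index of the list first, and this is the derivative that [dk]
    strips; hence the induction from the right end of the list. *)
Lemma dk_iter f x : (forall k, dk k f x) <->
  forall s, differentiable (iter_partial s f) x.
Proof.
split => [H s|H k].
  have {H} := H (size s); elim/last_ind: s f => [|s i IH] f; first by move=> [].
  rewrite size_rcons => -[_ /(_ i) /IH].
  by rewrite /iter_partial foldr_rcons pd_funE.
elim: k f H => [|k IH] f H; split=> //; try exact: (H [::]).
move=> i; apply: IH => s; have := H (rcons s i).
by rewrite /iter_partial foldr_rcons pd_funE.
Qed.

(** On an open set a function is its own smooth extension, so the local extensions of [smooth_on]
    can be traded for iterated partial derivatives, which compose better. *)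
Lemma smooth_onP A f : open A -> smooth_on A f <-> smo A f.
Proof.
move=> oA; split => [H k x Ax|H x Ax].
  have [U [g [oU Ux Hg gf]]] := H x Ax.
  apply: dk_near; last by apply: (dk_iter _ _).2 => s; exact: Hg.
  apply: (@open_near (U `&` A)) => //; first exact: openI.
  by move=> y [Uy Ay]; exact: gf.
exists A, f; split=> // s y Ay.
by apply: (dk_iter _ _).1 => k; exact: H.
Qed.

(** Small increments stay in an open [A], so the restricted filter of the one-sided definition is
    the full punctured filter at 0. *)
Lemma pderivE A i f x : open A -> A x -> pderiv A i f x = pd i f x.
Proof.
move=> oA Ax; rewrite /pderiv pd_unlock /derive.
have -> : (fun h => h^-1 * (f (x + h *: delta_mx 0 i) - f x)) =
   (fun h => h^-1 *: ((f \o shift x) (h *: delta_mx 0 i) - f x)).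
  by apply/funext => h; rewrite /= [_ + x]addrC.
set g := fun h : R => _; congr (lim _).
have nA : nbhs 0 [set h : R | A (x + h *: delta_mx 0 i)].
  have c : {for 0, continuous (fun h : R => x + h *: (delta_mx 0 i : 'rV[R]_n))}.
    by apply: continuousD; [exact: cst_continuous|apply: continuousZl].
  apply: c => /=; rewrite scale0r addr0; exact: open_nbhs_nbhs.
rewrite eqEsubset; split => B; rewrite /nbhs /within /=.
  by apply: filterS2 (nbhs_dnbhs nA) => h Ah; exact.
by apply: filterS => h Bh _.
Qed.

Lemma pderiv_ext A i f g x : open A -> A x -> (forall y, A y -> f y = g y) ->
  pderiv A i f x = pderiv A i g x.
Proof. by move=> oA Ax fg; rewrite !pderivE //; exact: pd_ext fg. Qed.

End Pd.

Arguments smo {n} A f.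
Arguments pd {n} i f x.

Section SmoClosure.
Variables (n : nat) (A : set 'rV[R]_n).
Hypothesis oA : open A.
Implicit Types f g : 'rV[R]_n -> R.

Lemma smo_cst c : smo A (fun=> c). Proof. by move=> k x _; exact: dk_cst. Qed.
Lemma smo_coord j : smo A (fun x => x 0 j). Proof. by move=> k x _; exact: dk_coord. Qed.
Lemma smoD f g : smo A f -> smo A g -> smo A (fun x => f x + g x).
Proof. by move=> Hf Hg k; exact: ckD. Qed.
Lemma smoB f g : smo A f -> smo A g -> smo A (fun x => f x - g x).
Proof. by move=> Hf Hg k; exact: ckB. Qed.
Lemma smoM f g : smo A f -> smo A g -> smo A (fun x => f x * g x).
Proof. by move=> Hf Hg k; exact: ckM. Qed.
Lemma smoN f : smo A f -> smo A (fun x => - f x).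
Proof. by move=> Hf k; exact: ckN. Qed.
Lemma smoV f : (forall x, A x -> f x != 0) -> smo A f -> smo A (fun x => (f x)^-1).
Proof. by move=> Hf Hg k; exact: ckV. Qed.
Lemma smo_sum (I : Type) (r : seq I) (P : pred I) (F : I -> 'rV[R]_n -> R) :
  (forall i, P i -> smo A (F i)) -> smo A (fun x => \sum_(i <- r | P i) F i x).
Proof. by move=> H k; apply: ck_big => [f g|i Pi]; [exact: ckD|exact: H]. Qed.
Lemma smo_prod (I : Type) (r : seq I) (P : pred I) (F : I -> 'rV[R]_n -> R) :
  (forall i, P i -> smo A (F i)) -> smo A (fun x => \prod_(i <- r | P i) F i x).
Proof. by move=> H k; apply: ck_big => [f g|i Pi]; [exact: ckM|exact: H]. Qed.
End SmoClosure.

Section Comp.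
Variables (V : normedModType R) (n : nat).

Lemma differentiable_rV (phi : V -> 'rV[R]_n) x :
  (forall j, differentiable (fun y => phi y 0 j) x) -> differentiable phi x.
Proof.
move=> H.
have -> : phi = \sum_(j < n) (fun y => phi y 0 j *: delta_mx 0 j).
  by apply/funext => y; rewrite {1}[phi y]row_sum_delta fct_sumE.
by apply: differentiable_sum => j; apply: differentiableZl.
Qed.

Lemma diff_coord_rV (phi : V -> 'rV[R]_n) x v j : differentiable phi x ->
  ('d phi x v) 0 j = 'd (fun y => phi y 0 j) x v.
Proof.
move=> d; pose f : 'rV[R]_n -> R := fun N => N 0 j.
have df : differentiable f (phi x) by exact: differentiable_coord.
have -> : (fun y => phi y 0 j) = f \o phi by [].
by rewrite (diff_comp d df) diff_coordE.
Qed.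

Lemma differentiable_coordE (phi : V -> 'rV[R]_n) x j : differentiable phi x ->
  differentiable (fun y => phi y 0 j) x.
Proof.
move=> d; apply: (@differentiable_comp _ _ _ _ phi (fun N : 'rV_n => N 0 j)) => //.
exact: differentiable_coord.
Qed.

Lemma diff_rV_sum (f : 'rV[R]_n -> R) x (v : 'rV[R]_n) : differentiable f x ->
  'd f x v = \sum_(j < n) v 0 j * pd j f x.
Proof.
move=> d; rewrite {1}[v]row_sum_delta linear_sum; apply: eq_bigr => j _.
by rewrite linearZ pdE.
Qed.

Lemma derive_comp_rV (f : 'rV[R]_n -> R) (phi : V -> 'rV[R]_n) x v :
  differentiable f (phi x) -> differentiable phi x ->
  'D_v (f \o phi) x = \sum_(j < n) 'D_v (fun y => phi y 0 j) x * pd j f (phi x).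
Proof.
move=> df dphi; rewrite deriveE; last exact: differentiable_comp.
rewrite diff_comp //= diff_rV_sum //; apply: eq_bigr => j _.
by rewrite diff_coord_rV // deriveE //; exact: differentiable_coordE.
Qed.

End Comp.

Section CompRV.
Variables (m n : nat).

Lemma pd_comp i (f : 'rV[R]_n -> R) (phi : 'rV[R]_m -> 'rV[R]_n) x :
  differentiable f (phi x) -> differentiable phi x ->
  pd i (f \o phi) x = \sum_(j < n) pd i (fun y => phi y 0 j) x * pd j f (phi x).
Proof.
move=> df dphi; rewrite pd_unlock derive_comp_rV //; apply: eq_bigr => j _.
by rewrite [X in _ = X * _]pd_unlock.
Qed.

Lemma ck_comp k A B (f : 'rV[R]_n -> R) (phi : 'rV[R]_m -> 'rV[R]_n) :
  open A -> (forall x, A x -> B (phi x)) -> (forall j, ck k A (fun x => phi x 0 j)) ->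
  ck k B f -> ck k A (f \o phi).
Proof.
move=> oA AB; elim: k f => [|k IH] f Hphi Hf.
  apply/ck0 => x Ax; apply: differentiable_comp.
    by apply: differentiable_rV => j; exact: ck_diff.
  by apply: ck_diff Hf _; exact: AB.
have dphi x : A x -> differentiable phi x.
  by move=> Ax; apply: differentiable_rV => j; exact: ck_diff.
have dff x : A x -> differentiable f (phi x).
  by move=> Ax; apply: ck_diff Hf _; exact: AB.
apply/ckS; split => [x Ax|i].
  by apply: differentiable_comp; [exact: dphi|exact: dff].
apply: (@ck_ext _ _ _ (fun x => \sum_(j < n) pd i (fun y => phi y 0 j) x * pd j f (phi x))) => //.
  by move=> x Ax; rewrite pd_comp //; [exact: dff|exact: dphi].
apply: ck_big => [? ?|j _]; first exact: ckD.
apply: ckM => //.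
  by have /ckS[_] := Hphi j.
apply: (IH (pd j f)); last by have /ckS[_] := Hf.
by move=> l; exact: ckW.
Qed.

Lemma smo_comp A B (f : 'rV[R]_n -> R) (phi : 'rV[R]_m -> 'rV[R]_n) :
  open A -> (forall x, A x -> B (phi x)) -> (forall j, smo A (fun x => phi x 0 j)) ->
  smo B f -> smo A (f \o phi).
Proof. by move=> oA AB Hphi Hf k; apply: (ck_comp oA AB) => // j; exact: Hphi. Qed.

End CompRV.

Lemma is_derive_continuous (V : normedModType R) (g : R -> V) (s : R) (l : V) :
  is_derive s 1 g l -> {for s, continuous g}.
Proof.
by move=> ds; apply: differentiable_continuous; apply/derivable1_diffP; exact: ex_derive.
Qed.

Lemma norm_le_minmax0 (h s : R) : Num.min 0 h <= s <= Num.max 0 h -> `|s| <= `|h|.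
Proof.
have [h0|h0] := leP 0 h => /andP[s1 s2].
  by rewrite !ger0_norm.
by rewrite !ler0_norm ?lerN2 // ltW.
Qed.

Lemma MVT_closed (g dg : R -> R) a b :
  (forall s : R, Num.min a b <= s <= Num.max a b -> is_derive s 1 g (dg s)) ->
  exists2 c : R, Num.min a b <= c <= Num.max a b & g b - g a = dg c * (b - a).
Proof.
move=> H.
wlog ab : a b H / a < b => [W|].
  have [ab|] := boolP (a < b); first exact: W.
  rewrite -leNgt le_eqVlt => /orP[/eqP ->|ba].
    by exists a; rewrite ?minxx ?maxxx ?lexx // !subrr mulr0.
  have [|c cab E] := W b a _ ba.
      by rewrite minC maxC.
  exists c; first by rewrite minC maxC.
  by rewrite -[LHS]opprB E -mulrN opprB.
rewrite (min_idPl (ltW ab)) (max_idPr (ltW ab)) in H *.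
have [s||c] := @MVT R g dg a b ab.
- by rewrite /= => /andP[s0 sh]; apply: H; rewrite !ltW.
- apply: continuous_in_subspaceT => s; rewrite inE /= in_itv /= => sab.
  exact: is_derive_continuous (H s sab).
- by rewrite /= => /andP[c0 ch] E; exists c => //; rewrite !ltW.
Qed.

(** * Symmetry of second derivatives *)

Section Schwarz.
Variables (n : nat) (A : set 'rV[R]_n).
Hypothesis oA : open A.
Implicit Types (i j : 'I_n).

Lemma is_derive_line (f : 'rV[R]_n -> R) (x v : 'rV[R]_n) s :
  differentiable f (x + s *: v) ->
  is_derive s 1 (fun s => f (x + s *: v)) ('D_v f (x + s *: v)).
Proof.
move=> d.
have dl : differentiable (fun s : R => x + s *: v) s.
  by [].
have dc : differentiable (f \o (fun s => x + s *: v)) s by exact: differentiable_comp.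
apply: DeriveDef; first exact: diff_derivable.
rewrite deriveE // diff_comp //= deriveE //; congr ('d f _ _).
rewrite -deriveE //.
have -> : (fun s => x + s *: v) = (cst x + (fun s => s *: v)) by [].
rewrite deriveD //.
by rewrite derive_cst add0r deriveE // diff_val scale1r.
exact: diff_derivable.
Qed.

Lemma cvg0_bound (q : R -> R) l :
  (forall e : R, 0 < e -> \forall h \near (0 : R)^', `|q h - l| <= e) -> q h @[h --> 0^'] --> l.
Proof.
by move=> H; apply/cvgrPdist_le => e e0; apply: filterS (H e e0) => h; rewrite distrC.
Qed.

Lemma diff_littleo_bound (f : 'rV[R]_n -> R) x e : differentiable f x -> 0 < e ->
  \forall h \near (0 : 'rV[R]_n), `|f (h + x) - f x - 'd f x h| <= e * `|h|.
Proof.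
move=> df e0; have [_ /eqaddoP /(_ e e0)] := (diff_locallyP x f).1 df.
apply: filterS => h.
by rewrite opprD addrA.
Qed.

Lemma norm_delta i : `|delta_mx 0 i : 'rV[R]_n| <= 1.
Proof.
rewrite [leLHS]/Num.Def.normr /= mx_normrE; apply: bigmax_le => // -[a b] _.
by rewrite mxE; case: (_ && _); rewrite ?normr1 ?normr0.
Qed.

Definition sdq (f : 'rV[R]_n -> R) x i j (h : R) : R :=
  (h ^+ 2)^-1 * (f (x + h *: delta_mx 0 i + h *: delta_mx 0 j) - f (x + h *: delta_mx 0 i)
     - f (x + h *: delta_mx 0 j) + f x).

Lemma sdqC f x i j : sdq f x i j = sdq f x j i.
Proof. by apply/funext => h; rewrite /sdq [x + _ + _]addrAC; ring. Qed.

(* Second difference quotients along [e_i], [e_j] converge to [d_j (d_i f)];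
   they are symmetric in [i] and [j]. *)
Lemma second_difference (f : 'rV[R]_n -> R) x i j : A x ->
  (forall y, A y -> differentiable f y) -> differentiable (pd i f) x ->
  sdq f x i j h @[h --> 0^'] --> pd j (pd i f) x.
Proof.
move=> Ax df dfi; apply: cvg0_bound => e e0.
pose ei : 'rV[R]_n := delta_mx 0 i; pose ej : 'rV[R]_n := delta_mx 0 j.
have e3 : 0 < e / 3 by rewrite divr_gt0.
have := diff_littleo_bound dfi e3.
move=> /nbhs_ballP[r /= r0 Hr].
have /nbhs_ballP[r' /= r'0 Hr'] : nbhs x A by exact: open_nbhs_nbhs.
pose d := Num.min r r' / 2.
have d0 : 0 < d by rewrite divr_gt0 // lt_min r0.
have dr : d * 2 <= r by rewrite divfK // ge_min lexx.
have dr' : d * 2 <= r' by rewrite divfK // ge_min lexx orbT.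
near=> h.
have h0 : h != 0 by near: h; exact: nbhs_dnbhs_neq.
have hd : `|h| < d by near: h; exact: dnbhs0_lt.
have nsm (s : R) : `|s| <= `|h| -> forall b : bool, `|s *: ei + (b%:R * h) *: ej| <= 2 * `|h|.
  move=> sh b; rewrite mulrDl mul1r; apply: (le_trans (ler_normD _ _)); apply: lerD; rewrite normrZ.
    rewrite -[leRHS]mulr1; apply: ler_pM => //; exact: norm_delta.
  rewrite -[leRHS]mulr1; apply: ler_pM => //; last exact: norm_delta.
  by case: b; rewrite ?mul1r // mul0r normr0.
have inA (s : R) (b : bool) : `|s| <= `|h| -> A (x + s *: ei + (b%:R * h) *: ej).
  move=> sh; apply: Hr'; rewrite -ball_normE /= -addrA opprD addrA subrr sub0r normrN.
  apply: (le_lt_trans (nsm _ sh b)); rewrite mulrC; apply: lt_le_trans dr'.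
  by rewrite ltr_pM2r.
(* The second difference is the increment of [g] from 0 to h. Its mean value is a difference of two
   values of [pd i f], and each of them is compared with the differential of [pd i f] at x. *)
pose g s := f (x + s *: ei + h *: ej) - f (x + s *: ei).
have dg (s : R) : `|s| <= `|h| -> is_derive s 1 g
    (pd i f (x + s *: ei + h *: ej) - pd i f (x + s *: ei)).
  move=> sh; have E : g = (fun s => f ((x + h *: ej) + s *: ei)) - (fun s => f (x + s *: ei)).
    by apply/funext => t; rewrite !fctE addrAC.
  rewrite E addrAC !pd_unlock; apply: is_deriveB; apply: is_derive_line; apply: df.
    by have := inA _ true sh; rewrite mul1r addrAC.
  by have := inA _ false sh; rewrite mul0r scale0r addr0.
have [c ch gE] : exists2 c : R, `|c| <= `|h| & g h - g 0 = h *
   (pd i f (x + c *: ei + h *: ej) - pd i f (x + c *: ei)).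
  have sub (s : R) : Num.min 0 h <= s <= Num.max 0 h -> `|s| <= `|h|. exact: norm_le_minmax0.
  have [c /sub ch E] := MVT_closed (fun s H => dg s (sub s H)).
  by exists c => //; rewrite E subr0 mulrC.
have bnd (s : R) (b : bool) : `|s| <= `|h| ->
   `|pd i f (x + s *: ei + (b%:R * h) *: ej) - pd i f x - 'd (pd i f) x (s *: ei + (b%:R * h) *: ej)|
     <= e / 3 * `|s *: ei + (b%:R * h) *: ej|.
  move=> sh; have := Hr (s *: ei + (b%:R * h) *: ej).
  rewrite -ball_normE /= sub0r normrN => H.
  have := H (le_lt_trans (nsm _ sh b) _); rewrite [_ + x]addrC addrA; apply.
  by rewrite mulrC; apply: lt_le_trans dr; rewrite ltr_pM2r.
have B1 := bnd c true ch; have B0 := bnd c false ch.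
have N1 := nsm c ch true; have N0 := nsm c ch false.
rewrite !mul1r in B1 N1; rewrite mul0r scale0r !addr0 in B0 N0.
have lin : 'd (pd i f) x (c *: ei + h *: ej) = 'd (pd i f) x (c *: ei) + h * pd j (pd i f) x.
  by rewrite linearD [X in _ + X]linearZ [pd j (pd i f) x]pdE.
have n0 : `|c *: ei| <= `|h|.
  by rewrite normrZ -[leRHS]mulr1; apply: ler_pM => //; exact: norm_delta.
have key : `|pd i f (x + c *: ei + h *: ej) - pd i f (x + c *: ei) - h * pd j (pd i f) x| <= e * `|h|.
  set P := pd i f (x + c *: ei + h *: ej) in B1 *; set Q := pd i f (x + c *: ei) in B0 *.
  have -> : P - Q - h * pd j (pd i f) x =
    (P - pd i f x - 'd (pd i f) x (c *: ei + h *: ej)) - (Q - pd i f x - 'd (pd i f) x (c *: ei)).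
    by rewrite lin; ring.
  apply: (le_trans (ler_normB _ _)).
  apply: (le_trans (lerD B1 B0)).
  have -> : e * `|h| = e / 3 * (2 * `|h|) + e / 3 * `|h| by field.
  by apply: lerD; apply: ler_pM => //; exact: ltW.
rewrite /sdq; have -> : f (x + h *: delta_mx 0 i + h *: delta_mx 0 j) - f (x + h *: delta_mx 0 i)
     - f (x + h *: delta_mx 0 j) + f x = g h - g 0.
  by rewrite /g scale0r addr0; ring.
rewrite gE; set D := _ - pd i f (x + c *: ei).
have -> : (h ^+ 2)^-1 * (h * D) - pd j (pd i f) x = h^-1 * (D - h * pd j (pd i f) x).
  by field.
by rewrite normrM normfV mulrC ler_pdivrMr ?normr_gt0.
Unshelve. all: by end_near. Qed.

Lemma pd_sym (f : 'rV[R]_n -> R) x i j : A x ->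
  (forall y, A y -> differentiable f y) ->
  differentiable (pd i f) x -> differentiable (pd j f) x ->
  pd j (pd i f) x = pd i (pd j f) x.
Proof.
move=> Ax df di dj.
have H1 := @second_difference f x i j Ax df di.
have H2 := @second_difference f x j i Ax df dj.
rewrite sdqC in H1.
by rewrite -(cvg_lim (@norm_hausdorff R R) H1) -(cvg_lim (@norm_hausdorff R R) H2).
Qed.

Lemma smo_pd_sym f x i j : smo A f -> A x -> pd j (pd i f) x = pd i (pd j f) x.
Proof.
move=> sf Ax; apply: pd_sym => //; try exact: smo_diff (smo_pd _ sf) _.
by move=> y; exact: smo_diff.
Qed.

End Schwarz.

(** * Entrywise calculus of matrix-valued functions *)

Section MatrixFunctions.
Variables (n : nat).
Implicit Types (i j : 'I_n) (S : set 'rV[R]_n).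

Definition mpd_def p q i (F : 'rV[R]_n -> 'M[R]_(p, q)) x : 'M[R]_(p, q) :=
  \matrix_(a, b) pd i (fun y => F y a b) x.
Definition mpd p q := locked_with lkey (@mpd_def p q).
Lemma mpdE p q i (F : 'rV[R]_n -> 'M[R]_(p, q)) x a b :
  mpd i F x a b = pd i (fun y => F y a b) x.
Proof. by rewrite /mpd unlock mxE. Qed.
Definition mdiff p q (F : 'rV[R]_n -> 'M[R]_(p, q)) x :=
  forall a b, differentiable (fun y => F y a b) x.
Definition msmo p q S (F : 'rV[R]_n -> 'M[R]_(p, q)) :=
  forall a b, smo S (fun y => F y a b).

Lemma msmo_mdiff p q S (F : 'rV[R]_n -> 'M[R]_(p, q)) x : msmo S F -> S x -> mdiff F x.
Proof. by move=> H Sx a b; exact: smo_diff. Qed.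

Lemma msmo_mpd p q S (F : 'rV[R]_n -> 'M[R]_(p, q)) i : open S -> msmo S F -> msmo S (mpd i F).
Proof.
move=> oS H a b; apply: (@smo_ext _ _ (pd i (fun y => F y a b))) => //; last exact: smo_pd.
by move=> x _; rewrite mpdE.
Qed.

Lemma mpd_ext p q S (F G : 'rV[R]_n -> 'M[R]_(p, q)) i x : open S -> S x ->
  (forall y, S y -> F y = G y) -> mpd i F x = mpd i G x.
Proof.
move=> oS Sx FG; apply/matrixP => a b; rewrite !mpdE.
by apply: (pd_ext i oS Sx) => y Sy; rewrite FG.
Qed.

Lemma mpdM p q r (F : 'rV[R]_n -> 'M[R]_(p, q)) (G : 'rV[R]_n -> 'M[R]_(q, r)) i x :
  mdiff F x -> mdiff G x ->
  mpd i (fun y => F y *m G y) x = mpd i F x *m G x + F x *m mpd i G x.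
Proof.
move=> dF dG; apply/matrixP => a b; rewrite mpdE ![in RHS]mxE -big_split /=.
under eq_fun do rewrite mxE.
rewrite pd_sum => [|c _]; last exact: differentiableM.
by apply: eq_bigr => c _; rewrite pdM // !mpdE.
Qed.

Lemma mpdD p q (F G : 'rV[R]_n -> 'M[R]_(p, q)) i x : mdiff F x -> mdiff G x ->
  mpd i (fun y => F y + G y) x = mpd i F x + mpd i G x.
Proof.
move=> dF dG; apply/matrixP => a b; rewrite addmxE !mpdE -pdD //.
by congr (pd i _ x); apply/funext => y; rewrite mxE.
Qed.

Lemma mpdZ p q (w : 'rV[R]_n -> R) (F : 'rV[R]_n -> 'M[R]_(p, q)) i x :
  differentiable w x -> mdiff F x ->
  mpd i (fun y => w y *: F y) x = pd i w x *: F x + w x *: mpd i F x.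
Proof.
move=> dF dG; apply/matrixP => a b; rewrite addmxE !scalemxE !mpdE -pdM //.
by congr (pd i _ x); apply/funext => y; rewrite mxE.
Qed.

Lemma mpd_tr p q (F : 'rV[R]_n -> 'M[R]_(p, q)) i x :
  mpd i (fun y => (F y)^T) x = (mpd i F x)^T.
Proof.
apply/matrixP => a b; rewrite trmxE !mpdE.
by congr (pd i _ x); apply/funext => y; rewrite mxE.
Qed.

Lemma mpd_cst p q (F : 'M[R]_(p, q)) i x : mpd i (fun=> F) x = 0.
Proof. by apply/matrixP => a b; rewrite mpdE mxE pd_cst. Qed.

Lemma mpd_sym p q S (F : 'rV[R]_n -> 'M[R]_(p, q)) i j x : open S -> S x -> msmo S F ->
  mpd j (mpd i F) x = mpd i (mpd j F) x.
Proof.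
move=> oS Sx sF; apply/matrixP => a b; rewrite !mpdE.
have E l : (fun y => mpd l F y a b) = pd l (fun y => F y a b).
  by apply/funext => y; rewrite mpdE.
rewrite E E.
exact: (smo_pd_sym oS i j (sF a b) Sx).
Qed.

Lemma msmoM p q r S (F : 'rV[R]_n -> 'M[R]_(p, q)) (G : 'rV[R]_n -> 'M[R]_(q, r)) :
  open S -> msmo S F -> msmo S G -> msmo S (fun y => F y *m G y).
Proof.
move=> oS sF sG a b.
under eq_fun do rewrite mxE.
by apply: smo_sum => // c _; apply: smoM.
Qed.

Lemma msmoD p q S (F G : 'rV[R]_n -> 'M[R]_(p, q)) : open S -> msmo S F -> msmo S G ->
  msmo S (fun y => F y + G y).
Proof.
move=> oS sF sG a b.
under eq_fun do rewrite mxE.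
exact: smoD.
Qed.

Lemma msmoZ p q S (w : 'rV[R]_n -> R) (F : 'rV[R]_n -> 'M[R]_(p, q)) : open S -> smo S w -> msmo S F ->
  msmo S (fun y => w y *: F y).
Proof.
move=> oS sF sG a b.
under eq_fun do rewrite mxE.
exact: smoM.
Qed.

Lemma msmo_tr p q S (F : 'rV[R]_n -> 'M[R]_(p, q)) : msmo S F -> msmo S (fun y => (F y)^T).
Proof. move=> sF a b; have -> : (fun y => (F y)^T a b) = (fun y => F y b a).
  by apply/funext => y; rewrite mxE.
exact: sF. Qed.

Lemma msmo_ext p q S (F G : 'rV[R]_n -> 'M[R]_(p, q)) : open S ->
  (forall y, S y -> F y = G y) -> msmo S F -> msmo S G.
Proof. by move=> oS FG H a b; apply: smo_ext (H a b) => // x Sx; rewrite FG. Qed.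

Lemma smo_det p S (F : 'rV[R]_n -> 'M[R]_p) : open S -> msmo S F -> smo S (fun y => \det (F y)).
Proof.
move=> oS sF; apply: smo_sum => // s _; apply: smoM => //.
  exact: smo_cst.
by apply: smo_prod.
Qed.

(** Cramer's formula writes the inverse with polynomials in the entries and one division by the
    determinant. *)
Lemma msmo_invmx p S (F : 'rV[R]_n -> 'M[R]_p) : open S -> msmo S F ->
  (forall y, S y -> F y \in unitmx) -> msmo S (fun y => invmx (F y)).
Proof.
move=> oS sF uF.
apply: (@msmo_ext _ _ _ (fun y => (\det (F y))^-1 *: \adj (F y))) => //.
  by move=> y Sy; rewrite /invmx uF.
apply: msmoZ => //.
  apply: smoV => //; last exact: smo_det.
  by move=> x Sx; have := uF x Sx; rewrite unitmxE unitfE.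
move=> a b; under eq_fun do rewrite mxE /cofactor.
apply: smoM => //; first exact: smo_cst.
apply: smo_det => // c d.
under eq_fun do rewrite !mxE.
exact: sF.
Qed.

End MatrixFunctions.

Lemma mpd_comp n k p q (F : 'rV[R]_k -> 'M[R]_(p, q)) (phi : 'rV[R]_n -> 'rV[R]_k) i x :
  mdiff F (phi x) -> differentiable phi x ->
  mpd i (F \o phi) x = \sum_(j < k) pd i (fun y => phi y 0 j) x *: mpd j F (phi x).
Proof.
move=> dF dphi; apply/matrixP => a b; rewrite mpdE summxE.
rewrite -[fun y => _]/((fun y => F y a b) \o phi) pd_comp //.
by apply: eq_bigr => j _; rewrite scalemxE mpdE.
Qed.

Lemma msmo_comp n k p q A B (F : 'rV[R]_k -> 'M[R]_(p, q)) (phi : 'rV[R]_n -> 'rV[R]_k) :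
  open A -> (forall x, A x -> B (phi x)) -> msmo A phi -> msmo B F -> msmo A (F \o phi).
Proof.
move=> oA AB sphi sF a b; apply: (smo_comp (f := fun y => F y a b) oA AB) => // j; exact: sphi.
Qed.

Lemma msmo_differentiable n k A (phi : 'rV[R]_n -> 'rV[R]_k) x :
  msmo A phi -> A x -> differentiable phi x.
Proof. by move=> s Ax; apply: differentiable_rV => j; exact: smo_diff. Qed.

Lemma msmo_continuous n k A (phi : 'rV[R]_n -> 'rV[R]_k) x : msmo A phi -> A x -> {for x, continuous phi}.
Proof. by move=> sphi Ax; apply: differentiable_continuous; exact: msmo_differentiable sphi Ax. Qed.

End Differentiability.

Section Jacobian.
Context {R : realType}.

Definition jac m n (phi : 'rV[R]_m -> 'rV[R]_n) (x : 'rV[R]_m) : 'M[R]_(m, n) :=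
  \matrix_(i, j) pd i (fun y => phi y 0 j) x.

Lemma jacE m n (phi : 'rV[R]_m -> 'rV[R]_n) x i j : jac phi x i j = pd i (fun y => phi y 0 j) x.
Proof. by rewrite mxE. Qed.

Lemma jac_smo m n A (phi : 'rV[R]_m -> 'rV[R]_n) : msmo A phi -> msmo A (jac phi).
Proof.
move=> sphi i j; have -> : (fun y => jac phi y i j) = pd i (fun y => phi y 0 j).
  by apply/funext => y; rewrite jacE.
exact: smo_pd.
Qed.

Lemma jac_comp m n p (psi : 'rV[R]_n -> 'rV[R]_p) (phi : 'rV[R]_m -> 'rV[R]_n) x :
  differentiable psi (phi x) -> differentiable phi x ->
  jac (psi \o phi) x = jac phi x *m jac psi (phi x).
Proof.
move=> dpsi dphi; apply/matrixP => i j; rewrite jacE [RHS]mxE.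
rewrite -[fun y => _]/((fun y => psi y 0 j) \o phi) pd_comp //.
  by apply: eq_bigr => l _; rewrite !jacE.
exact: differentiable_coordE.
Qed.

Lemma jac_ext m n A (phi psi : 'rV[R]_m -> 'rV[R]_n) x : open A -> A x ->
  (forall y, A y -> phi y = psi y) -> jac phi x = jac psi x.
Proof.
move=> oA Ax E; apply/matrixP => i j; rewrite !jacE; apply: (pd_ext i oA Ax) => y Ay.
by rewrite E.
Qed.

Lemma jac_id n (x : 'rV[R]_n) : jac id x = 1%:M.
Proof. by apply/matrixP => i j; rewrite jacE pd_coord mxE. Qed.

End Jacobian.

(** * Curvature in coordinates *)

(* Turns matrix products into variables, so that only linear relations remain. *)
Ltac mxgen := repeat match goal with
  | |- context [@mulmx ?R ?m ?n ?p ?X ?Y] => move: (@mulmx R m n p X Y) => ? end.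

(* Noncommutative identities obtained by commuting two derivatives. *)
Section CommutatorIdentities.
Ltac mxlra := let H := fresh in mxgen => H; apply/matrixP => a b;
  have := congr1 (fun M => fun_of_matrix M a b) H; rewrite !mxE => ?; lra.
Context {R : realFieldType} {n : nat}.
Implicit Types (A B C D G J : 'M[R]_n).

Lemma lower_anti_identity Gi Gj G dij dji :
  dij *m G + Gj *m (Gi *m G + G *m Gi^T) + ((Gi *m G + G *m Gi^T) *m Gj^T + G *m dij^T) =
  dji *m G + Gi *m (Gj *m G + G *m Gj^T) + ((Gj *m G + G *m Gj^T) *m Gi^T + G *m dji^T) ->
  (dij - dji + (Gj *m Gi - Gi *m Gj)) *m G + G *m (dij - dji + (Gj *m Gi - Gi *m Gj))^T = 0 :> 'M[R]_n.
Proof.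
rewrite !(trmxD, trmxN) !trmx_mul !(mulmxDl, mulmxDr, mulmxN, mulNmx, mulmxA).
mxlra.
Qed.

Lemma ricci_identity_identity (Gi Gj dij dji : 'M[R]_n) (o Ti Tj dTij dTji : 'cV[R]_n) w wi wj :
  dij *m o + Gj *m (Gi *m o + w *: Ti) + (wi *: Tj + w *: dTij) =
  dji *m o + Gi *m (Gj *m o + w *: Tj) + (wj *: Ti + w *: dTji) ->
  (dij - dji + (Gj *m Gi - Gi *m Gj)) *m o + wi *: Tj - wj *: Ti +
   w *: (Gj *m Ti - Gi *m Tj + dTij - dTji) = 0.
Proof.
rewrite !(mulmxDl, mulmxDr, mulmxN, mulNmx, mulmxA) -!scalemxAr !(scalerDr, scalerN).
mxlra.
Qed.

Lemma transform_identity (Gi Gj dij dji J Pi Pj dPij dPji : 'M[R]_n) :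
  dij *m J + Gj *m (Gi *m J - J *m Pi) - ((Gi *m J - J *m Pi) *m Pj + J *m dPij) =
  dji *m J + Gi *m (Gj *m J - J *m Pj) - ((Gj *m J - J *m Pj) *m Pi + J *m dPji) ->
  (dij - dji + (Gj *m Gi - Gi *m Gj)) *m J = J *m (dPij - dPji + (Pj *m Pi - Pi *m Pj)).
Proof.
rewrite !(mulmxDl, mulmxDr, mulmxN, mulNmx, mulmxA).
mxlra.
Qed.

End CommutatorIdentities.

(** * Levi-Civita connection, curvature and Hessian in one chart *)

Section Metric.
Context {R : realType} {n : nat}.
Implicit Types (i j k l : 'I_n).

Lemma metric_unit (G : 'rV[R]_n -> 'M[R]_n) x : metric_tensor G x -> G x \in unitmx.
Proof.
move=> [_ pG]; rewrite unitmxE unitfE; apply/negP => /det0P[v v0 vG].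
by have := pG v v0; rewrite vG mul0mx mxE ltxx.
Qed.

(* (Gam i)_{jk} = Gamma^k_{ij} *)
Definition Gam_def (A : set 'rV[R]_n) G i (x : 'rV[R]_n) : 'M[R]_n :=
  \matrix_(j, k) christoffel A G k i j x.
Definition Gam := locked_with lkey Gam_def.

(* (Curv i j)_{kl} = R^l_{kij} *)
Definition Curv (A : set 'rV[R]_n) G i j (x : 'rV[R]_n) : 'M[R]_n :=
  mpd i (Gam A G j) x - mpd j (Gam A G i) x
  + (Gam A G j x *m Gam A G i x - Gam A G i x *m Gam A G j x).

Lemma GamEntry (A : set 'rV[R]_n) G i x j k :
  Gam A G i x j k = christoffel A G k i j x.
Proof. by rewrite /Gam unlock mxE. Qed.

Definition dcol_def (w : 'rV[R]_n -> R) (x : 'rV[R]_n) : 'cV[R]_n := \col_k pd k w x.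
Definition dcol := locked_with lkey dcol_def.

Lemma dcolE w x k a : dcol w x k a = pd k w x.
Proof. by rewrite /dcol unlock mxE. Qed.

Variables (A : set 'rV[R]_n) (G : 'rV[R]_n -> 'M[R]_n).
Hypothesis oA : open A.
Hypothesis sG : msmo A G.
Hypothesis mG : forall x, A x -> metric_tensor G x.

Let Gsym x : A x -> (G x)^T = G x. Proof. by move=> /mG[]. Qed.
Let Gu x : A x -> G x \in unitmx. Proof. by move=> /mG/metric_unit. Qed.

(** The Christoffel symbols of the first kind; [GamE] raises their last index. *)
Definition Low_def i (x : 'rV[R]_n) : 'M[R]_n := \matrix_(j, l)
  (2^-1 * (mpd i G x j l + mpd j G x i l - mpd l G x i j)).
Definition Low := locked_with lkey Low_def.

Lemma LowE i x j l : Low i x j l = 2^-1 * (mpd i G x j l + mpd j G x i l - mpd l G x i j).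
Proof. by rewrite /Low unlock mxE. Qed.

Lemma GamE i x : A x -> Gam A G i x = Low i x *m invmx (G x).
Proof.
move=> Ax; apply/matrixP => j k; rewrite GamEntry [RHS]mxE /christoffel mulr_sumr.
apply: eq_bigr => l _; rewrite LowE !mpdE !pderivE //.
have -> : invmx (G x) k l = invmx (G x) l k by rewrite -{1}(Gsym Ax) -trmx_inv mxE.
by rewrite mulrCA mulrC.
Qed.

Lemma mpdG_sym i j l x : A x -> mpd i G x j l = mpd i G x l j.
Proof.
move=> Ax; rewrite !mpdE; apply: (pd_ext i oA Ax) => y Ay.
by rewrite -{1}(Gsym Ay) trmxE.
Qed.

Lemma metric_compat i x : A x -> mpd i G x = Gam A G i x *m G x + G x *m (Gam A G i x)^T.
Proof.
move=> Ax.
have E : Gam A G i x *m G x = Low i x by rewrite GamE // mulmxKV ?Gu.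
have -> : G x *m (Gam A G i x)^T = (Gam A G i x *m G x)^T by rewrite trmx_mul Gsym.
rewrite E; apply/matrixP => j l; rewrite addmxE trmxE !LowE.
rewrite (mpdG_sym i l j Ax).
by field.
Qed.

Lemma Gam_torsion i j k x : A x -> Gam A G i x j k = Gam A G j x i k.
Proof.
move=> Ax; rewrite !GamE // ![(_ *m _) _ _]mxE; apply: eq_bigr => l _; congr (_ * _).
rewrite !LowE (mpdG_sym l i j Ax); congr (_ * (_ - _)); exact: addrC.
Qed.

(** Koszul's argument: three instances of compatibility, combined by the symmetry of [C], express
    [C i *m G x] by derivatives of the metric. Later connections are therefore guessed and verified
    instead of being computed from the definition. *)
Lemma levi_civita_unique (C : 'I_n -> 'M[R]_n) x : A x ->
  (forall i, C i *m G x + G x *m (C i)^T = mpd i G x) ->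
  (forall i j k, C i j k = C j i k) -> forall i, C i = Gam A G i x.
Proof.
move=> Ax comp tor i.
have S1 a b c : mpd a G x b c = (C a *m G x) b c + (C a *m G x) c b.
  rewrite -comp mxE; congr (_ + _).
  by rewrite -(Gsym Ax) -trmx_mul mxE Gsym.
have S2 a b c : (C a *m G x) b c = (C b *m G x) a c.
  by rewrite !mxE; apply: eq_bigr => k _; rewrite tor.
have E : C i *m G x = Low i x.
  apply/matrixP => j l; rewrite LowE !S1.
  by rewrite (S2 l i j) (S2 l j i) S2; field.
by rewrite GamE // -E mulmxK ?Gu.
Qed.

Lemma Gam_smo i : msmo A (Gam A G i).
Proof.
apply: (@msmo_ext _ _ _ _ _ (fun y => Low i y *m invmx (G y))) => //.
  by move=> y Ay; rewrite GamE.
apply: msmoM => //; last by apply: msmo_invmx => // y.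
move=> j l; have -> : (fun y => Low i y j l) = fun y =>
   2^-1 * (mpd i G y j l + mpd j G y i l - mpd l G y i j).
  by apply/funext => y; rewrite LowE.
apply: smoM => //; first exact: smo_cst.
by apply: smoB => //; [apply: smoD => //|]; apply: msmo_mpd.
Qed.

Lemma Curv_anti i j x : Curv A G i j x = - Curv A G j i x.
Proof. by rewrite opprD !opprB. Qed.

Lemma riemannE l k i j x : A x -> riemann A G l k i j x = Curv A G i j x k l.
Proof.
move=> Ax; rewrite /riemann !pderivE // !addmxE !oppmxE; congr (_ + _).
  have E a b : mpd a (Gam A G b) x k l = pd a (christoffel A G l b k) x.
    by rewrite mpdE; congr (pd _ _ _); apply/funext => y; rewrite GamEntry.
  by rewrite E E.
by rewrite sumrB [X in _ = X - _]mxE [X in _ = _ - X]mxE; congr (_ - _);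
  apply: eq_bigr => a _; rewrite !GamEntry mulrC.
Qed.

Lemma ricciE j k x : A x -> ricci A G x j k = \sum_i Curv A G i j x k i.
Proof. by move=> Ax; rewrite mxE; apply: eq_bigr => i _; rewrite riemannE. Qed.

Lemma Curv_smo i j : msmo A (Curv A G i j).
Proof.
have H a b : msmo A (fun x => Gam A G a x *m Gam A G b x).
  by apply: msmoM => //; exact: Gam_smo.
have K a b : msmo A (mpd a (Gam A G b)) by apply: msmo_mpd => //; exact: Gam_smo.
have N (F : 'rV[R]_n -> 'M[R]_n) : msmo A F -> msmo A (fun x => - F x).
  move=> sF a b; have -> : (fun y => (- F y) a b) = (fun y => - F y a b).
    by apply/funext => y; rewrite mxE.
  exact: smoN.
by do 3?[apply: msmoD|apply: N].
Qed.

Lemma ricci_smo : msmo A (ricci A G).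
Proof.
move=> j k; apply: (@smo_ext _ _ _ (fun x => \sum_i Curv A G i j x k i)) => //.
  by move=> x Ax; rewrite ricciE.
by apply: smo_sum => // i _; exact: Curv_smo.
Qed.

(** The mixed second derivatives of [G] commute; expanding both by [metric_compat] leaves exactly
    the curvature terms. *)
Lemma Curv_lower_anti i j x : A x ->
  Curv A G i j x *m G x + G x *m (Curv A G i j x)^T = 0.
Proof.
move=> Ax.
have dGam k : mdiff (Gam A G k) x by exact: msmo_mdiff (Gam_smo k) _.
have dG : mdiff G x by exact: msmo_mdiff.
have H a b : mpd a (mpd b G) x = mpd a (Gam A G b) x *m G x
   + Gam A G b x *m (Gam A G a x *m G x + G x *m (Gam A G a x)^T)
   + ((Gam A G a x *m G x + G x *m (Gam A G a x)^T) *m (Gam A G b x)^T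
   + G x *m (mpd a (Gam A G b) x)^T).
  rewrite (mpd_ext _ oA Ax (metric_compat b)) mpdD; last first.
  - by apply: msmo_mdiff Ax; apply: msmoM => //; apply: msmo_tr; exact: Gam_smo.
  - by apply: msmo_mdiff Ax; apply: msmoM => //; exact: Gam_smo.
  rewrite !mpdM -?metric_compat ?mpd_tr //.
  by apply: (msmo_mdiff (msmo_tr (Gam_smo b)) Ax).
have := mpd_sym j i oA Ax sG; rewrite !H /Curv.
exact: lower_anti_identity.
Qed.

Lemma hessianE (w : 'rV[R]_n -> R) x i j : A x ->
  hessian A G w x i j = (mpd i (dcol w) x - Gam A G i x *m dcol w x) j 0.
Proof.
move=> Ax; rewrite mxE addmxE oppmxE; congr (_ - _).
  rewrite mpdE -(pderivE i _ oA Ax); apply: (pderiv_ext i oA Ax) => y Ay.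
  by rewrite dcolE pderivE.
by rewrite [RHS]mxE; apply: eq_bigr => k _; rewrite GamEntry dcolE pderivE.
Qed.

Lemma dcol_smo w : smo A w -> msmo A (dcol w).
Proof.
move=> sw a b; have -> : (fun y => dcol w y a b) = pd a w by apply/funext => y; rewrite dcolE.
exact: smo_pd.
Qed.

Lemma hessian_sym w x i j : smo A w -> A x -> hessian A G w x i j = hessian A G w x j i.
Proof.
move=> sw Ax; rewrite !hessianE // !addmxE !oppmxE; congr (_ - _).
  have E a b : mpd a (dcol w) x b 0 = pd a (pd b w) x.
    by rewrite mpdE; congr (pd _ _ _); apply/funext => y; rewrite dcolE.
  by rewrite E E; exact: (smo_pd_sym oA j i sw Ax).
by rewrite [LHS]mxE [RHS]mxE; apply: eq_bigr => k _; rewrite Gam_torsion.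
Qed.

Section RicciIdentity.
Variable T : 'rV[R]_n -> 'M[R]_n.
Hypothesis sT : msmo A T.
Definition Tcol i (x : 'rV[R]_n) : 'cV[R]_n := (row i (T x))^T.

Lemma Tcol_smo i : msmo A (Tcol i).
Proof.
move=> a b; have -> : (fun y => Tcol i y a b) = (fun y => T y i a).
  by apply/funext => y; rewrite !mxE.
exact: sT.
Qed.

(** The antisymmetrised covariant derivative of [T], a Cotton tensor; the Christoffel terms in the
    pair [i, j] cancel by symmetry. *)
Definition Cott i j (x : 'rV[R]_n) : 'cV[R]_n :=
  Gam A G j x *m Tcol i x - Gam A G i x *m Tcol j x + mpd i (Tcol j) x - mpd j (Tcol i) x.

Variable w : 'rV[R]_n -> R.
Hypothesis sw : smo A w.
Hypothesis Hw : forall x, A x -> hessian A G w x = w x *: T x.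

Lemma Weq_dcol i x : A x -> mpd i (dcol w) x = Gam A G i x *m dcol w x + w x *: Tcol i x.
Proof.
move=> Ax; apply/matrixP => j b; rewrite !ord1.
have := hessianE w i j Ax; rewrite Hw // !addmxE oppmxE !scalemxE [Tcol _ _ _ _]trmxE [row _ _ _ _]mxE => E.
by lra.
Qed.

(** Commuting the derivatives of [dw] in [Hess w = w T]. The term with [Cott] carries a factor [w],
    so at a zero of [w] only curvature, [T] and [dw] remain. *)
Lemma ricci_identity i j x : A x ->
  Curv A G i j x *m dcol w x + pd i w x *: Tcol j x - pd j w x *: Tcol i x
    + w x *: Cott i j x = 0.
Proof.
move=> Ax.
have dGam k : mdiff (Gam A G k) x by exact: msmo_mdiff (Gam_smo k) _.
have dw : differentiable w x by exact: smo_diff.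
have dT k : mdiff (Tcol k) x by exact: msmo_mdiff (Tcol_smo k) _.
have dd : mdiff (dcol w) x by exact: msmo_mdiff (dcol_smo sw) _.
have H a b : mpd a (mpd b (dcol w)) x = mpd a (Gam A G b) x *m dcol w x
   + Gam A G b x *m (Gam A G a x *m dcol w x + w x *: Tcol a x)
   + (pd a w x *: Tcol b x + w x *: mpd a (Tcol b) x).
  rewrite (mpd_ext _ oA Ax (Weq_dcol b)) mpdD; last first.
  - by apply: msmo_mdiff Ax; apply: msmoZ => //; exact: Tcol_smo.
  - by apply: msmo_mdiff Ax; apply: msmoM => //; [exact: Gam_smo|exact: dcol_smo].
  by rewrite mpdM // mpdZ // -Weq_dcol.
have := mpd_sym j i oA Ax (dcol_smo sw); rewrite !H /Curv /Cott.
exact: ricci_identity_identity.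
Qed.

End RicciIdentity.

End Metric.

(** * Orthonormal frames and the algebra of curvature at a point *)

Section Orthonormal.
Context {R : realType} {n : nat}.
Variable G : 'M[R]_n.
Hypothesis Gsym : G^T = G.
Hypothesis Gpos : forall v : 'rV[R]_n, v != 0 -> 0 < (v *m G *m v^T) 0 0.

Lemma orthonormal_step k (E : 'M[R]_(k, n)) (b : 'rV[R]_n) :
  E *m G *m E^T = 1%:M -> ~~ (b <= E)%MS ->
  exists v : 'rV[R]_n, [/\ v *m G *m v^T = 1%:M, v *m G *m E^T = 0 & (v <= col_mx b E)%MS].
Proof.
move=> EE bE; pose u := b - b *m G *m E^T *m E.
have u0 : u != 0.
  by apply: contra bE; rewrite subr_eq0 => /eqP ->; exact: submxMl.
have uE : u *m G *m E^T = 0.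
  rewrite !mulmxBl -!mulmxA [E *m _]mulmxA EE mulmx1 subrr //.
pose q := (u *m G *m u^T) 0 0; have q0 : 0 < q by exact: Gpos.
exists ((Num.sqrt q)^-1 *: u); split.
- rewrite linearZ /= -!scalemxAl -scalemxAr scalerA; apply/matrixP => i j.
  rewrite !ord1 scalemxE [1%:M _ _]mxE eqxx -[X in _ * X](sqr_sqrtr (ltW q0)).
  by rewrite mulr1n; field; rewrite gt_eqF // sqrtr_gt0.
- by rewrite -!scalemxAl uE scaler0.
- apply: scalemx_sub; apply: addmx_sub; first by rewrite -addsmxE addsmxSl.
  rewrite eqmx_opp; apply: (submx_trans (submxMl _ _)).
  by rewrite -addsmxE addsmxSr.
Qed.

Lemma orthonormal_col_mx k (E : 'M[R]_(k, n)) (v : 'rV[R]_n) :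
  E *m G *m E^T = 1%:M -> v *m G *m v^T = 1%:M -> v *m G *m E^T = 0 ->
  col_mx v E *m G *m (col_mx v E)^T = 1%:M.
Proof.
move=> EE vv vE; rewrite tr_col_mx mul_col_mx mul_col_row EE vv vE.
have H := congr1 trmx vE; rewrite !trmx_mul trmxK Gsym mulmxA trmx0 in H; rewrite H.
by rewrite -scalar_mx_block.
Qed.

Lemma gram_schmidt k (B : 'M[R]_(k, n)) : row_free B ->
  exists2 E : 'M[R]_(k, n), E *m G *m E^T = 1%:M & (E <= B)%MS.
Proof.
elim: k B => [|k IH] B fB; first by exists 0; [apply/matrixP => -[]|exact: sub0mx].
move: B fB; rewrite -[k.+1]/(1 + k)%N => B fB.
have rB : \rank B = (1 + k)%N by apply/eqP.
pose b := usubmx B; pose B' := dsubmx B.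
have BE : B = col_mx b B' by rewrite vsubmxK.
have rB' : row_free B'.
  rewrite /row_free eqn_leq rank_leq_row /= -(leq_add2l 1) -rB BE -addsmxE.
  by apply: (leq_trans (mxrank_adds_leqif _ _)); rewrite leq_add2r rank_leq_row.
have [E EE EB] := IH B' rB'.
have bE : ~~ (b <= E)%MS.
  apply/negP => bE; have : (\rank B <= k)%N.
    apply: (@leq_trans (\rank B')); last exact: rank_leq_row.
    apply: mxrankS; rewrite BE -addsmxE addsmx_sub submx_refl andbT.
    exact: submx_trans _ EB.
  by rewrite rB ltnn.
have [v [vv vE vb]] := orthonormal_step EE bE.
exists (col_mx v E); first exact: orthonormal_col_mx.
have E1 : (col_mx b E <= B)%MS by rewrite BE -!addsmxE addsmxS.
rewrite -addsmxE addsmx_sub (submx_trans vb E1) /=.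
by apply: submx_trans EB _; rewrite BE -addsmxE addsmxSr.
Qed.

End Orthonormal.

Section CurvatureAlgebra.
Context {R : realType} {n : nat}.
Variables (G : 'M[R]_n) (Rm : 'I_n -> 'I_n -> 'M[R]_n) (T : 'M[R]_n).
Hypothesis Gsym : G^T = G.
Hypothesis lower : forall i j, Rm i j *m G + G *m (Rm i j)^T = 0.
Hypothesis Tsym : T^T = T.
Implicit Types (X Y Z W : 'rV[R]_n) (xi : 'cV[R]_n).

(** The condition that [ricci_identity] imposes on the differential [xi] of a solution at one of its
    zeros. *)
Definition good xi := forall i j,
  Rm i j *m xi = xi j 0 *: (row i T)^T - xi i 0 *: (row j T)^T.

(** The curvature of three vectors, with a covector [xi] in the last slot, because good objects are
    covectors; a vector [W] enters as [G *m W^T]. *)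
Definition R4 X Y Z xi : R := \sum_i X 0 i * (\sum_j Y 0 j * (Z *m Rm i j *m xi) 0 0).
Definition bil (A : 'M[R]_n) X Y : R := (X *m A *m Y^T) 0 0.
Definition ev xi X : R := (X *m xi) 0 0.

Lemma bil_sum (A : 'M[R]_n) X Y : bil A X Y = \sum_i X 0 i * (Y *m (row i A)^T) 0 0.
Proof.
rewrite /bil -mulmxA mxE; apply: eq_bigr => i _; congr (_ * _).
rewrite !mxE; apply: eq_bigr => j _; by rewrite !mxE mulrC.
Qed.

Lemma R4_good X Y Z xi : good xi ->
  R4 X Y Z xi = ev xi Y * bil T X Z - ev xi X * bil T Y Z.
Proof.
move=> g; rewrite /R4 !bil_sum.
under eq_bigr => i _.
  under eq_bigr => j _.
    rewrite -mulmxA g mulmxBr -!scalemxAr addmxE oppmxE !scalemxE mulrBr.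
    over.
  rewrite sumrB mulrBr; over.
rewrite sumrB; congr (_ - _).
  rewrite mulr_sumr; apply: eq_bigr => i _; rewrite mulrCA; congr (_ * _).
  by rewrite [X in _ = X * _]mxE mulr_suml; apply: eq_bigr => j _; rewrite mulrA.
rewrite [X in _ = X * _]mxE mulr_suml; apply: eq_bigr => i _.
by rewrite -mulrA; congr (_ * _); rewrite mulr_sumr; apply: eq_bigr => j _; rewrite mulrCA.
Qed.

Lemma R4_anti X Y Z W : R4 X Y Z (G *m W^T) = - R4 X Y W (G *m Z^T).
Proof.
rewrite -sumrN; apply: eq_bigr => i _; rewrite -mulrN; congr (_ * _).
rewrite -sumrN; apply: eq_bigr => j _; rewrite -mulrN; congr (_ * _).
have E : Rm i j *m G = - (G *m (Rm i j)^T) by apply/eqP; rewrite -addr_eq0 lower.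
rewrite -!mulmxA [Rm i j *m (G *m W^T)]mulmxA E mulNmx mulmxN oppmxE; congr (- _).
rewrite -[in LHS](trmxK (Z *m _)) trmxE; congr (fun_of_matrix _ _ _).
by rewrite !trmx_mul !trmxK Gsym !mulmxA.
Qed.

Lemma R4_diag X Y Z : R4 X Y Z (G *m Z^T) = 0.
Proof. by have := R4_anti X Y Z Z; lra. Qed.

Definition Ric_of : 'M[R]_n := \matrix_(j, k) \sum_i Rm i j k i.

(** A trace may be taken in any frame together with its dual frame, and orthonormality makes
    [G *m E^T] the inverse of [E]. *)
Lemma bil_Ric (E : 'M[R]_n) Y Z : E *m G *m E^T = 1%:M ->
  bil Ric_of Y Z = \sum_a R4 (row a E) Y Z (G *m (row a E)^T).
Proof.
move=> EE.
have EE' : (G *m E^T) *m E = 1%:M by apply: mulmx1C; rewrite mulmxA.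
pose M i : 'rV[R]_n := \sum_j Y 0 j *: (Z *m Rm i j).
have ME i xi : \sum_j Y 0 j * (Z *m Rm i j *m xi) 0 0 = (M i *m xi) 0 0.
  rewrite mulmx_suml summxE; apply: eq_bigr => j _.
  by rewrite -scalemxAl scalemxE.
rewrite /R4; under eq_bigr => a _ do under eq_bigr => i _ do rewrite ME.
rewrite exchange_big /=.
have E1 i : \sum_a row a E 0 i * (M i *m (G *m (row a E)^T)) 0 0 = M i 0 i.
  rewrite -{2}[M i]mulmx1 -EE' mulmxA [RHS]mxE; apply: eq_bigr => a _.
  rewrite mulrC; congr (_ * _); last by rewrite mxE.
  rewrite !mulmxA [LHS]mxE [RHS]mxE; apply: eq_bigr => b _; congr (_ * _).
  by rewrite !mxE.
under eq_bigr => i _ do rewrite E1 summxE.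
rewrite exchange_big /= bil_sum; apply: eq_bigr => j _.
rewrite [(Z *m _) 0 0]mxE mulr_sumr [RHS](eq_bigr (fun i => \sum_k Y 0 j * (Z 0 k * Rm i j k i))).
  rewrite exchange_big; apply: eq_bigr => k _ /=.
  by rewrite -mulr_sumr -mulr_sumr !mxE.
by move=> i _; rewrite scalemxE [(Z *m _) 0 _]mxE mulr_sumr.
Qed.

Lemma goodD xi eta : good xi -> good eta -> good (xi + eta).
Proof.
move=> g h i j; rewrite mulmxDr g h !addmxE !scalerDl opprD.
by rewrite addrACA.
Qed.
Lemma goodZ c xi : good xi -> good (c *: xi).
Proof. by move=> g i j; rewrite -scalemxAr g !scalemxE scalerBr !scalerA. Qed.
Lemma good0 : good 0.
Proof. by move=> i j; rewrite mulmx0 [X in X *: _]mxE [X in _ - X *: _]mxE !scale0r subrr. Qed.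

Lemma good_comb k (X : 'M[R]_(n, k)) (d : 'cV[R]_k) : (forall a, good (col a X)) -> good (X *m d).
Proof.
move=> g; have -> : X *m d = \sum_a d a 0 *: col a X.
  apply/matrixP => i j; rewrite ord1 summxE mxE; apply: eq_bigr => a _.
  by rewrite !mxE mulrC.
by elim/big_ind : _ => [|x y|a _]; [exact: good0|exact: goodD|exact: goodZ].
Qed.

End CurvatureAlgebra.

Section EinsteinAlgebra.
Context {R : realType} {k : nat}.
Local Notation n := k.+1.
Variables (G : 'M[R]_n) (Rm : 'I_n -> 'I_n -> 'M[R]_n) (lambda m : R).
Hypothesis Gsym : G^T = G.
Hypothesis Gpos : forall v : 'rV[R]_n, v != 0 -> 0 < (v *m G *m v^T) 0 0.
Hypothesis lower : forall i j, Rm i j *m G + G *m (Rm i j)^T = 0.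
Hypothesis m0 : 0 < m.
Let T : 'M[R]_n := m^-1 *: (Ric_of Rm - lambda *: G).
Hypothesis Tsym : T^T = T.

(** Let all frame covectors but the first be good. Skewness of the curvature in its last two slots
    makes [T] diagonal in the frame, with equal entries [t] on the good directions. Tracing gives
    [Ric(e_0, e_0) = - k t_0] and [Ric(e_b, e_b) = - t_0 - (k - 1) t_b]; compared with
    [Ric = m T + lambda G] this forces every entry to be [- lambda / (m + k)]. *)
Lemma einstein_of_frame (E : 'M[R]_n) : (0 < k)%N -> E *m G *m E^T = 1%:M ->
  (forall a, a != ord0 -> good Rm T (G *m (row a E)^T)) ->
  Ric_of Rm = (k%:R * lambda / (m + k%:R)) *: G.
Proof.
move=> k0 EE g.
pose e a := row a E; pose xi a := G *m (e a)^T; pose t a := bil T (e a) (e a).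
have exi a b : ev (xi b) (e a) = (a == b)%:R.
  have -> : ev (xi b) (e a) = (E *m G *m E^T) a b.
    rewrite /ev /xi /e mulmxA -row_mul [LHS]mxE [RHS]mxE.
    by apply: eq_bigr => c _; rewrite !mxE.
  by rewrite EE mxE.
have ex1 b : ev (xi b) (e b) = 1 by rewrite exi eqxx.
have ex0 a b : a != b -> ev (xi b) (e a) = 0 by move=> /negbTE ab; rewrite exi ab.
have RG X Y Z b : b != ord0 ->
    R4 Rm X Y Z (xi b) = ev (xi b) Y * bil T X Z - ev (xi b) X * bil T Y Z.
  by move=> b0; apply: R4_good; exact: g.
have Ta b Y : b != ord0 -> bil T Y (e b) = ev (xi b) Y * t b.
  move=> b0; have := R4_diag Gsym lower (e b) Y (e b).
  by rewrite RG // ex1 -/(t b) => H; lra.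
have bsym X Y : bil T X Y = bil T Y X.
  rewrite /bil -[in LHS](trmxK (X *m _ *m _)) trmxE; congr (fun_of_matrix _ _ _).
  by rewrite !trmx_mul trmxK Tsym mulmxA.
have Tab a b : a != ord0 -> b != ord0 -> t a = t b.
  move=> a0 b0; have [->//|ab] := eqVneq a b.
  have := R4_anti Gsym lower (e a) (e b) (e b) (e a).
  rewrite !RG // !ex1 (ex0 a b) // ex0 1?eq_sym //.
  rewrite -/(t b) -/(t a) => H; lra.
have RicT X Y : bil (Ric_of Rm) X Y = m * bil T X Y + lambda * bil G X Y.
  have -> : Ric_of Rm = m *: T + lambda *: G.
    by rewrite scalerA divff ?gt_eqF // scale1r subrK.
  by rewrite /bil mulmxDr mulmxDl -!scalemxAr -!scalemxAl addmxE !scalemxE.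
have G1 a : bil G (e a) (e a) = 1.
  by have := ex1 a; rewrite /ev mulmxA.
have card_good : \sum_(a < n | a != ord0) (1 : R) = k%:R.
  rewrite sumr_const; congr (_ *+ _).
  by rewrite cardC1 card_ord.
have R00 : bil (Ric_of Rm) (e ord0) (e ord0) = - k%:R * t ord0.
  rewrite (bil_Ric Rm _ _ EE) (bigD1 ord0) //= R4_diag // add0r.
  rewrite (eq_bigr (fun=> - t ord0 * 1)); first by rewrite -mulr_sumr card_good mulrC mulrN mulNr.
  move=> a a0; rewrite RG // ex1 ex0 1?eq_sym // mul0r mul1r mulr1.
  by rewrite sub0r.
(* Nothing is known about the covector of [e_0], so in its term of the trace the last two slots are
   exchanged to bring the good covector of [e_b] to the end. *)
have Rbb b : b != ord0 -> bil (Ric_of Rm) (e b) (e b) = - t ord0 - (k%:R - 1) * t b.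
  move=> b0; rewrite (bil_Ric Rm _ _ EE) (bigD1 ord0) //= -/(e ord0) R4_anti //; congr (_ + _).
    by rewrite RG // ex1 ex0 1?eq_sym // mul1r mul0r subr0.
  rewrite (bigD1 b) //= R4_diag // add0r.
  have -> : - ((k%:R - 1) * t b) = \sum_(a < n | (a != ord0) && (a != b)) (- t b * 1).
    rewrite -mulr_sumr -card_good (bigD1 b) //=; ring.
  apply: eq_bigr => a /andP[a0 ab].
  rewrite RG // ex1 ex0 1?eq_sym // mul0r mul1r mulr1.
  by rewrite sub0r.
have k1 : 1 <= k%:R :> R by rewrite ler1n.
pose s := - lambda / (m + k%:R).
have mk : m + k%:R != 0 by rewrite gt_eqF // ltr_wpDr.
have t0 : t ord0 = s.
  have := RicT (e ord0) (e ord0); rewrite R00 G1 mulr1 -/(t ord0) => H.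
  by apply: (mulIf mk); rewrite divfK //; lra.
have tb b : b != ord0 -> t b = s.
  move=> b0; have := RicT (e b) (e b); rewrite Rbb // G1 mulr1 -/(t b) t0 => H.
  have mk' : m + k%:R - 1 != 0 by apply: lt0r_neq0; rewrite -addrA ltr_pwDl // subr_ge0.
  apply: (mulIf mk').
  have -> : t b * (m + k%:R - 1) = - lambda - s by lra.
  by rewrite /s; field.
have TE : E *m T *m E^T = s *: 1%:M.
  apply/matrixP => a b; have -> : (E *m T *m E^T) a b = bil T (e a) (e b).
    rewrite /bil /e -row_mul [LHS]mxE [RHS]mxE.
    by apply: eq_bigr => c _; rewrite !mxE.
  rewrite scalemxE mxE; have [->|ab] := eqVneq a b.
    rewrite mulr1; have [->|b0] := eqVneq b ord0; [exact: t0|exact: tb].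
  rewrite mulr0; have [b0|b0] := eqVneq b ord0.
    have a0 : a != ord0 by rewrite -b0.
    by rewrite bsym Ta // ex0 ?mul0r // eq_sym.
  by rewrite Ta // ex0 // mul0r.
have uE : E \in unitmx by case: (mulmx1_unit (etrans (mulmxA _ _ _) EE)).
have TG : T = s *: G.
  have : E *m T *m E^T = E *m (s *: G) *m E^T by rewrite TE -scalemxAr -scalemxAl EE.
  have uET : E^T \in unitmx by rewrite unitmx_tr.
  by move=> /(can_inj (mulmxK uET)) /(can_inj (mulKmx uE)).
have -> : Ric_of Rm = m *: T + lambda *: G.
  by rewrite scalerA divff ?gt_eqF // scale1r subrK.
by rewrite TG scalerA -scalerDl; congr (_ *: _); rewrite /s; field.
Qed.

(** Good covectors form a linear space, so Gram-Schmidt turns k independent ones into orthonormal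
    good ones; one more unit vector, of which nothing is asked, completes the frame. *)
Lemma einstein_of_good (X : 'M[R]_(n, k)) : (0 < k)%N -> \rank X = k ->
  (forall a, good Rm T (col a X)) -> Ric_of Rm = (k%:R * lambda / (m + k%:R)) *: G.
Proof.
move=> k0 rX gX.
have uG : G \in unitmx.
  rewrite unitmxE unitfE; apply/negP => /det0P[v v0 vG].
  by have := Gpos v0; rewrite vG mul0mx mxE ltxx.
pose B := (invmx G *m X)^T.
have fB : row_free B.
  by rewrite /row_free mxrank_tr eqmxMfull ?rX // row_full_unit unitmx_inv.
have [E EE EB] := gram_schmidt Gsym Gpos fB.
have [b bE] : exists b : 'rV[R]_n, ~~ (b <= E)%MS.
  apply/not_existsP => H; have : (1%:M <= E)%MS.
    by apply/row_subP => i; have /negP := H (row i 1%:M); rewrite negbK.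
  by move=> /mxrankS; rewrite mxrank1 => /leq_trans /(_ (rank_leq_row _)); rewrite ltnn.
have [v [vv vE _]] := orthonormal_step Gpos EE bE.
apply: (@einstein_of_frame (col_mx v E)) => //; first exact: orthonormal_col_mx.
move=> a a0.
have [a' ->] : exists a', a = rshift 1 a'.
  have [c|c] := splitP (a : 'I_(1 + k)).
    by rewrite ord1 => a1; move: a0; rewrite -val_eqE /= a1.
  by exists c; apply: val_inj.
have -> : row (rshift 1 a') (col_mx v E) = row a' E.
  by apply/rowP => j; rewrite [LHS]mxE [RHS]mxE; exact: col_mxEd.
have /submxP[D DE] : (row a' E <= B)%MS by apply: submx_trans EB; exact: row_sub.
by rewrite DE trmx_mul trmxK !mulmxA mulmxV // mul1mx; exact: good_comb.
Qed.

End EinsteinAlgebra.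

(** * Naturality of connection, curvature and Hessian under isometries *)

Section Isometry.
Context {R : realType} {n : nat}.
Variables (A B : set 'rV[R]_n) (G H : 'rV[R]_n -> 'M[R]_n) (phi : 'rV[R]_n -> 'rV[R]_n).
Hypotheses (oA : open A) (oB : open B) (sG : msmo A G) (sH : msmo B H).
Hypothesis mG : forall x, A x -> metric_tensor G x.
Hypothesis mH : forall x, B x -> metric_tensor H x.
Hypothesis AB : forall x, A x -> B (phi x).
Hypothesis sphi : msmo A phi.
Implicit Types (i j k : 'I_n).

Local Notation Jac := (jac phi).
Hypothesis iso : forall x, A x -> Jac x *m H (phi x) *m (Jac x)^T = G x.

Lemma Jac_smo : msmo A Jac.
Proof. exact: jac_smo. Qed.

Lemma Jac_unit x : A x -> Jac x \in unitmx.
Proof.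
move=> Ax; have := metric_unit (mG Ax); rewrite -iso // -mulmxA.
by rewrite unitmx_mul => /andP[].
Qed.

Lemma Jac_sym i j k x : A x -> mpd i Jac x j k = mpd j Jac x i k.
Proof.
move=> Ax; rewrite !mpdE.
have E a : (fun y => Jac y a k) = pd a (fun y => phi y 0 k) by apply/funext => y; rewrite jacE.
by rewrite !E (smo_pd_sym oA _ _ (sphi 0 k) Ax).
Qed.

(** Only the index [a] of the family is transformed, as for a 1-form; the matrix indices of its
    values stay in the target coordinates. *)
Definition pull p q (F : 'I_n -> 'rV[R]_n -> 'M[R]_(p, q)) i (x : 'rV[R]_n) : 'M[R]_(p, q) :=
  \sum_a Jac x i a *: F a (phi x).

Lemma dphi x : A x -> differentiable phi x.
Proof. exact: msmo_differentiable. Qed.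

Lemma mpd_pull p q (F : 'rV[R]_n -> 'M[R]_(p, q)) i x : A x -> msmo B F ->
  mpd i (F \o phi) x = pull (fun a => mpd a F) i x.
Proof.
move=> Ax sF; rewrite mpd_comp; last exact: dphi.
  by apply: eq_bigr => j _; rewrite jacE.
exact: msmo_mdiff _ (AB Ax).
Qed.

Let Gam' := Gam B H.
Let P := pull Gam'.

(** The right-hand side is compatible with the metric because [Jac] is isometric, and symmetric
    because second derivatives of [phi] commute; uniqueness of the Levi-Civita connection does the
    rest. *)
Lemma pull_Gam i x : A x -> Gam A G i x = (mpd i Jac x + Jac x *m P i x) *m invmx (Jac x).
Proof.
move=> Ax; have uJ := Jac_unit Ax.
have GJ : invmx (Jac x) *m G x = H (phi x) *m (Jac x)^T.
  by rewrite -iso // !mulmxA mulVmx // mul1mx.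
have dJ : mdiff Jac x by exact: msmo_mdiff Jac_smo _.
have dH : mdiff (H \o phi) x by apply: msmo_mdiff Ax; exact: msmo_comp _ _ _ sH.
have Hcomp j : mpd j (H \o phi) x = P j x *m H (phi x) + H (phi x) *m (P j x)^T.
  rewrite mpd_pull // /P /pull mulmx_suml.
  have -> : (\sum_a Jac x j a *: Gam' a (phi x))^T = \sum_a Jac x j a *: (Gam' a (phi x))^T.
    by rewrite trmx_sum; apply: eq_bigr => a _; rewrite trmxZ.
  rewrite mulmx_sumr -big_split /=; apply: eq_bigr => a _.
  by rewrite -scalemxAl -scalemxAr -scalerDr -(metric_compat oB mH a (AB Ax)).
pose C := fun i => (mpd i Jac x + Jac x *m P i x) *m invmx (Jac x).
have CJ j : C j *m Jac x = mpd j Jac x + Jac x *m P j x by rewrite mulmxKV.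
symmetry; apply: (levi_civita_unique oA mG (C := C)) => //.
- move=> {}i; have CG : C i *m G x = (mpd i Jac x + Jac x *m P i x) *m (H (phi x) *m (Jac x)^T).
    by rewrite -mulmxA GJ.
  have -> : G x *m (C i)^T = (C i *m G x)^T by rewrite [RHS]trmx_mul (mG Ax).1.
  rewrite CG (mpd_ext i oA Ax (fun y Ay => esym (iso Ay))).
  rewrite mpdM; last first.
  + exact: (msmo_mdiff (msmo_tr Jac_smo) Ax).
  + by apply: msmo_mdiff Ax; apply: msmoM => //; [exact: Jac_smo|exact: msmo_comp _ _ _ sH].
  rewrite (mpdM (F := Jac) (G := H \o phi)) // Hcomp mpd_tr !trmx_mul trmxK (mH (AB Ax)).1.
  rewrite trmxD trmx_mul !(mulmxDl, mulmxDr, mulmxA) /=.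
  rewrite -[LHS]addrA -[RHS]addrA; congr (_ + _).
  by rewrite -[RHS]addrA; congr (_ + _); exact: addrC.
- move=> {}i j k.
  have S a b c : (C a *m Jac x) b c = (C b *m Jac x) a c.
    rewrite !CJ !addmxE Jac_sym //; congr (_ + _).
    rewrite !mulmx_sumr !summxE.
    under eq_bigr => d _ do rewrite -scalemxAr scalemxE [(_ *m _) _ _]mxE mulr_sumr.
    under [RHS]eq_bigr => d _ do rewrite -scalemxAr scalemxE [(_ *m _) _ _]mxE mulr_sumr.
    rewrite exchange_big; apply: eq_bigr => d _; apply: eq_bigr => e _.
    by rewrite (Gam_torsion oB mH _ _ _ (AB Ax)) mulrCA.
  by rewrite -[C i](mulmxK uJ) -[C j](mulmxK uJ) [LHS]mxE [RHS]mxE; apply: eq_bigr => l _; rewrite S.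
Qed.

Lemma mpd_Jac i x : A x -> mpd i Jac x = Gam A G i x *m Jac x - Jac x *m P i x.
Proof. by move=> Ax; rewrite pull_Gam // mulmxKV ?Jac_unit // addrK. Qed.

Lemma pull_smo p q (F : 'I_n -> 'rV[R]_n -> 'M[R]_(p, q)) i :
  (forall a, msmo B (F a)) -> msmo A (pull F i).
Proof.
move=> sF a b; have -> : (fun y => pull F i y a b) = (fun y => \sum_c Jac y i c * F c (phi y) a b).
  by apply/funext => y; rewrite summxE; apply: eq_bigr => c _; rewrite scalemxE.
apply: smo_sum => // c _; apply: smoM => //; first exact: Jac_smo.
exact: (msmo_comp oA AB sphi (sF c) a b).
Qed.

Lemma P_smo i : msmo A (P i).
Proof. by apply: pull_smo => a; exact: Gam_smo. Qed.

Lemma mpd_pullP i j x : A x -> mpd i (P j) x =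
  \sum_b mpd i Jac x j b *: Gam' b (phi x) +
  \sum_b Jac x j b *: \sum_a Jac x i a *: mpd a (Gam' b) (phi x).
Proof.
move=> Ax; apply/matrixP => u v; rewrite mpdE addmxE !summxE.
have -> : (fun y => P j y u v) = (fun y => \sum_c Jac y j c * (Gam' c \o phi) y u v).
  by apply/funext => y; rewrite summxE; apply: eq_bigr => c _; rewrite scalemxE.
have dG c : differentiable (fun y => (Gam' c \o phi) y u v) x.
  by apply: (msmo_mdiff (msmo_comp oA AB sphi _) Ax); exact: Gam_smo.
have dJ c : differentiable (fun y => Jac y j c) x by exact: (msmo_mdiff Jac_smo Ax).
rewrite pd_sum => [|c _]; last exact: differentiableM.
rewrite -big_split; apply: eq_bigr => c _; rewrite pdM; [|exact: dJ|exact: dG].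
rewrite /=.
rewrite [X in _ = X + _]scalemxE [X in _ = _ + X]scalemxE -!mpdE; congr (_ * _ + _ * _).
by rewrite mpd_pull //; exact: Gam_smo.
Qed.

(** [mpd_Jac] is a linear equation for the Jacobian; the equality of its mixed second derivatives is
    the transformation law of the curvature. *)
Lemma Curv_pull i j x : A x -> Curv A G i j x *m Jac x =
  Jac x *m \sum_a \sum_b (Jac x i a * Jac x j b) *: Curv B H a b (phi x).
Proof.
move=> Ax.
have dGam k : mdiff (Gam A G k) x by apply: msmo_mdiff Ax; exact: Gam_smo.
have dJ : mdiff Jac x by exact: msmo_mdiff Jac_smo _.
have dP k : mdiff (P k) x by exact: msmo_mdiff (P_smo k) _.
have E a b : mpd a (mpd b Jac) x = mpd a (Gam A G b) x *m Jac x
  + Gam A G b x *m (Gam A G a x *m Jac x - Jac x *m P a x)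
  - ((Gam A G a x *m Jac x - Jac x *m P a x) *m P b x + Jac x *m mpd a (P b) x).
  have -> : mpd a (mpd b Jac) x = mpd a (fun y => Gam A G b y *m Jac y + (-1) *: (Jac y *m P b y)) x.
    by apply: (mpd_ext a oA Ax) => y Ay; rewrite mpd_Jac // scaleN1r.
  have dJP : mdiff (fun y => Jac y *m P b y) x.
    by apply: msmo_mdiff Ax; apply: msmoM => //; [exact: Jac_smo|exact: P_smo].
  rewrite mpdD; last first.
  - by move=> u v; under eq_fun do rewrite scalemxE; exact: differentiableM.
  - by apply: msmo_mdiff Ax; apply: msmoM => //; [exact: Gam_smo|exact: Jac_smo].
  rewrite mpdZ // pd_cst scale0r add0r scaleN1r.
  by rewrite !mpdM // !mpd_Jac.
have := mpd_sym j i oA Ax Jac_smo; rewrite !E => /transform_identity.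
rewrite -/Curv => ->; congr (_ *m _).
rewrite !mpd_pullP //.
have -> : \sum_b mpd i Jac x j b *: Gam' b (phi x) = \sum_b mpd j Jac x i b *: Gam' b (phi x).
  by apply: eq_bigr => b _; rewrite Jac_sym.
have sub4 (S X Y : 'M[R]_n) : S + X - (S + Y) = X - Y by rewrite opprD addrACA subrr add0r.
rewrite sub4.
have -> : \sum_a \sum_b (Jac x i a * Jac x j b) *: Curv B H a b (phi x) =
  (\sum_a \sum_b (Jac x i a * Jac x j b) *: mpd a (Gam' b) (phi x) -
   \sum_a \sum_b (Jac x i a * Jac x j b) *: mpd b (Gam' a) (phi x)) +
  (\sum_a \sum_b (Jac x i a * Jac x j b) *: (Gam' b (phi x) *m Gam' a (phi x)) -
   \sum_a \sum_b (Jac x i a * Jac x j b) *: (Gam' a (phi x) *m Gam' b (phi x))).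
  rewrite -!sumrB -big_split; apply: eq_bigr => a _; rewrite /= -!sumrB -big_split.
  by apply: eq_bigr => b _; rewrite /= -!scalerBr -scalerDr.
congr (_ - _ + (_ - _)).
- rewrite exchange_big; apply: eq_bigr => b _ /=; rewrite scaler_sumr.
  by apply: eq_bigr => a _; rewrite scalerA mulrC.
- by apply: eq_bigr => b _; rewrite scaler_sumr; apply: eq_bigr => a _; rewrite scalerA.
- rewrite /P /pull mulmx_suml exchange_big; apply: eq_bigr => b _ /=.
  rewrite mulmx_sumr; apply: eq_bigr => a _.
  by rewrite -scalemxAl -scalemxAr scalerA mulrC.
- rewrite /P /pull mulmx_suml; apply: eq_bigr => b _ /=.
  rewrite mulmx_sumr; apply: eq_bigr => a _.
  by rewrite -scalemxAl -scalemxAr scalerA.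
Qed.

Lemma ricci_pull x : A x ->
  ricci A G x = Jac x *m ricci B H (phi x) *m (Jac x)^T.
Proof.
move=> Ax; have uJ := Jac_unit Ax; apply/matrixP => j k; rewrite ricciE //.
pose J := Jac x; pose K := invmx (Jac x); pose Cv a b := Curv B H a b (phi x).
have E i : Curv A G i j x k i = \sum_a \sum_b (J i a * J j b) * (J *m Cv a b *m K) k i.
  rewrite -[Curv A G i j x](mulmxK uJ) Curv_pull // mulmx_sumr mulmx_suml summxE.
  apply: eq_bigr => a _; rewrite mulmx_sumr mulmx_suml summxE; apply: eq_bigr => b _.
  by rewrite -scalemxAr -scalemxAl scalemxE.
under eq_bigr => i _ do rewrite E.
rewrite exchange_big /=.
have E2 a b : \sum_i J i a * (J *m Cv a b *m K) k i = (J *m Cv a b) k a.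
  have -> : (J *m Cv a b) k a = ((J *m Cv a b *m K) *m J) k a by rewrite mulmxKV.
  by rewrite [RHS]mxE; apply: eq_bigr => i _; rewrite mulrC.
under eq_bigr => a _.
  rewrite exchange_big /=.
  under eq_bigr => b _.
    under eq_bigr => i _ do rewrite mulrAC.
    rewrite -mulr_suml E2; over.
  over.
rewrite exchange_big /= [RHS]mxE.
under [RHS]eq_bigr => c _ do rewrite [X in X * _]mxE mulr_suml.
rewrite [RHS]exchange_big; apply: eq_bigr => b _ /=.
under [RHS]eq_bigr => c _ do rewrite -mulrA.
rewrite -mulr_suml -mulr_sumr mulrC; congr (_ * _).
have RE c : ricci B H (phi x) b c = \sum_a Cv a b c a by apply: ricciE => //; exact: AB.
under [RHS]eq_bigr => c _ do rewrite RE trmxE mulr_suml.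
rewrite exchange_big; apply: eq_bigr => a _ /=.
by rewrite [LHS]mxE; apply: eq_bigr => c _; rewrite mulrC.
Qed.

Lemma dcol_pull (w : 'rV[R]_n -> R) x : A x -> smo B w ->
  dcol (w \o phi) x = Jac x *m dcol w (phi x).
Proof.
move=> Ax sw; apply/matrixP => i u; rewrite !ord1 dcolE pd_comp; last exact: dphi.
  by rewrite mxE; apply: eq_bigr => j _; rewrite jacE dcolE.
exact: smo_diff _ (AB Ax).
Qed.

Lemma hessian_pull (w : 'rV[R]_n -> R) x : A x -> smo B w ->
  hessian A G (w \o phi) x = Jac x *m hessian B H w (phi x) *m (Jac x)^T.
Proof.
move=> Ax sw; apply/matrixP => i j; rewrite hessianE //.
have sd : msmo B (dcol w) by exact: dcol_smo.
have dd : mdiff (dcol w \o phi) x by apply: msmo_mdiff Ax; exact: msmo_comp _ _ _ sd.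
have dJ : mdiff Jac x by exact: msmo_mdiff Jac_smo _.
rewrite (mpd_ext i oA Ax (fun y Ay => dcol_pull Ay sw)).
rewrite (mpdM (F := Jac) (G := dcol w \o phi)) // mpd_pull // mpd_Jac // dcol_pull //.
have sub3 (a b c : 'cV[R]_n) : a - b + c - a = c - b.
  by rewrite addrAC [a - b - a]addrAC subrr sub0r addrC.
rewrite mulmxBl -!mulmxA sub3 addrC -mulmxN -mulmxDr.
have -> : - (P i x *m (dcol w \o phi) x) + pull (fun a => mpd a (dcol w)) i x =
   \sum_a Jac x i a *: (mpd a (dcol w) (phi x) - Gam' a (phi x) *m dcol w (phi x)).
  rewrite addrC mulmx_suml -sumrB; apply: eq_bigr => a _.
  by rewrite -scalemxAl scalerBr.
rewrite mulmxA [RHS]mxE [LHS]mxE.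
apply: eq_bigr => b _; rewrite trmxE [RHS]mulrC; congr (_ * _).
rewrite summxE [RHS]mxE; apply: eq_bigr => a _.
by rewrite scalemxE hessianE //; exact: AB.
Qed.

End Isometry.

(** * Local flows of vector fields *)

Section Prelim.
Context {R : realType}.

Lemma coord_le_norm n (x : 'rV[R]_n) j : `|x 0 j| <= `|x|.
Proof.
rewrite [leRHS]/Num.Def.normr /= mx_normrE.
exact: (le_bigmax _ (fun ij => `|x ij.1 ij.2|) (0, j)).
Qed.

Lemma sum_le_const n (f : 'I_n -> R) c : (forall j, f j <= c) -> \sum_j f j <= n%:R * c.
Proof.
move=> H; apply: (le_trans (ler_sum _ (fun j _ => H j))).
by rewrite sumr_const card_ord mulr_natl.
Qed.

Lemma norm_rV_le n (x : 'rV[R]_n) (c : R) : 0 <= c -> (forall j, `|x 0 j| <= c) -> `|x| <= c.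
Proof.
move=> c0 H; rewrite [leLHS]/Num.Def.normr /= mx_normrE; apply: bigmax_le => // -[i j] _ /=.
by rewrite ord1.
Qed.

Lemma norm_rV_lt n (x : 'rV[R]_n) (c : R) : 0 < c -> (forall j, `|x 0 j| < c) -> `|x| < c.
Proof.
move=> c0 H; rewrite [ltLHS]/Num.Def.normr /= mx_normrE; apply: bigmax_lt => // -[i j] _ /=.
by rewrite ord1.
Qed.

Lemma near_norm (V : normedModType R) (x : V) (e : R) : 0 < e -> \forall y \near x, `|x - y| < e.
Proof. by move=> e0; have := nbhsx_ballx x e e0; rewrite -ball_normE. Qed.

Lemma near_dist (T : topologicalType) (V : normedModType R) (f : T -> V) x (e : R) :
  {for x, continuous f} -> 0 < e -> \forall y \near x, `|f x - f y| < e.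
Proof. by move=> cf e0; have /cvgrPdist_lt /(_ e e0) := cf. Qed.

Lemma near_all (T : topologicalType) (I : finType) (P : I -> T -> Prop) (x : T) :
  (forall i, \forall y \near x, P i y) -> \forall y \near x, forall i, P i y.
Proof. by apply: filter_forall. Qed.

Lemma continuous_eps (V W : normedModType R) (f : V -> W) x :
  (forall e : R, 0 < e -> \forall y \near x, `|f x - f y| < e) -> {for x, continuous f}.
Proof. by move=> H; apply/(@cvgrPdist_lt _ W _ _ (nbhs_filter x)) => e e0; exact: H. Qed.

Lemma is_derive_rV n (g : R -> 'rV[R]_n) (t : R) (v : 'rV[R]_n) :
  (forall j, is_derive t 1 (fun s => g s 0 j) (v 0 j)) -> is_derive t 1 g v.
Proof.
move=> H.
have d : derivable g t 1 by apply/derivable_mxP => i j; rewrite ord1.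
apply: DeriveDef => //; rewrite derive_mx //; apply/rowP => j; rewrite mxE.
exact: derive_val.
Qed.

Lemma is_derive_coord n (g : R -> 'rV[R]_n) (t : R) (v : 'rV[R]_n) j :
  is_derive t 1 g v -> is_derive t 1 (fun s => g s 0 j) (v 0 j).
Proof.
move=> [d <-]; rewrite derive_mx // mxE; apply: DeriveDef => //.
exact: (derivable_mxP _ _ _).1 d 0 j.
Qed.

Lemma is_derive_uniq (V : normedModType R) (g : R -> V) (t : R) (u v : V) :
  is_derive t 1 g u -> is_derive t 1 g v -> u = v.
Proof. by move=> [_ <-] [_ <-]. Qed.

Lemma is_derive_curve n (f : 'rV[R]_n -> R) (g : R -> 'rV[R]_n) t (v : 'rV[R]_n) :
  differentiable f (g t) -> is_derive t 1 g v ->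
  is_derive t 1 (f \o g) (\sum_j v 0 j * pd j f (g t)).
Proof.
move=> df dg; have dg' : differentiable g t by apply/derivable1_diffP.
apply: DeriveDef.
  by apply: diff_derivable; exact: differentiable_comp.
rewrite derive_comp_rV //; apply: eq_bigr => j _; congr (_ * _).
by have := is_derive_coord j dg => -[].
Qed.

Lemma ge0_derive_le (g dg : R -> R) a b : a <= b ->
  (forall s : R, a <= s <= b -> is_derive s 1 g (dg s)) ->
  (forall s : R, a <= s <= b -> 0 <= dg s) -> g a <= g b.
Proof.
move=> ab H H0.
have [|c] := @MVT_closed R g dg a b; rewrite (min_idPl ab) (max_idPr ab) => //.
by move=> cab E; rewrite -subr_ge0 E mulr_ge0 ?subr_ge0 ?H0.
Qed.

Lemma derive_norm_le (g H h : R -> R) (a b : R) : a <= b ->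
  (forall t : R, a <= t <= b -> is_derive t 1 H (h t) /\ exists2 D, is_derive t 1 g D & `|D| <= h t) ->
  `|g b - g a| <= H b - H a.
Proof.
move=> ab gH; have K e : `|e| = 1 -> e * (g b - g a) <= H b - H a.
  move=> e1; have : H a - e * g a <= H b - e * g b; last by rewrite mulrBr; lra.
  apply: (@ge0_derive_le (fun t => H t - e * g t) (fun t => h t - e * 'D_1 g t)) => // t /gH[dH [D dg Dh]].
    by apply: is_deriveB; apply: (is_deriveZ e); exact: DeriveDef.
  rewrite derive_val subr_ge0; apply: le_trans Dh; apply: le_trans (ler_norm _) _.
  by rewrite normrM e1 mul1r.
have := K 1 (normr1 _); have := K (-1) (normrN1 _); rewrite mulN1r mul1r => h1 h2.
by rewrite ler_norml; apply/andP; split; lra.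
Qed.

Lemma zero_derive_eq (g : R -> R) a b :
  (forall s : R, Num.min a b <= s <= Num.max a b -> is_derive s 1 g 0) -> g a = g b.
Proof.
move=> H; have [c _ E] := @MVT_closed R g (fun=> 0) a b H.
by apply/eqP; rewrite eq_sym -subr_eq0 E mul0r.
Qed.

Lemma is_derive_mulc (c t : R) : is_derive t 1 ( *%R c) c.
Proof.
have -> : *%R c = c \*: id by [].
by apply: is_derive_eq; rewrite /GRing.scale /= mulr1.
Qed.

Lemma is_derive_expc (c t : R) : is_derive t 1 (fun s : R => expR (c * s)) (c * expR (c * t)).
Proof.
have d := is_derive_mulc c t.
have := @is_derive1_comp R expR (fun s => c * s) t _ _ (is_derive_expR _) d.
by rewrite mulrC.
Qed.

Lemma is_derive_reflect (V : normedModType R) (g : R -> V) (t : R) (v : V) : is_derive (- t) 1 g v ->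
  is_derive t 1 (fun s => g (- s)) (- v).
Proof.
move=> dg.
have dg' : differentiable g (- t) by apply/derivable1_diffP.
have dn : is_derive t 1 (fun s => - s) (-1 : R) by apply: is_derive_eq.
have dn' : differentiable (fun s => - s) t by [].
apply: DeriveDef; first by apply: diff_derivable; exact: differentiable_comp.
rewrite deriveE; last exact: differentiable_comp.
rewrite (diff_comp dn' dg') /= -[X in 'd g _ X]deriveE // derive_val.
by rewrite linearN -deriveE // derive_val.
Qed.

Lemma gronwall_pos (E dE : R -> R) (c b T : R) : 0 <= c -> 0 <= b -> 0 <= T ->
  (forall s : R, 0 <= s <= T -> is_derive s 1 E (dE s)) ->
  (forall s : R, 0 <= s <= T -> dE s <= c * E s + b) ->
  E T <= (E 0 + b * T) * expR (c * T).
Proof.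
move=> c0 b0 T0 dE' H.
pose g s := b * s - E s * expR (- c * s).
have dg s : 0 <= s <= T -> is_derive s 1 g (b - (dE s * expR (- c * s) + E s * (- c * expR (- c * s)))).
  move=> sT; apply: is_deriveB.
    exact: is_derive_mulc.
  have dEs := dE' s sT; have de := is_derive_expc (- c) s.
  apply: is_derive_eq.
  by rewrite /GRing.scale /= addrC mulrC.
have : g 0 <= g T.
  apply: (ge0_derive_le T0 dg) => s sT; have := H s sT => Hs.
  have e0 : 0 < expR (- c * s) := expR_gt0 _.
  have e1 : expR (- c * s) <= 1.
    by rewrite -expR0 ler_expR mulNr oppr_le0 mulr_ge0; case/andP: sT.
  have : (dE s - c * E s) * expR (- c * s) <= b * expR (- c * s).
    by rewrite ler_pM2r; lra.
  have : b * expR (- c * s) <= b * 1 by rewrite ler_wpM2l.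
  by lra.
rewrite /g !mulr0 expR0 mulr1 sub0r => H1.
have e0 : 0 < expR (c * T) := expR_gt0 _.
have eE : expR (- c * T) * expR (c * T) = 1.
  by rewrite -expRD mulNr addNr expR0.
have : E T * expR (- c * T) <= E 0 + b * T by lra.
rewrite -(ler_pM2r e0) -mulrA eE mulr1; exact.
Qed.

Lemma gronwall (E dE : R -> R) (c b T : R) : 0 <= c -> 0 <= b ->
  (forall s : R, Num.min 0 T <= s <= Num.max 0 T -> is_derive s 1 E (dE s)) ->
  (forall s : R, Num.min 0 T <= s <= Num.max 0 T -> `|dE s| <= c * E s + b) ->
  E T <= (E 0 + b * `|T|) * expR (c * `|T|).
Proof.
move=> c0 b0; have [T0|T0] := leP 0 T => dE' H.
  rewrite (ger0_norm T0); apply: (gronwall_pos c0 b0 T0 dE') => s /H.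
  by apply: le_trans; exact: ler_norm.
have NT0 : 0 <= - T by rewrite oppr_ge0 ltW.
have := @gronwall_pos (fun s => E (- s)) (fun s => - dE (- s)) c b (- T) c0 b0 NT0.
rewrite opprK oppr0 (ltr0_norm T0); apply => s /andP[s0 sT].
  by apply: is_derive_reflect; apply: dE'; rewrite lerNr sT oppr_le0.
apply: le_trans (H _ _); first by rewrite -normrN ler_norm.
by rewrite lerNr sT oppr_le0.
Qed.

End Prelim.

(** * Primitives on the whole line *)

Section Primitive.
Context {R : realType}.

Lemma primitive_window (h : R -> R) (T : R) : continuous h -> 0 < T ->
  exists H : R -> R, H 0 = 0 /\ forall t : R, `|t| < T -> is_derive t 1 H (h t).
Proof.
move=> ch T0.
pose H0 x := \int[lebesgue_measure]_(t in [set` `[- T, x]]) h t.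
have int : (@lebesgue_measure R).-integrable `[- T, T] (EFin \o h).
  apply: continuous_compact_integrable; first exact: segment_compact.
  by apply: continuous_subspaceT.
exists (fun x => H0 x - H0 0); split; first by rewrite subrr.
move=> t; rewrite ltr_norml => /andP[t1 t2].
have [d e] := @continuous_FTC1_closed R h (- T) t T t2 int t1 (ch t).
have dH : is_derive t 1 H0 (h t).
  by apply: DeriveDef; [exact: d|rewrite -derive1E; exact: e].
have -> : (fun x => H0 x - H0 0) = H0 - cst (H0 0) by [].
by apply: is_derive_eq; rewrite subr0.
Qed.

(** Integration gives a primitive on each bounded window. All are normalised to vanish at 0 and so
    agree on overlaps; the value at t is taken from the window of radius [|t| + 1]. *)
Lemma primitive_ex (h : R -> R) : continuous h ->
  exists H : R -> R, H 0 = 0 /\ forall t : R, is_derive t 1 H (h t).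
Proof.
move=> ch.
have W (T : R) : exists H : R -> R, H 0 = 0 /\ (0 < T -> forall t : R, `|t| < T -> is_derive t 1 H (h t)).
  have [T0|T0] := ltP 0 T; last by exists (fun=> 0).
  by have [H [H1 H2]] := primitive_window ch T0; exists H.
pose HT T := sval (cid (W T)).
have HT0 T : HT T 0 = 0 by rewrite /HT; case: cid => ? [].
have HTd (T t : R) : `|t| < T -> is_derive t 1 (HT T) (h t).
  move=> tT; rewrite /HT; case: cid => H [_ H2] /=; apply: H2 => //.
  by apply: le_lt_trans tT.
have agree (T T' t : R) : `|t| < T -> `|t| < T' -> HT T t = HT T' t.
  move=> h1 h2; apply/eqP; rewrite -subr_eq0; apply/eqP.
  have E : HT T 0 - HT T' 0 = HT T t - HT T' t.
    apply: (@zero_derive_eq R (fun s => HT T s - HT T' s)) => s st.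
    have sn := norm_le_minmax0 st.
    have -> : (fun s => HT T s - HT T' s) = HT T - HT T' by [].
    have d1 := HTd T s (le_lt_trans sn h1); have d2 := HTd T' s (le_lt_trans sn h2).
    by apply: is_derive_eq; rewrite subrr.
  by rewrite -E !HT0 subrr.
exists (fun t => HT (`|t| + 1) t); split => //.
move=> t.
(* The radius [|t| + 2] serves all points at distance less than 1 from t, so that near t the glued
   function equals one fixed primitive. *)
have [d1 d2] := HTd (`|t| + 2) t ltac:(by rewrite ltrDl).
apply: near_eq_is_derive; last exact: DeriveDef _ d2.
have := near_norm t (@ltr01 R).
apply: filterS => s st; apply: agree; last by rewrite ltrDl.
have : `|s| <= `|t| + `|t - s|.
  by rewrite -{1}(subKr t s) (le_trans (ler_normB _ _)).
by move=> h1; apply: (le_lt_trans h1); rewrite ltrD2l (lt_trans st) // ltr1n.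
Qed.

Lemma Rintegral01_le (h H : R -> R) : continuous h -> (forall t : R, is_derive t 1 H (h t)) ->
  \int[lebesgue_measure]_(t in `[0, 1]) h t = H 1 - H 0.
Proof.
move=> ch dH; rewrite /Rintegral (@continuous_FTC2 R h H 0 1) //.
- exact: continuous_subspaceT.
- have cH t : {for t, continuous H} := is_derive_continuous (dH t).
  split.
  + by [].
  + exact: cvg_at_right_filter (cH _).
  + exact: cvg_at_left_filter (cH _).
- by move=> x _; rewrite derive1E; exact: derive_val.
Qed.

End Primitive.

Section GeometricLimit.
Context {R : realType}.

Lemma geometric_small (c e : R) : 0 <= c -> 0 < e -> exists k : nat, c / 2 ^+ k < e.
Proof.
move=> c0 e0; exists (Num.bound (c / e)).
rewrite ltr_pdivrMr // mulrC -ltr_pdivrMr //.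
apply: lt_le_trans (archi_boundP (divr_ge0 c0 (ltW e0))) _.
by rewrite -natrX ler_nat ltnW // ltn_expl.
Qed.

Lemma geometric_limit (u : nat -> R) (c : R) : 0 <= c ->
  (forall k l, `|u (k + l)%N - u k| <= c / 2 ^+ k) ->
  exists l : R, forall k, `|l - u k| <= c / 2 ^+ k.
Proof.
move=> c0 H; pose S := [set u k - c / 2 ^+ k | k in [set: nat]].
have p0 k : 0 <= c / 2 ^+ k by rewrite divr_ge0.
have ub k : ubound S (u k + c / 2 ^+ k).
  move=> _ [i _ <-]; have [ki|ik] := leqP k i.
    by have := H k (i - k)%N; rewrite subnKC // ler_norml => /andP[_ h]; have := p0 i; lra.
  by have := H i (k - i)%N; rewrite subnKC ?(ltnW ik) // ler_norml => /andP[h _]; have := p0 k; lra.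
have S0 : S !=set0 by exists (u 0%N - c / 2 ^+ 0), 0%N.
exists (sup S) => k.
have h1 : sup S <= u k + c / 2 ^+ k by apply: ge_sup.
have h2 : u k - c / 2 ^+ k <= sup S.
  by apply: ub_le_sup; [exists (u 0%N + c / 2 ^+ 0); exact: ub|exists k].
by rewrite ler_norml; lra.
Qed.

Lemma small_eq0 (c a : R) : 0 <= c -> (forall k, `|a| <= c / 2 ^+ k) -> a = 0.
Proof.
move=> c0 H; apply/eqP; rewrite -normr_eq0; apply/eqP/le_anti; rewrite normr_ge0 andbT.
rewrite leNgt; apply/negP => a0; have [k hk] := geometric_small c0 a0.
by have := le_lt_trans (H k) hk; rewrite ltxx.
Qed.

End GeometricLimit.

(** * Global solutions of Lipschitz equations *)

Section Picard.
Context {R : realType} {n : nat}.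
Variables (F : 'rV[R]_n -> 'rV[R]_n) (L : R) (x0 : 'rV[R]_n).
Hypothesis L0 : 0 < L.
Hypothesis LF : forall x y, `|F x - F y| <= L * `|x - y|.

Let Pr (h : R -> R) : R -> R :=
  xget (fun=> 0) [set H | H 0 = 0 /\ forall t : R, is_derive t 1 H (h t)].

Let PrP h : continuous h -> Pr h 0 = 0 /\ forall t : R, is_derive t 1 (Pr h) (h t).
Proof.
move=> /primitive_ex[H HP]; rewrite /Pr.
by have := @xgetPex _ (fun=> 0) [set H | H 0 = 0 /\ forall t : R, is_derive t 1 H (h t)] (ex_intro _ H HP).
Qed.

Fixpoint picard (k : nat) : R -> 'rV[R]_n :=
  if k is k'.+1 then fun t => \row_j (x0 0 j + Pr (fun s => F (picard k' s) 0 j) t)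
  else fun=> x0.

Lemma lipschitz_continuous : continuous F.
Proof.
move=> x; apply: continuous_eps => e e0.
have := near_norm x (divr_gt0 e0 L0).
apply: filterS => y; rewrite ltr_pdivlMr // mulrC; apply: le_lt_trans; exact: LF.
Qed.

Lemma continuous_Fcoord (g : R -> 'rV[R]_n) j : continuous g ->
  continuous (fun s => F (g s) 0 j).
Proof.
move=> cg s; apply: (@continuous_comp _ _ _ g (fun y => F y 0 j)); first exact: cg.
apply: (@continuous_comp _ _ _ F (fun y : 'rV_n => y 0 j)); first exact: lipschitz_continuous.
exact: coord_continuous.
Qed.

Lemma picardS_step k : continuous (picard k) -> forall t : R,
  is_derive t 1 (picard k.+1) (F (picard k t)).
Proof.
move=> ck t; apply: is_derive_rV => j /=.
have [_ /(_ t) d] := PrP (@continuous_Fcoord _ j ck).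
have -> : (fun s => (\row_j0 (x0 0 j0 + Pr (fun s0 => F (picard k s0) 0 j0) s)) 0 j) =
  cst (x0 0 j) + Pr (fun s0 => F (picard k s0) 0 j) by apply/funext => s; rewrite mxE.
by apply: is_derive_eq; rewrite add0r.
Qed.

Lemma picard_continuous k : continuous (picard k).
Proof.
elim: k => [|k IH]; first by move=> t; exact: cvg_cst.
by move=> t; apply: is_derive_continuous (picardS_step IH t).
Qed.

Lemma picard_derive k (t : R) : is_derive t 1 (picard k.+1) (F (picard k t)).
Proof. exact: picardS_step (@picard_continuous k) t. Qed.

Lemma picard0 k : picard k 0 = x0.
Proof.
case: k => // k; apply/rowP => j; rewrite mxE.
by rewrite (PrP (@continuous_Fcoord _ j (@picard_continuous k))).1 addr0.
Qed.

(** The weight [expR (2 * L * |t|)] makes the Picard operator a contraction with factor 1/2 on the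
    whole line at once: integrating [2 * L * A] times the weight costs at most [A] times the weight,
    while the Lipschitz bound supplies only [L]. *)
Lemma exp_bound (D dD : R -> R) (A : R) : 0 <= A -> D 0 = 0 ->
  (forall t : R, is_derive t 1 D (dD t)) ->
  (forall t : R, `|dD t| <= 2 * L * A * expR (2 * L * `|t|)) ->
  forall t : R, `|D t| <= A * expR (2 * L * `|t|).
Proof.
move=> A0 D0 dD' H t.
have pos (E dE : R -> R) (s : R) : 0 <= s -> E 0 = 0 -> (forall r : R, is_derive r 1 E (dE r)) ->
   (forall r, `|dE r| <= 2 * L * A * expR (2 * L * `|r|)) -> `|E s| <= A * expR (2 * L * s).
  move=> s0 E0 dE' HE.
  have := @derive_norm_le R E (fun r => A * expR (2 * L * r)) (fun r => A * (2 * L * expR (2 * L * r))) 0 s s0.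
  rewrite E0 subr0 mulr0 expR0 mulr1 => K.
  have : `|E s| <= A * expR (2 * L * s) - A; last by lra.
  apply: K => r /andP[r0 _]; split.
    by have d := is_derive_expc (2 * L) r; exact: (is_deriveZ A).
  exists (dE r) => //; have := HE r; rewrite (ger0_norm r0) => /le_trans; apply.
  by rewrite -!mulrA [A * (2 * _)]mulrCA [A * (L * _)]mulrCA.
have [t0|t0] := leP 0 t; first by rewrite [`|t|]ger0_norm //; exact: pos dD' H.
have nt0 : 0 <= - t by rewrite oppr_ge0 ltW.
rewrite [`|t|]ltr0_norm //; have := pos (fun s => D (- s)) (fun s => - dD (- s)) (- t) nt0.
rewrite opprK oppr0; apply => // s; first exact: is_derive_reflect.
by rewrite normrN -[X in _ <= _ * expR (_ * X)]normrN.
Qed.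

Let A0 : R := `|F x0| / (2 * L).
Let A0_ge0 : 0 <= A0. Proof. by rewrite divr_ge0 // mulr_ge0 // ltW. Qed.

Lemma picard_step_bound k t :
  `|picard k.+1 t - picard k t| <= A0 / 2 ^+ k * expR (2 * L * `|t|).
Proof.
have B i s : 0 <= A0 / 2 ^+ i * expR (2 * L * `|s|) by rewrite mulr_ge0 // divr_ge0.
elim: k t => [|k IH] t; apply: norm_rV_le => // j.
- apply: (@exp_bound (fun s => (picard 1 s - picard 0 s) 0 j) (fun s => F x0 0 j)).
  + by rewrite divr1.
  + by rewrite !picard0 subrr mxE.
  + by move=> s; have := is_derive_coord j (is_deriveB (@picard_derive 0 s) (is_derive_cst x0 s 1)); rewrite subr0.
  + move=> s; rewrite divr1 /A0 mulrC.
    apply: (le_trans (coord_le_norm _ _)).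
    rewrite -[leLHS]mul1r mulrC; rewrite [2 * L * _]mulrC divfK ?mulf_neq0 ?gt_eqF //.
    rewrite mulrC ler_wpM2r // -expR0 ler_expR.
    by rewrite mulr_ge0 // mulr_ge0 // ltW.
- apply: (@exp_bound (fun s => (picard k.+2 s - picard k.+1 s) 0 j)
    (fun s => (F (picard k.+1 s) - F (picard k s)) 0 j)).
  + by rewrite divr_ge0.
  + by rewrite !picard0 subrr mxE.
  + by move=> s; exact: (is_derive_coord j (is_deriveB (@picard_derive k.+1 s) (@picard_derive k s))).
  + move=> s; apply: (le_trans (coord_le_norm _ _)); apply: (le_trans (LF _ _)).
    apply: (@le_trans _ _ (L * (A0 / 2 ^+ k * expR (2 * L * `|s|)))).
      by rewrite ler_pM2l.
    rewrite exprS; set e := expR _; set q := 2 ^+ k.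
    have q0 : q != 0 by rewrite gt_eqF // exprn_gt0.
    rewrite [leRHS](_ : _ = L * (A0 / q * e)) //; field; exact: q0.
Qed.

Lemma picard_tail k l t :
  `|picard (k + l) t - picard k t| <= 2 * A0 / 2 ^+ k * expR (2 * L * `|t|).
Proof.
pose e := expR (2 * L * `|t|); have e0 : 0 <= e := expR_ge0 _.
suff : `|picard (k + l) t - picard k t| <= (2 * A0 / 2 ^+ k - 2 * A0 / 2 ^+ (k + l)) * e.
  move=> /le_trans; apply; rewrite ler_wpM2r // gerBl.
  by rewrite divr_ge0 // mulr_ge0.
elim: l => [|l IH]; first by rewrite addn0 !subrr mul0r normr0.
rewrite addnS -(subrKA (picard (k + l) t)).
apply: (le_trans (ler_normD _ _)); apply: (le_trans (lerD (picard_step_bound _ _) IH)).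
rewrite exprS -mulrDl ler_wpM2r //.
have q0 : 2 ^+ (k + l) != 0 :> R by [].
set q := 2 ^+ (k + l) in q0 *; rewrite [leLHS](_ : _ = 2 * A0 / 2 ^+ k - 2 * A0 / (2 * q)) //.
have q1 : 2 ^+ k != 0 :> R by [].
by field; rewrite q0.
Qed.

Lemma ode_global : exists psi : R -> 'rV[R]_n,
  psi 0 = x0 /\ forall t : R, is_derive t 1 psi (F (psi t)).
Proof.
pose C (t : R) := 2 * A0 * expR (2 * L * `|t|).
have C0 t : 0 <= C t by rewrite mulr_ge0 // mulr_ge0.
have tail k l t : `|picard (k + l) t - picard k t| <= C t / 2 ^+ k.
  by rewrite mulrAC; exact: picard_tail.
have ex t j : exists l : R, forall k, `|l - picard k t 0 j| <= C t / 2 ^+ k.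
  apply: geometric_limit => // k l.
  by apply: le_trans (tail k l t); have := coord_le_norm (picard (k + l) t - picard k t) j; rewrite addmxE oppmxE.
pose psi t : 'rV[R]_n := \row_j sval (cid (ex t j)).
have psik k t : `|psi t - picard k t| <= C t / 2 ^+ k.
  apply: norm_rV_le => [|j]; first by rewrite divr_ge0.
  by rewrite addmxE oppmxE mxE; case: cid => l.
have cpsi : continuous psi.
  move=> t; apply: continuous_eps => e e0.
  pose C1 := 2 * A0 * expR (2 * L * (`|t| + 1)).
  have C10 : 0 <= C1 by rewrite mulr_ge0 // mulr_ge0.
  have e3 : 0 < e / 3 by rewrite divr_gt0.
  have [k hk] := geometric_small C10 e3.
  have CC1 s : `|s| <= `|t| + 1 -> C s / 2 ^+ k < e / 3.
    move=> st; apply: le_lt_trans hk; rewrite ler_wpM2r //.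
    apply: ler_wpM2l; first exact: mulr_ge0.
    by rewrite ler_expR; apply: ler_wpM2l => //; rewrite mulr_ge0 // ltW.
  have ck : {for t, continuous (picard k)} by exact: picard_continuous.
  have H1 : \forall y \near t, `|picard k t - picard k y| < e / 3.
    exact: near_dist.
  have H2 := near_norm t (@ltr01 R).
  near=> s.
  have st : `|s| <= `|t| + 1.
    have : `|s| <= `|t| + `|t - s| by rewrite -{1}(subKr t s) (le_trans (ler_normB _ _)).
    move=> h; apply: (le_trans h); rewrite lerD2l //; near: s; exact: H2.
  have -> : psi t - psi s = (psi t - picard k t) + (picard k t - picard k s) + (picard k s - psi s).
    by rewrite subrKA subrKA.
  apply: (le_lt_trans (ler_normD _ _)); have -> : e = e / 3 + e / 3 + e / 3 by field.
  apply: ltrD; last by rewrite distrC; apply: le_lt_trans _ (CC1 s st).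
  apply: (le_lt_trans (ler_normD _ _)); apply: ltrD.
    by apply: le_lt_trans (psik k t) (CC1 t _); rewrite lerDl.
  by near: s.
(* [D k] compares the iterate [k.+1] with the Picard operator applied to the limit. By the
   contraction it is bounded by a constant over [2 ^+ k], as is the distance of the iterate from
   [psi]; hence the limit is a fixed point. *)
have eq t j : psi t 0 j = x0 0 j + Pr (fun s => F (psi s) 0 j) t.
  have [Pr0 Prd] := PrP (continuous_Fcoord (j := j) cpsi).
  pose D k s := picard k.+1 s 0 j - (x0 0 j + Pr (fun s => F (psi s) 0 j) s).
  have Db k s : `|D k s| <= A0 / 2 ^+ k * expR (2 * L * `|s|).
    apply: (@exp_bound (D k) (fun s => (F (picard k s) - F (psi s)) 0 j)).
    - by rewrite divr_ge0.
    - by rewrite /D picard0 Pr0 addr0 subrr.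
    - move=> {}s; have d1 := is_derive_coord j (picard_derive k s); have d2 := Prd s.
      have -> : D k = (fun s => picard k.+1 s 0 j) - (cst (x0 0 j) + Pr (fun s => F (psi s) 0 j)).
        by [].
      by apply: is_derive_eq; rewrite add0r addmxE oppmxE.
    - move=> {}s; apply: (le_trans (coord_le_norm _ _)); apply: (le_trans (LF _ _)).
      rewrite distrC; apply: (@le_trans _ _ (L * (C s / 2 ^+ k))); first by rewrite ler_pM2l.
      rewrite /C; set e := expR _; set q := 2 ^+ k.
      have q0 : q != 0 by rewrite gt_eqF // exprn_gt0.
      by rewrite [leRHS](_ : _ = L * (2 * A0 * e / q)) //; field.
  apply/eqP; rewrite -subr_eq0; apply/eqP.
  apply: (@small_eq0 _ (C t + C t)) => [|k]; first exact: addr_ge0.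
  have -> : psi t 0 j - (x0 0 j + Pr (fun s => F (psi s) 0 j) t) =
    (psi t - picard k.+1 t) 0 j + D k t by rewrite addmxE oppmxE subrKA.
  apply: (le_trans (ler_normD _ _)); rewrite mulrDl; apply: lerD.
    apply: (le_trans (coord_le_norm _ _)); apply: (le_trans (psik _ _)).
    rewrite ler_wpM2l // lef_pV2 ?posrE // exprS ler_peMl // ler1n //.
  apply: (le_trans (Db _ _)); rewrite mulrAC ler_wpM2r //.
  rewrite ler_wpM2r // ler_peMl // ler1n //.
exists psi; split.
  by apply/rowP => j; rewrite eq (PrP (continuous_Fcoord (j := j) cpsi)).1 addr0.
move=> t; apply: is_derive_rV => j.
have [_ /(_ t) d] := PrP (continuous_Fcoord (j := j) cpsi).
have -> : (fun s => psi s 0 j) = cst (x0 0 j) + Pr (fun s => F (psi s) 0 j).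
  by apply/funext => s.
by apply: is_derive_eq; rewrite add0r.
Unshelve. all: by end_near. Qed.

End Picard.

(** * Differentiability from continuous partial derivatives *)

Section C1Differentiable.
Context {R : realType} {n : nat}.

Lemma is_derive_dir (f : 'rV[R]_n -> R) (y v : 'rV[R]_n) s :
  derivable f (y + s *: v) v -> is_derive s 1 (fun s : R => f (y + s *: v)) ('D_v f (y + s *: v)).
Proof.
have E : (fun h : R => h^-1 *: (((fun s => f (y + s *: v)) \o shift s) (h *: 1) - f (y + s *: v))) =
   (fun h => h^-1 *: ((f \o shift (y + s *: v)) (h *: v) - f (y + s *: v))).
  apply/funext => h /=; congr (_ *: (f _ - _)).
  by rewrite [h *: 1]mulr1 scalerDl addrCA.
move=> d; apply: DeriveDef; first by rewrite /derivable E.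
by rewrite /derive E.
Qed.

Lemma is_derive_dir0 (f : 'rV[R]_n -> R) (y v : 'rV[R]_n) (l : R) :
  is_derive (0 : R) 1 (fun s : R => f (y + s *: v)) l -> is_derive y v f l.
Proof.
have E : (fun h : R => h^-1 *: (((fun s => f (y + s *: v)) \o shift 0) (h *: 1) - f (y + 0 *: v))) =
   (fun h => h^-1 *: ((f \o shift y) (h *: v) - f y)).
  apply/funext => h /=; congr (_ *: (f _ - f _)).
    by rewrite [h *: 1]mulr1 addr0 addrC.
  by rewrite scale0r addr0.
by move=> [d <-]; apply: DeriveDef; [move: d; rewrite /derivable E|rewrite /derive E].
Qed.

Let upto (h : 'rV[R]_n) (k : nat) : 'rV[R]_n := \row_j (if (j < k)%N then h 0 j else 0).

(** The increment is telescoped over the points [upto h k], which differ in one coordinate at a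
    time, and each term is a one-variable mean value. *)
Lemma C1_differentiable (A : set 'rV[R]_n) (f : 'rV[R]_n -> R) x : open A -> A x ->
  (forall y i, A y -> derivable f y (delta_mx 0 i)) ->
  (forall i, {for x, continuous (pd i f)}) -> differentiable f x.
Proof.
move=> oA Ax df cf.
pose l (h : 'rV[R]_n) : R := \sum_i h 0 i * pd i f x.
have ll : linear l.
  move=> c u v; rewrite scaler_sumr -big_split; apply: eq_bigr => i _ /=.
  by rewrite !mxE mulrDl scalerAl.
pose Ll : {linear 'rV[R]_n -> R} := HB.pack l (GRing.isLinear.Build _ _ _ _ l ll).
apply: (@differentiable_eps R _ _ f Ll).
  move=> h; rewrite -[Ll : _ -> _]/l; apply: differentiable_continuous.
  apply: differentiable_big => i _; apply: differentiableM => //.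
  exact: differentiable_coord.
move=> e e0.
(* With [n + 1] instead of [n] the quotient stays positive in dimension 0. *)
have en : 0 < e / (n%:R + 1) by rewrite divr_gt0.
have Ha : \forall y \near x, A y by exact: open_nbhs_nbhs.
have Hb : \forall y \near x, forall i, `|pd i f x - pd i f y| < e / (n%:R + 1).
  by apply: near_all => i; exact: near_dist.
have H1 := @filterI _ _ (nbhs_filter x) _ _ Ha Hb.
have /nbhs_ballP[r /= r0 Hr] := H1.
apply/nbhs_ballP; exists r => //= h; rewrite -ball_normE /= sub0r normrN => hr.
have inb (y : 'rV[R]_n) : `|y| <= `|h| -> A (x + y) /\ forall i, `|pd i f x - pd i f (x + y)| < e / (n%:R + 1).
  move=> yh; apply: Hr; rewrite -ball_normE /= opprD addrA subrr sub0r normrN.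
  exact: le_lt_trans hr.
have un : upto h n = h by apply/rowP => j; rewrite mxE ltn_ord.
have u0 : upto h 0 = 0 by apply/rowP => j; rewrite !mxE.
have uS (k : 'I_n) : upto h k.+1 = upto h k + h 0 k *: delta_mx 0 k.
  apply/rowP => j; rewrite !mxE /= ltnS leq_eqVlt.
  have [->|jk] := eqVneq j k; first by rewrite !eqxx ltnn add0r mulr1.
  have -> : (j == k :> nat) = false by apply/negbTE.
  by rewrite mulr0 addr0.
have step (k : 'I_n) : `|f (x + upto h k.+1) - f (x + upto h k) - h 0 k * pd k f x| <= e / (n%:R + 1) * `|h|.
  have small (c : R) : `|c| <= `|h 0 k| -> `|upto h k + c *: delta_mx 0 k| <= `|h|.
    move=> ch; apply: norm_rV_le => // j; rewrite !mxE /=.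
    have [->|jk] := eqVneq j k; first by rewrite ltnn add0r mulr1 (le_trans ch) // coord_le_norm.
    rewrite mulr0 addr0; case: ifP => _; first exact: coord_le_norm.
    by rewrite normr0.
  have [|c cI E] := @MVT_closed R (fun s => f (x + upto h k + s *: delta_mx 0 k))
     (fun s => pd k f (x + upto h k + s *: delta_mx 0 k)) 0 (h 0 k).
    move=> s sI; rewrite pd_unlock; apply: is_derive_dir; apply: df.
    by rewrite -addrA; apply: (inb _ (small _ _)).1; exact: norm_le_minmax0.
  move: E; rewrite scale0r addr0 subr0 -addrA -uS => ->.
  rewrite [h 0 k * _]mulrC -mulrBl normrM; apply: ler_pM => //; last exact: coord_le_norm.
  have [_ /(_ k)] := inb _ (small c (norm_le_minmax0 cI)).
  by rewrite distrC addrA => /ltW.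
have -> : f (h + x) - f x - Ll h =
    \sum_(k < n) (f (x + upto h k.+1) - f (x + upto h k) - h 0 k * pd k f x).
  rewrite sumrB -[\sum_(i < n) (_ - f _)](big_mkord xpredT (fun k => f (x + upto h k.+1) - f (x + upto h k))).
  by rewrite telescope_sumr // un u0 addr0 [h + x]addrC.
apply: (le_trans (ler_norm_sum _ _ _)).
apply: (le_trans (ler_sum _ (fun k _ => step k))).
rewrite sumr_const card_ord -mulrnAl ler_wpM2r // -mulr_natr.
by rewrite mulrAC ler_pdivrMr // ler_wpM2l ?(ltW e0) // lerDl.
Qed.

(** The scale [C^0, C^1, ...] with an index shift: [ck 0] already asks for differentiability,
    whereas the induction on the regularity of flows starts from continuity. *)
Definition cgood (k : nat) (A : set 'rV[R]_n) (f : 'rV[R]_n -> R) : Prop :=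
  if k is k'.+1 then ck k' A f else forall x, A x -> {for x, continuous f}.

Lemma cgood_continuous k A f x : cgood k A f -> A x -> {for x, continuous f}.
Proof.
case: k => [H Ax|k H Ax]; first exact: H.
exact: differentiable_continuous (ck_diff H Ax).
Qed.

Lemma cgood_step k A f : open A ->
  (forall y i, A y -> derivable f y (delta_mx 0 i)) ->
  (forall i, cgood k A (pd i f)) -> cgood k.+1 A f.
Proof.
move=> oA df gf.
have d x : A x -> differentiable f x.
  by move=> Ax; apply: (C1_differentiable oA Ax df) => i; exact: cgood_continuous.
by case: k gf => [|k] gf; [apply/ck0|apply/ckS].
Qed.

Lemma cgood_ext k A f g : open A -> (forall x, A x -> f x = g x) -> cgood k A f -> cgood k A g.
Proof.
case: k => [|k] oA fg H; last exact: ck_ext H.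
move=> x Ax; apply: continuous_eps => e e0.
have := near_dist (H x Ax) e0; have := open_near oA Ax fg; apply: filterS2 => y <-.
by rewrite fg.
Qed.

Lemma cgood_sub k A B f : B `<=` A -> cgood k A f -> cgood k B f.
Proof. by case: k => [|k] BA H x /BA; exact: H. Qed.

Lemma cgoodZ k A f c : open A -> cgood k A f -> cgood k A (fun x => c * f x).
Proof.
case: k => [|k] oA H; last exact: ckZ.
by move=> x Ax; apply: continuousM; [exact: cst_continuous|exact: H].
Qed.

End C1Differentiable.

Section CgoodComp.
Context {R : realType}.

Lemma continuous_rV (T : topologicalType) n (phi : T -> 'rV[R]_n) x :
  (forall j, {for x, continuous (fun y => phi y 0 j)}) -> {for x, continuous phi}.
Proof.
move=> H; apply/(@cvgrPdist_lt _ 'rV[R]_n _ _ (nbhs_filter x)) => e e0.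
have : \forall y \near x, forall j, `|phi x 0 j - phi y 0 j| < e.
  by apply: near_all => j; exact: near_dist.
apply: filterS => y Hy; apply: norm_rV_lt => // j.
by rewrite addmxE oppmxE.
Qed.

Lemma smo_cgood n k (A : set 'rV[R]_n) f : smo A f -> cgood k A f.
Proof.
case: k => [|k] sf; last exact: sf.
by move=> x Ax; exact: smo_continuous.
Qed.

Lemma cgood_comp m n k A B (f : 'rV[R]_n -> R) (phi : 'rV[R]_m -> 'rV[R]_n) :
  open A -> (forall x, A x -> B (phi x)) -> (forall j, cgood k A (fun x => phi x 0 j)) ->
  cgood k B f -> cgood k A (f \o phi).
Proof.
case: k => [|k] oA AB Hphi cf; last exact: (ck_comp oA AB Hphi cf).
move=> x Ax; apply: continuous_comp; last exact: cf (AB x Ax).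
by apply: continuous_rV => j; exact: Hphi.
Qed.

End CgoodComp.

Section VectorGronwall.
Context {R : realType} {n : nat}.

(** The sup norm is not differentiable, so the scalar inequality is applied to the sum of squares,
    which lies between the squared norm and [n] times it. *)
Lemma gronwall_rV (D dD : R -> 'rV[R]_n) (L b T : R) : 0 <= L -> 0 <= b ->
  (forall s : R, Num.min 0 T <= s <= Num.max 0 T -> is_derive s 1 D (dD s)) ->
  (forall s : R, Num.min 0 T <= s <= Num.max 0 T -> `|dD s| <= L * `|D s| + b) ->
  `|D T| ^+ 2 <= n%:R * (`|D 0| ^+ 2 + b ^+ 2 * `|T|) * expR ((2 * L + 1) * n%:R * `|T|).
Proof.
move=> L0 b0 dD' H.
pose E s := \sum_j D s 0 j ^+ 2.
pose dE s := \sum_j 2 * D s 0 j * dD s 0 j.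
have DE s : `|D s| ^+ 2 <= E s.
  have E0 : 0 <= E s by apply: sumr_ge0 => j _; exact: sqr_ge0.
  rewrite -[leRHS]sqr_sqrtr // ler_pXn2r ?nnegrE //.
  apply: norm_rV_le => [|j]; first exact: sqrtr_ge0.
  rewrite -sqrtr_sqr ler_wsqrtr // /E (bigD1 j) //= lerDl.
  by apply: sumr_ge0 => i _; exact: sqr_ge0.
have ED s : E s <= n%:R * `|D s| ^+ 2.
  apply: sum_le_const => j.
  by rewrite -real_normK ?num_real // ler_pXn2r ?nnegrE // coord_le_norm.
apply: (le_trans (DE T)).
have dE' s : Num.min 0 T <= s <= Num.max 0 T -> is_derive s 1 E (dE s).
  move=> sI; have -> : E = \sum_j (fun s => D s 0 j ^+ 2) by rewrite fct_sumE.
  apply: is_derive_sum => j; have d := is_derive_coord j (dD' s sI).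
  have -> : (fun s => D s 0 j ^+ 2) = (fun s => D s 0 j) ^+ 2 by [].
  by apply: is_derive_eq.
have c0 : 0 <= (2 * L + 1) * n%:R by rewrite mulr_ge0 // addr_ge0 // mulr_ge0.
have nb0 : 0 <= n%:R * b ^+ 2 by rewrite mulr_ge0 // sqr_ge0.
have G := gronwall c0 nb0 dE'.
apply: (le_trans (G _)) => [s sI|].
  have Hs := H s sI; have DEs := DE s; have EDs := ED s.
  apply: (le_trans (ler_norm_sum _ _ _)).
  have : \sum_j `|2 * D s 0 j * dD s 0 j| <= \sum_(j < n) (2 * `|D s| * (L * `|D s| + b)).
    apply: ler_sum => j _; rewrite !normrM ger0_norm //.
    by apply: ler_pM => //; [rewrite ler_wpM2l // coord_le_norm|apply: le_trans Hs; exact: coord_le_norm].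
  move=> /le_trans; apply; rewrite sumr_const card_ord -[leLHS]mulr_natl.
  have -> : (2 * L + 1) * n%:R * E s + n%:R * b ^+ 2 = n%:R * ((2 * L + 1) * E s + b ^+ 2) by ring.
  rewrite ler_wpM2l //.
  have : (2 * L + 1) * `|D s| ^+ 2 <= (2 * L + 1) * E s.
    by rewrite ler_wpM2l // addr_ge0 // mulr_ge0.
  have : 0 <= (`|D s| - b) ^+ 2 := sqr_ge0 _.
  by lra.
rewrite ler_wpM2r //; have -> : n%:R * (`|D 0| ^+ 2 + b ^+ 2 * `|T|) = n%:R * `|D 0| ^+ 2 + n%:R * b ^+ 2 * `|T| by rewrite mulrDr [n%:R * (b ^+ 2 * _)]mulrA.
by rewrite lerD2r.
Qed.

End VectorGronwall.

Section CubeEstimates.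
Context {R : realType} {n : nat}.
Variables (y0 : 'rV[R]_n) (rho : R).
Local Notation B := (ball y0 rho).

Lemma ball_rVP (y : 'rV[R]_n) : B y <-> `|y0 - y| < rho.
Proof. by rewrite -ball_normE. Qed.

Lemma ball_segment (y d : 'rV[R]_n) (s : R) : B y -> B (y + d) -> 0 <= s <= 1 -> B (y + s *: d).
Proof.
move=> /ball_rVP h1 /ball_rVP h2 /andP[s0 s1]; apply/ball_rVP.
have -> : y0 - (y + s *: d) = (1 - s) *: (y0 - y) + s *: (y0 - (y + d)).
  by apply/rowP => j; rewrite !mxE; ring.
apply: (le_lt_trans (ler_normD _ _)); rewrite !normrZ (ger0_norm s0) ger0_norm ?subr_ge0 //.
have [->|sn0] := eqVneq s 0; first by rewrite subr0 mul0r mul1r addr0.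
have sp : 0 < s by rewrite lt_neqAle eq_sym sn0.
have -> : rho = (1 - s) * rho + s * rho by ring.
apply: ler_ltD; first by rewrite ler_wpM2l ?subr_ge0 // ltW.
by rewrite ltr_pM2l.
Qed.

Lemma MVT_ball (f : 'rV[R]_n -> R) (y d : 'rV[R]_n) :
  (forall z, B z -> differentiable f z) -> B y -> B (y + d) ->
  exists2 c : R, 0 <= c <= 1 & f (y + d) - f y = \sum_l d 0 l * pd l f (y + c *: d).
Proof.
move=> df By Byd.
have [|c] := @MVT_closed R (fun s => f (y + s *: d)) (fun s => \sum_l d 0 l * pd l f (y + s *: d)) 0 1;
  rewrite (min_idPl ler01) (max_idPr ler01).
  move=> s sI; have dfs := df _ (ball_segment By Byd sI).
  by have := is_derive_line dfs; rewrite deriveE // diff_rV_sum.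
by rewrite scale1r scale0r addr0 subr0 mulr1 => E; exists c.
Qed.

Lemma lipschitz_ball (f : 'rV[R]_n -> R) (K : R) (y y' : 'rV[R]_n) :
  (forall z, B z -> differentiable f z) -> (forall z l, B z -> `|pd l f z| <= K) ->
  B y -> B y' -> `|f y' - f y| <= n%:R * K * `|y' - y|.
Proof.
move=> df bK By By'; have Byd : B (y + (y' - y)) by rewrite addrC subrK.
have [c cI] := MVT_ball df By Byd; rewrite [y + _]addrC subrK => ->.
apply: (le_trans (ler_norm_sum _ _ _)).
rewrite -mulrA; apply: sum_le_const => l.
rewrite normrM mulrC; apply: ler_pM => //; last exact: coord_le_norm.
by apply: bK; apply: ball_segment.
Qed.

Lemma taylor_ball (f : 'rV[R]_n -> R) (K : R) (y y' : 'rV[R]_n) :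
  (forall z, B z -> differentiable f z) -> (forall z l, B z -> differentiable (pd l f) z) ->
  (forall z l m, B z -> `|pd m (pd l f) z| <= K) -> 0 <= K ->
  B y -> B y' -> `|f y' - f y - \sum_l (y' - y) 0 l * pd l f y| <= n%:R * (n%:R * K) * `|y' - y| ^+ 2.
Proof.
move=> df ddf bK K0 By By'; have Byd : B (y + (y' - y)) by rewrite addrC subrK.
have [c cI] := MVT_ball df By Byd; rewrite [y + _]addrC subrK => ->.
rewrite -sumrB; apply: (le_trans (ler_norm_sum _ _ _)).
rewrite -mulrA; apply: sum_le_const => l.
rewrite -mulrBr normrM mulrCA; apply: ler_pM => //; first exact: coord_le_norm.
have Bc := ball_segment By Byd cI.
apply: (le_trans (lipschitz_ball (ddf^~ l) (fun z m => bK z l m) By Bc)).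
rewrite ler_wpM2l ?mulr_ge0 // addrAC subrr add0r normrZ.
by case/andP: cI => c0 c1; rewrite ger0_norm // ler_piMl.
Qed.

End CubeEstimates.

Section Clamp.
Context {R : realType} {n : nat}.
Variables (y0 : 'rV[R]_n) (rho : R).
Hypothesis rho0 : 0 < rho.

Definition clampR (a b x : R) : R := if x <= a then a else if b <= x then b else x.

Lemma clampR_lip a b x y : a <= b -> `|clampR a b x - clampR a b y| <= `|x - y|.
Proof.
move=> ab; rewrite /clampR.
case: (leP x a) => h1; case: (leP y a) => h2; try case: (leP b x) => h3; try case: (leP b y) => h4;
  rewrite ler_norml; have := ler_norm (x - y); have := lerNnormlW (lexx `|x - y|);
  move=> *; apply/andP; split; lra.
Qed.

Definition clamp (y : 'rV[R]_n) : 'rV[R]_n :=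
  \row_j clampR (y0 0 j - rho) (y0 0 j + rho) (y 0 j).

Lemma clamp_lip y y' : `|clamp y - clamp y'| <= `|y - y'|.
Proof.
apply: norm_rV_le => // j; rewrite !mxE.
apply: (le_trans (clampR_lip _ _ _)).
  by have := rho0; lra.
by have := coord_le_norm (y - y') j; rewrite !mxE.
Qed.

Lemma clamp_id y : `|y0 - y| <= rho -> clamp y = y.
Proof.
move=> h; apply/rowP => j; rewrite mxE /clampR.
have := le_trans (coord_le_norm (y0 - y) j) h; rewrite !mxE ler_norml.
move: (y0 0 j) (y 0 j) => c d /andP[h1 h2].
by case: leP => h3; [lra|case: leP => h4; lra].
Qed.

Lemma clamp_in y : `|y0 - clamp y| <= rho.
Proof.
apply: norm_rV_le => [|j]; first exact: ltW.
rewrite !mxE /clampR ler_norml; move: (y0 0 j) (y 0 j) => c d; have r0 := rho0.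
by case: (leP d (c - rho)) => h3; [|case: (leP (c + rho) d) => h4]; lra.
Qed.

End Clamp.

(** * Local flows: existence, uniqueness, continuity *)

Section LocalFlow.
Context {R : realType}.

Definition flow_box n (y0 : 'rV[R]_n) (d r : R) : set 'rV[R]_(1 + n) :=
  [set z | `|lsubmx z 0 0| < d /\ `|y0 - rsubmx z| < r].

Definition is_flow n (X : 'rV[R]_n -> 'rV[R]_n) (O : set 'rV[R]_n) y0 (d r : R)
    (psi : R -> 'rV[R]_n -> 'rV[R]_n) :=
  forall (t : R) x, `|t| < d -> `|y0 - x| < r ->
    [/\ O (psi t x), is_derive t 1 (psi^~ x) (X (psi t x)) & psi 0 x = x].

Lemma msmo_lsub a b (A : set 'rV[R]_(a + b)) : msmo A (fun z => lsubmx z).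
Proof.
move=> i j; have -> : (fun z : 'rV[R]_(a + b) => lsubmx z i j) = (fun z => z 0 (lshift b j)).
  by apply/funext => z; rewrite mxE ord1.
exact: smo_coord.
Qed.

Lemma msmo_rsub a b (A : set 'rV[R]_(a + b)) : msmo A (fun z => rsubmx z).
Proof.
move=> i j; have -> : (fun z : 'rV[R]_(a + b) => rsubmx z i j) = (fun z => z 0 (rshift a j)).
  by apply/funext => z; rewrite mxE ord1.
exact: smo_coord.
Qed.

Lemma continuous_lsub n (z : 'rV[R]_(1 + n)) : {for z, continuous (fun z : 'rV[R]_(1 + n) => lsubmx z 0 0)}.
Proof. exact: smo_continuous (@msmo_lsub 1 n setT 0 0) I. Qed.

Lemma continuous_rsub m n (z : 'rV[R]_(m + n)) : {for z, continuous (fun z : 'rV[R]_(m + n) => rsubmx z)}.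
Proof. exact: msmo_continuous (@msmo_rsub m n setT) I. Qed.

Lemma open_flow_box n (y0 : 'rV[R]_n) d r : open (flow_box y0 d r).
Proof.
rewrite openE => z [h1 h2].
have e1 : 0 < d - `|lsubmx z 0 0| by rewrite subr_gt0.
have e2 : 0 < r - `|y0 - rsubmx z| by rewrite subr_gt0.
have n1 := near_dist (@continuous_lsub n z) e1.
have n2 := near_dist (@continuous_rsub 1 n z) e2.
apply: filterS2 n1 n2 => w w1 w2; split.
  have := ler_normB (lsubmx z 0 0) (lsubmx z 0 0 - lsubmx w 0 0).
  by rewrite subKr => h; apply: (le_lt_trans h); rewrite addrC -ltrBrDr.
have := ler_normD (y0 - rsubmx z) (rsubmx z - rsubmx w).
by rewrite subrKA => h; apply: (le_lt_trans h); rewrite addrC -ltrBrDr.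
Qed.

Variables (n : nat) (X : 'rV[R]_n -> 'rV[R]_n) (O : set 'rV[R]_n) (y0 : 'rV[R]_n).
Hypotheses (oO : open O) (sX : msmo O X) (Oy0 : O y0).

Local Notation DX := (jac X).

(** One constant bounds the field, its first derivatives (Lipschitz estimates and uniqueness) and
    its second derivatives (the quadratic Taylor remainder behind differentiability of the flow). *)
Definition tame (rho K : R) := [/\ 0 < rho, 0 <= K & forall y, ball y0 rho y ->
  [/\ O y, `|X y| <= K, forall l j, `|pd l (fun y => X y 0 j) y| <= K &
    forall l m j, `|pd m (pd l (fun y => X y 0 j)) y| <= K]].

Lemma tame_ex : exists rho K, tame rho K.
Proof.
pose S1 : R := \sum_l \sum_j `|pd l (fun y => X y 0 j) y0|.
pose S2 : R := \sum_l \sum_m \sum_j `|pd m (pd l (fun y => X y 0 j)) y0|.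
pose K := `|X y0| + S1 + S2 + 1.
have p1 l j : `|pd l (fun y => X y 0 j) y0| <= S1.
  rewrite /S1 (bigD1 l) //= (bigD1 j) //= -addrA lerDl addr_ge0 //; first exact: sumr_ge0.
  by apply: sumr_ge0 => ? _; exact: sumr_ge0.
have p2 l m j : `|pd m (pd l (fun y => X y 0 j)) y0| <= S2.
  rewrite /S2 (bigD1 l) //= (bigD1 m) //= (bigD1 j) //= -!addrA lerDl !addr_ge0 //.
  - exact: sumr_ge0.
  - by apply: sumr_ge0 => ? _; exact: sumr_ge0.
  - by apply: sumr_ge0 => ? _; apply: sumr_ge0 => ? _; exact: sumr_ge0.
have S10 : 0 <= S1 by apply: sumr_ge0 => ? _; exact: sumr_ge0.
have S20 : 0 <= S2 by apply: sumr_ge0 => ? _; apply: sumr_ge0 => ? _; exact: sumr_ge0.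
have cts f : smo O f -> {for y0, continuous f}.
  by move=> sf; exact: smo_continuous.
have bnd (V : normedModType R) (f : 'rV[R]_n -> V) C : {for y0, continuous f} -> `|f y0| <= C ->
    \forall y \near y0, `|f y| <= C + 1.
  move=> cf fC; have := near_dist cf (@ltr01 R); apply: filterS => y fy.
  have := ler_normB (f y0) (f y0 - f y); rewrite subKr => /le_trans; apply.
  by apply: lerD => //; exact: ltW.
have N1 : \forall y \near y0, O y by exact: open_nbhs_nbhs.
have N2 : \forall y \near y0, `|X y| <= `|X y0| + 1.
  by apply: bnd => //; apply: continuous_rV => j; apply: cts.
have N3 : \forall y \near y0, forall l, forall j, `|pd l (fun y => X y 0 j) y| <= S1 + 1.
  apply: near_all => l; apply: near_all => j; apply: bnd; last exact: p1.
  by apply: cts; apply: smo_pd.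
have N4 : \forall y \near y0, forall l m j : 'I_n, `|pd m (pd l (fun y => X y 0 j)) y| <= S2 + 1.
  apply: near_all => l; apply: near_all => m; apply: near_all => j; apply: bnd; last exact: p2.
  by apply: cts; do 2!apply: smo_pd.
have := @filterI _ _ (nbhs_filter y0) _ _ (@filterI _ _ (nbhs_filter y0) _ _ N1 N2)
   (@filterI _ _ (nbhs_filter y0) _ _ N3 N4).
move=> /nbhs_ballP[rho /= rho0 H]; exists rho, K; split => //.
  by rewrite !addr_ge0.
have X0 : 0 <= `|X y0| by [].
move=> y /H[[Oy h2] [h3 h4]]; split => //.
- by rewrite /K; lra.
- by move=> l j; apply: (le_trans (h3 l j)); rewrite /K; lra.
- by move=> l m j; apply: (le_trans (h4 l m j)); rewrite /K; lra.
Qed.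

Variables (rho K : R).
Hypothesis tm : tame rho K.
Local Notation B := (ball y0 rho).

Let dXj j z : B z -> differentiable (fun y => X y 0 j) z.
Proof. by have [_ _ H] := tm; move=> /H[Oz _ _ _]; exact: smo_diff. Qed.

Lemma tame_lip y y' : B y -> B y' -> `|X y' - X y| <= n%:R * K * `|y' - y|.
Proof.
have [r0 K0 H] := tm; move=> By By'.
apply: norm_rV_le => [|j]; first by rewrite !mulr_ge0.
rewrite addmxE oppmxE.
apply: (@lipschitz_ball R n y0 rho (fun y => X y 0 j)) => //; first exact: dXj.
by move=> z l /H[_ _ h _].
Qed.

Lemma tame_taylor y y' : B y -> B y' ->
  `|X y' - X y - (y' - y) *m DX y| <= n%:R * (n%:R * K) * `|y' - y| ^+ 2.
Proof.
have [r0 K0 H] := tm; move=> By By'.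
apply: norm_rV_le => [|j]; first by rewrite !mulr_ge0.
rewrite !addmxE !oppmxE [(_ *m _) _ _]mxE.
under eq_bigr => l _ do rewrite jacE.
apply: (@taylor_ball R n y0 rho (fun y => X y 0 j)) => //.
- exact: dXj.
- by move=> z l /H[Oz _ _ _]; exact: smo_diff (smo_pd l (sX 0 j)) _.
- by move=> z l m /H[_ _ _ h].
Qed.

Lemma tame_DX y (v : 'rV[R]_n) : B y -> `|v *m DX y| <= n%:R * K * `|v|.
Proof.
have [r0 K0 H] := tm; move=> /H[_ _ h _].
apply: norm_rV_le => [|j]; first by rewrite !mulr_ge0.
rewrite mxE; apply: (le_trans (ler_norm_sum _ _ _)); rewrite -mulrA; apply: sum_le_const => l.
by rewrite normrM jacE mulrC; apply: ler_pM => //; exact: coord_le_norm.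
Qed.

Let Q (a b : R) : R := n%:R * ((2 * (n%:R * K) + 1) * a + b).

Lemma tame_gronwall (g h : R -> 'rV[R]_n) (t : R) :
  (forall s : R, Num.min 0 t <= s <= Num.max 0 t ->
    [/\ B (g s), B (h s), is_derive s 1 g (X (g s)) & is_derive s 1 h (X (h s))]) ->
  `|h t - g t| ^+ 2 <= n%:R * `|h 0 - g 0| ^+ 2 * expR ((2 * (n%:R * K) + 1) * n%:R * `|t|).
Proof.
have [r0 K0 H] := tm; move=> HH.
have nK : 0 <= n%:R * K by rewrite mulr_ge0.
have := @gronwall_rV R n (fun s => h s - g s) (fun s => X (h s) - X (g s)) (n%:R * K) 0 t nK (lexx 0).
rewrite expr0n mul0r addr0; apply.
  move=> s /HH[_ _ dg dh]; have -> : (fun s => h s - g s) = h - g by [].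
  exact: is_deriveB.
by move=> s /HH[Bg Bh _ _]; rewrite addr0; exact: tame_lip.
Qed.

Lemma tame_unique (g h : R -> 'rV[R]_n) (t : R) :
  (forall s : R, Num.min 0 t <= s <= Num.max 0 t ->
    [/\ B (g s), B (h s), is_derive s 1 g (X (g s)) & is_derive s 1 h (X (h s))]) ->
  g 0 = h 0 -> g t = h t.
Proof.
move=> HH e; have := tame_gronwall HH; rewrite e subrr normr0 expr0n mulr0 mul0r => h0.
have : `|h t - g t| ^+ 2 == 0 by rewrite eq_le h0 exprn_ge0.
by rewrite sqrf_eq0 normr_eq0 subr_eq0 => /eqP.
Qed.

(* The C^0 case: Picard iteration for the field composed with the retraction
   onto a closed cube; solutions starting near the centre do not reach its
   boundary for short times. *)
Lemma local_flow0 : exists (d r : R) psi, [/\ 0 < d, 0 < r, is_flow X B y0 d r psi &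
  forall j, cgood 0 (flow_box y0 d r) (fun z => psi (lsubmx z 0 0) (rsubmx z) 0 j)].
Proof.
have [r0 K0 H] := tm.
pose rh := rho / 2; have rh0 : 0 < rh by rewrite divr_gt0.
have rhr : rh < rho by rewrite ltr_pdivrMr // ltr_pMr // ltr1n.
pose F x := X (clamp y0 rh x).
have clB x : B (clamp y0 rh x) by apply/ball_rVP; apply: le_lt_trans rhr; exact: clamp_in.
pose L := n%:R * K + 1; have L0 : 0 < L by rewrite ltr_wpDl // mulr_ge0.
have LF x y : `|F x - F y| <= L * `|x - y|.
  apply: (le_trans (tame_lip (clB y) (clB x))).
  apply: ler_pM => //; [by rewrite mulr_ge0|by rewrite lerDl|exact: clamp_lip].
have ex x := ode_global x L0 LF.
pose psi t x := sval (cid (ex x)) t.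
have psi0 x : psi 0 x = x by rewrite /psi; case: cid => ? [].
have dpsi (t : R) x : is_derive t 1 (psi^~ x) (F (psi t x)).
  by rewrite /psi; case: cid => g [_ dg] /=.
have FK x : `|F x| <= K by have [_ h _ _] := H _ (clB x).
have speed t s x : `|psi t x - psi s x| <= K * `|t - s|.
  apply: norm_rV_le => [|j]; first by rewrite mulr_ge0.
  rewrite addmxE oppmxE.
  have [c _ ->] := @MVT_closed R (fun s => psi s x 0 j) (fun s => F (psi s x) 0 j) s t
     (fun u _ => is_derive_coord j (dpsi u x)).
  rewrite normrM ler_wpM2r // (le_trans (coord_le_norm _ _)) //; exact: FK.
(* Within time [d], at speed at most [K], a solution moves at most [rh / 2]; starting within
   [r = rh / 2] of the centre it stays in the cube of radius [rh], where the truncated field is [X]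
   itself. *)
pose d := rh / (2 * (K + 1)); pose r := rh / 2.
have K1 : 0 < K + 1 by rewrite ltr_wpDl.
have d0 : 0 < d by rewrite divr_gt0 // mulr_gt0.
have rr0 : 0 < r by rewrite divr_gt0.
have stay t x : `|t| < d -> `|y0 - x| < r -> `|y0 - psi t x| < rh.
  move=> td xr; have : `|y0 - psi t x| <= `|y0 - x| + `|psi t x - psi 0 x|.
    by rewrite psi0 [X in _ <= _ + X]distrC; apply: le_trans (ler_normD _ _); rewrite subrKA.
  move=> /le_lt_trans; apply; have -> : rh = r + rh / 2 by rewrite /r; field.
  apply: ltr_leD => //; apply: (le_trans (speed t 0 x)); rewrite subr0.
  apply: (@le_trans _ _ ((K + 1) * d)).
    by apply: ler_pM => //; [rewrite lerDl|exact: ltW].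
  by rewrite /d le_eqVlt; apply/orP; left; apply/eqP; field; rewrite gt_eqF.
exists d, r, psi; split => //.
- move=> t x td xr; have h := stay t x td xr.
  split => //; first by apply/ball_rVP; exact: lt_trans h _.
  by have := dpsi t x; rewrite /F clamp_id // ltW.
- move=> j z [z1 z2]; apply: continuous_eps => e e0.
  pose c := expR ((2 * (n%:R * K) + 1) * n%:R * d).
  have c0 : 0 < c := expR_gt0 _.
  have nc0 : 0 <= n%:R * c by rewrite mulr_ge0 // ltW.
  have e1 : 0 < e / 2 / (K + 1) by rewrite !divr_gt0.
  have e2 : 0 < e / 2 / (n%:R * c + 1) by rewrite !divr_gt0 // ltr_wpDl.
  have n1 := near_dist (@continuous_lsub _ z) e1.
  have n2 := near_dist (@continuous_rsub 1 n z) e2.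
  have n3 : \forall w \near z, flow_box y0 d r w.
    by apply: open_nbhs_nbhs; split; [exact: open_flow_box|].
  apply: filterS3 n1 n2 n3 => w w1 w2 [w3 w4].
  set t := lsubmx z 0 0 in z1 w1 *; set x := rsubmx z in z2 w2 *.
  set s := lsubmx w 0 0 in w1 w3 *; set y := rsubmx w in w2 w4 *.
  have A1 : `|psi t x - psi s x| < e / 2.
    apply: (le_lt_trans (speed t s x)).
    apply: (@le_lt_trans _ _ ((K + 1) * `|t - s|)); first by rewrite ler_wpM2r // lerDl.
    by rewrite mulrC -ltr_pdivlMr.
  have A2 : `|psi s x - psi s y| < e / 2.
    have := @tame_gronwall (psi^~ x) (psi^~ y) s.
    rewrite !psi0 distrC => G.
    have {}G : `|psi s x - psi s y| ^+ 2 <= n%:R * `|x - y| ^+ 2 * c.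
      rewrite [`|x - y|]distrC; apply: (le_trans (G _)).
        move=> u uI; have ud : `|u| < d by apply: le_lt_trans w3; exact: norm_le_minmax0.
        have h1 := stay u x ud z2; have h2 := stay u y ud w4.
        split; try by apply/ball_rVP; apply: lt_trans rhr.
        + by have := dpsi u x; rewrite /F clamp_id // ltW.
        + by have := dpsi u y; rewrite /F clamp_id // ltW.
      rewrite ler_wpM2l // ler_expR.
      by apply: ler_wpM2l; [rewrite mulr_ge0 // addr_ge0 // !mulr_ge0|exact: ltW].
    have n1c : 0 < n%:R * c + 1 by rewrite ltr_wpDl.
    have : (n%:R * c + 1) * `|x - y| < e / 2 by rewrite mulrC -ltr_pdivlMr.
    apply: le_lt_trans; rewrite -ler_sqr ?nnegrE ?mulr_ge0 ?(ltW n1c) //.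
    apply: (le_trans G); rewrite exprMn mulrAC ler_wpM2r //.
    have : 0 <= (n%:R * c) ^+ 2 := sqr_ge0 _.
    by nra.
  have -> : psi t x 0 j - psi s y 0 j = (psi t x - psi s y) 0 j by rewrite addmxE oppmxE.
  apply: (le_lt_trans (coord_le_norm _ _)).
  have -> : psi t x - psi s y = (psi t x - psi s x) + (psi s x - psi s y) by rewrite subrKA.
  apply: (le_lt_trans (ler_normD _ _)); have -> : e = e / 2 + e / 2 by field.
  exact: ltrD.
Qed.

End LocalFlow.

Section BlockCalculus.
Context {R : realType}.

Lemma is_derive_lsub a b (g : R -> 'rV[R]_(a + b)) (t : R) v :
  is_derive t 1 g v -> is_derive t 1 (fun s => lsubmx (g s)) (lsubmx v).
Proof.
move=> dg; apply: is_derive_rV => j; rewrite mxE.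
under eq_fun do rewrite mxE.
exact: is_derive_coord.
Qed.

Lemma is_derive_rsub a b (g : R -> 'rV[R]_(a + b)) (t : R) v :
  is_derive t 1 g v -> is_derive t 1 (fun s => rsubmx (g s)) (rsubmx v).
Proof.
move=> dg; apply: is_derive_rV => j; rewrite mxE.
under eq_fun do rewrite mxE.
exact: is_derive_coord.
Qed.

Lemma msmo_row_mx n p a b (A : set 'rV[R]_n) (F : 'rV[R]_n -> 'M[R]_(p, a)) (G : 'rV[R]_n -> 'M[R]_(p, b)) :
  msmo A F -> msmo A G -> msmo A (fun z => row_mx (F z) (G z)).
Proof.
move=> sF sG i j; case: (split_ordP j) => l ->.
  under eq_fun do rewrite row_mxEl.
  exact: sF.
under eq_fun do rewrite row_mxEr.
exact: sG.
Qed.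

Lemma msmo_cst n p q (A : set 'rV[R]_n) (c : 'M[R]_(p, q)) : msmo A (fun=> c).
Proof. by move=> i j; exact: smo_cst. Qed.

Lemma norm_row_mx_lt a b (u : 'rV[R]_a) (v : 'rV[R]_b) c :
  `|u| < c -> `|v| < c -> `|row_mx u v| < c.
Proof.
move=> uc vc; apply: norm_rV_lt => [|j]; first exact: le_lt_trans uc.
case: (split_ordP j) => l ->; rewrite ?row_mxEl ?row_mxEr.
  by apply: le_lt_trans uc; exact: coord_le_norm.
by apply: le_lt_trans vc; exact: coord_le_norm.
Qed.

Lemma is_derive_shift (V : normedModType R) (g : R -> V) (t : R) v :
  is_derive t 1 g v -> is_derive (0 : R) 1 (fun s => g (t + s)) v.
Proof.
have E : (fun h : R => h^-1 *: (((fun s => g (t + s)) \o shift 0) (h *: 1) - g (t + 0))) =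
   (fun h => h^-1 *: ((g \o shift t) (h *: 1) - g t)).
  by apply/funext => h /=; rewrite !addr0 [t + _]addrC.
by move=> [d <-]; apply: DeriveDef; [move: d; rewrite /derivable E|rewrite /derive E].
Qed.

Lemma is_derive_quadratic (g : R -> R) (l C e : R) : 0 < e ->
  (forall h : R, `|h| < e -> `|g h - g 0 - h * l| <= C * h ^+ 2) -> is_derive (0 : R) 1 g l.
Proof.
move=> e0 H.
have C0 : 0 <= C.
  have e2 : 0 < e / 2 by rewrite divr_gt0.
  have /H h1 : `|e / 2| < e by rewrite gtr0_norm // ltr_pdivrMr // ltr_pMr // ltr1n.
  have := le_trans (normr_ge0 _) h1; rewrite pmulr_lge0 //; exact: exprn_gt0.
have cv : h^-1 *: ((g \o shift 0) (h *: 1) - g 0) @[h --> 0^'] --> l.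
  apply: cvg0_bound => e' e'0.
  have e1 : 0 < Num.min e (e' / (C + 1)).
    by rewrite lt_min e0 divr_gt0 // ltr_wpDl.
  near=> h; have h0 : h != 0 by near: h; exact: nbhs_dnbhs_neq.
  have : `|h| < Num.min e (e' / (C + 1)) by near: h; exact: dnbhs0_lt.
  rewrite lt_min => /andP[h1 h2].
  rewrite /= addr0 [h *: 1]mulr1.
  have -> : h^-1 *: (g h - g 0) - l = h^-1 * (g h - g 0 - h * l).
    by rewrite /GRing.scale /=; field.
  rewrite normrM normfV mulrC ler_pdivrMr ?normr_gt0 //.
  apply: (le_trans (H h h1)); rewrite -real_normK ?num_real // mulrA ler_wpM2r //.
  move: h2; rewrite ltr_pdivlMr ?ltr_wpDl // => h2; have := normr_ge0 h => h3.
  by nra.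
by apply: DeriveDef; [apply/cvg_ex; exists l|exact: cvg_lim].
Unshelve. all: by end_near. Qed.

Lemma cgood_precomp a b k A B (f : 'rV[R]_b -> R) (phi : 'rV[R]_a -> 'rV[R]_b) :
  open A -> (forall x, A x -> B (phi x)) -> msmo A phi -> cgood k B f -> cgood k A (f \o phi).
Proof. by move=> oA AB sphi; apply: cgood_comp oA AB _ => j; exact: smo_cgood. Qed.

End BlockCalculus.

Section LocalFlowSmooth.
Context {R : realType}.

(* The flow of (X, v |-> v DX) is the flow of X together with its linearisation,
   which bounds the difference quotients of the flow in the initial point. *)
Theorem local_flow k n (X : 'rV[R]_n -> 'rV[R]_n) (O : set 'rV[R]_n) y0 :
  open O -> msmo O X -> O y0 ->
  exists (d r : R) psi, [/\ 0 < d, 0 < r, is_flow X O y0 d r psi &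
    forall j, cgood k (flow_box y0 d r) (fun z => psi (lsubmx z 0 0) (rsubmx z) 0 j)].
Proof.
elim: k n X O y0 => [|k IH] n X O y0 oO sX Oy0;
  have [rho [K tm]] := tame_ex oO sX Oy0; have [rho0 K0 HB] := tm.
  have [d [r [psi [d0 r0 fl cg]]]] := local_flow0 sX tm.
  exists d, r, psi; split=> // t x td xr; have [h1 h2 h3] := fl t x td xr.
  by have [] := HB _ h1.
pose B := ball y0 rho.
have oB : open B by exact: ball_open.
have BO y : B y -> O y by move=> /HB[].
pose Y z : 'rV[R]_(n + n) := row_mx (X (lsubmx z)) (rsubmx z *m jac X (lsubmx z)).
pose O' : set 'rV[R]_(n + n) := [set z | B (lsubmx z)].
have cl : continuous (fun z : 'rV[R]_(n + n) => lsubmx z).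
  move=> z; apply: continuous_rV => j; apply: differentiable_continuous.
  exact: smo_diff (@msmo_lsub R n n setT 0 j) I.
have oO' : open O' by move/continuousP: cl; apply.
have sY : msmo O' Y.
  apply: msmo_row_mx.
    apply: (@msmo_comp R (n + n) n 1 n O' B X (fun z => lsubmx z)) => //; first exact: msmo_lsub.
    by move=> i j; apply: smo_sub (sX i j) => y /BO.
  apply: msmoM => //; first exact: msmo_rsub.
  apply: (@msmo_comp R (n + n) n n n O' B (jac X) (fun z => lsubmx z)) => //; first exact: msmo_lsub.
  move=> l j; have -> : (fun y => jac X y l j) = pd l (fun y => X y 0 j).
    by apply/funext => y; rewrite jacE.
  by apply: smo_sub (smo_pd l (sX 0 j)) => y /BO.
have Oy' : O' (row_mx y0 0) by rewrite /O' /= row_mxKl; exact: ballxx.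
have [d [r' [Psi [d0 r'0 fl cg]]]] := IH _ Y O' (row_mx y0 0) oO' sY Oy'.
pose r := r' / 2; have r0 : 0 < r by rewrite divr_gt0.
have rr' : r < r' by rewrite ltr_pdivrMr // ltr_pMr // ltr1n.
pose psi t x := lsubmx (Psi t (row_mx x 0)).
(* The linearised component starts at [r] times the basis vector, to lie in the box of the doubled
   flow; since its equation is linear, division by [r] gives the solution starting at the basis
   vector. *)
pose xi i t x := r^-1 *: rsubmx (Psi t (row_mx x (r *: delta_mx 0 i))).
have nd i : `|r *: delta_mx 0 i : 'rV[R]_n| < r'.
  by rewrite normrZ gtr0_norm //; apply: le_lt_trans rr'; rewrite ler_piMr ?norm_delta // ltW.
have box x (v : 'rV[R]_n) : `|y0 - x| < r -> `|v| < r' -> `|row_mx y0 0 - row_mx x v| < r'.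
  move=> h1 h2; rewrite opp_row_mx add_row_mx sub0r; apply: norm_row_mx_lt; first exact: lt_trans rr'.
  by rewrite normrN.
have FL t x v : `|t| < d -> `|y0 - x| < r -> `|v| < r' ->
    [/\ B (lsubmx (Psi t (row_mx x v))),
        is_derive t 1 (fun s => lsubmx (Psi s (row_mx x v))) (X (lsubmx (Psi t (row_mx x v)))),
        is_derive t 1 (fun s => rsubmx (Psi s (row_mx x v)))
          (rsubmx (Psi t (row_mx x v)) *m jac X (lsubmx (Psi t (row_mx x v)))) &
        Psi 0 (row_mx x v) = row_mx x v].
  move=> td xr vr; have [h1 h2 h3] := fl t (row_mx x v) td (box x v xr vr).
  split=> //.
    by have := is_derive_lsub h2; rewrite row_mxKl.
  by have := is_derive_rsub h2; rewrite row_mxKr.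
have n0r : `|0 : 'rV[R]_n| < r' by rewrite normr0.
(* The first component solves the equation of [X] alone, so it does not depend on the linear
   component [v]. *)
have lE t x v : `|t| < d -> `|y0 - x| < r -> `|v| < r' -> lsubmx (Psi t (row_mx x v)) = psi t x.
  move=> td xr vr; apply: (@tame_unique R n X O y0 sX rho K tm (fun s => lsubmx (Psi s (row_mx x v))) (psi^~ x) t).
    move=> s sI; have sd : `|s| < d by apply: le_lt_trans td; exact: norm_le_minmax0.
    by have [? ? _ _] := FL s x v sd xr vr; have [? ? _ _] := FL s x 0 sd xr n0r.
  have d00 : `|0 : R| < d by rewrite normr0.
  have [_ _ _ ->] := FL 0 x v d00 xr vr; have [_ _ _ E0] := FL 0 x 0 d00 xr n0r.
  by rewrite /psi E0 !row_mxKl.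
have psiP t x : `|t| < d -> `|y0 - x| < r ->
    [/\ B (psi t x), is_derive t 1 (psi^~ x) (X (psi t x)) & psi 0 x = x].
  move=> td xr; have [h1 h2 h3 _] := FL t x 0 td xr n0r; split=> //.
  have d00 : `|0 : R| < d by rewrite normr0.
  by have [_ _ _ h] := FL 0 x 0 d00 xr n0r; rewrite /psi h row_mxKl.
have xiP i (t : R) x : `|t| < d -> `|y0 - x| < r ->
    is_derive t 1 (xi i ^~ x) (xi i t x *m jac X (psi t x)) /\ xi i 0 x = delta_mx 0 i.
  move=> td xr; have [_ _ h3 _] := FL t x _ td xr (nd i); split.
    have -> : xi i ^~ x = r^-1 \*: (fun s => rsubmx (Psi s (row_mx x (r *: delta_mx 0 i)))) by [].
    apply: is_derive_eq; rewrite -scalemxAl -(lE t x _ td xr (nd i)) //.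
  have d00 : `|0 : R| < d by rewrite normr0.
  have [_ _ _ h] := FL 0 x _ d00 xr (nd i).
  by rewrite /xi h row_mxKr scalerA mulVf ?gt_eqF // scale1r.
have nK : 0 <= n%:R * K by rewrite mulr_ge0.
have DXi i t x j : `|t| < d -> `|y0 - x| < r ->
    is_derive x (delta_mx 0 i) (fun x => psi t x 0 j) (xi i t x 0 j).
  move=> td xr; apply: is_derive_dir0.
  pose e := r - `|y0 - x|; have e0 : 0 < e by rewrite subr_gt0.
  pose EE := expR ((2 * (n%:R * K) + 1) * n%:R * d).
  have cE (s : R) : `|s| < d -> expR ((2 * (n%:R * K) + 1) * n%:R * `|s|) <= EE.
    move=> sd; rewrite ler_expR ler_wpM2l ?(ltW sd) //.
    by rewrite mulr_ge0 // addr_ge0 // mulr_ge0.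
  pose C := n%:R * (n%:R * K) * (n%:R * EE).
  have EE0 : 0 <= EE by exact: expR_ge0.
  have C0 : 0 <= C by rewrite !mulr_ge0.
  pose Q := n%:R * d * EE; have Q0 : 0 <= Q by rewrite !mulr_ge0 // ltW.
  apply: (@is_derive_quadratic R _ _ (C * (1 + Q)) e e0) => h he.
  have xh : `|y0 - (x + h *: delta_mx 0 i)| < r.
    rewrite opprD addrA; apply: (le_lt_trans (ler_normB _ _)); rewrite normrZ.
    apply: (@le_lt_trans _ _ (`|y0 - x| + `|h|)).
      by rewrite lerD2l ler_piMr // norm_delta.
    by move: he; rewrite ltrBrDl.
  have hd s : `|s| < d -> `|psi s (x + h *: delta_mx 0 i) - psi s x| ^+ 2 <= n%:R * EE * h ^+ 2.
    move=> sd; have := @tame_gronwall R n X O y0 sX rho K tm (psi^~ x) (psi^~ (x + h *: delta_mx 0 i)) s.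
    move=> /(_ _)/le_trans; apply.
      move=> u uI; have ud : `|u| < d by apply: le_lt_trans sd; exact: norm_le_minmax0.
      by have [? ? ?] := psiP u _ ud xr; have [? ? ?] := psiP u _ ud xh.
    have [_ _ ->] := psiP s _ sd xr; have [_ _ ->] := psiP s _ sd xh.
    rewrite addrAC subrr add0r normrZ exprMn mulrAC ler_pM //.
    - by apply: ler_wpM2l => //; exact: cE.
    - by rewrite real_normK ?num_real // ler_piMr ?sqr_ge0 // exprn_ile1 // norm_delta.
  (* [D] is the error of the first-order expansion in the initial point. It solves the linearised
     equation up to the Taylor remainder, which is quadratic in h, so Gronwall bounds it by a
     multiple of [h ^+ 2]. *)
  pose D s := psi s (x + h *: delta_mx 0 i) - psi s x - h *: xi i s x.
  pose dD s := X (psi s (x + h *: delta_mx 0 i)) - X (psi s x) - h *: (xi i s x *m jac X (psi s x)).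
  have G := @gronwall_rV R n D dD (n%:R * K) (C * h ^+ 2) t nK.
  have b0 : 0 <= C * h ^+ 2 by rewrite mulr_ge0 // sqr_ge0.
  have D0 : D 0 = 0.
    have d00 : `|0 : R| < d by rewrite normr0.
    have [_ _ e1] := psiP 0 _ d00 xr; have [_ _ e2] := psiP 0 _ d00 xh; have [_ e3] := xiP i 0 _ d00 xr.
    by rewrite /D e1 e2 e3 [x + _]addrC addrK subrr.
  rewrite D0 normr0 expr0n add0r in G.
  have {}G : `|D t| ^+ 2 <= n%:R * ((C * h ^+ 2) ^+ 2 * `|t|) * expR ((2 * (n%:R * K) + 1) * n%:R * `|t|).
    apply: G => // s sI; have sd : `|s| < d by apply: le_lt_trans td; exact: norm_le_minmax0.
      have [_ d1 _] := psiP s _ sd xr; have [_ d2 _] := psiP s _ sd xh; have [d3 _] := xiP i s _ sd xr.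
      have -> : D = (psi^~ (x + h *: delta_mx 0 i)) - (psi^~ x) - h \*: (xi i ^~ x) by [].
      exact: is_derive_eq.
    have [B1 _ _] := psiP s _ sd xr; have [B2 _ _] := psiP s _ sd xh.
    have -> : dD s = (X (psi s (x + h *: delta_mx 0 i)) - X (psi s x) -
       (psi s (x + h *: delta_mx 0 i) - psi s x) *m jac X (psi s x)) + D s *m jac X (psi s x).
      rewrite [D s *m _]mulmxBl -scalemxAl; set P := (_ - _) *m _; rewrite [in RHS]addrA subrK //.
    apply: (le_trans (ler_normD _ _)); rewrite addrC; apply: lerD.
      exact: (tame_DX tm (D s) B1).
    apply: (le_trans (tame_taylor sX tm B1 B2)).
    have -> : C * h ^+ 2 = n%:R * (n%:R * K) * (n%:R * EE * h ^+ 2) by rewrite /C; ring.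
    by apply: ler_wpM2l; [rewrite mulr_ge0|exact: hd].
  have {}G : `|D t| <= C * h ^+ 2 * (1 + Q).
    rewrite -ler_sqr ?nnegrE //; last by rewrite mulr_ge0 // addr_ge0.
    apply: (le_trans G); rewrite [leRHS]exprMn.
    apply: (@le_trans _ _ ((C * h ^+ 2) ^+ 2 * Q)).
      set q := (C * _) ^+ 2; set w := expR _; have -> : n%:R * (q * `|t|) * w = q * (n%:R * `|t| * w) by ring.
      apply: ler_wpM2l; first exact: sqr_ge0.
      apply: ler_pM; rewrite ?expR_ge0 //; last exact: cE.
      by apply: ler_wpM2l => //; exact: ltW.
    by [exact: sqr_ge0|nra].
  rewrite scale0r addr0 mulrAC.
  have -> : psi t (x + h *: delta_mx 0 i) 0 j - psi t x 0 j - h * xi i t x 0 j = D t 0 j.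
    have aux (u v w : 'rV[R]_n) : (u - v - h *: w) 0 j = u 0 j - v 0 j - h * w 0 j.
      by rewrite !addmxE !oppmxE scalemxE.
    by rewrite -aux.
  exact: le_trans (coord_le_norm _ _) G.
exists d, r, psi; split=> //.
  by move=> t x td xr; have [h1 h2 h3] := psiP t x td xr; split=> //; exact: BO.
have oBx : open (flow_box y0 d r) by exact: open_flow_box.
have cgPsi (v : 'rV[R]_n) l : `|v| < r' ->
    cgood k (flow_box y0 d r) (fun z => Psi (lsubmx z 0 0) (row_mx (rsubmx z) v) 0 l).
  move=> vr.
  have := @cgood_precomp R (1 + n) (1 + (n + n)) k (flow_box y0 d r) (flow_box (row_mx y0 0) d r')
    (fun z => Psi (lsubmx z 0 0) (rsubmx z) 0 l) (fun z => row_mx (lsubmx z) (row_mx (rsubmx z) v)).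
  move=> /(_ oBx _ _ (cg l)) H.
  have -> : (fun z : 'rV[R]_(1 + n) => Psi (lsubmx z 0 0) (row_mx (rsubmx z) v) 0 l) =
    (fun z => Psi (lsubmx z 0 0) (rsubmx z) 0 l) \o (fun z => row_mx (lsubmx z) (row_mx (rsubmx z) v)).
    by apply/funext => z /=; rewrite row_mxKl row_mxKr.
  apply: H.
    by move=> z [z1 z2]; split; rewrite ?row_mxKl // row_mxKr; exact: box.
  do !apply: msmo_row_mx; [exact: msmo_lsub|exact: msmo_rsub|exact: msmo_cst].
move=> j.
have Dl z : flow_box y0 d r z ->
    is_derive z (delta_mx 0 (lshift n 0)) (fun z => psi (lsubmx z 0 0) (rsubmx z) 0 j)
      (X (psi (lsubmx z 0 0) (rsubmx z)) 0 j).
  move=> [z1 z2]; apply: is_derive_dir0.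
  have -> : (fun s => psi (lsubmx (z + s *: delta_mx 0 (lshift n 0)) 0 0)
      (rsubmx (z + s *: delta_mx 0 (lshift n 0))) 0 j) = (fun s => psi (lsubmx z 0 0 + s) (rsubmx z) 0 j).
    apply/funext => s; congr (psi _ _ _ _).
      by rewrite !mxE mulr1.
    by apply/rowP => l; rewrite !mxE mulr0 addr0.
  have [_ h _] := psiP _ _ z1 z2.
  exact: (is_derive_shift (is_derive_coord j h)).
have Dr i z : flow_box y0 d r z ->
    is_derive z (delta_mx 0 (rshift 1 i)) (fun z => psi (lsubmx z 0 0) (rsubmx z) 0 j)
      (xi i (lsubmx z 0 0) (rsubmx z) 0 j).
  move=> [z1 z2]; apply: is_derive_dir0.
  have -> : (fun s => psi (lsubmx (z + s *: delta_mx 0 (rshift 1 i)) 0 0)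
      (rsubmx (z + s *: delta_mx 0 (rshift 1 i))) 0 j) =
      (fun s => psi (lsubmx z 0 0) (rsubmx z + s *: delta_mx 0 i) 0 j).
    apply/funext => s; congr (psi _ _ _ _).
      by rewrite !mxE mulr0 addr0.
    by apply/rowP => l; rewrite !mxE.
  have [d1 e1] := DXi i _ _ j z1 z2.
  rewrite -e1; have := @is_derive_dir R n (fun x => psi (lsubmx z 0 0) x 0 j) (rsubmx z) (delta_mx 0 i) 0.
  by rewrite scale0r addr0; apply.
(* The time derivative of the flow is [X] along the flow and its space derivatives are the [xi i].
   Both are components of the doubled flow or composed with them, hence one class less regular by
   the induction hypothesis. *)
apply: cgood_step => //.
  move=> z i zb; case: (split_ordP i) => l ->; last by have [] := Dr l z zb.
  by rewrite ord1; have [] := Dl z zb.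
move=> i; case: (split_ordP i) => l ->.
  rewrite ord1; apply: (@cgood_ext R _ k _ (fun z => X (psi (lsubmx z 0 0) (rsubmx z)) 0 j)) => //.
    by move=> z zb; rewrite pd_unlock; have [_ ->] := Dl z zb.
  apply: (@cgood_comp R (1 + n) n k _ O (fun x => X x 0 j) (fun z => psi (lsubmx z 0 0) (rsubmx z))) => //; last exact: smo_cgood.
    by move=> z [z1 z2]; have [h _ _] := psiP _ _ z1 z2; exact: BO.
  move=> l'; have -> : (fun z => psi (lsubmx z 0 0) (rsubmx z) 0 l') =
     (fun z : 'rV[R]_(1 + n) => Psi (lsubmx z 0 0) (row_mx (rsubmx z) 0) 0 (lshift n l')).
    by apply/funext => z; rewrite mxE.
  exact: cgPsi.
apply: (@cgood_ext R _ k _ (fun z => xi l (lsubmx z 0 0) (rsubmx z) 0 j)) => //.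
  by move=> z zb; rewrite pd_unlock; have [_ ->] := Dr l z zb.
under eq_fun do rewrite scalemxE mxE.
apply: cgoodZ => //; exact: cgPsi.
Qed.

End LocalFlowSmooth.

(** * Solutions on a manifold *)

Section ConnectedInduction.

(** The local hypothesis is symmetric in y and z, so it shows that [S] and its negation both define
    open subsets of [A]. *)
Lemma connected_ind (T : topologicalType) (A : set T) (S : T -> Prop) x0 :
  open A -> connected A -> A x0 -> S x0 ->
  (forall x, A x -> exists2 U, nbhs x U &
     forall y z, A y -> A z -> U y -> U z -> S y -> S z) ->
  forall x, A x -> S x.
Proof.
move=> oA cA Ax0 Sx0 H.
have opn P : (forall x, A x -> exists2 U, nbhs x U &
    forall y z, A y -> A z -> U y -> U z -> P y -> P z) -> open [set x | A x /\ P x].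
  move=> HP; rewrite openE => x [Ax Px]; have [U xU HU] := HP x Ax.
  have nA : nbhs x A by exact: open_nbhs_nbhs.
  have Ux := nbhs_singleton xU.
  apply: filterS2 xU nA => y Uy Ay; split => //.
  exact: HU Px.
have E : [set x | A x /\ S x] = A.
  apply: cA.
  - by exists x0.
  - exists [set x | A x /\ S x]; first exact: opn.
    by rewrite setIidr // => x [].
  - exists (~` [set x | A x /\ ~ S x]).
      apply: open_closedC; apply: opn => x Ax; have [U xU HU] := H x Ax.
      by exists U => // y z Ay Az Uy Uz nS Sz; apply: nS; exact: HU Sz.
    apply/seteqP; split => [x [Ax Sx]|x [Ax nS]]; first by split => // -[].
    by split; apply: contrapT => nSx; apply: nS.
by move=> x Ax; have [] : [set x | A x /\ S x] x by rewrite E.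
Qed.

End ConnectedInduction.

(** * A solution is determined by its 1-jet *)

Section UniqueContinuation.
Context {R : realType} {n : nat}.

Lemma is_derive_lineS (f : 'rV[R]_n -> R) (x v : 'rV[R]_n) s :
  differentiable f (x + s *: v) ->
  is_derive s 1 (fun s => f (x + s *: v)) (\sum_l v 0 l * pd l f (x + s *: v)).
Proof. by move=> df; have := is_derive_line df; rewrite deriveE // diff_rV_sum. Qed.

Lemma near_bounded (V : normedModType R) (f : 'rV[R]_n -> V) x K :
  {for x, continuous f} -> `|f x| <= K -> \forall y \near x, `|f y| <= K + 1.
Proof.
move=> cf fK; have := near_dist cf (@ltr01 R); apply: filterS => y fy.
have := ler_normB (f x) (f x - f y); rewrite subKr => /le_trans; apply.
by apply: lerD => //; exact: ltW.
Qed.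

Lemma near_entries_bounded p q A (F : 'rV[R]_n -> 'M[R]_(p, q)) x : msmo A F -> A x ->
  exists K : R, \forall y \near x, forall a b, `|F y a b| <= K.
Proof.
move=> sF Ax; exists (\sum_a \sum_b `|F x a b| + 1).
apply: near_all => a; apply: near_all => b; apply: near_bounded.
  by exact: smo_continuous.
rewrite (bigD1 a) //= (bigD1 b) //= -addrA lerDl addr_ge0 //; first exact: sumr_ge0.
by apply: sumr_ge0 => ? _; exact: sumr_ge0.
Qed.

Variables (A : set 'rV[R]_n) (G T : 'rV[R]_n -> 'M[R]_n) (w : 'rV[R]_n -> R).
Hypothesis oA : open A.
Hypothesis sG : msmo A G.
Hypothesis mG : forall x, A x -> metric_tensor G x.
Hypothesis sT : msmo A T.
Hypothesis sw : smo A w.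
Hypothesis Hw : forall x, A x -> hessian A G w x = w x *: T x.

(* (w, dw) solves a linear ODE along straight lines. *)
Lemma jet_unique_continuation x : A x -> \forall r \near (0 : R)^'+, forall y z,
  ball x r y -> ball x r z -> w y = 0 -> dcol w y = 0 -> w z = 0 /\ dcol w z = 0.
Proof.
move=> Ax.
have bG i := near_entries_bounded (Gam_smo oA sG mG i) Ax.
have [KT bT] := near_entries_bounded sT Ax.
pose KG i : R := sval (cid (bG i)).
have bG' : \forall y \near x, forall i a b, `|Gam A G i y a b| <= KG i.
  by apply: near_all => i; rewrite /KG; case: cid.
have nA : \forall y \near x, A y by exact: open_nbhs_nbhs.
pose K := \sum_i `|KG i| + `|KT| + 1.
have K0 : 0 <= K by rewrite addr_ge0 // addr_ge0 // sumr_ge0.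
have := @filterI _ _ (nbhs_filter x) _ _ (@filterI _ _ (nbhs_filter x) _ _ bG' bT) nA.
move=> /nbhs_ballP[r /= r0 Hr].
have HB y : ball x r y -> [/\ A y, forall i a b, `|Gam A G i y a b| <= K & forall a b, `|T y a b| <= K].
  move=> /Hr[[h1 h2] h3]; split => //.
    move=> i a b; apply: (le_trans (h1 i a b)); apply: (le_trans (ler_norm _)).
    rewrite /K (bigD1 i) //= -!addrA lerDl !addr_ge0 //.
    by apply: sumr_ge0.
  move=> a b; apply: (le_trans (h2 a b)); apply: (le_trans (ler_norm _)).
  by rewrite /K -addrA addrCA lerDl addr_ge0 // sumr_ge0.
near=> r'.
have r'r : r' <= r by near: r'; exact: nbhs_right_le.
move=> y z yb zb wy dwy.
have sub u : ball x r' u -> ball x r u by exact: le_ball.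
pose v := z - y.
have seg (s : R) : 0 <= s <= 1 -> ball x r (y + s *: v).
  by apply: ball_segment; [exact: sub|rewrite addrC subrK; exact: sub].
pose D s : 'rV[R]_(1 + n) := row_mx (w (y + s *: v))%:M (dcol w (y + s *: v))^T.
pose dD s : 'rV[R]_(1 + n) := row_mx (\sum_l v 0 l * pd l w (y + s *: v))%:M
   (\row_j \sum_l v 0 l * pd l (fun u => dcol w u j 0) (y + s *: v)).
have c1 s : `|w (y + s *: v)| <= `|D s|.
  by have := coord_le_norm (D s) (lshift n 0); rewrite row_mxEl mxE.
have c2 s j : `|dcol w (y + s *: v) j 0| <= `|D s|.
  by have := coord_le_norm (D s) (rshift 1 j); rewrite row_mxEr mxE.
(* Along the direction v, [w] changes by at most [n |v| |D|], and each entry of [dw] by the bound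
   for [Gam dw + w T], which is [(n + 1) K |D|] per direction. *)
pose L := n%:R * (`|v| * ((n%:R + 1) * K + 1)).
have L0 : 0 <= L by rewrite !mulr_ge0 // addr_ge0 // mulr_ge0.
have := @gronwall_rV R (1 + n) D dD L 0 1 L0 (lexx 0).
rewrite (min_idPl ler01) (max_idPr ler01).
have D0 : D 0 = 0.
  rewrite /D scale0r addr0 wy dwy trmx0.
  by apply/matrixP => a b; case: (split_ordP b) => l ->; rewrite ?row_mxEl ?row_mxEr !mxE ?mul0rn.
rewrite D0 normr0 !expr0n mul0r addr0 mulr0 mul0r => G'.
have {}G' : `|D 1| ^+ 2 <= 0.
  apply: G' => s sI.
    have [As _ _] := HB _ (seg s sI).
    apply: is_derive_rV => j; rewrite /D /dD; case: (split_ordP j) => l ->.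
      have -> : (fun s0 => row_mx (w (y + s0 *: v))%:M (dcol w (y + s0 *: v))^T 0 (lshift n l)) =
         (fun s0 => w (y + s0 *: v)).
        by apply/funext => u; rewrite row_mxEl ord1 mxE.
      rewrite row_mxEl ord1 mxE; apply: is_derive_lineS; exact: smo_diff.
    under eq_fun do rewrite row_mxEr mxE.
    rewrite row_mxEr mxE; apply: is_derive_lineS.
    exact: smo_diff (dcol_smo sw l 0) _.
  have [As hG hT] := HB _ (seg s sI); rewrite addr0.
  have D00 : 0 <= `|D s| by [].
  have LE : L * `|D s| = n%:R * (`|v| * (((n%:R + 1) * K + 1) * `|D s|)).
    by rewrite /L !mulrA.
  apply: norm_rV_le => [|j]; first by rewrite mulr_ge0.
  rewrite LE /dD; case: (split_ordP j) => l ->.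
    rewrite row_mxEl ord1 mxE; apply: (le_trans (ler_norm_sum _ _ _)).
    apply: sum_le_const => i; rewrite normrM; apply: ler_pM => //; first exact: coord_le_norm.
    have := c2 s i; rewrite dcolE => /le_trans; apply; rewrite ler_peMl //.
    by rewrite lerDr mulr_ge0.
  rewrite row_mxEr mxE; apply: (le_trans (ler_norm_sum _ _ _)).
  apply: sum_le_const => i; rewrite normrM; apply: ler_pM => //; first exact: coord_le_norm.
  rewrite -mpdE (Weq_dcol oA Hw) // addmxE scalemxE mxE.
  apply: (le_trans (ler_normD _ _)).
  apply: (@le_trans _ _ (n%:R * (K * `|D s|) + `|D s| * K)).
    apply: lerD.
      apply: (le_trans (ler_norm_sum _ _ _)); apply: sum_le_const => a.
      by rewrite normrM; apply: ler_pM.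
    by rewrite normrM trmxE mxE; apply: ler_pM.
  rewrite (_ : n%:R * (K * `|D s|) + `|D s| * K = ((n%:R + 1) * K) * `|D s|); last by ring.
  by apply: ler_wpM2r => //; rewrite lerDl.
have {}G' : D 1 = 0.
  apply/eqP; rewrite -normr_eq0 -sqrf_eq0 eq_le G'; exact: exprn_ge0.
have zE : y + 1 *: v = z by rewrite scale1r addrC subrK.
split.
  have := c1 1; rewrite zE G' normr0 normr_le0; exact/eqP.
apply/matrixP => j b; rewrite ord1 [RHS]mxE.
by have := c2 1 j; rewrite zE G' normr0 normr_le0 => /eqP.
Unshelve. all: by end_near. Qed.

End UniqueContinuation.

Section HessianLinear.
Context {R : realType} {n : nat}.
Variables (A : set 'rV[R]_n) (G : 'rV[R]_n -> 'M[R]_n).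
Hypothesis oA : open A.

Lemma dcol_comb al be (f g : 'rV[R]_n -> R) x : differentiable f x -> differentiable g x ->
  dcol (fun y => al * f y + be * g y) x = al *: dcol f x + be *: dcol g x.
Proof.
move=> df dg; apply/matrixP => j b; rewrite addmxE !scalemxE !dcolE pdD ?pdZ //.
all: by apply: differentiableM.
Qed.

Lemma hessian_comb al be (f g : 'rV[R]_n -> R) x : smo A f -> smo A g -> A x ->
  hessian A G (fun y => al * f y + be * g y) x = al *: hessian A G f x + be *: hessian A G g x.
Proof.
move=> sf sg Ax; apply/matrixP => i j; rewrite addmxE !scalemxE !hessianE // !addmxE !oppmxE.
have -> : dcol (fun y => al * f y + be * g y) x = al *: dcol f x + be *: dcol g x.
  by apply: dcol_comb; exact: smo_diff.
rewrite mulmxDr -!scalemxAr !addmxE !scalemxE !mpdE.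
have -> : pd i (fun y => dcol (fun y0 => al * f y0 + be * g y0) y j 0) x =
   pd i (fun y => al * pd j f y + be * pd j g y) x.
  apply: (pd_ext i oA Ax) => y Ay; rewrite dcol_comb ?addmxE ?scalemxE ?dcolE //; exact: smo_diff.
have E h : (fun y => dcol h y j 0) = pd j h by apply/funext => y; rewrite dcolE.
have dp h : smo A h -> differentiable (pd j h) x by move=> sh; exact: smo_diff (smo_pd j sh) _.
rewrite !E pdD ?pdZ; try exact: dp.
- by ring.
- by apply: differentiableM; [exact: differentiable_cst|exact: dp].
- by apply: differentiableM; [exact: differentiable_cst|exact: dp].
Qed.

End HessianLinear.

Section OpenIsometric.
Context {R : realType}.

Lemma isometric_inP k n (A : set 'rV[R]_k) (phi : 'rV[R]_k -> 'rV[R]_n) G G' : open A ->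
  isometric_in A phi G G' <->
  msmo A phi /\ forall x, A x -> jac phi x *m G' (phi x) *m (jac phi x)^T = G x.
Proof.
move=> oA; have E x : A x -> jacobian_in A phi x = jac phi x.
  by move=> Ax; apply/matrixP => i j; rewrite jacE mxE pderivE.
split=> -[H1 H2]; split.
- by move=> i j; rewrite ord1; apply: (smooth_onP _ oA).1.
- by move=> x Ax; rewrite -E //; exact: H2.
- by move=> j; apply: (smooth_onP _ oA).2.
- by move=> x Ax; rewrite E //; exact: H2.
Qed.

Lemma open_preimage_in (T U : topologicalType) (f : T -> U) (A : set T) (B : set U) :
  open A -> open B -> (forall x, A x -> {for x, continuous f}) -> open (A `&` f @^-1` B).
Proof.
move=> oA oB cf; rewrite openE => x [Ax Bfx]; apply: filterI; first exact: open_nbhs_nbhs.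
by apply: (cf x Ax); exact: open_nbhs_nbhs.
Qed.

End OpenIsometric.

(** * Manifolds without boundary and their spaces [W] *)

Section Manifold.
Context {R : realType} {n : nat}.
Variable M : rmanifold R n.
Hypothesis noB : boundary M = set0.
Implicit Types (c d e : chart R M n) (p q : M).
Local Notation G := (@metric R n M).

Lemma ccod_open c : atlas c -> open (ccod c).
Proof.
move=> ac; rewrite openE => x xc; apply: contrapT => nx.
have Hc := rm_chart ac.
suff : boundary M (cinv c x) by rewrite noB.
exists c => //; split; first exact: chart_inv.
by rewrite chart_invK.
Qed.

Lemma cmap_cts c p : atlas c -> cdom c p -> {for p, continuous (cmap c)}.
Proof.
move=> ac cp; have Hc := rm_chart ac; have := chart_map_cts Hc.
by rewrite (continuous_open_subspace _ (chart_open_dom Hc)) => /(_ p); apply; rewrite inE.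
Qed.

Lemma cinv_cts c x : atlas c -> ccod c x -> {for x, continuous (cinv c)}.
Proof.
move=> ac cx; have Hc := rm_chart ac; have := chart_inv_cts Hc.
by rewrite (continuous_open_subspace _ (ccod_open ac)) => /(_ x); apply; rewrite inE.
Qed.

Lemma cdom_near c p : atlas c -> cdom c p -> \forall q \near p, cdom c q.
Proof. by move=> ac cp; apply: open_nbhs_nbhs; split=> //; exact: chart_open_dom (rm_chart ac). Qed.

Lemma ccod_near c x : atlas c -> ccod c x -> \forall y \near x, ccod c y.
Proof. by move=> ac cp; apply: open_nbhs_nbhs; split=> //; exact: ccod_open. Qed.

Lemma cmapP c p : atlas c -> cdom c p -> ccod c (cmap c p).
Proof. by move=> ac cp; exact: (chart_map (rm_chart ac) cp). Qed.
Lemma cinvP c x : atlas c -> ccod c x -> cdom c (cinv c x).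
Proof. by move=> ac cx; exact: (chart_inv (rm_chart ac) cx). Qed.
Lemma cmapK c p : atlas c -> cdom c p -> cinv c (cmap c p) = p.
Proof. by move=> ac cp; exact: (chart_mapK (rm_chart ac) cp). Qed.
Lemma cinvK c x : atlas c -> ccod c x -> cmap c (cinv c x) = x.
Proof. by move=> ac cx; exact: (chart_invK (rm_chart ac) cx). Qed.

Definition ov c d : set 'rV[R]_n := [set x | ccod c x /\ cdom d (cinv c x)].
Definition tr c d (x : 'rV[R]_n) := cmap d (cinv c x).

Lemma ov_open c d : atlas c -> atlas d -> open (ov c d).
Proof.
move=> ac ad; apply: open_preimage_in.
- exact: ccod_open.
- exact: chart_open_dom (rm_chart ad).
- by move=> x; exact: cinv_cts.
Qed.

Lemma ov_tr c d x : atlas c -> atlas d -> ov c d x -> ov d c (tr c d x) /\ tr d c (tr c d x) = x.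
Proof.
move=> ac ad [cx dx]; split; first split.
- exact: cmapP.
- by rewrite cmapK //; exact: cinvP.
- by rewrite /tr cmapK // cinvK.
Qed.

Lemma ov_cmap c d p : atlas c -> cdom c p -> cdom d p -> ov c d (cmap c p).
Proof. by split; [exact: cmapP|rewrite cmapK]. Qed.

Lemma tr_cmap c d p : atlas c -> cdom c p -> tr c d (cmap c p) = cmap d p.
Proof. by move=> ac cp; rewrite /tr cmapK. Qed.

Lemma metric_smo c : atlas c -> msmo (ccod c) (G c).
Proof. by move=> ac i j; apply/(smooth_onP _ (ccod_open ac)); exact: rm_metric_smooth. Qed.

Lemma metric_mt c x : atlas c -> ccod c x -> metric_tensor (G c) x.
Proof. by move=> ac; exact: rm_metric. Qed.

Lemma tr_isoP c d : atlas c -> atlas d -> msmo (ov c d) (tr c d) /\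
  forall x, ov c d x -> jac (tr c d) x *m G d (tr c d x) *m (jac (tr c d) x)^T = G c x.
Proof. by move=> ac ad; apply/(isometric_inP _ _ _ (ov_open ac ad)); exact: rm_transition. Qed.

Lemma tr_smo c d : atlas c -> atlas d -> msmo (ov c d) (tr c d).
Proof. by move=> ac /(tr_isoP ac)[]. Qed.

Lemma tr_iso c d x : atlas c -> atlas d -> ov c d x ->
  jac (tr c d) x *m G d (tr c d x) *m (jac (tr c d) x)^T = G c x.
Proof. by move=> ac /(tr_isoP ac)[_]; apply. Qed.

Lemma smooth_funP w c : smooth_fun w -> atlas c -> smo (ccod c) (w \o cinv c).
Proof. by move=> sw ac; apply/(smooth_onP _ (ccod_open ac)); exact: sw. Qed.

Lemma fun_tr (w : M -> R) c d x : atlas d -> ov c d x -> w (cinv c x) = (w \o cinv d) (tr c d x).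
Proof. by move=> ad [cx dx]; rewrite /= cmapK. Qed.

Lemma smooth_fun_cts w p : smooth_fun w -> {for p, continuous w}.
Proof.
move=> sw; have [c ac cp] := rm_cover p.
have cw : {for cmap c p, continuous (w \o cinv c)}.
  by exact: smo_continuous (smooth_funP sw ac) (cmapP ac cp).
apply/cvgrPdist_lt => e e0; have := near_dist cw e0.
have := cmap_cts ac cp => /[apply]; rewrite /= cmapK // => H.
have := @filterI _ _ (nbhs_filter p) _ _ (H : \forall q \near p, _) (cdom_near ac cp).
by apply: filterS => q [h1 h2]; move: h1; rewrite /= cmapK.
Qed.

Lemma dcol_tr (w : M -> R) c d x : smooth_fun w -> atlas c -> atlas d -> ov c d x ->
  dcol (w \o cinv c) x = jac (tr c d) x *m dcol (w \o cinv d) (tr c d x).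
Proof.
move=> sw ac ad ox; have oo := ov_open ac ad.
rewrite -(@dcol_pull R n (ov c d) (ccod d) (tr c d) _ _ (w \o cinv d) x ox (smooth_funP sw ad)).
- apply/matrixP => i j; rewrite !dcolE; apply: (pd_ext i oo ox) => y oy.
  exact: fun_tr.
- by move=> y [cy dy]; exact: cmapP.
- exact: tr_smo.
Qed.

Section Jets.
Variables (lambda m : R).
Hypothesis m0 : 0 < m.
Hypothesis conn : connected [set: M].
Local Notation W := (Wspace M lambda m).
Implicit Types (w : M -> R).

(** The tensor [T] of the equation [Hess w = w T]; it is common to all elements of [W]. *)
Definition Tw c (x : 'rV[R]_n) : 'M[R]_n := m^-1 *: (ricci (ccod c) (G c) x - lambda *: G c x).

Lemma Tw_smo c : atlas c -> msmo (ccod c) (Tw c).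
Proof.
move=> ac; have oc := ccod_open ac; have sG := metric_smo ac.
have sR := ricci_smo oc sG (fun x => metric_mt ac (x := x)).
apply: msmoZ => //; first exact: smo_cst.
have -> : (fun x => ricci (ccod c) (G c) x - lambda *: G c x) =
   (fun x => ricci (ccod c) (G c) x + (- lambda) *: G c x).
  by apply/funext => x; rewrite scaleNr.
by apply: msmoD => //; apply: msmoZ => //; exact: smo_cst.
Qed.

Lemma W_smo w c : W w -> atlas c -> smo (ccod c) (w \o cinv c).
Proof. by move=> [sw _]; exact: smooth_funP. Qed.

Lemma W_hess w c x : W w -> atlas c -> ccod c x ->
  hessian (ccod c) (G c) (w \o cinv c) x = w (cinv c x) *: Tw c x.
Proof. by move=> [_ H] ac cx; rewrite H // scalerA. Qed.

Lemma W_intro w : (forall c, atlas c -> smo (ccod c) (w \o cinv c)) ->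
  (forall c x, atlas c -> ccod c x ->
    hessian (ccod c) (G c) (w \o cinv c) x = w (cinv c x) *: Tw c x) -> W w.
Proof.
move=> sw H; split.
  by move=> c ac; apply/(smooth_onP _ (ccod_open ac)); exact: sw.
by move=> c ac x cx; rewrite H // scalerA.
Qed.

Lemma W_comb al be w1 w2 : W w1 -> W w2 -> W (fun p => al * w1 p + be * w2 p).
Proof.
move=> W1 W2; apply: W_intro => [c ac|c x ac cx].
  have oc := ccod_open ac.
  by apply: smoD => //; apply: smoM => //; try exact: smo_cst; exact: W_smo.
have -> : (fun p => al * w1 p + be * w2 p) \o cinv c =
   (fun y => al * (w1 \o cinv c) y + be * (w2 \o cinv c) y) by [].
rewrite hessian_comb; try exact: W_smo; try exact: ccod_open; rewrite // !W_hess //.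
by rewrite scalerA scalerA -scalerDl.
Qed.

Lemma W_zero w : W w -> W (fun=> 0).
Proof. by move=> Ww; have := W_comb 0 0 Ww Ww; under eq_fun do rewrite !mul0r addr0. Qed.

Lemma W_sum I (r : seq I) (a : I -> R) (w : I -> M -> R) : W (fun=> 0) -> (forall i, W (w i)) ->
  W (fun p => \sum_(i <- r) a i * w i p).
Proof.
move=> W0 Ww; elim: r => [|i r IH].
  by under eq_fun do rewrite big_nil.
have -> : (fun p => \sum_(i <- i :: r) a i * w i p) =
   (fun p => a i * w i p + 1 * \sum_(i <- r) a i * w i p).
  by apply/funext => p; rewrite big_cons mul1r.
exact: W_comb.
Qed.

Definition jet0 w p := w p = 0 /\ forall c, atlas c -> cdom c p -> dcol (w \o cinv c) (cmap c p) = 0.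

Lemma jet0P w c p : W w -> atlas c -> cdom c p -> w p = 0 -> dcol (w \o cinv c) (cmap c p) = 0 -> jet0 w p.
Proof.
move=> Ww ac cp wp dw; split => // d ad dp.
by rewrite (dcol_tr Ww.1 ad ac (ov_cmap ad dp cp)) tr_cmap // dw mulmx0.
Qed.

(** Vanishing of the 1-jet does not depend on the chart and spreads over small coordinate balls,
    hence over the connected manifold. *)
Lemma jet0_zero w p : W w -> jet0 w p -> forall q, w q = 0.
Proof.
move=> Ww jp q.
suff : jet0 w q by case.
apply: (@connected_ind M setT (jet0 w) p) => //; first exact: openT.
move=> {}q _; have [c ac cq] := rm_cover q.
have [r /= r0 Hr] : exists2 r : R, 0 < r & forall y z, ball (cmap c q) r y -> ball (cmap c q) r z ->
    ccod c y -> ccod c z ->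
    (w \o cinv c) y = 0 -> dcol (w \o cinv c) y = 0 ->
    (w \o cinv c) z = 0 /\ dcol (w \o cinv c) z = 0.
  have := jet_unique_continuation (ccod_open ac) (metric_smo ac) (fun x => metric_mt ac (x := x))
    (Tw_smo ac) (W_smo Ww ac) (fun x => @W_hess w c x Ww ac) (cmapP ac cq).
  move=> H; have := @filterI _ _ (at_right_proper_filter 0) _ _ H (nbhs_right_gt 0).
  move=> /filter_ex[r [Hr r0]]; exists r => // y z yb zb _ _; exact: Hr.
exists ([set y | cdom c y] `&` cmap c @^-1` (ball (cmap c q) r)).
  apply: filterI; first exact: cdom_near.
  apply: (cmap_cts ac cq); exact: nbhsx_ballx.
move=> y z _ _ [cy yb] [cz zb] [wy dwy].
have [|wz dwz] := Hr _ _ yb zb (cmapP ac cy) (cmapP ac cz) _ (dwy c ac cy); first by rewrite cmapK.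
by apply: (jet0P Ww ac cz); move: wz; rewrite cmapK.
Qed.

Lemma good_of_zero w c x : W w -> atlas c -> ccod c x -> w (cinv c x) = 0 ->
  good (fun i j => Curv (ccod c) (G c) i j x) (Tw c x) (dcol (w \o cinv c) x).
Proof.
move=> Ww ac cx wx i j.
have := ricci_identity (ccod_open ac) (metric_smo ac) (fun x => metric_mt ac (x := x))
    (Tw_smo ac) (W_smo Ww ac) (fun x => @W_hess w c x Ww ac) i j cx.
rewrite [(w \o cinv c) x]wx scale0r addr0 !dcolE => /eqP; rewrite subr_eq0 => /eqP h.
by rewrite -[LHS](addrK (pd i (w \o cinv c) x *: Tcol (Tw c) j x)) h.
Qed.

(** Hessians are symmetric, and [Tw] is the Hessian of the positive solution divided by its
    value. *)
Lemma Tw_sym u c x : W u -> (forall p, 0 < u p) -> atlas c -> ccod c x -> (Tw c x)^T = Tw c x.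
Proof.
move=> Wu u0 ac cx; have up := u0 (cinv c x).
apply/matrixP => i j; rewrite trmxE.
have := hessian_sym (ccod_open ac) (fun x => metric_mt ac (x := x)) j i (W_smo Wu ac) cx.
by rewrite W_hess // !scalemxE => /mulfI; apply; rewrite gt_eqF.
Qed.

End Jets.
End Manifold.

(** * Small dimensions of spaces of functions *)

Section LinearSpaces.
Context {R : realType} {T : Type}.
Implicit Types (f g w : T -> R) (V : set (T -> R)).

Definition lin_indep d (b : 'I_d -> T -> R) :=
  forall a : 'I_d -> R, (forall t, \sum_(i < d) a i * b i t = 0) -> forall i, a i = 0.

Definition pair_fun f g (i : 'I_2) : T -> R := if i == 0 then f else g.

Variable V : set (T -> R).
Lemma lin_indep2P f g : lin_indep (pair_fun f g) <->
  forall a b : R, (forall t, a * f t + b * g t = 0) -> a = 0 /\ b = 0.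
Proof.
have E a t : \sum_(i < 2) a i * pair_fun f g i t = a 0 * f t + a 1 * g t.
  by rewrite !big_ord_recl big_ord0 addr0; congr (_ + a _ * _); exact: val_inj.
split=> [H a b ab|H a ab i].
  have K := H (fun i => if i == 0 then a else b) _.
  split; [have := K _ 0|have := K _ 1]; apply => t; rewrite E; exact: ab.
have [a0 a1] := H (a 0) (a 1) (fun t => etrans (esym (E a t)) (ab t)).
by case: i => -[|[|//]] Hi; [rewrite -a0|rewrite -a1]; congr a; apply: val_inj.
Qed.

Lemma not_indep2 f g : (exists t, f t != 0) -> ~ lin_indep (pair_fun f g) ->
  exists a : R, forall t, g t = a * f t.
Proof.
move=> [t0 ft0] nI; apply: contrapT => nE; apply: nI; apply/lin_indep2P => a b ab.
have [b0|b0] := eqVneq b 0.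
  split => //; have /eqP := ab t0; rewrite b0 mul0r addr0 mulf_eq0 (negbTE ft0) orbF.
  by move/eqP.
exfalso; apply: nE; exists (- a / b) => t.
have := ab t => h; apply: (mulfI b0); rewrite mulrA mulrCA divff; lra.
Qed.

(** A maximal independent family is chosen greedily: a nonzero element, then one independent of it;
    a function outside their span would complete an independent triple. *)
Lemma has_dim_le2 : V (fun=> 0) ->
  (forall w : 'I_3 -> T -> R, (forall i, V (w i)) -> ~ lin_indep w) ->
  exists2 d : nat, (d <= 2)%N & has_dim V d.
Proof.
move=> V0 H3.
have [[e Ve [t0 et0]]|ne] := pselect (exists2 e, V e & exists t, e t != 0); last first.
  exists 0%N => //; exists (fun=> fun=> 0); split=> [[]//|a _ [] //|w Vw].
  exists (fun=> 0) => t; rewrite big_ord0; apply/eqP; apply: contrapT => /negP wt.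
  by apply: ne; exists w => //; exists t.
have [[g Vg ng]|nI] := pselect (exists2 g, V g & lin_indep (pair_fun e g)); last first.
  exists 1%N => //; exists (fun=> e); split=> // [a ae i|w Vw].
    have /eqP := ae t0; rewrite big_ord1 mulf_eq0 (negbTE et0) orbF => /eqP <-.
    by rewrite ord1.
  have [a E] := @not_indep2 e w (ex_intro _ t0 et0) (fun h => nI (ex_intro2 _ _ w Vw h)).
  by exists (fun=> a) => t; rewrite big_ord1.
exists 2%N => //; exists (pair_fun e g); split => // [i|w Vw].
  by rewrite /pair_fun; case: ifP.
apply: contrapT => nE.
apply: (H3 (fun i => if val i == 0%N then e else if val i == 1%N then g else w)).
  by move=> i; case: ifP => // _; case: ifP.
move=> a ae.
have E t : a 0 * e t + a 1 * g t + a ord_max * w t = 0.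
  rewrite -(ae t) !big_ord_recl big_ord0 /= !addr0 addrA.
  by congr (_ + _ * _ + a _ * _); [congr (a _)|]; apply: val_inj.
have [a2|a2] := eqVneq (a ord_max) 0.
  have [|a0 a1] := (lin_indep2P e g).1 ng (a 0) (a 1).
    by move=> t; have := E t; rewrite a2 mul0r addr0.
  by case=> -[|[|[|//]]] Hi; [rewrite -a0|rewrite -a1|rewrite -a2]; congr a; apply: val_inj.
exfalso; apply: nE; exists (fun i => - a (widen_ord (leqnSn 2) i) / a ord_max) => t.
apply: (mulfI a2); rewrite mulr_sumr !big_ord_recl big_ord0 addr0 /pair_fun /=.
have -> : widen_ord (leqnSn 2) 0 = 0 :> 'I_3 by apply: val_inj.
have -> : widen_ord (leqnSn 2) (lift ord0 ord0) = 1 :> 'I_3 by apply: val_inj.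
rewrite !mulrA ![a ord_max * _ / _]mulrAC mulfV; have := E t => h; lra.
Qed.

End LinearSpaces.

Section EinsteinOfIndependent.
Context {R : realType} {k : nat}.
Variable M : rmanifold R k.+1.
Hypothesis noB : boundary M = set0.
Hypothesis conn : connected [set: M].
Variables (lambda m : R) (u : M -> R).
Hypothesis m0 : 0 < m.
Local Notation W := (Wspace M lambda m).
Hypothesis Wu : W u.
Hypothesis u0 : forall p, 0 < u p.

(* The k-dimensional space of functions in the span that vanish at a point has
   independent differentials there, each of which is a good covector. *)
Theorem einstein_of_independent (w : 'I_k.+1 -> M -> R) : (0 < k)%N ->
  (forall a, W (w a)) -> lin_indep w ->
  forall c x, atlas c -> ccod c x ->
  ricci (ccod c) (@metric R k.+1 M c) x = (k%:R * lambda / (m + k%:R)) *: @metric R k.+1 M c x.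
Proof.
move=> k0 Ww ind c x ac cx; set p := cinv c x.
have oc := ccod_open noB ac; have sG := metric_smo noB ac.
have mG : forall y, ccod c y -> metric_tensor (@metric R k.+1 M c) y by move=> y; exact: metric_mt.
have RicE : Ric_of (fun i j => Curv (ccod c) (@metric R k.+1 M c) i j x) = ricci (ccod c) (@metric R k.+1 M c) x.
  by apply/matrixP => i j; rewrite ricciE // mxE.
pose col0 : 'cV[R]_k.+1 := \col_a w a p.
pose dA : 'M[R]_k.+1 := \matrix_(a, j) pd j (w a \o cinv c) x.
have Wv (v : 'rV[R]_k.+1) : W (fun q => \sum_a v 0 a * w a q) by apply: W_sum => //; exact: (W_zero noB Wu).
have dv (v : 'rV[R]_k.+1) : dcol ((fun q => \sum_a v 0 a * w a q) \o cinv c) x = (v *m dA)^T.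
  apply/matrixP => j b; rewrite ord1 dcolE trmxE [RHS]mxE.
  rewrite -[_ \o _]/(fun y => \sum_a v 0 a * (w a \o cinv c) y).
  have dw a : differentiable (w a \o cinv c) x by exact: smo_diff (W_smo noB (Ww a) ac) _.
  rewrite pd_sum; last by move=> a _; apply: differentiableM.
  by apply: eq_bigr => a _; rewrite pdZ // mxE.
have vv (v : 'rV[R]_k.+1) : (fun q => \sum_a v 0 a * w a q) p = (v *m col0) 0 0.
  by rewrite mxE; apply: eq_bigr => a _; rewrite mxE.
(* Independent solutions have independent 1-jets at the point: a combination with vanishing jet
   vanishes everywhere. *)
have fA : row_free (row_mx col0 dA).
  apply: inj_row_free => v; rewrite mul_mx_row -[0]row_mx0 => /eq_row_mx[v0 vd].
  have z : forall q, \sum_a v 0 a * w a q = 0.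
    apply: (@jet0_zero R k.+1 M noB lambda m conn _ p (Wv v)).
    apply: (@jet0P R k.+1 M noB lambda m _ c p (Wv v) ac (cinvP ac cx)).
      by rewrite vv v0 mxE.
    by rewrite (cinvK ac cx) dv vd trmx0.
  by apply/rowP => a; rewrite (ind (v 0) z) mxE.
pose K := row_base (kermx col0).
have K0 : K *m col0 = 0.
  have /submxP[D ->] : (K <= kermx col0)%MS by rewrite eq_row_base.
  by rewrite -mulmxA mulmx_ker mulmx0.
have rK : (k <= \rank (kermx col0))%N.
  rewrite mxrank_ker; have := rank_leq_col col0; case: (\rank col0) => [|[|//]] _.
    by [].
  by rewrite subn1.
(* The coefficient vectors of combinations vanishing at the point form a space of dimension k, or k
   + 1 if every [w a] vanishes there; [pid_mx] keeps k rows of its basis in both cases. *)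
pose P : 'M[R]_(k, k.+1) := pid_mx k *m K.
have rP : \rank P = k by rewrite mxrankMfree ?row_base_free // rank_pid_mx.
have P0 : P *m col0 = 0 by rewrite -mulmxA K0 mulmx0.
pose X := (P *m dA)^T.
have rX : \rank X = k.
  rewrite mxrank_tr; have := mxrankMfree P fA; rewrite rP mul_mx_row P0.
  by rewrite rank_row_0mx.
rewrite -RicE; apply: (@einstein_of_good R k (@metric R k.+1 M c x) (fun i j => Curv (ccod c) (@metric R k.+1 M c) i j x)
   lambda m _ _ _ m0 _ X k0 rX).
- by have [] := mG x cx.
- by have [] := mG x cx.
- by move=> i j; exact: Curv_lower_anti.
- by rewrite RicE; exact: (Tw_sym noB Wu u0 ac cx).
- move=> a; rewrite RicE.
  have -> : col a X = dcol ((fun q => \sum_b (row a P) 0 b * w b q) \o cinv c) x.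
    by rewrite dv -row_mul tr_row.
  apply: (@good_of_zero R k.+1 M noB lambda m _ c x (Wv (row a P)) ac cx).
  by rewrite vv -row_mul P0 !mxE.
Qed.

End EinsteinOfIndependent.

(** * Killing fields and their flows *)

Section LineTools.
Context {R : realType}.

Lemma itv_ind a b t0 (S : R -> Prop) : a < t0 < b -> S t0 ->
  (forall x : R, a < x < b -> exists2 e : R, 0 < e &
     forall y z : R, a < y < b -> a < z < b -> `|x - y| < e -> `|x - z| < e -> S y -> S z) ->
  forall x : R, a < x < b -> S x.
Proof.
move=> t0I St0 H.
have E : [set x : R | a < x < b] = [set` `]a, b[] by [].
apply: (@connected_ind R [set x : R | a < x < b] S t0) => //.
- by rewrite E.
- apply/connected_intervalP => x y /= /andP[x1 x2] /andP[y1 y2] z /andP[z1 z2].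
  by rewrite (lt_le_trans x1) // (le_lt_trans z2).
- move=> x xI; have [e e0 He] := H x xI; exists (ball x e); first exact: nbhsx_ballx.
  by [].
Qed.

Lemma is_derive_translate (V : normedModType R) (g : R -> V) (t s : R) v :
  is_derive (t + s) 1 g v -> is_derive s 1 (fun u => g (t + u)) v.
Proof.
have E : (fun h : R => h^-1 *: (((fun u => g (t + u)) \o shift s) (h *: 1) - g (t + s))) =
   (fun h => h^-1 *: ((g \o shift (t + s)) (h *: 1) - g (t + s))).
  by apply/funext => h /=; rewrite addrCA.
by move=> [d <-]; apply: DeriveDef; [move: d; rewrite /derivable E|rewrite /derive E].
Qed.

Lemma cts_near (T U : topologicalType) (f : T -> U) x (P : U -> Prop) :
  {for x, continuous f} -> (\forall y \near f x, P y) -> \forall z \near x, P (f z).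
Proof. by move=> cf; exact: cf. Qed.

Lemma near_itv (x : R) (P : R -> Prop) : (\forall y \near x, P y) ->
  exists2 e : R, 0 < e & forall y, `|x - y| < e -> P y.
Proof.
move=> /nbhs_ballP[e e0 H]; by exists e => // y xy.
Qed.

Lemma continuous_near_eq (T U : topologicalType) (f g : T -> U) x : (\forall y \near x, f y = g y) ->
  {for x, continuous f} -> {for x, continuous g}.
Proof.
move=> fg cf B; rewrite -(nbhs_singleton fg) => /cf.
by apply: filterS2 fg => y /= ->.
Qed.

Lemma norm_seg (x y z u e : R) : `|x - y| < e -> `|x - z| < e ->
  Num.min y z <= u <= Num.max y z -> `|x - u| < e.
Proof.
rewrite !ltr_norml => /andP[h1 h2] /andP[h3 h4].
by have [yz|yz] := leP y z => /andP[u1 u2]; lra.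
Qed.

Lemma lt_between (a b y z u : R) : a < y < b -> a < z < b -> y <= u <= z -> a < u < b.
Proof. by move=> /andP[ay yb] /andP[az zb] /andP[yu uz]; rewrite (lt_le_trans ay) // (le_lt_trans uz). Qed.

Lemma norm_between (x y z u e : R) : `|x - y| < e -> `|x - z| < e -> y <= u <= z -> `|x - u| < e.
Proof.
rewrite !ltr_norml => /andP[h1 h2] /andP[h3 h4] /andP[u1 u2]; apply/andP; split; first by rewrite (lt_le_trans h3) // lerD2l lerN2.
by rewrite (le_lt_trans _ h2) // lerD2l lerN2.
Qed.

Lemma dist_between (y u z : R) : y <= u -> u <= z -> `|u - y| + `|z - u| = `|z - y|.
Proof.
move=> yu uz; rewrite !ger0_norm ?subr_ge0 ?(le_trans yu) //.
by rewrite addrC subrKA.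
Qed.

End LineTools.

(** * Killing fields, their integral curves and their speed *)

Section VectorFields.
Context {R : realType} {n : nat}.
Variable M : rmanifold R n.
Hypothesis noB : boundary M = set0.
Implicit Types (c d e : chart R M n) (p q : M) (X : chart R M n -> 'rV[R]_n -> 'rV[R]_n).
Local Notation G := (@metric R n M).

(* X c is the expression of a vector field in the chart c *)
Definition killing_field X := [/\ forall c, atlas c -> msmo (ccod c) (X c),
  forall c d, atlas c -> atlas d -> forall x, ov c d x ->
    X d (tr c d x) = X c x *m jac (tr c d) x &
  forall c, atlas c -> forall x, ccod c x ->
    jac (X c) x *m G c x + \sum_a X c x 0 a *: mpd a (G c) x + G c x *m (jac (X c) x)^T = 0].

(** Continuity is a clause of its own because [cmap c] has no meaning off the domain of [c], so
    differentiability of [cmap c \o g] does not keep the curve in the chart. *)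
Definition vel X (g : R -> M) (t : R) := {for t, continuous g} /\
  exists c, [/\ atlas c, cdom c (g t) & is_derive t 1 (cmap c \o g) (X c (cmap c (g t)))].

Definition opp_field X : chart R M n -> 'rV[R]_n -> 'rV[R]_n := fun c x => - X c x.

Lemma killing_opp X : killing_field X -> killing_field (opp_field X).
Proof.
move=> [H1 H2 H3]; split.
- move=> c ac i j; have -> : (fun y => opp_field X c y i j) = (fun y => - X c y i j).
    by apply/funext => y; rewrite oppmxE.
  by apply: smoN; [exact: ccod_open|exact: H1].
- by move=> c d ac ad x ox; rewrite /opp_field H2 // mulNmx.
- move=> c ac x cx; have := H3 c ac x cx.
  have -> : jac (opp_field X c) x = - jac (X c) x.
    apply/matrixP => i j; rewrite oppmxE !jacE.
    under eq_fun do rewrite oppmxE.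
    by rewrite pdN //; exact: smo_diff (H1 c ac 0 j) _.
  have -> : \sum_a opp_field X c x 0 a *: mpd a (G c) x = - \sum_a X c x 0 a *: mpd a (G c) x.
    by rewrite -sumrN; apply: eq_bigr => a _; rewrite oppmxE scaleNr.
  by rewrite trmxN mulNmx mulmxN -!opprD => ->; rewrite oppr0.
Qed.

Lemma vel_near X g h t : (\forall s \near t, g s = h s) -> vel X g t -> vel X h t.
Proof.
move=> gh [cg [c [ac cgt dg]]].
have E : g t = h t := nbhs_singleton gh.
split; first exact: continuous_near_eq _ cg.
exists c; rewrite -E; split=> //; apply: near_eq_is_derive dg.
by apply: filterS gh => s /= ->.
Qed.

Section OneField.
Variable X : chart R M n -> 'rV[R]_n -> 'rV[R]_n.
Hypothesis KX : killing_field X.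

Lemma X_smo c : atlas c -> msmo (ccod c) (X c). Proof. by case: KX => H _ _; exact: H. Qed.

Lemma velP g t c : vel X g t -> atlas c -> cdom c (g t) ->
  is_derive t 1 (cmap c \o g) (X c (cmap c (g t))).
Proof.
move=> [cg [d [ad dg dv]]] ac cgt; have [_ tX _] := KX.
have ox : ov d c (cmap d (g t)) by exact: ov_cmap.
have nd : \forall s \near t, cdom d (g s) by apply: (cts_near cg); exact: cdom_near.
rewrite -(tr_cmap c ad dg) tX //; apply: is_derive_rV => j.
have dt : differentiable (fun y => tr d c y 0 j) (cmap d (g t)) by exact: smo_diff (tr_smo noB ad ac 0 j) _.
have := is_derive_curve dt dv; rewrite [(_ *m _) _ _]mxE.
under eq_bigr => l _ do rewrite -jacE.
apply: near_eq_is_derive; apply: filterS nd => s ds /=.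
by rewrite tr_cmap.
Qed.

Lemma vel_cts g t : vel X g t -> {for t, continuous g}. Proof. by case. Qed.

Lemma vel_agree g h (t e : R) : 0 < e -> (forall s : R, `|t - s| < e -> vel X g s /\ vel X h s) ->
  g t = h t -> exists2 e' : R, 0 < e' & forall s : R, `|t - s| < e' -> g s = h s.
Proof.
move=> e0 H E; have [c ac cp] := rm_cover (g t).
have [vg vh] : vel X g t /\ vel X h t by apply: H; rewrite subrr normr0.
have [rho [K tm]] := tame_ex (ccod_open noB ac) (X_smo ac) (cmapP ac cp); have [rho0 K0 HB] := tm.
have cg : {for t, continuous (cmap c \o g)} by apply: continuous_comp (vel_cts vg) _; exact: cmap_cts.
have ch : {for t, continuous (cmap c \o h)}.
  by apply: continuous_comp (vel_cts vh) _; rewrite -E; exact: cmap_cts.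
have n1 : \forall s \near t, cdom c (g s) by apply: (cts_near (vel_cts vg)); exact: cdom_near.
have n2 : \forall s \near t, cdom c (h s) by apply: (cts_near (vel_cts vh)); rewrite -E; exact: cdom_near.
have n3 := near_dist cg rho0; have n4 := near_dist ch rho0.
have := @filterI _ _ (nbhs_filter t) _ _ (@filterI _ _ (nbhs_filter t) _ _ n1 n2)
  (@filterI _ _ (nbhs_filter t) _ _ n3 n4).
move=> /near_itv[e1 e10 Hn].
have m0 : 0 < Num.min e e1 by rewrite lt_min e0.
exists (Num.min e e1) => // s ts.
have key : cmap c (g s) = cmap c (h s).
  have := @tame_unique R n (X c) (ccod c) _ (X_smo ac) rho K tm (fun u => cmap c (g (t + u)))
    (fun u => cmap c (h (t + u))) (s - t).
  rewrite addr0 E [t + (s - t)]addrC subrK; apply => //.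
  move=> u uI; have ul : `|t - (t + u)| < Num.min e e1.
    rewrite opprD addrA subrr sub0r normrN; apply: le_lt_trans ts.
    by rewrite distrC; exact: norm_le_minmax0.
  move: ul; rewrite lt_min => /andP[u1 u2]; have [[a1 a2] [a3 a4]] := Hn _ u2.
  have [v1 v2] := H _ u1; split.
  - by rewrite -E; apply/ball_rVP.
  - by apply/ball_rVP.
  - exact: is_derive_translate (velP v1 ac a1).
  - exact: is_derive_translate (velP v2 ac a2).
move: ts; rewrite lt_min => /andP[_ /Hn[[a1 a2] _]].
by rewrite -(cmapK ac a1) key cmapK.
Qed.

Lemma vel_unique g h a b t0 : a < t0 < b ->
  (forall t : R, a < t < b -> vel X g t /\ vel X h t) -> g t0 = h t0 ->
  forall t : R, a < t < b -> g t = h t.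
Proof.
move=> t0I V E; apply: (itv_ind t0I (S := fun t => g t = h t)) => // x /[dup] xI /andP[ax xb].
have e0 : 0 < Num.min (x - a) (b - x) by rewrite lt_min !subr_gt0.
have Ve s : `|x - s| < Num.min (x - a) (b - x) -> vel X g s /\ vel X h s.
  rewrite lt_min => /andP[]; rewrite !ltr_norml => /andP[h1 h2] /andP[h3 h4].
  by apply: V; lra.
have [Ex|nE] := pselect (g x = h x).
  have [e' e'0 H] := vel_agree e0 Ve Ex.
  by exists e' => // y z _ _ _ /H.
(* Where the curves differ, disjoint neighbourhoods keep them different for nearby times, so the set
   of agreement is closed as well as open. *)
have [U UP] : exists U : set M * set M, [/\ g x \in U.1, h x \in U.2, open U.1, open U.2 & U.1 `&` U.2 == set0].
  have := @rm_hausdorff R n M; rewrite open_hausdorff => /(_ (g x) (h x)).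
  by case=> [|U [? ?] [? ? ?]]; [apply/eqP|exists U].
have [gU hU oU1 oU2 /eqP U12] := UP.
have [vg vh] := V x xI.
have n1 : \forall s \near x, U.1 (g s).
  by apply: (cts_near (vel_cts vg)); apply: open_nbhs_nbhs; split=> //; rewrite -in_setE.
have n2 : \forall s \near x, U.2 (h s).
  by apply: (cts_near (vel_cts vh)); apply: open_nbhs_nbhs; split=> //; rewrite -in_setE.
have /near_itv[e' e'0 H] := @filterI _ _ (nbhs_filter x) _ _ n1 n2.
exists e' => // y z _ _ /H[h1 h2] _ Ey; exfalso.
have : (U.1 `&` U.2) (g y) by split; rewrite // Ey.
by rewrite U12.
Qed.

Lemma flow_vel c (y0 : 'rV[R]_n) dl r psi x t : atlas c -> is_flow (X c) (ccod c) y0 dl r psi ->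
  `|t| < dl -> `|y0 - x| < r -> vel X (fun s => cinv c (psi s x)) t.
Proof.
move=> ac fl td xr; have [h1 h2 h3] := fl t x td xr.
have cp : {for t, continuous (psi^~ x)}.
  by apply: differentiable_continuous; apply/derivable1_diffP.
split.
  by apply: continuous_comp cp _; exact: cinv_cts.
exists c; split=> //; first exact: cinvP.
rewrite cinvK //; apply: near_eq_is_derive h2.
have e0 : 0 < dl - `|t| by rewrite subr_gt0.
have := near_norm t e0; apply: filterS => s /= st.
rewrite cinvK //; have [] := fl s x _ xr => //.
have := ler_normB t (t - s); rewrite subKr => /le_lt_trans; apply.
by rewrite addrC -ltrBrDr.
Qed.

Lemma local_curves p : exists2 dl : R, 0 < dl & \forall q \near p, exists g : R -> M,
  g 0 = q /\ forall t : R, `|t| < dl -> vel X g t.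
Proof.
have [c ac cp] := rm_cover p.
have [dl [r [psi [d0 r0 fl _]]]] := local_flow 0 (ccod_open noB ac) (X_smo ac) (cmapP ac cp).
exists dl => //; have := near_dist (cmap_cts ac cp) r0.
have := cdom_near ac cp; apply: filterS2 => q cq qr.
exists (fun t => cinv c (psi t (cmap c q))); split.
  have [|_ _ ->] := fl 0 (cmap c q) _ qr; first by rewrite normr0.
  exact: cmapK.
by move=> t td; exact: flow_vel _ td qr.
Qed.

Definition spd c (x : 'rV[R]_n) : R := (X c x *m G c x *m (X c x)^T) 0 0.

Lemma spd_tr c d x : atlas c -> atlas d -> ov c d x -> spd d (tr c d x) = spd c x.
Proof.
move=> ac ad ox; have [_ tX _] := KX.
by rewrite /spd tX // -(tr_iso noB ac ad ox) trmx_mul !mulmxA.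
Qed.

Lemma spd_smo c : atlas c -> smo (ccod c) (spd c).
Proof.
move=> ac; have oc := ccod_open noB ac.
apply: (msmoM oc (msmoM oc (X_smo ac) (metric_smo noB ac)) (msmo_tr (X_smo ac)) 0 0).
Qed.

(** The Killing equation contracted twice with [X]: the terms are those of the derivative of [|X|^2]
    in the direction of [X]. *)
Lemma spd_killing c x : atlas c -> ccod c x -> \sum_a X c x 0 a * pd a (spd c) x = 0.
Proof.
move=> ac cx; have [_ _ kX] := KX.
have dX : mdiff (X c) x by exact: msmo_mdiff (X_smo ac) _.
have dG : mdiff (G c) x by exact: msmo_mdiff (metric_smo noB ac) _.
have oc := ccod_open noB ac.
have dXG : mdiff (fun y => X c y *m G c y) x.
  exact: msmo_mdiff (msmoM oc (X_smo ac) (metric_smo noB ac)) _.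
have dXt : mdiff (fun y => (X c y)^T) x by exact: msmo_mdiff (msmo_tr (X_smo ac)) _.
have E a : pd a (spd c) x = ((mpd a (X c) x *m G c x + X c x *m mpd a (G c) x) *m (X c x)^T +
    X c x *m G c x *m (mpd a (X c) x)^T) 0 0.
  by rewrite -mpd_tr -(mpdM a dX dG) -(mpdM a dXG dXt) mpdE.
have XJ : \sum_a X c x 0 a *: mpd a (X c) x = X c x *m jac (X c) x.
  apply/matrixP => i j; rewrite ord1 summxE [RHS]mxE; apply: eq_bigr => a _.
  by rewrite scalemxE mpdE jacE.
transitivity ((X c x *m (jac (X c) x *m G c x + \sum_a X c x 0 a *: mpd a (G c) x +
    G c x *m (jac (X c) x)^T) *m (X c x)^T) 0 0); last by rewrite kX // mulmx0 mul0mx mxE.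
transitivity ((\sum_a X c x 0 a *: ((mpd a (X c) x *m G c x + X c x *m mpd a (G c) x) *m (X c x)^T +
    X c x *m G c x *m (mpd a (X c) x)^T)) 0 0).
  by rewrite summxE; apply: eq_bigr => a _; rewrite E scalemxE.
congr (fun_of_matrix _ 0 0).
under eq_bigr => a _ do rewrite scalerDr mulmxDl scalerDr !scalemxAl.
rewrite !big_split /= -!mulmx_suml XJ.
have -> : \sum_a X c x 0 a *: X c x *m mpd a (G c) x = X c x *m (\sum_a X c x 0 a *: mpd a (G c) x).
  by rewrite mulmx_sumr; apply: eq_bigr => a _; rewrite -scalemxAl scalemxAr.
have -> : \sum_a X c x 0 a *: X c x *m G c x *m (mpd a (X c) x)^T =
   X c x *m G c x *m (X c x *m jac (X c) x)^T.
  by rewrite -XJ trmx_sum mulmx_sumr; apply: eq_bigr => a _; rewrite trmxZ -scalemxAr !scalemxAl.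
by rewrite trmx_mul !mulmxDr !mulmxDl !mulmxA.
Qed.

Lemma spd_const g a b t t' c d : (forall s : R, a < s < b -> vel X g s) -> a < t < b -> a < t' < b ->
  atlas c -> atlas d -> cdom c (g t) -> cdom d (g t') -> spd c (cmap c (g t)) = spd d (cmap d (g t')).
Proof.
move=> V tI t'I ac ad ct dt'; apply/esym.
pose S s := forall e, atlas e -> cdom e (g s) -> spd e (cmap e (g s)) = spd c (cmap c (g t)).
suff : S t' by apply.
have Sch s e : atlas e -> cdom e (g s) -> spd e (cmap e (g s)) = spd c (cmap c (g t)) -> S s.
  move=> ae es E e' ae' e's; rewrite -(tr_cmap e' ae es) spd_tr //; exact: ov_cmap.
apply: (itv_ind tI (S := S)) => //; first exact: Sch _ _ erefl.
move=> x /[dup] xI /andP[ax xb]; have [e ae ex] := rm_cover (g x).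
have n1 : \forall s \near x, cdom e (g s) by apply: (cts_near (vel_cts (V x xI))); exact: cdom_near.
have [r r0 H] := near_itv n1.
exists r => // y z yI zI yr zr Sy.
have ez := H z zr; have ey := H y yr; apply: (Sch z e ae ez); rewrite -(Sy e ae ey).
apply/esym; apply: (@zero_derive_eq R (spd e \o (cmap e \o g)) y z) => u uI.
have ur := norm_seg yr zr uI; have eu := H u ur.
have uI' : a < u < b.
  move: uI; case/andP: yI => y1 y2; case/andP: zI => z1 z2.
  by have [yz|yz] := leP y z => /andP[u1 u2]; lra.
have ds : differentiable (spd e) (cmap e (g u)) by exact: smo_diff (spd_smo ae) (cmapP ae eu).
have := is_derive_curve ds (velP (V u uI') ae eu).
by rewrite spd_killing //; exact: cmapP.
Qed.

(* The reparametrisation by (1 - cos (pi tau)) / 2 stays in the segment for all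
   times, so that the piece is a C^1 curve defined on the whole line. *)
Lemma vel_piece g c p (t1 t2 q L0 : R) : atlas c ->
  (forall u : R, Num.min t1 t2 <= u <= Num.max t1 t2 ->
     [/\ cdom c (g u), vel X g u & spd c (cmap c (g u)) = q]) ->
  curve_length p (g t1) L0 ->
  exists2 L, curve_length p (g t2) L & L <= L0 + 2 * Num.sqrt q * `|t2 - t1|.
Proof.
move=> ac H CL.
pose be s := t1 + (t2 - t1) * ((1 - cos (pi * s)) / 2).
pose db s := (t2 - t1) * (pi / 2 * sin (pi * s)).
have beI s : Num.min t1 t2 <= be s <= Num.max t1 t2.
  have := @cos_le1 R (pi * s); have := @cos_geN1 R (pi * s); rewrite /be.
  by have [t12|t12] := leP t1 t2; nra.
have dbe (s : R) : is_derive s 1 be (db s).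
  have d := @is_derive1_comp R cos (fun s => pi * s) s _ _ (is_derive_cos _) (is_derive_mulc pi s).
  have -> : be = cst (t1 + (t2 - t1) / 2) + (- ((t2 - t1) / 2)) \*: (cos \o (fun s => pi * s)).
    have E u : be u = t1 + (t2 - t1) / 2 + (- ((t2 - t1) / 2)) * cos (pi * u) by rewrite /be; field.
    by apply/funext => u.
  by apply: is_derive_eq; rewrite /db /GRing.scale /=; field.
have be0 : be 0 = t1 by rewrite /be mulr0 cos0 subrr mul0r mulr0 addr0.
have be1 : be 1 = t2 by rewrite /be mulr1 cospi; field.
pose gh s := cmap c (g (be s)).
have Hb s := H _ (beI s).
have dgh (s : R) : is_derive s 1 gh (db s *: X c (gh s)).
  have [h1 h2 _] := Hb s; apply: is_derive_rV => j.
  have := @is_derive1_comp R (fun u => cmap c (g u) 0 j) be s _ _ (is_derive_coord j (velP h2 ac h1)) (dbe s).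
  by rewrite scalemxE mulrC.
have E1 : derive1 gh = (fun s => db s *: X c (gh s)).
  by apply/funext => s; rewrite derive1E; exact: derive_val.
have cbe (s : R) : {for s, continuous gh}.
  by apply: differentiable_continuous; apply/derivable1_diffP.
have cdb (s : R) : {for s, continuous db}.
  apply: continuousM; first exact: cst_continuous.
  apply: continuousM; first exact: cst_continuous.
  by apply: continuous_comp; [exact: mulrl_continuous|exact: continuous_sin].
have CL1 : curve_length p (cinv c (gh 0)) L0.
  by rewrite /gh be0; have [h _ _] := Hb 0; rewrite be0 in h; rewrite cmapK.
have c1 (s : R) : 0 <= s <= 1 -> ccod c (gh s) by move=> _; apply: cmapP; have [] := Hb s.
have c2 (s : R) : derivable gh s 1 by [].
have c3 : continuous (derive1 gh).
  rewrite E1 => s; apply: continuous_rV => j.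
  have -> : (fun y => (db y *: X c (gh y)) 0 j) = (fun y => db y * X c (gh y) 0 j).
    by apply/funext => y; rewrite scalemxE.
  apply: continuousM; first exact: cdb.
  apply: (@continuous_comp _ _ _ gh (fun y => X c y 0 j)); first exact: cbe.
  have [h _ _] := Hb s; exact: smo_continuous (X_smo ac 0 j) (cmapP ac h).
have := curve_lengthS ac c1 c2 c3 CL1.
have -> : cinv c (gh 1) = g t2.
  by rewrite /gh be1; have [h _ _] := Hb 1; rewrite be1 in h; rewrite cmapK.
have -> : (fun t => Num.sqrt ((derive1 gh t *m @metric R n M c (gh t) *m (derive1 gh t)^T) 0 0)) =
   (fun t => `|db t| * Num.sqrt q).
  apply/funext => t; rewrite E1 trmxZ -!scalemxAl -scalemxAr scalerA scalemxE -expr2.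
  have [_ _ <-] := Hb t; rewrite sqrtrM ?sqr_ge0 // sqrtr_sqr //.
move=> CL2; eexists; first exact: CL2.
rewrite lerD2l.
have ch (t : R) : {for t, continuous (fun t => `|db t| * Num.sqrt q)}.
  apply: continuousM; last exact: cst_continuous.
  by apply: continuous_comp; [exact: cdb|exact: norm_continuous].
have [I [_ dI]] := primitive_ex ch; rewrite (Rintegral01_le ch dI).
have [u _ ->] := @MVT_closed R I (fun t => `|db t| * Num.sqrt q) 0 1 (fun s _ => dI s).
rewrite subr0 mulr1 [2 * _]mulrC -mulrA mulrC ler_wpM2l //.
rewrite normrM mulrC ler_wpM2r // normrM.
have /andP[p0 p2] := pihalf_02 R; rewrite (gtr0_norm p0) -[leRHS]mulr1.
apply: ler_pM => //; [exact: ltW|exact: ltW|].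
by rewrite ler_norml sin_geN1 sin_le1.
Qed.

(** The speed is constant, so the length is proportional to time. The factor 2 comes from
    [vel_piece], where the reparametrisation has slope up to [pi / 2]. *)
Lemma vel_length g (a b s t q : R) : (forall u : R, a < u < b -> vel X g u) -> a < s < b -> a < t < b ->
  (forall c, atlas c -> cdom c (g s) -> spd c (cmap c (g s)) = q) ->
  exists2 L, curve_length (g s) (g t) L & L <= 2 * Num.sqrt q * `|t - s|.
Proof.
move=> V sI tI sq.
pose C := 2 * Num.sqrt q; have C0 : 0 <= C by rewrite mulr_ge0.
pose P u := exists2 L, curve_length (g s) (g u) L & L <= C * `|u - s|.
have P0 : P s by exists 0; [exact: curve_length0|rewrite subrr normr0 mulr0].
have sqa u c : a < u < b -> atlas c -> cdom c (g u) -> spd c (cmap c (g u)) = q.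
  move=> uI ac cu; have [d ad ds] := rm_cover (g s).
  by rewrite -(sq d ad ds); exact: (spd_const V uI sI ac ad cu ds).
(* The bound is carried for all times between s and x. A new piece can then start at a time on the
   same side of s, where distances to s add without loss. *)
pose S x := forall u, (s <= u <= x) \/ (x <= u <= s) -> P u.
suff : S t by apply; have [h|h] := leP s t; [left|right]; rewrite ?lexx ?ltW.
apply: (itv_ind sI (S := S)) => //.
  by move=> u [/andP[h1 h2]|/andP[h1 h2]]; have -> : u = s by apply/le_anti/andP.
move=> x xI; have [c ac cx] := rm_cover (g x).
have /near_itv[e e0 He] : \forall y \near x, cdom c (g y) by apply: (cts_near (vel_cts (V x xI))); exact: cdom_near.
have PP y z : a < y < b -> a < z < b -> `|x - y| < e -> `|x - z| < e -> P y ->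
    exists2 L, curve_length (g s) (g z) L & L <= C * `|y - s| + C * `|z - y|.
  move=> /andP[y1 y2] /andP[z1 z2] ye ze [L0 CL0 L0b].
  have [|L CL Lb] := @vel_piece g c (g s) y z q L0 ac _ CL0.
    move=> u uI; have ue := norm_seg ye ze uI; have cu := He u ue.
    have uab : a < u < b by move: uI; have [yz|yz] := leP y z => /andP[u1 u2]; lra.
    by split; [|exact: V|exact: sqa].
  by exists L => //; apply: (le_trans Lb); rewrite lerD2r.
exists e => // y z yI zI ye ze Sy u uz.
have [uy|uy] := pselect (s <= u <= y \/ y <= u <= s); first exact: Sy.
have [sy|sy] := leP s y; have [sz|sz] := leP s z.
- have /andP[yu uz'] : y <= u <= z.
    case: uz => /andP[u1 u2]; last by apply: False_ind; apply: uy; left; rewrite (le_trans sz u1) (le_trans u2 sy).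
    by rewrite u2 andbT leNgt; apply/negP => /ltW h; apply: uy; left; rewrite u1.
  have uI : y <= u <= z by rewrite yu.
  have Py : P y by apply: Sy; left; rewrite sy lexx.
  have [L CL Lb] := PP y u yI (lt_between yI zI uI) ye (norm_between ye ze uI) Py.
  by exists L => //; apply: (le_trans Lb); rewrite -mulrDr dist_between.
- have uI : z <= u <= s.
    by case: uz => // /andP[u1 u2]; have := lt_le_trans sz (le_trans u1 u2); rewrite ltxx.
  have sI' : z <= s <= y by rewrite ltW.
  have se := norm_between ze ye sI'.
  have [L CL Lb] := PP s u sI (lt_between zI sI uI) se (norm_between ze se uI) P0.
  by exists L => //; apply: (le_trans Lb); rewrite subrr normr0 mulr0 add0r.
- have uI : s <= u <= z.
    case: uz => // /andP[u1 u2]; have := le_trans u1 u2 => h; have -> : u = s by apply/le_anti; rewrite u2 (le_trans sz u1).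
    by rewrite lexx.
  have sI' : y <= s <= z by rewrite ltW.
  have se := norm_between ye ze sI'.
  have [L CL Lb] := PP s u sI (lt_between sI zI uI) se (norm_between se ze uI) P0.
  by exists L => //; apply: (le_trans Lb); rewrite subrr normr0 mulr0 add0r.
- have /andP[uz' yu] : z <= u <= y.
    case: uz => /andP[u1 u2]; first by have := lt_le_trans sz (le_trans u1 u2); rewrite ltxx.
    by rewrite u1 leNgt; apply/negP => /ltW h; apply: uy; right; rewrite h.
  have uI : z <= u <= y by rewrite uz'.
  have Py : P y by apply: Sy; right; rewrite lexx ltW.
  have [L CL Lb] := PP y u yI (lt_between zI yI uI) ye (norm_between ze ye uI) Py.
  exists L => //; apply: (le_trans Lb); rewrite -mulrDr ![`|_ - s|]distrC [`|u - y|]distrC.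
  by rewrite addrC (dist_between yu (ltW sy)).
Qed.

End OneField.
End VectorFields.

(** * Short curves stay in small neighbourhoods *)

Section ShortCurves.
Context {R : realType} {n : nat}.

(** Cauchy-Schwarz: the coordinate [v 0 j] is the inner product of v with row j of the inverse
    metric, and [y] below is the part of v orthogonal to that row. *)
Lemma entry_bound (G : 'rV[R]_n -> 'M[R]_n) x (v : 'rV[R]_n) j : metric_tensor G x ->
  v 0 j ^+ 2 <= invmx (G x) j j * (v *m G x *m v^T) 0 0.
Proof.
move=> mt; have uG := metric_unit mt; have [sG pG] := mt.
pose z : 'rV[R]_n := row j (invmx (G x)).
have zG : z *m G x = delta_mx 0 j by rewrite -row_mul mulVmx // row1.
have Gz : G x *m z^T = (delta_mx 0 j)^T by rewrite -zG trmx_mul sG.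
have zz : (z *m G x *m z^T) 0 0 = invmx (G x) j j.
  by rewrite zG -rowE !mxE.
have vz : (v *m G x *m z^T) 0 0 = v 0 j.
  by rewrite -mulmxA Gz trmx_delta -colE mxE.
have zv : (z *m G x *m v^T) 0 0 = v 0 j by rewrite zG -rowE !mxE.
have k0 : 0 < invmx (G x) j j.
  rewrite -zz; apply: pG; apply/eqP => z0; move: zG; rewrite z0 mul0mx => /matrixP/(_ 0 j)/eqP.
  by rewrite !mxE !eqxx eq_sym oner_eq0.
set k := invmx (G x) j j in zz k0 *; set q := (v *m G x *m v^T) 0 0.
pose s := v 0 j / k; pose y := v - s *: z.
have : 0 <= (y *m G x *m y^T) 0 0.
  have [->|y0] := eqVneq y 0; first by rewrite !mul0mx mxE.
  exact/ltW/pG.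
have -> : (y *m G x *m y^T) 0 0 = q - v 0 j ^+ 2 / k.
  have -> : y *m G x *m y^T = v *m G x *m v^T - s *: (z *m G x *m v^T) -
      (s *: (v *m G x *m z^T) - s *: (s *: (z *m G x *m z^T))).
    rewrite trmxD trmxN trmxZ mulmxDr mulmxN -scalemxAr !mulmxDl !mulNmx -!scalemxAl.
    by rewrite scalerDr scalerN.
  rewrite !addmxE !oppmxE !addmxE !oppmxE !scalemxE vz zv zz -/q /s.
  by field; rewrite gt_eqF.
by rewrite subr_ge0 ler_pdivrMr // mulrC.
Qed.

(** The square of the positive part, a simple cut-off that is still C^1. *)
Definition sqp (s : R) : R := if 0 <= s then s ^+ 2 else 0.
Definition dsqp (s : R) : R := if 0 <= s then 2 * s else 0.

Lemma is_derive_sqp (s : R) : is_derive s 1 sqp (dsqp s).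
Proof.
have H : is_derive (0 : R) 1 (fun h => sqp (s + h)) (dsqp s).
  apply: (@is_derive_quadratic R _ _ 1 1 ltr01) => h _; rewrite addr0 mul1r ler_norml /sqp /dsqp.
  by have [s0|s0] := leP 0 s; have [sh0|sh0] := leP 0 (s + h); nra.
rewrite -(addNr s) in H; have := is_derive_translate H.
have -> // : (fun u => (fun h => sqp (s + h)) (- s + u)) = sqp.
by apply/funext => u; rewrite addrA subrr add0r.
Qed.

Lemma continuous_sum (T : topologicalType) I (r : seq I) (F : I -> T -> R) x :
  (forall i, {for x, continuous (F i)}) -> {for x, continuous (fun y => \sum_(i <- r) F i y)}.
Proof.
move=> H; elim: r => [|i r IH].
  have -> : (fun y => \sum_(i <- [::]) F i y) = cst 0 by apply/funext => y; rewrite big_nil.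
  exact: cst_continuous.
have -> : (fun y => \sum_(i <- i :: r) F i y) = (fun y => F i y + \sum_(i <- r) F i y).
  by apply/funext => y; rewrite big_cons.
by apply: continuousD.
Qed.

Lemma continuous_quadratic (T : topologicalType) (v : T -> 'rV[R]_n) (B : T -> 'M[R]_n) x :
  {for x, continuous v} -> (forall i j, {for x, continuous (fun y => B y i j)}) ->
  {for x, continuous (fun y => (v y *m B y *m (v y)^T) 0 0)}.
Proof.
move=> cv cB; have cvj j : {for x, continuous (fun y => v y 0 j)}.
  by apply: (@continuous_comp _ _ _ v (fun u => u 0 j)) => //; exact: coord_continuous.
have -> : (fun y => (v y *m B y *m (v y)^T) 0 0) =
   (fun y => \sum_k (\sum_j v y 0 j * B y j k) * v y 0 k).
  apply/funext => y; rewrite mxE; apply: eq_bigr => k _.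
  by rewrite trmxE [(_ *m _) _ _]mxE.
apply: continuous_sum => k; apply: continuousM => //.
by apply: continuous_sum => j; apply: continuousM.
Qed.

Variable M : rmanifold R n.
Hypothesis noB : boundary M = set0.
Local Notation G := (@metric R n M).

(* A C^1 bump function with bounded differential cannot vary much along a
   short curve. *)
Lemma short_curves (l : M) (U : set M) : nbhs l U ->
  exists2 dl : R, 0 < dl & forall x L, curve_length x l L -> L < dl -> U x.
Proof.
move=> lU; have [c ac cl] := rm_cover l; set x0 := cmap c l.
have x0c : ccod c x0 by exact: cmapP.
have sI : msmo (ccod c) (fun y => invmx (G c y)).
  apply: msmo_invmx; [exact: ccod_open|exact: metric_smo|].
  by move=> y cy; apply: metric_unit; exact: metric_mt.
have [K bK] := near_entries_bounded sI x0c.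
have n1 : \forall y \near x0, U (cinv c y).
  by apply: (cts_near (cinv_cts noB ac x0c)); rewrite cmapK.
have n2 := ccod_near noB ac x0c.
have := @filterI _ _ (nbhs_filter x0) _ _ (@filterI _ _ (nbhs_filter x0) _ _ n1 n2) bK.
move=> /nbhs_ballP[r1 /= r10 Hr].
pose r := r1 / 2; have r0 : 0 < r by rewrite divr_gt0.
have HB (y : 'rV[R]_n) : `|x0 - y| <= r -> [/\ U (cinv c y), ccod c y & forall i j, `|invmx (G c y) i j| <= K].
  move=> yr; have /Hr[[h1 h2] h3] : ball x0 r1 y.
    by rewrite -ball_normE; apply: (le_lt_trans yr); rewrite ltr_pdivrMr // ltr_pMr // ltr1n.
  by [].
clearbody r.
pose rho (y : 'rV[R]_n) := \sum_j (x0 0 j - y 0 j) ^+ 2.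
have rhoj (y : 'rV[R]_n) j : (x0 0 j - y 0 j) ^+ 2 <= rho y.
  by rewrite /rho (bigD1 j) //= lerDl; apply: sumr_ge0 => ? _; exact: sqr_ge0.
have rhor y : rho y <= r ^+ 2 -> `|x0 - y| <= r.
  move=> h; apply: norm_rV_le => [|j]; first exact: ltW.
  rewrite addmxE oppmxE -ler_sqr ?nnegrE ?(ltW r0) // real_normK ?num_real //.
  exact: le_trans.
pose phi q : R := if pselect (cdom c q) then sqp (r ^+ 2 - rho (cmap c q)) else 0.
have phic q : cdom c q -> phi q = sqp (r ^+ 2 - rho (cmap c q)) by rewrite /phi; case: pselect.
have phiN q : ~ cdom c q -> phi q = 0 by rewrite /phi; case: pselect.
have phi_pos q : 0 < phi q -> U q.
  have [cq|ncq] := pselect (cdom c q); last by rewrite phiN // ltxx.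
  rewrite phic // /sqp; case: (leP 0 (r ^+ 2 - rho (cmap c q))) => [h _|]; last by rewrite ltxx.
  by rewrite -(cmapK ac cq); have [] := HB (cmap c q) _ => //; apply: rhor; rewrite -subr_ge0.
(* A bound for [|d phi|]: the factor [2 * r ^+ 2] bounds the derivative of [sqp], the rest bounds
   [rho] along a vector, its entries being controlled by [entry_bound]. *)
pose C := 2 * r ^+ 2 * (n%:R * (2 * r * Num.sqrt `|K|)).
have C0 : 0 <= C by rewrite !mulr_ge0 // ltW.
(* A closed coordinate cube containing the support of [phi]. Its image is compact, hence closed in
   the Hausdorff space; therefore [phi] vanishes near every point outside the chart, and the
   extension by zero is C^1. *)
pose Kc : set 'rV[R]_n := [set v | forall i, `[x0 0 i - r, x0 0 i + r]%classic (v ord0 i)].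
have KcE y : Kc y <-> `|x0 - y| <= r.
  split=> [H|H].
    apply: norm_rV_le => [|j]; first exact: ltW.
    have := H j; rewrite /= in_itv /= addmxE oppmxE ler_norml => /andP[h1 h2].
    by lra.
  move=> j /=; rewrite in_itv /=; have := le_trans (coord_le_norm (x0 - y) j) H.
  by rewrite addmxE oppmxE ler_norml => /andP[h1 h2]; lra.
have cK : closed (cinv c @` Kc).
  apply: (compact_closed (@rm_hausdorff R n M)); apply: continuous_compact.
    apply: continuous_in_subspaceT => y; rewrite inE => /KcE/HB[_ cy _].
    exact: cinv_cts.
  exact: (@rV_compact R n (fun i => `[x0 0 i - r, x0 0 i + r]%classic) (fun i => @segment_compact R _ _)).
have step d g (t : R) v : atlas d -> ccod d (g t) -> is_derive t 1 g v ->
    exists2 D, is_derive t 1 (fun s => phi (cinv d (g s))) D &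
      `|D| <= C * Num.sqrt ((v *m G d (g t) *m v^T) 0 0).
  move=> ad dt dg.
  have cg : {for t, continuous g}.
    by apply: differentiable_continuous; apply/derivable1_diffP.
  have cig : {for t, continuous (fun s => cinv d (g s))}.
    by apply: continuous_comp cg _; exact: cinv_cts.
  have [cp|ncp] := pselect (cdom c (cinv d (g t))); last first.
    exists 0; last by rewrite normr0 mulr_ge0.
    apply: (@near_eq_is_derive R R R (cst 0)).
    have nK : \forall s \near t, ~ (cinv c @` Kc) (cinv d (g s)).
      apply: (@cts_near _ _ _ t (fun q => ~ (cinv c @` Kc) q) cig); apply: open_nbhs_nbhs; split; first exact: closed_openC.
      by move=> -[y /KcE/HB[_ cy _] E]; apply: ncp; rewrite -E; exact: cinvP.
    apply: filterS nK => s ns; rewrite [LHS]/0.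
    have [cs|ncs] := pselect (cdom c (cinv d (g s))); last by rewrite phiN.
    rewrite phic // /sqp; case: ifP => // h; exfalso; apply: ns; exists (cmap c (cinv d (g s))); last exact: cmapK.
    by apply/KcE/rhor; rewrite -subr_ge0.
  have od : ov d c (g t) by [].
  pose gh s := tr d c (g s); pose vh := v *m jac (tr d c) (g t).
  have dgh j : is_derive t 1 (fun s => gh s 0 j) (vh 0 j).
    have dt' : differentiable (fun y => tr d c y 0 j) (g t) by exact: smo_diff (tr_smo noB ad ac 0 j) _.
    have := is_derive_curve dt' dg; rewrite [vh _ _]mxE.
    by under eq_bigr => k _ do rewrite -jacE.
  pose al s := r ^+ 2 - rho (gh s).
  have dal : is_derive t 1 al (\sum_j 2 * (x0 0 j - gh t 0 j) * vh 0 j).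
    have -> : al = cst (r ^+ 2) - \sum_j (cst (x0 0 j) - (fun s => gh s 0 j)) ^+ 2.
      apply/funext => s; congr (_ - _); rewrite fct_sumE; apply: eq_bigr => j _ //.
    apply: is_derive_eq; rewrite sub0r -sumrN; apply: eq_bigr => j _.
    have -> : (cst (x0 0 j) - (fun s => gh s 0 j)) t = x0 0 j - gh t 0 j by [].
    by rewrite /GRing.scale /= sub0r mulrN opprK.
  have dphi := @is_derive1_comp R sqp al t _ _ (is_derive_sqp _) dal.
  exists (dsqp (al t) * \sum_j 2 * (x0 0 j - gh t 0 j) * vh 0 j).
    apply: near_eq_is_derive dphi.
    have nc : \forall s \near t, cdom c (cinv d (g s)) by apply: (cts_near cig); exact: cdom_near.
    by apply: filterS nc => s cs; rewrite phic.
  have sq0 : 0 <= Num.sqrt ((v *m G d (g t) *m v^T) 0 0) by [].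
  rewrite /dsqp; case: (leP 0 (al t)) => al0; last by rewrite mul0r normr0 mulr_ge0.
  have ghr : rho (gh t) <= r ^+ 2 by rewrite -subr_ge0.
  have [_ cgh bKt] := HB _ (rhor _ ghr).
  have GE : vh *m G c (gh t) *m vh^T = v *m G d (g t) *m v^T.
    by rewrite trmx_mul -(tr_iso noB ad ac od) !mulmxA.
  have vj j : `|vh 0 j| <= Num.sqrt `|K| * Num.sqrt ((v *m G d (g t) *m v^T) 0 0).
    rewrite -sqrtrM // -sqrtr_sqr ler_wsqrtr // -GE.
    apply: (le_trans (entry_bound vh j (metric_mt ac cgh))).
    have p0 : 0 <= (vh *m G c (gh t) *m vh^T) 0 0.
      have [_ pG] := metric_mt ac cgh.
      have [->|y0] := eqVneq vh 0; first by rewrite !mul0mx mxE.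
      exact/ltW/pG.
    apply: ler_wpM2r => //; apply: le_trans (ler_norm _) _; apply: (le_trans (bKt j j)); exact: ler_norm.
  rewrite normrM -mulrA; apply: ler_pM => //.
    rewrite ger0_norm ?mulr_ge0 // ler_wpM2l // gerBl.
    by apply: sumr_ge0 => j _; exact: sqr_ge0.
  apply: (le_trans (ler_norm_sum _ _ _)); rewrite -!mulrA; apply: sum_le_const => j.
  rewrite !normrM (ger0_norm (ler0n _ 2)) -!mulrA ler_wpM2l //.
  apply: ler_pM => //.
  rewrite -ler_sqr ?nnegrE ?(ltW r0) // real_normK ?num_real //.
  exact: le_trans.
have lip p q L : curve_length p q L -> `|phi q - phi p| <= C * L.
  elim=> [p'|p' L' d g ad cg dg c1g CL IH]; first by rewrite subrr normr0 mulr0.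
  pose h t := Num.sqrt ((derive1 g t *m G d (g t) *m (derive1 g t)^T) 0 0).
  have chh (t : R) : 0 <= t <= 1 -> {for t, continuous h}.
    move=> t01; apply: (@continuous_comp _ _ _ (fun t => (derive1 g t *m G d (g t) *m (derive1 g t)^T) 0 0) Num.sqrt);
      last exact: sqrt_continuous.
    apply: continuous_quadratic; first exact: c1g.
    move=> i j; apply: (@continuous_comp _ _ _ g (fun y => G d y i j)).
      by apply: differentiable_continuous; apply/derivable1_diffP.
    by exact: smo_continuous (metric_smo noB ad i j) (cg t t01).
  (* The curve is only known to lie in the chart for times in [0, 1]; composing with [clampR 0 1]
     gives an integrand that is continuous on the line and has the same integral. *)
  have ci (t : R) : 0 <= clampR 0 1 t <= 1.
    rewrite /clampR; case: (leP t 0) => h1; first by rewrite lexx ler01.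
    by case: (leP 1 t) => h2; [rewrite lexx ler01|rewrite !ltW].
  have cid (t : R) : 0 <= t <= 1 -> clampR 0 1 t = t.
    rewrite /clampR => /andP[t0 t1]; case: (leP t 0) => h1; first by apply/le_anti; rewrite t0.
    by case: (leP 1 t) => // h2; apply/le_anti; rewrite h2.
  have ch (t : R) : {for t, continuous (fun t => h (clampR 0 1 t))}.
    apply: continuous_comp; last exact: chh.
    apply: continuous_eps => e e0; have := near_norm t e0; apply: filterS => s.
    by apply: le_lt_trans; exact: clampR_lip.
  have -> : \int[lebesgue_measure]_(t in `[0, 1]) Num.sqrt ((derive1 g t *m metric d (g t) *m (derive1 g t)^T) 0 0)
     = \int[lebesgue_measure]_(t in `[0, 1]) h (clampR 0 1 t).
    apply: eq_Rintegral => t; rewrite inE /= in_itv /= => t01.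
    by rewrite cid.
  have [I [_ dI]] := primitive_ex ch; rewrite (Rintegral01_le ch dI).
  have B : `|phi (cinv d (g 1)) - phi (cinv d (g 0))| <= C * I 1 - C * I 0.
    apply: (@derive_norm_le _ (fun s => phi (cinv d (g s))) (fun s => C * I s) (fun t => C * h (clampR 0 1 t)) 0 1 ler01) => t t01.
    split; first exact: (is_deriveZ C).
    rewrite cid //; apply: step => //; first exact: cg.
    by rewrite derive1E; apply: DeriveDef.
  rewrite -(subrKA (phi (cinv d (g 0)))); apply: (le_trans (ler_normD _ _)).
  by rewrite mulrDr addrC; apply: lerD => //; rewrite mulrBr.
(* [phi] has the value [r ^+ 4] at l, so a curve shorter than this cannot bring it down to 0. *)
exists (r ^+ 4 / (C + 1)); first by rewrite divr_gt0 ?exprn_gt0 // ltr_wpDl.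
move=> x L CL Ld; apply: phi_pos.
have phl : phi l = r ^+ 4.
  rewrite phic // /sqp /rho big1; last by move=> j _; rewrite subrr expr0n.
  by rewrite subr0 sqr_ge0 -exprM.
have := lip _ _ _ CL; rewrite phl ler_norml => /andP[_].
have : C * L < r ^+ 4.
  move: Ld; rewrite ltr_pdivlMr ?ltr_wpDl // mulrDr mulr1 [L * C]mulrC.
  have [L0|L0] := leP 0 L; first by lra.
  move=> _; apply: le_lt_trans; last exact: exprn_gt0.
  by rewrite mulr_ge0_le0 // ltW.
by lra.
Qed.

End ShortCurves.

(** * Killing fields on complete manifolds are complete *)

Section CompleteFlow.
Context {R : realType} {n : nat}.
Variable M : rmanifold R n.
Hypothesis noB : boundary M = set0.
Hypothesis complete : rcomplete M.
Implicit Types (c d e : chart R M n) (p q : M) (X : chart R M n -> 'rV[R]_n -> 'rV[R]_n).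
Local Notation G := (@metric R n M).

Lemma near_open_itv (a b t : R) : a < t < b -> \forall s \near t, a < s < b.
Proof.
move=> tI; have E : [set s : R | a < s < b] = [set` `]a, b[] by [].
have : open [set s : R | a < s < b] by rewrite E.
by move=> o; apply: open_nbhs_nbhs.
Qed.

Lemma vel_shift X g s t : vel X g (s + t) -> vel X (fun u => g (s + u)) t.
Proof.
move=> [cg [c [ac ct dg]]]; split.
  apply: (@continuous_comp _ _ _ (fun u => s + u) g) => //.
  by apply: continuousD; [exact: cst_continuous|].
by exists c; split=> //; exact: is_derive_translate.
Qed.

Lemma vel_reverse X g t : vel (opp_field X) g (- t) -> vel X (fun u => g (- u)) t.
Proof.
move=> [cg [c [ac ct dg]]]; split.
  by apply: continuous_comp => //; exact: opp_continuous.
by exists c; have := is_derive_reflect dg; rewrite opprK.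
Qed.

(** By constant speed the points [g (xs i)] form a Cauchy sequence. Near its limit all integral
    curves exist for a common time [dl], and [short_curves] puts late points into that
    neighbourhood; a curve started there reaches beyond b. *)
Lemma vel_extend X g a b : killing_field X -> a < b -> (forall t : R, a < t < b -> vel X g t) ->
  exists h (e : R), [/\ 0 < e, forall t : R, a < t < b -> h t = g t & forall t : R, a < t < b + e -> vel X h t].
Proof.
(* A sequence increasing to b; the denominator [i + 2] puts its first term at the midpoint, strictly
   inside the interval. *)
move=> KX ab V; pose xs i : R := b - (b - a) / i.+2%:R.
have xsI i : a < xs i < b.
  have i0 : (0 : R) < i.+2%:R by [].
  rewrite /xs ltrBlDr ltrDl divr_gt0 ?subr_gt0 // andbT.
  by rewrite ltrBrDl -ltrBrDr ltr_pdivrMr // ltr_pMr ?subr_gt0 // ltr1n.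
have mI : a < xs 0 < b := xsI 0%N.
have [c0 ac0 cm] := rm_cover (g (xs 0%N)).
pose q := spd X c0 (cmap c0 (g (xs 0%N))).
have Q t c : a < t < b -> atlas c -> cdom c (g t) -> spd X c (cmap c (g t)) = q.
  by move=> tI ac ct; exact: (spd_const noB KX V tI mI ac ac0 ct cm).
pose C := 2 * Num.sqrt q; have C0 : 0 <= C by rewrite mulr_ge0.
have dist s t : a < s < b -> a < t < b -> (rdist (g s) (g t) <= (C * `|t - s|)%:E)%E.
  move=> sI tI; have [L CL Lb] := vel_length noB KX V sI tI (fun c => Q s c sI).
  apply: (@le_trans _ _ L%:E) => //.
  by apply: ereal_inf_lbound; exists L.
have [l Hl] : exists l, forall e : R, 0 < e -> exists n0 : nat, forall i,
       (n0 <= i)%N -> (rdist (g (xs i)) l < e%:E)%E.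
  apply: complete => e e0.
  pose n0 := Num.bound (C * (b - a) / e).
  have n0P : C * (b - a) < e * n0.+2%:R.
    have : C * (b - a) / e < n0%:R by apply: archi_boundP; rewrite divr_ge0 ?mulr_ge0 // ?subr_ge0 ltW.
    rewrite ltr_pdivrMr // => /lt_le_trans; apply; rewrite [leRHS]mulrC ler_wpM2r ?(ltW e0) // ler_nat.
    by rewrite -addn2 leq_addr.
  exists n0 => i j i0 j0; apply: le_lt_trans (dist _ _ (xsI i) (xsI j)) _; rewrite lte_fin.
  have nn : (0 : R) < n0.+2%:R by [].
  have near_b k : (n0 <= k)%N -> b - (b - a) / n0.+2%:R <= xs k.
    move=> k0; rewrite lerB // ler_pM2l ?subr_gt0 // lef_pV2 ?posrE //.
    by rewrite ler_nat.
  apply: (@le_lt_trans _ _ (C * ((b - a) / n0.+2%:R))).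
    rewrite ler_wpM2l // ler_norml.
    move: (near_b i i0) (near_b j j0) (xsI i) (xsI j) => h1 h2 /andP[_ h3] /andP[_ h4].
    move: ((b - a) / n0.+2%:R) (xs i) (xs j) h1 h2 h3 h4 => w x y h1 h2 h3 h4.
    by lra.
  by rewrite mulrA ltr_pdivrMr.
have [dl dl0 Hloc] := local_curves noB KX l.
have [del del0 Hdel] := short_curves noB Hloc.
have [n1 Hn1] := Hl _ del0.
pose n2 := Num.bound (2 * (b - a) / dl); pose i := maxn n1 n2.
have bi : b - xs i < dl / 2.
  have i0 : (0 : R) < i.+2%:R by [].
  rewrite subKr ltr_pdivrMr //.
  have : 2 * (b - a) / dl < n2%:R.
    by apply: archi_boundP; rewrite divr_ge0 ?mulr_ge0 // ?subr_ge0 ltW.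
  rewrite ltr_pdivrMr // => h1; have : n2%:R <= i.+2%:R :> R.
    by rewrite ler_nat -addn2 (leq_trans (leq_maxr n1 n2)) // leq_addr.
  by move=> h2; have := ler_wpM2r (ltW dl0) h2 => h3; lra.
have [h [h0 Vh]] : exists h : R -> M, h 0 = g (xs i) /\ forall t, `|t| < dl -> vel X h t.
  have /ereal_inf_lt[_ [L CL <-]] := Hn1 i (leq_maxl _ _).
  by rewrite lte_fin => Ld; exact: Hdel _ Ld.
pose h' t := h (- xs i + t).
have Vh' t : `|t - xs i| < dl -> vel X h' t.
  by move=> ti; apply: vel_shift; apply: Vh; rewrite addrC.
have xi := xsI i.
have agree t : Num.max a (xs i - dl) < t < b -> g t = h' t.
  apply: (vel_unique noB KX (t0 := xs i)).
  - rewrite gt_max; case/andP: xi => -> ->; rewrite ltrBlDr ltrDl dl0 //.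
  - move=> s; rewrite gt_max => /andP[/andP[s1 s2] s3]; split; first by apply: V; rewrite s1.
    by apply: Vh'; rewrite ltr_norml; lra.
  - by rewrite /h' addNr.
exists (fun t => if t <= xs i then g t else h' t), (dl / 2); split; first by rewrite divr_gt0.
- move=> t tI; case: leP => // xt; rewrite -agree // gt_max; case/andP: tI => -> ->.
  by rewrite (lt_trans _ xt) // ltrBlDr ltrDl.
- move=> t /andP[t1 t2]; have [tx|tx] := leP t (xs i).
    have tI : a < t < b by rewrite t1 (le_lt_trans tx); case/andP: xi.
    have near_t := near_open_itv tI.
    apply: vel_near (V t tI); apply: filterS near_t => s sI; case: leP => // xs'.
    rewrite agree // gt_max; case/andP: sI => -> ->.
    by rewrite (lt_trans _ xs') // ltrBlDr ltrDl.
  apply: (@vel_near _ _ _ X h').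
    have e0 : 0 < t - xs i by rewrite subr_gt0.
    have := near_norm t e0; apply: filterS => s st; case: leP => // sx; exfalso.
    by move: st; rewrite ltr_norml => /andP[? ?]; lra.
  by apply: Vh'; rewrite ltr_norml; lra.
Qed.

(** All intervals contain t0, where the curves agree; by uniqueness they agree on overlaps, and at
    each time any member of the family defined there may be used. *)
Lemma vel_glue X p t0 (P : R -> Prop) (A B : R -> R) : killing_field X -> (exists T, P T) ->
  (forall T, P T -> A T < t0 < B T) ->
  (forall T, P T -> exists g, g t0 = p /\ forall t : R, A T < t < B T -> vel X g t) ->
  exists g, g t0 = p /\ forall T, P T -> forall t : R, A T < t < B T -> vel X g t.
Proof.
move=> KX [T0 PT0] H0 H.
pose Q T g := g t0 = p /\ forall t, A T < t < B T -> vel X g t.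
pose ga T : R -> M := xget (fun=> p) [set g | Q T g].
have gaP T : P T -> Q T (ga T) by move=> /H/(@xgetPex _ (fun=> p) [set g | Q T g]).
pose Tc t : R := xget T0 [set T | P T /\ A T < t < B T].
have TcP t : (exists T, P T /\ A T < t < B T) -> P (Tc t) /\ A (Tc t) < t < B (Tc t).
  by move=> /(@xgetPex _ T0 [set T | P T /\ A T < t < B T]).
have E T (t : R) : P T -> A T < t < B T -> ga (Tc t) t = ga T t.
  move=> PT tT; have [PTc tTc] := TcP t (ex_intro _ T (conj PT tT)).
  have [e1 v1] := gaP _ PTc; have [e2 v2] := gaP _ PT.
  apply: (@vel_unique _ _ _ noB _ KX _ _ (Num.max (A T) (A (Tc t))) (Num.min (B T) (B (Tc t))) t0).
  - by rewrite gt_max lt_min; have /andP[-> ->] := H0 T PT; have /andP[-> ->] := H0 _ PTc.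
  - move=> s; rewrite gt_max lt_min => /andP[/andP[s1 s2] /andP[s3 s4]].
    by split; [apply: v1; rewrite s2|apply: v2; rewrite s1].
  - by rewrite e2.
  - by rewrite gt_max lt_min; case/andP: tT => -> ->.
exists (fun t => ga (Tc t) t); split.
  by rewrite (E T0 t0 PT0 (H0 T0 PT0)); have [] := gaP _ PT0.
move=> T PT t tT; have [_ v] := gaP _ PT.
have near_t := near_open_itv tT.
by apply: vel_near (v t tT); apply: filterS near_t => s sI; rewrite (E T).
Qed.

(** If some end time could not be reached, the supremum of the reachable ones would be reached by
    gluing and then passed by [vel_extend]. *)
Lemma vel_forward X g p a t0 b : killing_field X -> a < t0 < b -> g t0 = p ->
  (forall t : R, a < t < b -> vel X g t) ->
  forall T : R, exists h, h t0 = p /\ forall t : R, a < t < T -> vel X h t.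
Proof.
move=> KX /andP[at0 t0b] gp V.
pose S T := exists h, h t0 = p /\ forall t, a < t < T -> vel X h t.
apply: contrapT => /existsNP[T1 nT1].
pose E := [set T : R | t0 < T /\ S T].
have mono T T' : T' <= T -> S T -> S T'.
  move=> TT [h [h0 Vh]]; exists h; split => // t /andP[t1 t2]; apply: Vh.
  by rewrite t1 (lt_le_trans t2).
have Sb : S b by exists g.
have hs : has_sup E.
  split; first by exists b.
  by exists T1 => T [_ ST]; rewrite leNgt; apply/negP => /ltW h; apply: nT1; exact: mono h _.
have [h [h0 Vh]] := @vel_glue X p t0 E (fun=> a) id KX (ex_intro _ b (conj t0b Sb))
  (fun T ET => introT andP (conj at0 ET.1)) (fun T ET => ET.2).
have Vs t : a < t < sup E -> vel X h t.
  move=> /andP[t1 t2]; have e0 : 0 < sup E - t by rewrite subr_gt0.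
  have [T ET TT] := sup_adherent e0 hs.
  by apply: (Vh T ET); rewrite t1 -[t](subKr (sup E)).
have bs : b <= sup E by apply: ub_le_sup; [case: hs|].
have as' : a < sup E by rewrite (lt_le_trans at0) // ltW // (lt_le_trans t0b).
have [h' [e [e0 hh' Vh']]] := vel_extend KX as' Vs.
have : E (sup E + e).
  split; first by rewrite (lt_le_trans t0b) // (le_trans bs) // lerDl ltW.
  exists h'; split=> //; rewrite hh' // at0 (lt_le_trans t0b) //.
move=> /(ub_le_sup hs.2); rewrite gerDl leNgt e0 //.
Qed.

Lemma flow_ex X p : killing_field X -> exists g, g 0 = p /\ forall t : R, vel X g t.
Proof.
move=> KX.
have fwd Y : killing_field Y -> exists2 a : R, a < 0 &
    forall T, exists h, h 0 = p /\ forall t, a < t < T -> vel Y h t.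
  move=> KY; have [dl dl0 /nbhs_singleton[g [g0 Vg]]] := local_curves noB KY p.
  exists (- dl); first by rewrite oppr_lt0.
  apply: (@vel_forward Y g p (- dl) 0 dl) => //; first by rewrite oppr_lt0 dl0.
  by move=> t tI; apply: Vg; rewrite ltr_norml.
(* Backward in time the curve is an integral curve of [- X] run in reverse. *)
have [a a0 Ha] := fwd _ KX; have [b b0 Hb] := fwd _ (killing_opp noB KX).
have [||T T0|g [g0 Vg]] := @vel_glue X p 0 (fun T => 0 < T) (fun T => - T) id KX.
- by exists 1.
- by move=> T T0; rewrite oppr_lt0 T0.
- have [h [h0 Vh]] := Ha T; have [k [k0 Vk]] := Hb T.
  have Vk' (t : R) : - T < t < - b -> vel X (fun u => k (- u)) t.
    by move=> /andP[t1 t2]; apply: vel_reverse; apply: Vk; apply/andP; split; [rewrite ltrNr|rewrite ltrNl].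
  have agree t : Num.max a (- T) < t < Num.min T (- b) -> h t = k (- t).
    apply: (@vel_unique _ _ _ noB X KX h (fun u => k (- u)) _ _ 0).
    - by rewrite gt_max lt_min a0 oppr_lt0 T0 oppr_gt0.
    - move=> s; rewrite gt_max lt_min => /andP[/andP[s1 s2] /andP[s3 s4]]; split.
        by apply: Vh; rewrite s1.
      by apply: Vk'; rewrite s2.
    - by rewrite oppr0 k0.
  exists (fun t => if 0 <= t then h t else k (- t)); rewrite lexx; split=> // t /andP[t1 t2].
  have m1 : 0 < Num.min (- a) T by rewrite lt_min oppr_gt0 a0.
  have [tpos|tneg] := ltP (Num.max a (- T)) t; last first.
    have tn : t < 0 by rewrite (le_lt_trans tneg) // gt_max a0 oppr_lt0.
    apply: (@vel_near _ _ _ X (fun u => k (- u))).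
      have e0 : 0 < - t by rewrite oppr_gt0.
      have := near_norm t e0; apply: filterS => s st; case: leP => // s0; exfalso.
      by move: st; rewrite ltr_norml => /andP[? ?]; lra.
    by apply: Vk'; rewrite t1 (lt_trans tn) // oppr_gt0.
  move: tpos; rewrite gt_max => /andP[ta _].
  apply: vel_near; last by apply: Vh; rewrite ta.
  have e0 : 0 < Num.min (Num.min (t - a) (t + T)) (T - t) by rewrite !lt_min !subr_gt0 ta -ltrBlDr sub0r t1.
  have := near_norm t e0; apply: filterS => s; rewrite !lt_min !ltr_norml => /andP[/andP[/andP[s1 s2] /andP[s3 s4]] /andP[s5 s6]].
  case: leP => // sneg; apply: agree; rewrite gt_max lt_min.
  have b0' : b < 0 := b0.
  by lra.
exists g; split=> // t; apply: (Vg (`|t| + 1)) => //.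
by rewrite -ltr_norml ltrDl.
Qed.

End CompleteFlow.

Section CgoodExtra.
Context {R : realType}.

Lemma cgood_continuous_rV m n k A (phi : 'rV[R]_m -> 'rV[R]_n) x :
  (forall j, cgood k A (fun x => phi x 0 j)) -> A x -> {for x, continuous phi}.
Proof. by move=> H Ax; apply: continuous_rV => j; exact: cgood_continuous. Qed.

Definition tp n (t : R) (x : 'rV[R]_n) : 'rV[R]_(1 + n) := row_mx t%:M x.

Lemma tp_l n t (x : 'rV[R]_n) : lsubmx (tp t x) 0 0 = t.
Proof. by rewrite row_mxKl mxE. Qed.

Lemma tp_r n t (x : 'rV[R]_n) : rsubmx (tp t x) = x.
Proof. by rewrite row_mxKr. Qed.

Lemma tp_eta n (z : 'rV[R]_(1 + n)) : tp (lsubmx z 0 0) (rsubmx z) = z.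
Proof.
rewrite -[RHS]hsubmxK; congr row_mx; apply/matrixP => i j.
by rewrite !ord1 [LHS]mxE.
Qed.

Lemma tp_shift_t n (t s : R) x : tp t x + s *: delta_mx 0 (lshift n 0) = tp (t + s) x.
Proof.
apply/rowP => j; rewrite !mxE; case: (split_ordP j) => l ->.
  by rewrite ord1 !mxE mulr1.
by rewrite mulr0 addr0.
Qed.

Lemma tp_shift_x n (t s : R) (x : 'rV[R]_n) i : tp t x + s *: delta_mx 0 (rshift 1 i) = tp t (x + s *: delta_mx 0 i).
Proof.
apply/rowP => j; rewrite !mxE; case: (split_ordP j) => l ->.
  by rewrite eq_lrshift mulr0 addr0.
by rewrite !mxE.
Qed.

Lemma is_derive_tp n (f : 'rV[R]_(1 + n) -> R) t x : differentiable f (tp t x) ->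
  is_derive t 1 (fun s => f (tp s x)) (pd (lshift n 0) f (tp t x)).
Proof.
move=> df; have E s : tp 0 x + s *: delta_mx 0 (lshift n 0) = tp s x by rewrite tp_shift_t add0r.
have := @is_derive_dir R _ f (tp 0 x) (delta_mx 0 (lshift n 0)) t.
rewrite E -pd_unlock => /(_ (diff_derivable df)).
by under eq_fun do rewrite E.
Qed.

Lemma pd_tp n (f : 'rV[R]_(1 + n) -> R) t x i : differentiable f (tp t x) ->
  pd i (fun y => f (tp t y)) x = pd (rshift 1 i) f (tp t x).
Proof.
move=> df; rewrite !pd_unlock.
have := @is_derive_dir R _ f (tp t x) (delta_mx 0 (rshift 1 i)) 0.
rewrite scale0r addr0 => /(_ (diff_derivable df)).
under eq_fun do rewrite tp_shift_x.
by move=> /(@is_derive_dir0 R n (fun y => f (tp t y)))[_ ->].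
Qed.

Lemma msmo_tp n m (A : set 'rV[R]_m) (f : 'rV[R]_m -> R) (phi : 'rV[R]_m -> 'rV[R]_n) :
  smo A f -> msmo A phi -> msmo A (fun z => tp (f z) (phi z)).
Proof.
move=> sf sphi; apply: msmo_row_mx => // i j.
under eq_fun do rewrite !ord1 mxE.
exact: sf.
Qed.

Lemma smo_lsub00 n (A : set 'rV[R]_(1 + n)) : smo A (fun z => lsubmx z 0 0).
Proof. exact: msmo_lsub. Qed.

Lemma msmo_id n (A : set 'rV[R]_n) : msmo A id.
Proof. by move=> i j; rewrite ord1; exact: smo_coord. Qed.

Lemma connected_R : connected [set: R].
Proof. by apply/connected_intervalP => x y _ _ z _. Qed.

End CgoodExtra.

(** * The global flow: smoothness and isometry *)

Section Flow.
Context {R : realType} {n : nat}.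
Variable M : rmanifold R n.
Hypothesis noB : boundary M = set0.
Hypothesis complete : rcomplete M.
Implicit Types (c d e : chart R M n) (p q : M).
Local Notation G := (@metric R n M).
Variable X : chart R M n -> 'rV[R]_n -> 'rV[R]_n.
Hypothesis KX : killing_field X.

Definition Theta (t : R) (p : M) : M := xget (fun=> p) [set g | g 0 = p /\ forall s, vel X g s] t.

Lemma ThetaP p : Theta 0 p = p /\ forall t : R, vel X (Theta^~ p) t.
Proof.
have /(@xgetPex _ (fun=> p) [set g | g 0 = p /\ forall s, vel X g s])[H1 H2] :=
  flow_ex noB complete p KX.
by [].
Qed.

Lemma Theta0 p : Theta 0 p = p. Proof. by have [] := ThetaP p. Qed.
Lemma Theta_vel p t : vel X (Theta^~ p) t. Proof. by have [] := ThetaP p. Qed.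
Lemma Theta_cts p (t : R) : {for t, continuous (Theta^~ p)}. Proof. exact: vel_cts (Theta_vel p t). Qed.

Lemma Theta_unique g p (a b t : R) : a < 0 < b -> g 0 = p -> (forall s : R, a < s < b -> vel X g s) ->
  a < t < b -> g t = Theta t p.
Proof.
move=> H0 g0 V; apply: (@vel_unique _ _ _ noB X KX g (Theta^~ p) a b 0) => //.
  by split; [exact: V|exact: Theta_vel].
by rewrite Theta0.
Qed.

Lemma ThetaD s t p : Theta (s + t) p = Theta s (Theta t p).
Proof.
have := @Theta_unique (fun u => Theta (t + u) p) (Theta t p) (- (`|s| + 1)) (`|s| + 1) s.
rewrite addr0 [t + s]addrC; apply => //.
- by rewrite oppr_lt0 ltr_wpDl.
- by move=> u _; apply: vel_shift; exact: Theta_vel.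
- by rewrite -ltr_norml ltrDl.
Qed.

Lemma ThetaNK s p : Theta (- s) (Theta s p) = p.
Proof. by rewrite -ThetaD addNr Theta0. Qed.

Definition frep c e (z : 'rV[R]_(1 + n)) := cmap e (Theta (lsubmx z 0 0) (cinv c (rsubmx z))).
Definition fdom c e : set 'rV[R]_(1 + n) :=
  [set z | ccod c (rsubmx z) /\ cdom e (Theta (lsubmx z 0 0) (cinv c (rsubmx z)))].

(** Stated for a fixed order because the neighbourhood produced by [local_flow] depends on [k];
    smoothness follows since differentiability of every order is a pointwise statement. *)
Definition FLc k c e z0 := exists A, [/\ open A, A z0, A `<=` fdom c e &
  forall j, cgood k A (fun z => frep c e z 0 j)].

Lemma frep_dom c e z : atlas e -> fdom c e z -> ccod e (frep c e z).
Proof. by move=> ae [_ h]; exact: cmapP. Qed.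

Lemma cinv_frep c e z : atlas e -> fdom c e z ->
  cinv e (frep c e z) = Theta (lsubmx z 0 0) (cinv c (rsubmx z)).
Proof. by move=> ae [_ h]; rewrite cmapK. Qed.

Lemma FLc_chart k c e e' z0 : atlas c -> atlas e -> atlas e' -> FLc k c e z0 ->
  cdom e' (Theta (lsubmx z0 0 0) (cinv c (rsubmx z0))) -> FLc k c e' z0.
Proof.
move=> ac ae ae' [A [oA Az AD cg]] e'z.
have fe z : fdom c e z -> cdom e' (Theta (lsubmx z 0 0) (cinv c (rsubmx z))) -> ov e e' (frep c e z).
  by move=> [_ h1] h2; exact: ov_cmap.
exists (A `&` frep c e @^-1` ov e e'); split.
- apply: open_preimage_in => //; first exact: ov_open.
  by move=> x Ax; exact: cgood_continuous_rV.
- by split=> //; apply: fe => //; exact: AD.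
- by move=> z [Az' [_ h]]; have [h1 h2] := AD _ Az'; move: h; rewrite cinv_frep.
- move=> j; have oA' : open (A `&` frep c e @^-1` ov e e').
    apply: open_preimage_in => //; first exact: ov_open.
    by move=> x Ax; exact: cgood_continuous_rV.
  apply: (@cgood_ext _ _ k _ ((fun y => tr e e' y 0 j) \o frep c e)) => //.
    by move=> z [Az' _]; rewrite /= /tr cinv_frep //; exact: AD.
  apply: (@cgood_comp _ _ _ k _ (ov e e')) => //.
  + by move=> z [].
  + by move=> l; apply: cgood_sub (cg l) => z [].
  + exact/smo_cgood/tr_smo.
Qed.

(* Near each point q the flow is given by a C^k local flow; transport from time
   t to time t' by composing with it. *)
Lemma FLc_step k c x t0 : atlas c -> ccod c x -> exists2 eps : R, 0 < eps &
  forall t t' : R, `|t0 - t| < eps -> `|t0 - t'| < eps ->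
    (forall e, atlas e -> cdom e (Theta t (cinv c x)) -> FLc k c e (tp t x)) ->
    (forall e, atlas e -> cdom e (Theta t' (cinv c x)) -> FLc k c e (tp t' x)).
Proof.
move=> ac cx; set p := cinv c x; have [e ae ep] := rm_cover (Theta t0 p).
set y0 := cmap e (Theta t0 p).
have [dl [r [psi [dl0 r0 fl cg]]]] := local_flow k (ccod_open noB ae) (X_smo KX ae) (cmapP ae ep).
have loc q tau : cdom e q -> `|y0 - cmap e q| < r -> `|tau| < dl ->
    ccod e (psi tau (cmap e q)) /\ Theta tau q = cinv e (psi tau (cmap e q)).
  move=> eq qr taud; have [h1 _ _] := fl tau _ taud qr; split=> //; apply/esym.
  apply: (@Theta_unique (fun s => cinv e (psi s (cmap e q))) q (- dl) dl).
  - by rewrite oppr_lt0 dl0.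
  - have [|_ _ ->] := fl 0 (cmap e q) _ qr; first by rewrite normr0.
    exact: cmapK.
  - by move=> s; rewrite -ltr_norml => sd; exact: flow_vel _ _ sd qr.
  - by rewrite -ltr_norml.
have n1 : \forall t \near t0, cdom e (Theta t p).
  by apply: (cts_near (@Theta_cts p t0)); exact: cdom_near.
have cc : {for t0, continuous (fun t => cmap e (Theta t p))}.
  apply: continuous_comp; first exact: Theta_cts.
  exact: cmap_cts.
have n2 := near_dist cc r0.
have /near_itv[e1 e10 He] := @filterI _ _ (nbhs_filter t0) _ _ n1 n2.
have m0 : 0 < Num.min e1 (dl / 2) by rewrite lt_min e10 divr_gt0.
exists (Num.min e1 (dl / 2)) => // t t'; rewrite !lt_min => /andP[t1 t2] /andP[t'1 t'2] H.
have [et tr_] := He t t1; have [et' _] := He t' t'1.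
have td : `|t' - t| < dl.
  move: t2 t'2; rewrite !ltr_norml => /andP[? ?] /andP[? ?]; apply/andP; split; lra.
suff F : FLc k c e (tp t' x).
  by move=> e' ae' e't'; apply: (FLc_chart ac ae ae' F); rewrite tp_l tp_r.
have [A [oA Az AD cgA]] := H e ae et.
pose sg (z : 'rV[R]_(1 + n)) : 'rV[R]_(1 + n) := tp t (rsubmx z).
have ssg : msmo setT sg by apply: msmo_tp; [exact: smo_cst|exact: msmo_rsub].
have csg : continuous sg.
  move=> z; apply: continuous_rV => j; exact: smo_continuous.
pose A1 := sg @^-1` A.
have oA1 : open A1 by move/continuousP: csg; apply.
pose eta z : 'rV[R]_(1 + n) := tp (lsubmx z 0 0 - t) (frep c e (sg z)).
have ceta j : cgood k A1 (fun z => eta z 0 j).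
  rewrite /eta /tp; case: (split_ordP j) => l ->.
    have -> : (fun z => row_mx (lsubmx z 0 0 - t)%:M (frep c e (sg z)) 0 (lshift n l)) =
       (fun z => lsubmx z 0 0 - t).
      by apply/funext => z; rewrite row_mxEl ord1 mxE.
    apply: smo_cgood; apply: smoB => //; [exact: smo_lsub00|exact: smo_cst].
  have -> : (fun z => row_mx (lsubmx z 0 0 - t)%:M (frep c e (sg z)) 0 (rshift 1 l)) =
     (fun z => frep c e z 0 l) \o sg.
    by apply/funext => z; rewrite row_mxEr.
  apply: (@cgood_precomp _ _ _ k A1 A) => //.
  by move=> i j'; apply: smo_sub (ssg i j').
pose A' := A1 `&` eta @^-1` (flow_box y0 dl r).
have oA' : open A'.
  apply: open_preimage_in => //; first exact: open_flow_box.
  by move=> z Az'; exact: cgood_continuous_rV.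
have repr z : A' z -> [/\ ccod c (rsubmx z), cdom e (Theta t (cinv c (rsubmx z))),
    ccod e (psi (lsubmx (eta z) 0 0) (rsubmx (eta z))) &
    Theta (lsubmx z 0 0) (cinv c (rsubmx z)) = cinv e (psi (lsubmx (eta z) 0 0) (rsubmx (eta z)))].
  move=> [/AD[h1 h2] [h3 h4]]; rewrite tp_r in h1; rewrite tp_l tp_r in h2.
  rewrite tp_l in h3; rewrite tp_r in h4.
  have fE : frep c e (sg z) = cmap e (Theta t (cinv c (rsubmx z))) by rewrite /frep tp_l tp_r.
  rewrite fE in h4; have [g1 g2] := loc _ _ h2 h4 h3.
  split=> //; rewrite tp_l tp_r fE //.
  by rewrite -g2 -ThetaD subrK.
exists A'; split => //.
- split; first by rewrite /A1 /= /sg tp_r.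
  rewrite /flow_box /= !tp_l !tp_r /sg tp_r /frep tp_l tp_r; split=> //.
- by move=> z /repr[h1 h2 h3 h4]; split=> //; rewrite h4; exact: cinvP.
- move=> j; apply: (@cgood_ext _ _ k _ ((fun z => psi (lsubmx z 0 0) (rsubmx z) 0 j) \o eta)) => //.
    by move=> z /repr[h1 h2 h3 h4]; rewrite /frep h4 cinvK.
  apply: (@cgood_comp _ _ _ k A' (flow_box y0 dl r)) => //.
  + by move=> z [].
  + by move=> l; apply: cgood_sub (ceta l) => z [].
Qed.

Lemma FLc0 k c e x : atlas c -> atlas e -> ccod c x -> cdom e (cinv c x) -> FLc k c e (tp 0 x).
Proof.
move=> ac ae cx ex.
suff F : FLc k c c (tp 0 x).
  by apply: (FLc_chart ac ac ae F); rewrite tp_l tp_r Theta0.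
have [dl [r [psi [dl0 r0 fl cg]]]] := local_flow k (ccod_open noB ac) (X_smo KX ac) cx.
have loc y tau : `|x - y| < r -> `|tau| < dl ->
    [/\ ccod c y, ccod c (psi tau y) & Theta tau (cinv c y) = cinv c (psi tau y)].
  move=> yr taud; have [h1 _ _] := fl tau _ taud yr.
  have [|h2 _ h3] := fl 0 y _ yr; first by rewrite normr0.
  split=> //; first by rewrite h3 in h2.
  apply/esym; apply: (@Theta_unique (fun s => cinv c (psi s y)) _ (- dl) dl).
  - by rewrite oppr_lt0 dl0.
  - by rewrite h3.
  - by move=> s; rewrite -ltr_norml => sd; exact: flow_vel _ _ sd yr.
  - by rewrite -ltr_norml.
exists (flow_box x dl r); split.
- exact: open_flow_box.
- by rewrite /flow_box /= tp_l tp_r normr0 subrr normr0.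
- by move=> z [z1 z2]; have [h1 h2 h3] := loc _ _ z2 z1; split=> //; rewrite h3; exact: cinvP.
- move=> j; apply: cgood_ext (cg j); first exact: open_flow_box.
  by move=> z [z1 z2]; have [h1 h2 h3] := loc _ _ z2 z1; rewrite /frep h3 cinvK.
Qed.

Lemma FLcP k c e z : atlas c -> atlas e -> fdom c e z -> FLc k c e z.
Proof.
move=> ac ae [cz ez]; rewrite -(tp_eta z); move: (lsubmx z 0 0) (rsubmx z) cz ez => t x cx ex.
pose S t := forall e, atlas e -> cdom e (Theta t (cinv c x)) -> FLc k c e (tp t x).
suff : S t by apply.
apply: (@connected_ind R setT S 0) => //; [exact: openT|exact: connected_R| |].
  by move=> e' ae'; rewrite Theta0 => e'x; exact: FLc0.
move=> t0 _; have [eps eps0 H] := FLc_step k t0 ac cx.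
exists (ball t0 eps); first exact: nbhsx_ballx.
by move=> t1 t2 _ _; exact: H.
Qed.

Lemma fdom_open c e : atlas c -> atlas e -> open (fdom c e).
Proof.
move=> ac ae; rewrite openE => z zD; have [A [oA Az AD _]] := FLcP 0 ac ae zD.
by apply: filterS AD _; exact: open_nbhs_nbhs.
Qed.

Lemma frep_smo c e : atlas c -> atlas e -> msmo (fdom c e) (frep c e).
Proof.
move=> ac ae i j k z zD; rewrite ord1.
have [A [oA Az AD cg]] := FLcP k.+1 ac ae zD.
exact: cg.
Qed.

Lemma frep_vel c e z j : atlas c -> atlas e -> fdom c e z ->
  pd (lshift n 0) (fun y => frep c e y 0 j) z = X e (frep c e z) 0 j.
Proof.
move=> ac ae zD; have ds : differentiable (fun y => frep c e y 0 j) z by exact: smo_diff (frep_smo ac ae 0 j) _.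
move: zD ds; rewrite -(tp_eta z); move: (lsubmx z 0 0) (rsubmx z) => t x [cx ex] ds.
rewrite tp_l tp_r in ex.
have := is_derive_tp ds; have := is_derive_coord j (velP noB KX (Theta_vel (cinv c x) t) ae ex).
have -> : (fun s => frep c e (tp s x) 0 j) = (fun s => (cmap e \o Theta^~ (cinv c x)) s 0 j).
  by apply/funext => s; rewrite /frep tp_l tp_r.
move=> d1 d2; rewrite -(is_derive_uniq d1 d2) /frep tp_l tp_r //.
Qed.

Definition fjac c e z : 'M[R]_n := \matrix_(i, j) pd (rshift 1 i) (fun y => frep c e y 0 j) z.

Lemma fjacE c e t x : atlas c -> atlas e -> fdom c e (tp t x) ->
  jac (fun y => frep c e (tp t y)) x = fjac c e (tp t x).
Proof.
move=> ac ae zD; apply/matrixP => i j; rewrite jacE mxE.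
by rewrite (@pd_tp _ _ (fun y => frep c e y 0 j)) //; exact: smo_diff (frep_smo ac ae 0 j) _.
Qed.

Lemma fjac_smo c e : atlas c -> atlas e -> msmo (fdom c e) (fjac c e).
Proof.
move=> ac ae i j; have -> : (fun y => fjac c e y i j) = pd (rshift 1 i) (fun y => frep c e y 0 j).
  by apply/funext => y; rewrite mxE.
by apply: smo_pd; exact: frep_smo.
Qed.

(** The time derivative of the pulled-back metric is the pull-back of the Lie derivative of the
    metric: the Jacobian obeys the linearised equation, and the metric is differentiated along
    [X]. *)
Lemma frep_killing c e z : atlas c -> atlas e -> fdom c e z ->
  mpd (lshift n 0) (fun z => fjac c e z *m G e (frep c e z) *m (fjac c e z)^T) z = 0.
Proof.
move=> ac ae zD; have oD := fdom_open ac ae; have [_ _ kX] := KX.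
have sF := frep_smo ac ae; have sJ := fjac_smo ac ae.
have sG : msmo (fdom c e) (fun z => G e (frep c e z)).
  apply: (msmo_comp oD (fun x => frep_dom ae (z := x)) sF); exact: metric_smo.
have dJ := msmo_mdiff sJ zD; have dG := msmo_mdiff sG zD.
have dF : differentiable (frep c e) z by exact: msmo_differentiable.
have ez := frep_dom ae zD.
have J0 : mpd (lshift n 0) (fjac c e) z = fjac c e z *m jac (X e) (frep c e z).
  apply/matrixP => i j; rewrite mpdE [RHS]mxE.
  under eq_fun do rewrite mxE.
  rewrite (smo_pd_sym oD _ _ (sF 0 j) zD).
  rewrite (@pd_ext _ _ _ _ _ ((fun y => X e y 0 j) \o frep c e) z oD zD); last first.
    by move=> y yD; exact: frep_vel.
  rewrite pd_comp //; last exact: smo_diff (X_smo KX ae 0 j) _.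
  by apply: eq_bigr => l _; rewrite mxE jacE.
have G0 : mpd (lshift n 0) (fun z => G e (frep c e z)) z = \sum_a X e (frep c e z) 0 a *: mpd a (G e) (frep c e z).
  rewrite @mpd_comp //; last exact: msmo_mdiff (metric_smo noB ae) _.
  by apply: eq_bigr => a _; rewrite frep_vel.
have dJG : mdiff (fun z => fjac c e z *m G e (frep c e z)) z by exact: msmo_mdiff (msmoM oD sJ sG) _.
have dJt : mdiff (fun z => (fjac c e z)^T) z by exact: msmo_mdiff (msmo_tr sJ) _.
rewrite (mpdM _ dJG dJt) (mpdM _ dJ dG) mpd_tr J0 G0.
set J := fjac c e z; set H := jac (X e) _; set S := \sum_a _; set g := G e _.
have -> : (J *m H *m g + J *m S) *m J^T + J *m g *m (J *m H)^T = J *m (H *m g + S + g *m H^T) *m J^T.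
  by rewrite trmx_mul !mulmxDr !mulmxDl !mulmxA.
by rewrite kX // mulmx0 mul0mx.
Qed.

(** The pulled-back metric is constant in time and equals [G c] at time 0. The target chart may
    change along the flow line, which the isometric transition maps allow. *)
Lemma flow_iso c e t x : atlas c -> atlas e -> fdom c e (tp t x) ->
  jac (fun y => frep c e (tp t y)) x *m G e (frep c e (tp t x)) *m (jac (fun y => frep c e (tp t y)) x)^T = G c x.
Proof.
move=> ac ae zD; have cx : ccod c x by case: zD; rewrite tp_r.
pose P e t := fjac c e (tp t x) *m G e (frep c e (tp t x)) *m (fjac c e (tp t x))^T.
rewrite fjacE //.
pose S t := forall e, atlas e -> fdom c e (tp t x) -> P e t = G c x.
suff : S t by apply.
have Sch s d : atlas d -> fdom c d (tp s x) -> P d s = G c x -> S s.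
  move=> ad dD dE e' ae' e'D; rewrite -dE /P -!fjacE //.
  have od : ov d e' (frep c d (tp s x)).
    by split; [exact: frep_dom|rewrite cinv_frep; case: e'D].
  have oo := ov_open noB ad ae'.
  have oDD : open [set y | fdom c d (tp s y) /\ fdom c e' (tp s y)].
    have ct : continuous (fun y : 'rV[R]_n => tp s y).
      move=> y; apply: continuous_rV => j; apply: differentiable_continuous.
      exact: smo_diff (msmo_tp (@smo_cst R n setT s) (@msmo_id _ n setT) 0 j) I.
    have := @openI _ _ _ (fdom_open ac ad) (fdom_open ac ae').
    by move/continuousP: ct => /[apply].
  have E1 : frep c e' (tp s x) = tr d e' (frep c d (tp s x)) by rewrite /tr cinv_frep.
  have E2 : jac (fun y => frep c e' (tp s y)) x =
     jac (fun y => frep c d (tp s y)) x *m jac (tr d e') (frep c d (tp s x)).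
    rewrite -jac_comp.
    - apply: (jac_ext oDD) => // y [yd ye']; rewrite /= /tr cinv_frep //.
    - exact: msmo_differentiable (tr_smo noB ad ae') _.
    - apply: (@msmo_differentiable _ _ _ [set y | fdom c d (tp s y)]) => //.
      apply: (@msmo_comp _ _ _ _ _ _ (fdom c d) (frep c d) (fun y => tp s y)) => //.
      + have ct : continuous (fun y : 'rV[R]_n => tp s y).
          move=> y; apply: continuous_rV => j; apply: differentiable_continuous.
          exact: smo_diff (msmo_tp (@smo_cst R n setT s) (@msmo_id _ n setT) 0 j) I.
        by move/continuousP: ct; apply; exact: fdom_open.
      + by apply: msmo_tp; [exact: smo_cst|exact: msmo_id].
      + exact: frep_smo.
  rewrite E2 E1 trmx_mul -(tr_iso noB ad ae' od) !mulmxA //.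
apply: (@connected_ind R setT S 0) => //; [exact: openT|exact: connected_R| |].
  have c0 : fdom c c (tp 0 x) by split; rewrite ?tp_r // tp_l Theta0; exact: cinvP.
  apply: (Sch 0 c ac c0); rewrite /P -fjacE //.
  have E y : ccod c y -> frep c c (tp 0 y) = y by move=> cy; rewrite /frep tp_l tp_r Theta0 cinvK.
  rewrite (jac_ext (ccod_open noB ac) cx E) jac_id E //.
  by rewrite mul1mx trmx1 mulmx1.
move=> t0 _; have [d ad dt0] := rm_cover (Theta t0 (cinv c x)).
have n1 : \forall s \near t0, cdom d (Theta s (cinv c x)).
  by apply: (cts_near (@Theta_cts (cinv c x) t0)); exact: cdom_near.
have /near_itv[eps eps0 H] := n1.
exists (ball t0 eps); first exact: nbhsx_ballx.
move=> t1 t2 _ _; rewrite -ball_normE => h1 h2 S1.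
have HD s : `|t0 - s| < eps -> fdom c d (tp s x) by move=> /H hs; split; rewrite ?tp_l tp_r.
apply: (Sch t2 d ad (HD _ h2)); rewrite -(S1 d ad (HD _ h1)).
apply/matrixP => i j; apply/esym.
apply: (@zero_derive_eq R (fun s => P d s i j) t1 t2) => s sI.
have sD := HD s (norm_seg h1 h2 sI).
pose Q z := (fjac c d z *m G d (frep c d z) *m (fjac c d z)^T) i j.
have sQ : smo (fdom c d) Q.
  have oD := fdom_open ac ad.
  apply: (msmoM oD (msmoM oD (fjac_smo ac ad) _) (msmo_tr (fjac_smo ac ad)) i j).
  apply: (msmo_comp oD (fun x => frep_dom ad (z := x)) (frep_smo ac ad)); exact: metric_smo.
have := is_derive_tp (smo_diff sQ sD).
by rewrite -mpdE frep_killing // mxE.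
Qed.

End Flow.

(** * The space of solutions of dimension two *)

Section Locality.
Context {R : realType} {n : nat}.
Variables (A B : set 'rV[R]_n) (G : 'rV[R]_n -> 'M[R]_n).
Hypotheses (oA : open A) (oB : open B) (BA : B `<=` A).

Lemma christoffel_loc k i j x : B x -> christoffel A G k i j x = christoffel B G k i j x.
Proof.
move=> Bx; have Ax := BA Bx; congr (_ * _); apply: eq_bigr => l _.
by rewrite !pderivE.
Qed.

Lemma ricci_loc x : B x -> ricci A G x = ricci B G x.
Proof.
move=> Bx; have Ax := BA Bx; apply/matrixP => j k; rewrite !mxE; apply: eq_bigr => i _.
have E a l c d : pderiv A a (christoffel A G l c d) x = pderiv B a (christoffel B G l c d) x.
  rewrite !pderivE //; apply: (pd_ext _ oB Bx) => y By; exact: christoffel_loc.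
rewrite /riemann !E; congr (_ + _); apply: eq_bigr => a _.
by rewrite !christoffel_loc.
Qed.

Lemma hessian_loc f g x : B x -> (forall y, B y -> f y = g y) -> hessian A G f x = hessian B G g x.
Proof.
move=> Bx fg; have Ax := BA Bx; apply/matrixP => i j; rewrite !mxE; congr (_ - _).
  rewrite !pderivE //; apply: (pd_ext _ oB Bx) => y By; rewrite !pderivE //; last exact: BA.
  exact: pd_ext _ _ fg.
apply: eq_bigr => k _; rewrite christoffel_loc // !pderivE //; congr (_ * _).
exact: pd_ext _ _ fg.
Qed.

End Locality.

(** * Positive solutions of [U'' = kappa U] on the line *)

Section PositiveSolutions.
Context {R : realType}.
Variables (U V : R -> R) (kappa : R).
Hypothesis dU : forall t : R, is_derive t 1 U (V t).
Hypothesis dV : forall t : R, is_derive t 1 V (kappa * U t).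
Hypothesis U0 : forall t : R, 0 < U t.

(* A positive concave function on the line is constant. *)
Lemma concave_const : kappa <= 0 -> (forall t, V t = 0) /\ kappa = 0.
Proof.
move=> k0.
have tangent s t : U t <= U s + V s * (t - s).
  have [c cI E] := @MVT_closed R U V s t (fun x _ => dU x).
  have [b bI E2] := @MVT_closed R V (fun x => kappa * U x) s c (fun x _ => dV x).
  have kU : kappa * U b <= 0 by rewrite mulr_le0_ge0 // ltW.
  rewrite -lerBlDl E; have [st|st] := leP s t.
    move: cI; rewrite (min_idPl st) (max_idPr st) => /andP[c1 c2].
    by apply: ler_wpM2r; [rewrite subr_ge0|rewrite -subr_le0 E2 mulr_le0_ge0 // subr_ge0].
  move: cI; rewrite (min_idPr (ltW st)) (max_idPl (ltW st)) => /andP[c1 c2].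
  apply: ler_wnM2r; first by rewrite subr_le0 ltW.
  by rewrite -subr_ge0 E2 mulr_le0 // subr_le0.
have V0 t : V t = 0.
  apply/eqP; apply: contraT => Vt; have := tangent t (t - (U t + 1) / V t).
  have -> : V t * (t - (U t + 1) / V t - t) = - (U t + 1) by field.
  by have := U0 (t - (U t + 1) / V t) => h1 h2; lra.
split=> //; have d0 := dV 0; have : is_derive (0 : R) 1 V 0.
  have -> : V = cst 0 by apply/funext => t.
  exact: is_derive_cst.
by move/(is_derive_uniq d0)/eqP; rewrite mulf_eq0 (gt_eqF (U0 0)) orbF => /eqP.
Qed.

Lemma positive_ge0 : 0 <= kappa.
Proof.
rewrite leNgt; apply/negP => k0; have [_ k1] := concave_const (ltW k0).
by move: k0; rewrite k1 ltxx.
Qed.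

Lemma exp_solution (E : R -> R) k : (forall t : R, is_derive t 1 E (k * E t)) ->
  forall t, E t = E 0 * expR (k * t).
Proof.
move=> dE t; have : E t * expR (- k * t) = E 0 * expR (- k * 0).
  apply: (@zero_derive_eq R (fun t => E t * expR (- k * t)) t 0) => s _.
  have d1 := dE s; have d2 := is_derive_expc (- k) s.
  apply: is_derive_eq.
  by rewrite /GRing.scale /=; ring.
rewrite mulr0 expR0 mulr1 => <-; rewrite -mulrA -expRD mulNr addNr expR0 mulr1 //.
Qed.

(** With [k ^+ 2 = kappa], [V + k U] and [V - k U] are exponentials of rates [k] and [- k] with
    initial values [P] and [N]. Positivity of [U] keeps the first above the second; large positive
    times give [P >= 0], large negative ones [N <= 0], and [P * N] is the discriminant. *)
Lemma positive_discriminant : 0 < kappa -> V 0 ^+ 2 <= kappa * U 0 ^+ 2.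
Proof.
move=> k0; pose k := Num.sqrt kappa; have kp : 0 < k by rewrite sqrtr_gt0.
have kk : k * k = kappa by rewrite -expr2 sqr_sqrtr // ltW.
have dE (s : R) (t : R) : s * s = kappa -> is_derive t 1 (fun t => V t + s * U t) (s * (V t + s * U t)).
  move=> ss; have -> : (fun t => V t + s * U t) = V + s \*: U by [].
  have d1 := dU t; have d2 := dV t; apply: is_derive_eq; rewrite /GRing.scale /= -ss; ring.
have EP := exp_solution (fun t => dE k t kk).
have EN := exp_solution (fun t => dE (- k) t ltac:(by rewrite mulrNN)).
set P := V 0 + k * U 0 in EP; set N := V 0 + - k * U 0 in EN.
have PN t : N * expR (- k * t) < P * expR (k * t).
  rewrite -EP -EN; have := mulr_gt0 kp (U0 t) => h; lra.
have ee t : expR (- k * t) * expR (k * t) = 1 by rewrite -expRD mulNr addNr expR0.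
have P0 : 0 <= P.
  (* The time at which [1 + x <= expR x], with [x = 2 k t = |N / P|], already contradicts the
     comparison of the exponentials. *)
  rewrite leNgt; apply/negP => Pn; pose t := `|N / P| / (2 * k).
  have e1 := expR_ge1Dx (k * t + k * t).
  have t2 : k * t + k * t = `|N / P| by rewrite /t; field; rewrite gt_eqF.
  have := PN t; rewrite -(ltr_pM2r (expR_gt0 (k * t))) -!mulrA ee mulr1 -expRD t2 => h.
  rewrite t2 in e1; have : P * expR `|N / P| <= P * (1 + `|N / P|) by rewrite ler_nM2l.
  have -> : P * (1 + `|N / P|) = P - `|N| by rewrite normrM normfV (ltr0_norm Pn); field; rewrite lt_eqF.
  by have := ler_norm (- N); rewrite normrN => h3; lra.
have N0 : N <= 0.
  rewrite leNgt; apply/negP => Np; pose t := - (`|P / N| / (2 * k)).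
  have e1 := expR_ge1Dx (- k * t + - k * t).
  have t2 : - k * t + - k * t = `|P / N| by rewrite /t; field; rewrite gt_eqF.
  have := PN t; rewrite -(ltr_pM2r (expR_gt0 (- k * t))) -!mulrA [expR (k * t) * _]mulrC ee mulr1 -expRD t2 => h.
  rewrite t2 in e1; have : N * (1 + `|P / N|) <= N * expR `|P / N| by rewrite ler_pM2l.
  have -> : N * (1 + `|P / N|) = N + `|P| by rewrite normrM normfV (gtr0_norm Np); field; rewrite gt_eqF.
  by have := ler_norm P => h3; lra.
have : P * N <= 0 by rewrite mulr_ge0_le0.
by rewrite /P /N -kk => h; lra.
Qed.

End PositiveSolutions.

(** * The Killing field of a pair of solutions *)

Section PairField.
Context {R : realType} {n : nat}.
Variable M : rmanifold R n.
Hypothesis noB : boundary M = set0.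
Variables (lambda m : R).
Local Notation W := (Wspace M lambda m).
Local Notation G := (@metric R n M).
Implicit Types (a b f g w : M -> R) (c d e : chart R M n).

(* The field a grad b - b grad a, and its dual 1-form. *)
Definition xi a b c (x : 'rV[R]_n) : 'cV[R]_n :=
  a (cinv c x) *: dcol (b \o cinv c) x - b (cinv c x) *: dcol (a \o cinv c) x.
Definition Xf a b c (x : 'rV[R]_n) : 'rV[R]_n := (xi a b c x)^T *m invmx (G c x).

Lemma metric_unitc c x : atlas c -> ccod c x -> G c x \in unitmx.
Proof. by move=> ac cx; apply: metric_unit; exact: metric_mt. Qed.

Lemma metric_sym c x : atlas c -> ccod c x -> (G c x)^T = G c x.
Proof. by move=> ac cx; have [] := metric_mt ac cx. Qed.

Lemma Xf_G a b c x : atlas c -> ccod c x -> Xf a b c x *m G c x = (xi a b c x)^T.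
Proof. by move=> ac cx; rewrite mulmxKV // metric_unitc. Qed.

Lemma xi_smo a b c : W a -> W b -> atlas c -> msmo (ccod c) (xi a b c).
Proof.
move=> Wa Wb ac; have oc := ccod_open noB ac.
have sa := W_smo noB Wa ac; have sb := W_smo noB Wb ac.
have H (f g : 'rV[R]_n -> R) : smo (ccod c) f -> smo (ccod c) g -> msmo (ccod c) (fun x => f x *: dcol g x).
  by move=> sf sg; apply: msmoZ => //; exact: dcol_smo.
apply: msmoD => //; first exact: H.
move=> i j; have -> : (fun y => (- (b (cinv c y) *: dcol (a \o cinv c) y)) i j) =
  (fun y => - ((b \o cinv c) y *: dcol (a \o cinv c) y) i j) by apply/funext => y; rewrite oppmxE.
by apply: smoN => //; exact: H.
Qed.

Lemma xi_tr a b c d x : W a -> W b -> atlas c -> atlas d -> ov c d x ->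
  xi a b c x = jac (tr c d) x *m xi a b d (tr c d x).
Proof.
move=> Wa Wb ac ad ox; rewrite /xi (dcol_tr noB Wa.1 ac ad ox) (dcol_tr noB Wb.1 ac ad ox).
by rewrite mulmxBr -!scalemxAr cmapK; case: ox.
Qed.

(** The two terms with [Tw] both carry the product of a and b and cancel. What remains besides the
    connection term is skew in [i] and the component, which is the Killing equation for the dual
    field. *)
Lemma mpd_xi a b c x i : W a -> W b -> atlas c -> ccod c x ->
  mpd i (xi a b c) x = Gam (ccod c) (G c) i x *m xi a b c x +
    (pd i (a \o cinv c) x *: dcol (b \o cinv c) x - pd i (b \o cinv c) x *: dcol (a \o cinv c) x).
Proof.
move=> Wa Wb ac cx; have oc := ccod_open noB ac.
have sa := W_smo noB Wa ac; have sb := W_smo noB Wb ac.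
have wd f : W f -> mpd i (dcol (f \o cinv c)) x =
    Gam (ccod c) (G c) i x *m dcol (f \o cinv c) x + f (cinv c x) *: Tcol (Tw lambda m c) i x.
  move=> Wf; exact: (@Weq_dcol R n (ccod c) (G c) oc (Tw lambda m c) (f \o cinv c) (fun y => W_hess (x := y) Wf ac) i x cx).
have dfx f : W f -> differentiable (f \o cinv c) x by move=> Wf; exact: smo_diff (W_smo noB Wf ac) _.
have ddx f : W f -> mdiff (dcol (f \o cinv c)) x.
  by move=> Wf; apply: msmo_mdiff cx; apply: dcol_smo; exact: (W_smo noB Wf ac).
have E : xi a b c = (fun y => (a \o cinv c) y *: dcol (b \o cinv c) y + (- 1) *: ((b \o cinv c) y *: dcol (a \o cinv c) y)).
  by apply/funext => y; rewrite scaleN1r.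
have dZ f g : W f -> W g -> mdiff (fun y => (f \o cinv c) y *: dcol (g \o cinv c) y) x.
  move=> Wf Wg; apply: msmo_mdiff cx; apply: msmoZ => //; first exact: (W_smo noB Wf ac).
  by apply: dcol_smo; exact: (W_smo noB Wg ac).
rewrite {1}E mpdD; [|exact: dZ|]; last first.
  apply: msmo_mdiff cx; apply: msmoZ => //; first exact: smo_cst.
  by apply: msmoZ => //; apply: dcol_smo.
rewrite (@mpdZ _ _ _ _ (fun=> -1) (fun y => (b \o cinv c) y *: dcol (a \o cinv c) y)); [|exact: differentiable_cst|exact: dZ].
rewrite pd_cst scale0r add0r scaleN1r !mpdZ ?wd; try exact: dfx; try exact: ddx; try by [].
rewrite mulmxBr -!scalemxAr /=.
move: (pd i _ x *: _) (pd i _ x *: _) => A B.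
rewrite !scalerDr !scalerA [b _ * a _]mulrC.
move: (a (cinv c x) *: (_ *m _)) (b (cinv c x) *: (_ *m _)) ((_ * _) *: _) => P Q S.
by apply/matrixP => r s; rewrite !addmxE !oppmxE !addmxE; lra.
Qed.

Lemma Xf_killing a b : W a -> W b -> killing_field (Xf a b).
Proof.
move=> Wa Wb.
have sX c : atlas c -> msmo (ccod c) (Xf a b c).
  move=> ac; have oc := ccod_open noB ac.
  apply: msmoM => //; first by apply: msmo_tr; exact: xi_smo.
  by apply: msmo_invmx => //; [exact: metric_smo|move=> y cy; exact: metric_unitc].
split=> //.
- move=> c d ac ad x ox; rewrite /Xf (xi_tr Wa Wb ac ad ox).
  have dx : ccod d (tr c d x) by have [[h _] _] := ov_tr ac ad ox.
  have cx : ccod c x by case: ox.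
  have uG := metric_unitc ac cx; have uH := metric_unitc ad dx.
  have E := tr_iso noB ac ad ox.
  set J := jac (tr c d) x in E *; set H := G d _ in E uH *.
  have uJ : J \in unitmx.
    by move: uG; rewrite -E -mulmxA unitmx_mul => /andP[].
  rewrite trmx_mul -E -!mulmxA; congr (_ *m _).
  have uJt : J^T \in unitmx by rewrite unitmx_tr.
  have ug : J *m (H *m J^T) \in unitmx by rewrite mulmxA E.
  have JH : J *m H = (J *m (H *m J^T)) *m invmx J^T by rewrite -!mulmxA mulmxV // mulmx1.
  apply: (can_inj (mulmxK uH)); rewrite mulVmx // -!mulmxA JH.
  by rewrite mulKmx // mulmxV.
- move=> c ac x cx; have oc := ccod_open noB ac.
  have sG := metric_smo noB ac.
  set g := G c x; set Xx := Xf a b c x.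
  have sg : g^T = g by exact: metric_sym.
  have dX : mdiff (Xf a b c) x by exact: msmo_mdiff (sX c ac) _.
  have dG : mdiff (G c) x by exact: msmo_mdiff.
  have E1 i : mpd i (Xf a b c) x *m g + Xx *m mpd i (G c) x = (mpd i (xi a b c) x)^T.
    rewrite -mpd_tr -(mpdM i dX dG); apply: (mpd_ext i oc cx) => y cy; exact: Xf_G.
  have E2 i j : (jac (Xf a b c) x *m g) i j = mpd i (xi a b c) x j 0 - (Xx *m mpd i (G c) x) 0 j.
    have := E1 i => /matrixP/(_ 0 j); rewrite addmxE trmxE => <-; rewrite addrK [RHS]mxE mxE.
    by apply: eq_bigr => l _; rewrite jacE mpdE.
  have xiX : xi a b c x = g *m Xx^T by rewrite -[LHS]trmxK -Xf_G // trmx_mul sg.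
  have GX i j : (Gam (ccod c) (G c) i x *m xi a b c x) j 0 = \sum_l Xx 0 l * Low (G c) i x j l.
    rewrite xiX mulmxA GamE //; last by move=> y; exact: metric_mt.
    rewrite mulmxKV ?metric_unitc // mxE; apply: eq_bigr => l _.
    by rewrite trmxE mulrC.
  apply/matrixP => i j; rewrite !addmxE.
  have -> : (g *m (jac (Xf a b c) x)^T) i j = (jac (Xf a b c) x *m g) j i.
    by rewrite -{1}sg -trmx_mul trmxE.
  rewrite !E2 !mpd_xi // !addmxE !oppmxE !scalemxE !dcolE !GX summxE.
  rewrite [(Xx *m mpd i _ x) _ _]mxE [(Xx *m mpd j _ x) _ _]mxE [RHS]mxE.
  rewrite [pd j _ x * pd i _ x]mulrC [pd j (b \o _) x * _]mulrC.
  set p1 := pd i _ x * pd j _ x; set p2 := pd i _ x * pd j _ x.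
  have S : \sum_l Xx 0 l * Low (G c) i x j l + \sum_l Xx 0 l * Low (G c) j x i l
     - \sum_l Xx 0 l * mpd i (G c) x l j - \sum_l Xx 0 l * mpd j (G c) x l i +
     \sum_l (Xx 0 l *: mpd l (G c) x) i j = 0.
    rewrite -!sumrN -!big_split /=; apply: big1 => l _; rewrite scalemxE !LowE.
    rewrite (mpdG_sym oc (fun y => metric_mt ac (x := y)) i l j cx).
    rewrite (mpdG_sym oc (fun y => metric_mt ac (x := y)) j l i cx).
    rewrite (mpdG_sym oc (fun y => metric_mt ac (x := y)) l j i cx).
    by field.
  by lra.
Qed.

End PairField.

(** * The action of the flow on [W] *)

Section FlowOnW.
Context {R : realType} {n : nat}.
Variable M : rmanifold R n.
Hypothesis noB : boundary M = set0.
Hypothesis complete : rcomplete M.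
Hypothesis conn : connected [set: M].
Variables (lambda m : R).
Local Notation W := (Wspace M lambda m).
Local Notation G := (@metric R n M).
Implicit Types (f g w : M -> R) (c d e : chart R M n).

Section AnyKilling.
Variable X : chart R M n -> 'rV[R]_n -> 'rV[R]_n.
Hypothesis KX : killing_field X.
Local Notation Th := (Theta X).

Lemma Theta_local c e t : atlas c -> atlas e ->
  let D := [set x | fdom X c e (tp t x)] in let phi := fun x => frep X c e (tp t x) in
  [/\ open D, msmo D phi & forall x, D x -> jac phi x *m G e (phi x) *m (jac phi x)^T = G c x].
Proof.
move=> ac ae D phi.
have stp : msmo setT (fun x : 'rV[R]_n => tp t x) by apply: msmo_tp; [exact: smo_cst|exact: msmo_id].
have ct : continuous (fun x : 'rV[R]_n => tp t x).
  by move=> y; apply: continuous_rV => j; exact: smo_continuous.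
have oD : open D by move/continuousP: ct; apply; exact: fdom_open.
split=> //; last by move=> x; exact: flow_iso.
apply: (@msmo_comp _ _ _ _ _ D (fdom X c e) (frep X c e) (fun x => tp t x)) => //.
  by move=> i j; apply: smo_sub (stp i j).
exact: frep_smo.
Qed.

(** The flow is isometric, and Hessian, Ricci tensor and metric all transform by the same
    Jacobian. *)
Lemma Theta_W w t : W w -> W (fun p => w (Th t p)).
Proof.
move=> Ww.
have loc c x : atlas c -> ccod c x -> exists e, atlas e /\ fdom X c e (tp t x).
  move=> ac cx; have [e ae ex] := rm_cover (Th t (cinv c x)).
  by exists e; split=> //; split; rewrite ?tp_r ?tp_l.
have repr c e y : atlas e -> fdom X c e (tp t y) ->
    ((fun p => w (Th t p)) \o cinv c) y = ((w \o cinv e) \o (fun x => frep X c e (tp t x))) y.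
  by move=> ae yD; rewrite /= cinv_frep // tp_l tp_r.
have into c e y : atlas e -> fdom X c e (tp t y) -> ccod e (frep X c e (tp t y)).
  exact: frep_dom.
apply: (W_intro noB (m := m)) => [c ac|c x ac cx].
  move=> k x cx; have [e [ae xD]] := loc c x ac cx.
  have [oD sphi iso] := Theta_local t ac ae.
  have : smo [set x | fdom X c e (tp t x)] ((w \o cinv e) \o (fun x => frep X c e (tp t x))).
    apply: (smo_comp oD (fun y => into c e y ae) (sphi 0)); exact: (W_smo noB Ww ae).
  move=> /(smo_ext oD (fun y yD => esym (repr c e y ae yD))).
  by move=> /(_ k x xD).
have [e [ae xD]] := loc c x ac cx; have [oD sphi iso] := Theta_local t ac ae.
have oc := ccod_open noB ac.
have sub : [set x | fdom X c e (tp t x)] `<=` ccod c by move=> y [h _]; rewrite tp_r in h.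
rewrite (hessian_loc (G c) oc oD sub xD (fun y yD => repr c e y ae yD)).
have sGD : msmo [set x | fdom X c e (tp t x)] (G c).
  by move=> i j; apply: smo_sub sub _; exact: metric_smo.
have mGD y : [set x | fdom X c e (tp t x)] y -> metric_tensor (G c) y by move=> /sub; exact: metric_mt.
have mGe y : ccod e y -> metric_tensor (G e) y by exact: metric_mt.
rewrite (hessian_pull oD (ccod_open noB ae) (metric_smo noB ae) mGD mGe (fun y => into c e y ae) sphi iso xD (W_smo noB Ww ae)).
rewrite (W_hess Ww ae (into c e x ae xD)) -scalemxAr -scalemxAl.
have -> : w (cinv e (frep X c e (tp t x))) = w (Th t (cinv c x)) by rewrite cinv_frep // tp_l tp_r.
congr (_ *: _); rewrite -scalemxAr -scalemxAl; congr (_ *: _).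
rewrite (ricci_loc (G c) oc oD sub xD).
rewrite (ricci_pull oD (ccod_open noB ae) sGD (metric_smo noB ae) mGD mGe (fun y => into c e y ae) sphi iso xD).
by rewrite mulmxBr mulmxBl -scalemxAr -scalemxAl iso.
Qed.

Definition XD w p : R := derive1 (fun s => w (Th s p)) 0.

Lemma flow_derive w p t c : smooth_fun w -> atlas c -> cdom c (Th t p) ->
  is_derive t 1 (fun s => w (Th s p))
    ((X c (cmap c (Th t p)) *m dcol (w \o cinv c) (cmap c (Th t p))) 0 0).
Proof.
move=> sw ac ct.
have dw : differentiable (w \o cinv c) ((cmap c \o Th^~ p) t) by exact: smo_diff (smooth_funP noB sw ac) (cmapP ac ct).
have := is_derive_curve dw (velP noB KX (Theta_vel noB complete KX p t) ac ct).
have -> : \sum_j X c (cmap c (Th t p)) 0 j * pd j (w \o cinv c) ((cmap c \o Th^~ p) t) =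
   (X c (cmap c (Th t p)) *m dcol (w \o cinv c) (cmap c (Th t p))) 0 0.
  by rewrite mxE; apply: eq_bigr => j _; rewrite dcolE.
apply: near_eq_is_derive.
have n1 : \forall s \near t, cdom c (Th s p).
  by apply: (cts_near (@Theta_cts _ _ _ noB complete _ KX p t)); exact: cdom_near.
by apply: filterS n1 => s cs; rewrite /= cmapK.
Qed.

Lemma XDE w p c : smooth_fun w -> atlas c -> cdom c p ->
  XD w p = (X c (cmap c p) *m dcol (w \o cinv c) (cmap c p)) 0 0.
Proof.
move=> sw ac cp; have := @flow_derive w p 0 c sw ac; rewrite Theta0 // => /(_ cp) d.
by rewrite /XD derive1E; exact: derive_val.
Qed.

Lemma XD_derive w p (t : R) : smooth_fun w -> is_derive t 1 (fun s => w (Th s p)) (XD w (Th t p)).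
Proof.
move=> sw; have [c ac ct] := rm_cover (Th t p).
by rewrite (XDE sw ac ct); exact: flow_derive.
Qed.

Lemma XD_comb al be f g p : smooth_fun f -> smooth_fun g ->
  XD (fun q => al * f q + be * g q) p = al * XD f p + be * XD g p.
Proof.
move=> sf sg; rewrite /XD [LHS]derive1E; apply: derive_val.
have -> : (fun s => al * f (Th s p) + be * g (Th s p)) = al \*: (fun s => f (Th s p)) + be \*: (fun s => g (Th s p)) by [].
have d1 := XD_derive p 0 sf; have d2 := XD_derive p 0 sg; rewrite !Theta0 // in d1 d2.
by apply: is_derive_eq.
Qed.

End AnyKilling.

Section TwoDimensional.
Variables (b0 b1 u0 : M -> R).
Hypotheses (Wb0 : W b0) (Wb1 : W b1) (Wu0 : W u0) (u0_gt0 : forall p, 0 < u0 p).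
Hypothesis span : forall w, W w -> exists al be : R, forall p, w p = al * b0 p + be * b1 p.
Hypothesis indep : forall al be : R, (forall p, al * b0 p + be * b1 p = 0) -> al = 0 /\ be = 0.
Local Notation X := (Xf b0 b1).
Let KX : killing_field X.
Proof. exact: (Xf_killing noB Wb0 Wb1). Qed.
Local Notation Th := (Theta X).
Local Notation D := (XD X).

Lemma b_neq0 p : (b0 p != 0) || (b1 p != 0).
Proof.
apply: contraT; rewrite negb_or !negbK => /andP[/eqP e0 /eqP e1].
have [al [be E]] := span Wu0; have := u0_gt0 p.
by rewrite E e0 e1 !mulr0 addr0 ltxx.
Qed.

(** If [xi] vanishes at p, the solution [b0(p) b1 - b1(p) b0] has zero 1-jet at p and is zero;
    independence makes p a common zero of the basis, against the positive solution. *)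
Lemma xi_neq0 c x : atlas c -> ccod c x -> xi b0 b1 c x != 0.
Proof.
move=> ac cx; apply/eqP => x0; set p := cinv c x.
pose f q := b0 p * b1 q + (- b1 p) * b0 q.
have Wf : W f by exact: W_comb.
have f0 : forall q, f q = 0.
  apply: (@jet0_zero _ _ _ noB lambda m conn f p Wf).
  apply: (@jet0P _ _ _ noB lambda m f c p Wf ac (cinvP ac cx)); first by rewrite /f mulNr mulrC subrr.
  have ds h : W h -> differentiable (h \o cinv c) x by move=> Wh; exact: smo_diff (W_smo noB Wh ac) _.
  rewrite cinvK // -[f \o _]/(fun y => b0 p * (b1 \o cinv c) y + (- b1 p) * (b0 \o cinv c) y).
  rewrite @dcol_comb; [|exact: ds|exact: ds].
  by rewrite scaleNr.
have [h1 h2] : - b1 p = 0 /\ b0 p = 0 by apply: indep => q; rewrite addrC; exact: f0.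
by move: h1 => /eqP; rewrite oppr_eq0 => /eqP h1; have := b_neq0 p; rewrite h2 h1 eqxx.
Qed.

Definition Wr f g p : R := f p * D g p - g p * D f p.

(** [X] is dual to [xi], so [|X|^2] is [xi(X)], which is the Wronskian in the direction of [X]. Thus
    it is positive where [X] is nonzero and constant along the flow with the speed. *)
Lemma spd_Wr c x : atlas c -> ccod c x -> spd X c x = Wr b0 b1 (cinv c x).
Proof.
move=> ac cx; have cp := cinvP ac cx; rewrite /spd Xf_G // -trmx_mul trmxE.
rewrite /Wr !(@XDE _ KX _ _ c) //; [|exact: Wb0.1|exact: Wb1.1].
rewrite cinvK // mulmxBr -!scalemxAr addmxE oppmxE !scalemxE.
by [].
Qed.

Lemma Wr_gt0 p : 0 < Wr b0 b1 p.
Proof.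
have [c ac cp] := rm_cover p; have cx := cmapP ac cp.
rewrite -(cmapK ac cp) -spd_Wr //; have [_ pG] := metric_mt ac cx; apply: pG.
apply/eqP => X0; have := xi_neq0 ac cx; rewrite -[xi _ _ _ _]trmxK -Xf_G // X0.
by rewrite mul0mx trmx0 eqxx.
Qed.

Lemma Wr_const p t : Wr b0 b1 (Th t p) = Wr b0 b1 p.
Proof.
have [c ac cp] := rm_cover p; have [d ad dp] := rm_cover (Th t p).
rewrite -{2}(cmapK ac cp) -(cmapK ad dp) -!spd_Wr; try exact: cmapP; try by [].
have -> : spd X d (cmap d (Th t p)) = spd X c (cmap c (Th 0 p)); last by rewrite Theta0.
apply: (@spd_const _ _ _ noB X KX (Th^~ p) (- (`|t| + 1)) (`|t| + 1) t 0 d c) => //.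
- by move=> s _; exact: Theta_vel.
- by rewrite -ltr_norml ltrDl.
- by rewrite oppr_lt0 ltr_wpDl.
- by rewrite Theta0.
Qed.

(* By Cramer's rule w o Theta_t is a combination of b0, b1 with coefficients
   that are smooth in t. *)
Lemma D_W w : W w -> W (D w).
Proof.
move=> Ww; have W0' := W_zero noB Wb0.
(* Two points at which the values of the basis are independent determine the coefficients. Without
   them, [b1(p) b0 - b0(p) b1] would vanish for every p, against independence, so that case only
   concerns an empty M. *)
have [[p1 [p2 dt]]|nE] := pselect (exists p1 p2, b0 p1 * b1 p2 - b0 p2 * b1 p1 != 0); last first.
  have -> : D w = (fun=> 0) => //.
  apply/funext => p1.
  have [|h1 h2] := @indep (b1 p1) (- b0 p1).
    move=> p; apply/eqP; apply: contraT => h; exfalso; apply: nE; exists p, p1.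
    by move: h; rewrite mulNr [b1 p1 * _]mulrC.
  by have := b_neq0 p1; rewrite h1 -oppr_eq0 h2 eqxx.
set dlt := b0 p1 * b1 p2 - b0 p2 * b1 p1 in dt.
pose c1 p := (b0 p * b1 p2 - b1 p * b0 p2) / dlt.
pose c2 p := (b1 p * b0 p1 - b0 p * b1 p1) / dlt.
have E p t : w (Th t p) = c1 p * w (Th t p1) + c2 p * w (Th t p2).
  have [al [be H]] := span (Theta_W KX t Ww).
  by rewrite !H /c1 /c2 /dlt; field.
have DE p : D w p = c1 p * D w p1 + c2 p * D w p2.
  have sw := Ww.1.
  have d0 := XD_derive KX p 0 sw; have d1 := XD_derive KX p1 0 sw; have d2 := XD_derive KX p2 0 sw.
  rewrite !Theta0 // in d0 d1 d2; apply: (is_derive_uniq d0).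
  have -> : (fun s => w (Th s p)) = c1 p \*: (fun s => w (Th s p1)) + c2 p \*: (fun s => w (Th s p2)).
    by apply/funext => s.
  exact: is_derive_eq.
have -> : D w = (fun p => ((b1 p2 * D w p1 - b1 p1 * D w p2) / dlt) * b0 p +
    ((b0 p1 * D w p2 - b0 p2 * D w p1) / dlt) * b1 p).
  by apply/funext => p; rewrite DE /c1 /c2; field.
exact: W_comb.
Qed.

Lemma D_comb al be f g p : W f -> W g ->
  D (fun q => al * f q + be * g q) p = al * D f p + be * D g p.
Proof. by move=> Wf Wg; apply: XD_comb => //; [exact: Wf.1|exact: Wg.1]. Qed.

Lemma D_ext f g p : (forall q, f q = g q) -> D f p = D g p.
Proof. by move=> fg; have -> : f = g by apply/funext. Qed.

Lemma D_derive w p (t : R) : W w -> is_derive t 1 (fun s => w (Th s p)) (D w (Th t p)).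
Proof. by move=> Ww; apply: XD_derive => //; exact: Ww.1. Qed.

(* The Wronskian of b0, b1 is constant along the flow, so D has trace 0. *)
Lemma D_square : exists kappa : R, forall w, W w -> forall p, D (D w) p = kappa * w p.
Proof.
have [x [y E0]] := span (D_W Wb0); have [z [v E1]] := span (D_W Wb1).
have DD0 p : D (D b0) p = x * D b0 p + y * D b1 p by rewrite (D_ext p E0) D_comb.
have DD1 p : D (D b1) p = z * D b0 p + v * D b1 p by rewrite (D_ext p E1) D_comb.
have tr0 p : (x + v) * Wr b0 b1 p = 0.
  have h0 := D_derive p 0 Wb0; have h1 := D_derive p 0 Wb1.
  have k0 := D_derive p 0 (D_W Wb0); have k1 := D_derive p 0 (D_W Wb1).
  rewrite !Theta0 // in h0 h1 k0 k1.
  have d : is_derive (0 : R) 1 (fun s => Wr b0 b1 (Th s p)) (b0 p * D (D b1) p - b1 p * D (D b0) p).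
    have -> : (fun s => Wr b0 b1 (Th s p)) = (fun s => b0 (Th s p)) * (fun s => D b1 (Th s p)) -
       (fun s => b1 (Th s p)) * (fun s => D b0 (Th s p)) by [].
    apply: is_derive_eq.
    have T0 := Theta0 noB complete KX p; rewrite T0 /GRing.scale /=.
    by move: (b0 p) (b1 p) (D b0 p) (D b1 p) (D (D b0) p) (D (D b1) p) => *; ring.
  have : is_derive (0 : R) 1 (fun s => Wr b0 b1 (Th s p)) 0.
    under eq_fun do rewrite Wr_const.
    exact: is_derive_cst.
  by move/(is_derive_uniq d); rewrite DD0 DD1 /Wr E0 E1 => h; lra.
have nt (p : M) : v = - x.
  apply/eqP; rewrite -addr_eq0 addrC; have /eqP := tr0 p.
  by rewrite mulf_eq0 (gt_eqF (Wr_gt0 p)) orbF.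
(* Cayley-Hamilton: the matrix of [D] has trace 0, and this is minus its determinant. *)
exists (x ^+ 2 + y * z) => w Ww p; have vx := nt p.
have [al [be Ew]] := span Ww.
rewrite (@D_ext _ (fun q => al * D b0 q + be * D b1 q)); last first.
  by move=> q; rewrite (D_ext q Ew) D_comb.
rewrite D_comb; [|exact: D_W|exact: D_W].
by rewrite DD0 DD1 E0 E1 Ew vx; ring.
Qed.

Lemma Wr_det al be ga de p : Wr (fun q => al * b0 q + be * b1 q) (fun q => ga * b0 q + de * b1 q) p =
  (al * de - be * ga) * Wr b0 b1 p.
Proof. by rewrite /Wr !D_comb //; ring. Qed.

Lemma Wr_W f g : W f -> W g -> exists C : R, forall p, Wr f g p = C * Wr b0 b1 p.
Proof.
move=> Wf Wg; have [al [be Ef]] := span Wf; have [ga [de Eg]] := span Wg.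
exists (al * de - be * ga) => p; rewrite -Wr_det.
by congr Wr; apply/funext => q.
Qed.

Lemma W_dep f g p0 : W f -> W g -> (exists p, f p != 0) -> Wr f g p0 = 0 ->
  exists c : R, forall p, g p = c * f p.
Proof.
move=> Wf Wg [p1 fp1]; have [al [be Ef]] := span Wf; have [ga [de Eg]] := span Wg.
have -> : f = (fun q => al * b0 q + be * b1 q) by apply/funext.
have -> : g = (fun q => ga * b0 q + de * b1 q) by apply/funext.
rewrite Wr_det => /eqP; rewrite mulf_eq0 (gt_eqF (Wr_gt0 p0)) orbF subr_eq0 => /eqP h.
have [al0|al0] := eqVneq al 0.
  have be0 : be != 0.
    by apply/eqP => be0; move: fp1; rewrite Ef al0 be0 !mul0r addr0 eqxx.
  exists (de / be) => p; have : be * ga = 0 by rewrite -h al0 mul0r.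
  by move/eqP; rewrite mulf_eq0 (negbTE be0) => /eqP ->; rewrite al0; field.
exists (ga / al) => p; have -> : de = be * ga / al by rewrite -h; field.
by field.
Qed.

(** The aim is a positive u with [u^2 - kappa w^2 > 0], the Wronskian of u and w; it excludes
    eigenvectors of [D] when [kappa > 0]. The cases are [kappa = 0], then [u0] and [D u0]
    independent, then [u0] an eigenvector. *)
Lemma pre_adapted (p0 : M) : exists kappa u w, [/\ W u, W w, 0 <= kappa & forall p, 0 < u p] /\
  [/\ forall f, W f -> forall p, D (D f) p = kappa * f p, forall p, D w p = u p,
      forall p, D u p = kappa * w p & forall p, 0 < u p ^+ 2 - kappa * w p ^+ 2].
Proof.
have [kappa DD] := D_square; have WD0 := D_W Wu0.
have ode p : [/\ forall t : R, is_derive t 1 (fun s => u0 (Th s p)) (D u0 (Th t p)),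
   forall t : R, is_derive t 1 (fun s => D u0 (Th s p)) (kappa * u0 (Th t p)) & forall t, 0 < u0 (Th t p)].
  split=> // t; first exact: D_derive.
  by have := D_derive p t WD0; rewrite DD.
have k0 : 0 <= kappa by have [h1 h2 h3] := ode p0; exact: positive_ge0 _ _ h3.
(* For [kappa = 0] the positive solution is constant along the flow. Every [D b] has zero Wronskian
   with it, so a [b] with nonzero [D b] becomes, after scaling, the required [w]. *)
have [k00|kn0] := eqVneq kappa 0.
  have Du0 p : D u0 p = 0.
    have [h1 h2 h3] := ode p; have [|H _] := concave_const h1 h2 h3; first by rewrite k00.
    by have := H 0; rewrite Theta0.
  have [b [Wb Db]] : exists b, W b /\ exists p, D b p != 0.
    apply: contrapT => nE; have := Wr_gt0 p0; rewrite /Wr.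
    have Z f : W f -> D f p0 = 0.
      by move=> Wf; apply/eqP; apply: contraT => h; exfalso; apply: nE; exists f; split=> //; exists p0.
    by rewrite !Z // !mulr0 subrr ltxx.
  have [al Eal] : exists c : R, forall p, D b p = c * u0 p.
    apply: (W_dep (p0 := p0) Wu0 (D_W Wb)); first by exists p0; rewrite gt_eqF.
    by rewrite /Wr DD // Du0 k00 mul0r !mulr0 subrr.
  have al0 : al != 0 by case: Db => p; rewrite Eal mulf_eq0 negb_or => /andP[].
  have Ww : W (fun p => al^-1 * b p + 0 * u0 p) by exact: W_comb.
  exists kappa, u0, (fun p => al^-1 * b p + 0 * u0 p); split=> //; split=> //.
  - by move=> p; rewrite D_comb // Eal mul0r addr0 mulrA mulVf // mul1r.
  - by move=> p; rewrite k00 mul0r.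
  - by move=> p; rewrite k00 mul0r subr0 exprn_gt0.
have kp : 0 < kappa by rewrite lt_neqAle eq_sym kn0.
have J0 p : D u0 p ^+ 2 <= kappa * u0 p ^+ 2.
  have [h1 h2 h3] := ode p; have := positive_discriminant h1 h2 h3 kp.
  by rewrite Theta0.
have JE p : Wr u0 (D u0) p = kappa * u0 p ^+ 2 - D u0 p ^+ 2 by rewrite /Wr DD //; ring.
have [C EC] := Wr_W Wu0 WD0.
(* If [u0] and [D u0] are independent then [w = D u0 / kappa] works: the discriminant is nonnegative
   by positivity along flow lines and nonzero as a nonzero multiple of [Wr b0 b1]. *)
have [C0|C0] := eqVneq C 0; last first.
  have Ww : W (fun p => kappa^-1 * D u0 p + 0 * u0 p) by exact: W_comb.
  exists kappa, u0, (fun p => kappa^-1 * D u0 p + 0 * u0 p); split=> //; split=> //.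
  - by move=> p; rewrite D_comb // DD // mul0r addr0 mulrA mulVf // mul1r.
  - by move=> p; rewrite mul0r addr0 mulrA mulfV // mul1r.
  - move=> p; have Jp : 0 < kappa * u0 p ^+ 2 - D u0 p ^+ 2.
      rewrite lt_neqAle subr_ge0 J0 andbT eq_sym -JE EC mulf_eq0 negb_or C0 /=.
      by rewrite gt_eqF // Wr_gt0.
    have -> : u0 p ^+ 2 - kappa * (kappa^-1 * D u0 p + 0 * u0 p) ^+ 2 =
       (kappa * u0 p ^+ 2 - D u0 p ^+ 2) / kappa by field.
    exact: divr_gt0.
have [mu Emu] : exists c : R, forall p, D u0 p = c * u0 p.
  apply: (W_dep (p0 := p0) Wu0 WD0); first by exists p0; rewrite gt_eqF.
  by rewrite EC C0 mul0r.
have mu2 : mu ^+ 2 = kappa.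
  have := DD _ Wu0 p0; rewrite (@D_ext _ (fun p => mu * u0 p + 0 * u0 p)); last by move=> q; rewrite mul0r addr0.
  rewrite D_comb // Emu mul0r addr0 mulrA -expr2 => /eqP.
  have un : u0 p0 != 0 by rewrite gt_eqF.
  by move=> /eqP; exact: mulIf.
have mu0 : mu != 0 by apply/eqP => h; move: kp; rewrite -mu2 h expr0n ltxx.
(* Otherwise [u0] is an eigenvector for [mu], and [D b - mu b] is one for [- mu]; it is nonzero for
   some [b], as the Wronskian of the basis would vanish. *)
have [b [Wb [p1 Db]]] : exists b, W b /\ exists p, D b p - mu * b p != 0.
  apply: contrapT => nE; have := Wr_gt0 p0; rewrite /Wr.
  have Z f : W f -> D f p0 = mu * f p0.
    move=> Wf; apply/eqP; rewrite -subr_eq0; apply: contraT => h; exfalso; apply: nE.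
    by exists f; split=> //; exists p0.
  by rewrite !Z // => h; move: h; rewrite (_ : _ - _ = 0) ?ltxx //; ring.
pose e p := 1 * D b p + (- mu) * b p.
have We : W e by apply: W_comb => //; exact: D_W.
have De p : D e p = - mu * e p.
  by rewrite /e D_comb ?DD //; [rewrite -mu2; ring|exact: D_W].
have [C' EC'] := Wr_W Wu0 We.
have Ee p : - (2 * mu) * (u0 p * e p) = C' * Wr b0 b1 p by rewrite -EC' /Wr De Emu; ring.
have C'0 : C' != 0.
  apply/eqP => h; have /eqP := Ee p1; rewrite h mul0r !mulf_eq0 oppr_eq0 mulf_eq0 (negbTE mu0) orbF.
  by rewrite pnatr_eq0 (gt_eqF (u0_gt0 p1)) /e mul1r mulNr (negbTE Db).
(* Scaled so that [e1 = Wr b0 b1 / u0], hence positive. Then [u = u0 + e1] and the multiple [w] of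
   [u0 - e1] have discriminant [4 u0 e1]. *)
pose e1 p := (- (2 * mu) / C') * e p + 0 * e p.
have We1 : W e1 by exact: W_comb.
have e1_gt0 p : 0 < e1 p.
  have -> : e1 p = Wr b0 b1 p / u0 p; last by rewrite divr_gt0 ?Wr_gt0.
  have un : u0 p != 0 by rewrite gt_eqF.
  apply: (mulfI C'0); apply: (mulfI un).
  have -> : u0 p * (C' * (Wr b0 b1 p / u0 p)) = C' * Wr b0 b1 p by field.
  by rewrite -Ee /e1; field.
have De1 p : D e1 p = - mu * e1 p by rewrite /e1 D_comb // De; ring.
have Wu : W (fun p => 1 * u0 p + 1 * e1 p) by exact: W_comb.
have Ww : W (fun p => (mu / kappa) * u0 p + (- (mu / kappa)) * e1 p) by exact: W_comb.
exists kappa, (fun p => 1 * u0 p + 1 * e1 p), (fun p => (mu / kappa) * u0 p + (- (mu / kappa)) * e1 p).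
split; split=> //.
- by move=> p; rewrite !mul1r addr_gt0.
- by move=> p; rewrite D_comb // Emu De1 -mu2; field.
- by move=> p; rewrite D_comb // Emu De1; field.
- move=> p; have -> : (1 * u0 p + 1 * e1 p) ^+ 2 - kappa * (mu / kappa * u0 p + - (mu / kappa) * e1 p) ^+ 2 =
     4 * (u0 p * e1 p) by rewrite -mu2; field.
  by rewrite !mulr_gt0.
Qed.

(* The field is that of the pair (u, w) itself after scaling. *)
Theorem adapted_basis (p0 : M) : exists kappa u w, [/\ W u, W w, 0 <= kappa & forall p, 0 < u p] /\
  [/\ forall p, D w p = u p, forall p, D u p = kappa * w p,
      forall p, u p ^+ 2 - kappa * w p ^+ 2 = Wr b0 b1 p,
      forall c x, atlas c -> ccod c x -> xi u w c x = xi b0 b1 c x &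
      forall f, W f -> exists al be : R, forall p, f p = al * u p + be * w p].
Proof.
have [kappa [u [w [[Wu Ww k0 up] [DD Dw Du J]]]]] := pre_adapted p0.
have [al [be Eu]] := span Wu; have [ga [de Ew]] := span Ww.
pose C := al * de - be * ga.
have JE p : u p ^+ 2 - kappa * w p ^+ 2 = C * Wr b0 b1 p.
  rewrite -Wr_det; have -> : (fun q => al * b0 q + be * b1 q) = u by apply/funext => q.
  have -> : (fun q => ga * b0 q + de * b1 q) = w by apply/funext => q.
  by rewrite /Wr Dw Du; ring.
have C0 : 0 < C by have := J p0; rewrite JE pmulr_lgt0 // Wr_gt0.
pose s := (Num.sqrt C)^-1; have s0 : 0 < s by rewrite invr_gt0 sqrtr_gt0.
have sC : s ^+ 2 * C = 1 by rewrite exprVn sqr_sqrtr ?mulVf ?gt_eqF // ltW.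
have sn : s != 0 by rewrite gt_eqF.
have Wsu : W (fun p => s * u p + 0 * u p) by exact: W_comb.
have Wsw : W (fun p => s * w p + 0 * w p) by exact: W_comb.
exists kappa, (fun p => s * u p + 0 * u p), (fun p => s * w p + 0 * w p); split; split=> //.
- by move=> p; rewrite mul0r addr0 mulr_gt0.
- by move=> p; rewrite D_comb // Dw.
- by move=> p; rewrite D_comb // Du; ring.
- move=> p; have -> : (s * u p + 0 * u p) ^+ 2 - kappa * (s * w p + 0 * w p) ^+ 2 =
     s ^+ 2 * (u p ^+ 2 - kappa * w p ^+ 2) by ring.
  by rewrite JE mulrA sC mul1r.
- move=> c x ac cx.
  have dW f : W f -> differentiable (f \o cinv c) x by move=> Wf; exact: smo_diff (W_smo noB Wf ac) _.
  have E f x1 y1 : (forall p, f p = x1 * b0 p + y1 * b1 p) ->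
     dcol (f \o cinv c) x = x1 *: dcol (b0 \o cinv c) x + y1 *: dcol (b1 \o cinv c) x.
    move=> Ef; rewrite -(dcol_comb x1 y1 (dW _ Wb0) (dW _ Wb1)); congr (dcol _ x).
    by apply/funext => y; rewrite /=.
  rewrite /xi (@E (fun p => s * u p + 0 * u p) (s * al) (s * be)); last by move=> p; rewrite Eu; ring.
  rewrite (@E (fun p => s * w p + 0 * w p) (s * ga) (s * de)); last by move=> p; rewrite Ew; ring.
  rewrite Eu Ew; move: (dcol (b0 \o _) _) (dcol (b1 \o _) _) (b0 _) (b1 _) => v0 v1 x0 x1.
  apply/matrixP => i j; rewrite !(addmxE, oppmxE, scalemxE).
  have := sC; rewrite /C expr2 => h.
  have -> : x0 * v1 i j - x1 * v0 i j = (s * s * (al * de - be * ga)) * (x0 * v1 i j - x1 * v0 i j) by rewrite h mul1r.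
  by ring.
- move=> f Wf; have [C1 E1] := Wr_W Wf Ww; have [C2 E2] := Wr_W Wu Wf.
  exists (C1 / C / s), (C2 / C / s) => p.
  have qn : Wr b0 b1 p != 0 by rewrite gt_eqF // Wr_gt0.
  have Cn : C != 0 by rewrite gt_eqF.
  have JW : Wr u w p = C * Wr b0 b1 p by rewrite -JE /Wr Dw Du; ring.
  have Cq : C * Wr b0 b1 p != 0 by rewrite mulf_neq0.
  apply: (mulIf Cq); rewrite -{1}JW.
  have -> : (C1 / C / s * (s * u p + 0 * u p) + C2 / C / s * (s * w p + 0 * w p)) * (C * Wr b0 b1 p) =
    u p * (C1 * Wr b0 b1 p) + w p * (C2 * Wr b0 b1 p) by field; rewrite sn.
  by rewrite -E1 -E2 /Wr; ring.
Qed.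

End TwoDimensional.
End FlowOnW.

(** * Regular level sets *)

Section ImplicitGraph.
Context {R : realType} {k : nat}.
Variable f : 'rV[R]_(1 + k) -> R.
Local Notation dt := (pd (lshift k 0) f).

Lemma tp_el n t (x : 'rV[R]_n) : tp t x 0 (lshift n 0) = t.
Proof. by rewrite row_mxEl mxE. Qed.

Lemma tp_er n t (x : 'rV[R]_n) i : tp t x 0 (rshift 1 i) = x 0 i.
Proof. by rewrite row_mxEr. Qed.

(* The graph is swept out by the flow of e_0 / (d_0 f), which changes f at
   unit speed and fixes the other coordinates; thus no regularity of the
   graph has to be proved by hand. *)
Lemma graph_local l (O : set 'rV[R]_(1 + k)) z1 : open O -> smo O f ->
  (forall z, O z -> dt z != 0) -> O z1 -> f z1 = 0 ->
  exists (e : R) (h : 'rV[R]_k -> R), [/\ 0 < e, cgood l (ball (rsubmx z1) e) h,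
    h (rsubmx z1) = lsubmx z1 0 0 &
    forall y : 'rV[R]_k, ball (rsubmx z1) e y -> O (tp (h y) y) /\ f (tp (h y) y) = 0].
Proof.
move=> oO sf dn Oz fz.
pose X z : 'rV[R]_(1 + k) := (dt z)^-1 *: delta_mx 0 (lshift k 0).
have sX : msmo O X.
  by apply: msmoZ => //; [apply: smoV => //; exact: smo_pd|exact: msmo_cst].
have [d [r [psi [d0 r0 fl cg]]]] := local_flow l oO sX Oz.
have inv z t : `|t| < d -> `|z1 - z| < r ->
    f (psi t z) = f z + t /\ rsubmx (psi t z) = rsubmx z.
  move=> td zr; have btw s : Num.min t 0 <= s <= Num.max t 0 -> `|s| < d.
    by rewrite minC maxC => h; apply: le_lt_trans (norm_le_minmax0 h) _.
  have dpsi s : Num.min t 0 <= s <= Num.max t 0 -> is_derive s 1 (psi^~ z) (X (psi s z)).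
    by move=> /btw sd; have [] := fl s z sd zr.
  have [_ _ p0] := fl 0 z ltac:(by rewrite normr0) zr; split.
    have : f (psi t z) - t = f (psi 0 z) - 0.
      apply: (@zero_derive_eq R (fun s => f (psi s z) - s)) => s sI.
      have [Os _ _] := fl s z (btw s sI) zr.
      have d1 := is_derive_curve (smo_diff sf Os) (dpsi s sI).
      have E : \sum_j X (psi s z) 0 j * pd j f (psi s z) = 1.
        rewrite (bigD1 (lshift k 0)) //= big1 ?addr0.
          by rewrite scalemxE mxE mulr1 mulVf // dn.
        by move=> j jn; rewrite scalemxE mxE (negbTE jn) !(mulr0, mul0r).
      have -> : (fun s => f (psi s z) - s) = (f \o psi^~ z) - id by [].
      by apply: is_derive_eq; rewrite E subrr.
    by rewrite p0 subr0 => <-; rewrite subrK.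
  apply/rowP => j; rewrite -[in RHS]p0; apply: (@zero_derive_eq R (fun s => rsubmx (psi s z) 0 j)) => s sI.
  have := is_derive_coord j (is_derive_rsub (dpsi s sI)).
  by rewrite !mxE !mulr0.
pose zy (y : 'rV[R]_k) := tp (lsubmx z1 0 0) y.
have sz A : msmo A zy by apply: msmo_tp; [exact: smo_cst|exact: msmo_id].
have zy1 : zy (rsubmx z1) = z1 by rewrite /zy tp_eta.
have czy : {for rsubmx z1, continuous zy}.
  by exact: msmo_continuous (sz setT) I.
have NO : \forall y \near rsubmx z1, O (zy y).
  by apply: (cts_near czy); rewrite zy1; exact: open_nbhs_nbhs.
have Nr : \forall y \near rsubmx z1, `|z1 - zy y| < r.
  by have := near_dist czy r0; rewrite zy1.
have Nd : \forall y \near rsubmx z1, `|- f (zy y)| < d.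
  have cf : {for rsubmx z1, continuous (f \o zy)}.
    by apply: continuous_comp => //; rewrite zy1; exact: smo_continuous.
  have := near_dist cf d0; apply: filterS => y /=; rewrite zy1 fz sub0r //.
have : \forall y \near rsubmx z1, O (zy y) /\ (`|z1 - zy y| < r /\ `|- f (zy y)| < d).
  by near=> y; split; [near: y|split; near: y].
case/nbhs_ballP => e /= e0 eB.
exists e, (fun y => lsubmx (psi (- f (zy y)) (zy y)) 0 0).
have E y : ball (rsubmx z1) e y -> tp (lsubmx (psi (- f (zy y)) (zy y)) 0 0) y = psi (- f (zy y)) (zy y).
  move=> /eB [Oy [yr yd]]; have [_ h] := inv _ _ yd yr.
  by rewrite -[RHS]tp_eta h tp_r.
split=> //.
- have -> : (fun y => lsubmx (psi (- f (zy y)) (zy y)) 0 0) =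
     (fun z => psi (lsubmx z 0 0) (rsubmx z) 0 (lshift k 0)) \o (fun y => tp (- f (zy y)) (zy y)).
    by apply/funext => y /=; rewrite tp_l tp_r mxE.
  apply: (cgood_precomp (B := flow_box z1 d r)) (cg _); first exact: ball_open.
    by move=> y /eB [_ [yr yd]]; rewrite /flow_box /= tp_l tp_r.
  apply: msmo_tp (sz _); apply: smoN; first exact: ball_open.
  have oe : open (ball (rsubmx z1) e : set 'rV[R]_k) by exact: ball_open.
  apply: smo_comp => // [y /eB []|j] //; exact: sz.
- have [_ _ p0] := fl 0 z1 ltac:(by rewrite normr0) ltac:(by rewrite subrr normr0).
  by rewrite zy1 fz oppr0 p0.
- move=> y yB; rewrite E //; have [Oy [yr yd]] := eB y yB.
  have [Op _ _] := fl _ _ yd yr; have [h _] := inv _ _ yd yr.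
  by rewrite h subrr.
Unshelve. all: by end_near. Qed.

(** [graph_local] yields regularity of a given order on a neighbourhood depending on the order.
    Since f is strictly monotone on vertical lines in the box, all these graphs coincide with the
    one function [h], which is therefore smooth. *)
Theorem implicit_graph (O : set 'rV[R]_(1 + k)) z0 : open O -> smo O f -> O z0 -> f z0 = 0 -> dt z0 != 0 ->
  exists (e : R) (h : 'rV[R]_k -> R) (U : set 'rV[R]_(1 + k)),
  [/\ 0 < e, smo (ball (rsubmx z0) e) h, open U, U z0 & U `<=` O] /\
  [/\ h (rsubmx z0) = lsubmx z0 0 0, forall y : 'rV[R]_k, ball (rsubmx z0) e y -> U (tp (h y) y) /\ f (tp (h y) y) = 0 &
    forall z, U z -> f z = 0 -> ball (rsubmx z0) e (rsubmx z) /\ h (rsubmx z) = lsubmx z 0 0].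
Proof.
move=> oO sf Oz fz dz.
have : \forall z \near z0, O z /\ dt z != 0.
  have c1 : {for z0, continuous dt} by exact: smo_continuous (smo_pd _ sf) _.
  near=> z; split; near: z; first exact: open_nbhs_nbhs.
  have dz0 : 0 < `|dt z0| by rewrite normr_gt0.
  have := near_dist c1 dz0; apply: filterS => y; apply: contraTneq => ->.
  by rewrite subr0 ltxx.
case/nbhs_ballP => rho /= rho0 rB; pose B : set 'rV[R]_(1 + k) := ball z0 rho.
have oB : open B by exact: ball_open.
have sB : smo B f by apply: smo_sub sf => z /rB [].
have dn z : B z -> dt z != 0 by move=> /rB [].
have Bz : B z0 by exact: ballxx.
have vline z s : B z -> `|lsubmx z0 0 0 - s| < rho -> B (tp s (rsubmx z)).
  move=> /ball_rVP zb sb; apply/ball_rVP; apply: norm_rV_lt => // j; rewrite addmxE oppmxE.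
  case: (split_ordP j) => i ->.
    by rewrite ord1 tp_el; move: sb; rewrite mxE.
  have := coord_le_norm (z0 - z) (rshift 1 i); rewrite addmxE oppmxE.
  by rewrite tp_er mxE => h; apply: le_lt_trans h _.
have uniq z z' : B z -> B z' -> rsubmx z = rsubmx z' -> f z = 0 -> f z' = 0 -> lsubmx z 0 0 = lsubmx z' 0 0.
  move=> Bz1 Bz2 rE f1 f2; apply/eqP; apply: contraT => ne.
  have lb z2 : B z2 -> `|lsubmx z0 0 0 - lsubmx z2 0 0| < rho.
    move=> /ball_rVP h; apply: le_lt_trans h; have := coord_le_norm (z0 - z2) (lshift k 0).
    by rewrite !mxE.
  have vB s : Num.min (lsubmx z 0 0) (lsubmx z' 0 0) <= s <= Num.max (lsubmx z 0 0) (lsubmx z' 0 0) ->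
      B (tp s (rsubmx z)).
    by move=> sI; apply: vline => //; exact: norm_seg (lb _ Bz1) (lb _ Bz2) _.
  have [c cI] := @MVT_closed R (fun s => f (tp s (rsubmx z))) (fun s => dt (tp s (rsubmx z))) _ _
     (fun s sI => is_derive_tp (smo_diff sB (vB s sI))).
  rewrite {1}rE !tp_eta f1 f2 subrr => /esym/eqP; rewrite mulf_eq0 (negbTE (dn _ (vB c cI))) subr_eq0 eq_sym.
  by rewrite (negbTE ne).
have [e [h [e0 _ h0 hB]]] := @graph_local 0 B z0 oB sB dn Bz fz.
pose U := B `&` [set z | ball (rsubmx z0) e (rsubmx z)].
exists e, h, U; split; split=> //.
- move=> l y yB; have [By fy] := hB y yB.
  have [e1 [h1 [e10 cg h11 h1B]]] := @graph_local l.+1 B (tp (h y) y) oB sB dn By fy.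
  rewrite tp_r tp_l in cg h11 h1B.
  have y1 : ball y e1 y by exact: ballxx.
  apply: dk_near (cg y y1); have nB : \forall y' \near y, ball (rsubmx z0) e y'.
    by apply: open_near yB _ => //; exact: ball_open.
  have nB1 : \forall y' \near y, ball y e1 y' by apply: open_near y1 _ => //; exact: ball_open.
  apply: filterS2 nB nB1 => y' b1 b2; have [P1 P2] := hB y' b1; have [P3 P4] := h1B y' b2.
  by have := uniq _ _ P3 P1; rewrite !tp_r !tp_l; exact.
- apply: openI => //; have /continuousP := @continuous_rsub R 1 k; apply; exact: ball_open.
- by split=> //=; exact: ballxx.
- by move=> z [/rB []].
- by move=> y yB; have [By fy] := hB y yB; split=> //; split=> //=; rewrite tp_r.
- move=> z [Bz1 yB] fz1; split=> //; have [By fy] := hB _ yB.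
  by rewrite -(tp_l (h (rsubmx z)) (rsubmx z)); apply: uniq => //; rewrite tp_r.
Unshelve. all: by end_near. Qed.

End ImplicitGraph.

Section Subspace.
Context {T : topologicalType} (A : set T).

Lemma subspace_val_continuous : continuous (fun x : A => val x : T).
Proof. exact: initial_continuous. Qed.

Lemma continuous_to_subspace (S : topologicalType) (g : S -> A) x :
  {for x, continuous (fun y => val (g y) : T)} -> {for x, continuous g}.
Proof.
move=> cg V; rewrite nbhsE => -[W [[Q oQ <-] Wx] WV].
have nQ : nbhs (val (g x) : T) Q by exact: open_nbhs_nbhs.
have h : \forall y \near x, Q (val (g y)) by exact: cg.
have h2 : \forall y \near x, V (g y) by apply: filterS h => y; exact: WV.
exact: h2.
Qed.

Lemma subspace_hausdorff_space : hausdorff_space T -> hausdorff_space A.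
Proof.
rewrite !open_hausdorff => H x y xy; have vxy : val x != val y by [].
have [[U V] [/= Ux Vy] [oU oV d]] := H _ _ vxy.
exists (val @^-1` U, val @^-1` V) => //.
split; [by exists U|by exists V|].
apply/eqP/seteqP; split=> // z [/= h1 h2].
by have : (U `&` V) (val z) by []; move/eqP: d => ->.
Qed.

Lemma subspace_second_countable : @second_countable T -> @second_countable A.
Proof.
case=> B cB [oB bB]; exists [set (fun x => val x) @^-1` U | U in B]; first exact: card_le_trans (card_image_le _ _) _.
split; first by move=> _ [U /oB oU <-]; exists U.
move=> x V; rewrite nbhsE => -[W [[Q oQ <-] Wx] WV].
have [U [BU Ux] UO] := bB (val x) Q (open_nbhs_nbhs (conj oQ Wx)).
by exists (val @^-1` U); [split=> //; exists U|move=> y Uy; apply: WV; exact: UO].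
Qed.

End Subspace.

(** * A regular zero set as a Riemannian manifold *)

Section LevelSet.
Context {R : realType} {k : nat}.
Variable M : rmanifold R (1 + k).
Hypothesis noB : boundary M = set0.
Variable w : M -> R.
Hypothesis sw : smooth_fun w.
Hypothesis reg : forall c p, atlas c -> cdom c p -> w p = 0 -> dcol (w \o cinv c) (cmap c p) != 0.
Local Notation G := (@metric R (1 + k) M).

Definition zeros : set M := [set p | w p = 0].
Local Notation N := (zeros : topologicalType).
Implicit Types (c : chart R M (1 + k)) (d : chart R N k).

Definition to_zeros (q : zeros) (p : M) : zeros :=
  if pselect (zeros p) is left h then exist _ p (mem_set h) else q.

Lemma to_zerosK q p : w p = 0 -> val (to_zeros q p) = p.
Proof. by rewrite /to_zeros; case: pselect. Qed.

Lemma zerosP (q : zeros) : w (val q) = 0.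
Proof. exact: (set_valP q). Qed.

Definition zrep d c (y : 'rV[R]_k) : 'rV[R]_(1 + k) := cmap c (val (cinv d y)).

(** The chart [d] is a graph in the chart [c] of M: [zrep] is the smooth inclusion and [P] a smooth
    left inverse, which makes transition maps smooth and the induced metric definite. Images are
    balls so that segments in coordinates stay in the chart. *)
Definition adapted d c := [/\ atlas c, exists (y : 'rV[R]_k) (e : R), 0 < e /\ ccod d = ball y e,
  msmo (ccod d) (zrep d c), forall p, cdom d p -> cdom c (val p) &
  exists2 P : 'rV[R]_(1 + k) -> 'rV[R]_k, msmo (ccod c) P & forall p, cdom d p -> cmap d p = P (cmap c (val p))].

Definition zatlas : set (chart R N k) := [set d | is_chart d /\ exists c, adapted d c].

(** The induced metric in some chart [c] to which [d] is adapted; by [zmetricE] the choice does not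
    matter. *)
Definition zmetric d (y : 'rV[R]_k) : 'M[R]_k :=
  if pselect (exists c, adapted d c) is left h then
    let c := projT1 (cid h) in jac (zrep d c) y *m G c (zrep d c y) *m (jac (zrep d c) y)^T
  else 1%:M.

Lemma jac_mulmx (Q : 'M[R]_(1 + k)) x : jac (fun z : 'rV[R]_(1 + k) => z *m Q) x = Q.
Proof.
apply/matrixP => i j; rewrite jacE.
under eq_fun do rewrite mxE.
have dc l : differentiable (fun y : 'rV[R]_(1 + k) => y 0 l) x by exact: smo_diff (smo_coord (A := setT) l) I.
rewrite pd_sum => [|l _]; last by apply: differentiableM.
rewrite (bigD1 i) //= big1 ?addr0 => [|l li].
  by rewrite pdM ?pd_cst ?mulr0 ?addr0 ?pd_coord ?eqxx ?mul1r.
by rewrite pdM ?pd_cst ?mulr0 ?addr0 ?pd_coord ?[i == l]eq_sym ?(negbTE li) ?mul0r.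
Qed.

Lemma zatlas_cover (q : N) : exists2 d, zatlas d & cdom d q.
Proof.
have [c ac cq] := rm_cover (val q); have oc := ccod_open noB ac.
set x0 := cmap c (val q); have cx : ccod c x0 by exact: cmapP.
have swc : smo (ccod c) (w \o cinv c) := smooth_funP noB sw ac.
have [i di] : exists i, pd i (w \o cinv c) x0 != 0.
  apply: contrapT => nE; have := reg ac cq (zerosP q); move/negP; apply; apply/eqP/colP => i.
  rewrite dcolE [RHS]mxE; apply/eqP; apply: contraT => h; exfalso; apply: nE; exists i; exact: h.
(* Exchanges coordinate i, in which the derivative of w is nonzero, with the first one, for which
   [implicit_graph] solves. *)
pose Q : 'M[R]_(1 + k) := tperm_mx i (lshift k 0).
have QQ : Q *m Q = 1%:M by rewrite -perm_mxM tperm2 perm_mx1.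
have QK (z : 'rV[R]_(1 + k)) : z *m Q *m Q = z by rewrite -mulmxA QQ mulmx1.
have sQ A : msmo A (fun z => z *m Q).
  move=> a j; have := @msmoM R (1 + k) _ _ _ setT (fun z => z) (fun=> Q) openT (@msmo_id _ _ _) (@msmo_cst _ _ _ _ _ _) a j.
  by apply: smo_sub.
have cQ : continuous (fun z : 'rV[R]_(1 + k) => z *m Q).
  by move=> z; exact: msmo_continuous.
pose f z := w (cinv c (z *m Q)).
pose O : set 'rV[R]_(1 + k) := [set z | ccod c (z *m Q)].
have oO : open O by move/continuousP: cQ; exact.
have sf : smo O f by apply: (@smo_comp R (1 + k) (1 + k) O (ccod c) (w \o cinv c) (fun z => z *m Q)) => // j; exact: sQ.
have z0Q : x0 *m Q *m Q = x0 by [].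
have df : pd (lshift k 0) f (x0 *m Q) = pd i (w \o cinv c) x0.
  have dwx : differentiable (w \o cinv c) (x0 *m Q *m Q) by rewrite z0Q; exact: smo_diff.
  have -> : f = (w \o cinv c) \o (fun z => z *m Q) by [].
  rewrite (pd_comp _ dwx); last exact: msmo_differentiable (sQ setT) I.
  rewrite (bigD1 i) //= big1 ?addr0 => [|j ji]; rewrite -jacE jac_mulmx mxE mxE.
    by rewrite tpermR ?eqxx ?mul1r ?z0Q.
  by rewrite tpermR ?[i == j]eq_sym ?(negbTE ji) ?mul0r.
have [] := @implicit_graph R k f O (x0 *m Q) oO sf; rewrite ?df ?/O ?/f /= ?z0Q ?cmapK //; first exact: zerosP.
move=> e [h [U [[e0 sh oU Uz UO] [hz hU Uh]]]].
set y0 := rsubmx _ in sh hz hU Uh.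
pose gr y : 'rV[R]_(1 + k) := tp (h y) y *m Q.
have sgr : msmo (ball y0 e) gr.
  have oB : open (ball y0 e : set 'rV[R]_k) by exact: ball_open.
  have s1 := msmo_tp sh (@msmo_id R k (ball y0 e)).
  exact: (msmoM oB s1 (@msmo_cst R _ _ _ _ Q)).
have grP (y : 'rV[R]_k) : ball y0 e y -> ccod c (gr y) /\ w (cinv c (gr y)) = 0.
  by move=> yB; have [Uy fy] := hU y yB; split=> //; exact: UO.
pose rs x : 'rV[R]_k := rsubmx (x *m Q : 'rV[R]_(1 + k)).
pose dm : set N := [set p | cdom c (val p) /\ U (cmap c (val p) *m Q)].
have oV : open (cdom c `&` [set p | U (cmap c p *m Q)]).
  have oC : open (cdom c) by exact: chart_open_dom (rm_chart ac).
  apply: (open_preimage_in oC oU) => p cp.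
  apply: (continuous_comp (g := fun z : 'rV[R]_(1 + k) => z *m Q)); last exact: cQ.
  exact: cmap_cts.
have oD : open dm by have /continuousP H := @subspace_val_continuous M zeros; exact: (H _ oV).
have dmP p : dm p -> ball y0 e (rs (cmap c (val p))) /\ gr (rs (cmap c (val p))) = cmap c (val p).
  move=> [cp Up]; have [] := Uh _ Up; first by rewrite QK cmapK //; exact: zerosP.
  by move=> h1 h2; rewrite /gr h2 tp_eta.
pose d := @Chart R N k dm (ball y0 e) (fun p => rs (cmap c (val p))) (fun y => to_zeros q (cinv c (gr y))).
have vcinv (y : 'rV[R]_k) : ball y0 e y -> val (cinv d y) = cinv c (gr y).
  by move=> /grP[_ h1]; exact: to_zerosK.
have rep (y : 'rV[R]_k) : ball y0 e y -> zrep d c y = gr y.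
  by move=> yB; rewrite /zrep vcinv // cinvK; have [] := grP y yB.
exists d => //.
split; last first.
  exists c; split=> //; first by exists y0, e.
  - by apply: msmo_ext sgr => [|y yB]; [exact: ball_open|rewrite rep].
  - by move=> p [].
  - exists rs => // a j.
    apply: (@msmo_comp R (1 + k) (1 + k) 1 k (ccod c) setT (fun z => rsubmx z) (fun x => x *m Q) oc) => //.
    exact: msmo_rsub.
have cdm p : dm p -> {for p, continuous (fun p : N => rs (cmap c (val p)))}.
  move=> [cp _]; apply: (continuous_comp (g := fun z => rsubmx z)); last exact: continuous_rsub.
  apply: (continuous_comp (g := fun z : 'rV[R]_(1 + k) => z *m Q)); last exact: cQ.
  by apply: continuous_comp; [exact: subspace_val_continuous|exact: cmap_cts].
split=> /=.
- exact: oD.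
- by exists (ball y0 e); [exact: ball_open|left].
- by move=> p /dmP[].
- move=> y yB; split; rewrite vcinv //; have [h1 h2] := grP y yB; first exact: cinvP.
  by rewrite cinvK // QK; have [] := hU y yB.
- move=> p dp; have [h1 h2] := dmP p dp; apply: val_inj.
  by rewrite vcinv // h2 cmapK; case: dp.
- move=> y yB; rewrite vcinv //; have [h1 h2] := grP y yB.
  by rewrite cinvK // /rs QK tp_r.
- by apply: continuous_in_subspaceT => p; rewrite inE; exact: cdm.
- apply: continuous_in_subspaceT => y; rewrite inE => yB.
  apply: continuous_to_subspace; have [h1 _] := grP y yB.
  apply: (@continuous_near_eq _ _ (cinv c \o gr)).
    have : \forall y' \near y, ball y0 e y' by apply: open_near yB _ => //; exact: ball_open.
    by apply: filterS => y' y'B; rewrite vcinv.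
  apply: continuous_comp; last exact: cinv_cts.
  by exact: msmo_continuous.
Qed.

Lemma ball_chart_open d c : adapted d c -> open (ccod d).
Proof. by case=> _ [y [e [_ ->]]] _ _ _; exact: ball_open. Qed.

Lemma zrepP d c y : is_chart d -> adapted d c -> ccod d y ->
  [/\ ccod c (zrep d c y), cinv c (zrep d c y) = val (cinv d y) & cdom d (cinv d y)].
Proof.
move=> cd [ac _ _ sub _] dy; have dd := chart_inv cd dy; have cv := sub _ dd.
by split=> //; [exact: cmapP|exact: cmapK].
Qed.

Lemma zrep_tr d c c' y : is_chart d -> adapted d c -> adapted d c' -> ccod d y ->
  ov c c' (zrep d c y) /\ zrep d c' y = tr c c' (zrep d c y).
Proof.
move=> cd a a' dy; have [h1 h2 h3] := zrepP cd a dy; have [_ _ _ sub' _] := a'.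
by split; [split=> //; rewrite h2; exact: sub'|rewrite /tr h2].
Qed.

Lemma zrep_diff d c y : adapted d c -> ccod d y -> differentiable (zrep d c) y.
Proof. by case=> _ _ sz _ _ dy; exact: msmo_differentiable. Qed.

Lemma tr_diff c c' x : atlas c -> atlas c' -> ov c c' x -> differentiable (tr c c') x.
Proof. by move=> ac ac' ox; exact: msmo_differentiable (tr_smo noB ac ac') _. Qed.

Lemma zmetricE d c y : is_chart d -> adapted d c -> ccod d y ->
  zmetric d y = jac (zrep d c) y *m G c (zrep d c y) *m (jac (zrep d c) y)^T.
Proof.
move=> cd a dy; rewrite /zmetric; case: pselect => [h|]; last by case; exists c.
set c' := projT1 (cid h); have a' : adapted d c' by exact: projT2.
have [ox E] := zrep_tr cd a a' dy; have [ac _ _ _ _] := a; have [ac' _ _ _ _] := a'.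
have -> : jac (zrep d c') y = jac (zrep d c) y *m jac (tr c c') (zrep d c y).
  rewrite -jac_comp; [|exact: tr_diff|exact: zrep_diff].
  by apply: (jac_ext (ball_chart_open a) dy) => z dz; have [] := zrep_tr cd a a' dz.
by rewrite E -(tr_iso noB ac ac' ox) trmx_mul !mulmxA.
Qed.

Lemma zjac_inv d c y : is_chart d -> adapted d c -> ccod d y -> exists K, jac (zrep d c) y *m K = 1%:M.
Proof.
move=> cd a dy; have [ac _ _ sub [P sP EP]] := a; have [h1 h2 h3] := zrepP cd a dy.
exists (jac P (zrep d c y)); rewrite -jac_comp; [|exact: msmo_differentiable|exact: zrep_diff].
rewrite -(jac_id y); apply: (jac_ext (ball_chart_open a) dy) => z dz.
by rewrite /= -EP; [exact: chart_invK|exact: chart_inv].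
Qed.

Lemma zmetric_mt d y : zatlas d -> ccod d y -> metric_tensor (zmetric d) y.
Proof.
move=> [cd [c a]] dy; have [h1 h2 h3] := zrepP cd a dy; have [ac _ _ _ _] := a.
have [sG pG] := metric_mt ac h1; have [K JK] := zjac_inv cd a dy.
rewrite /metric_tensor (zmetricE cd a dy); split; first by rewrite !trmx_mul trmxK sG mulmxA.
move=> v v0; have := pG (v *m jac (zrep d c) y); rewrite trmx_mul !mulmxA; apply.
by apply: contraNneq v0 => h; rewrite -(mulmx1 v) -JK mulmxA h mul0mx.
Qed.

Lemma zmetric_smo d : zatlas d -> msmo (ccod d) (zmetric d).
Proof.
move=> [cd [c a]]; have [ac _ sz _ _] := a; have od := ball_chart_open a.
apply: (msmo_ext od (F := fun y => jac (zrep d c) y *m G c (zrep d c y) *m (jac (zrep d c) y)^T)).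
  by move=> y dy; rewrite (zmetricE cd a dy).
have sJ := jac_smo sz; apply: msmoM => //; last exact: msmo_tr.
apply: msmoM => //; apply: (msmo_comp od _ sz (metric_smo noB ac)) => y dy.
by have [] := zrepP cd a dy.
Qed.

Lemma within_open_continuous (S S' : topologicalType) (A : set S) (g : S -> S') x : open A -> A x ->
  {within A, continuous g} -> {for x, continuous g}.
Proof. by move=> oA Ax; rewrite (continuous_open_subspace _ oA) => /(_ x); apply; rewrite inE. Qed.

Lemma ztransition d d' : zatlas d -> zatlas d' ->
  isometric_in [set x | ccod d x /\ cdom d' (cinv d x)] (fun x => cmap d' (cinv d x)) (zmetric d) (zmetric d').
Proof.
move=> [cd [c a]] [cd' [c' a']]; set A := [set x | _]; set phi := fun x => _.
have od := ball_chart_open a; have [ac _ sz sub _] := a; have [ac' _ sz' sub' [P sP EP]] := a'.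
have oA : open A.
  apply: open_preimage_in; [exact: od|exact: chart_open_dom|].
  by move=> x dx; exact: within_open_continuous _ _ (chart_inv_cts cd).
have ovA x : A x -> ov c c' (zrep d c x) /\ cmap c' (val (cinv d x)) = tr c c' (zrep d c x).
  move=> [dx dx']; have [h1 h2 h3] := zrepP cd a dx.
  by split; [split=> //; rewrite h2; exact: sub'|rewrite /tr h2].
have phiA x : A x -> ccod d' (phi x) /\ cinv d' (phi x) = cinv d x.
  by move=> [dx dx']; split; [exact: chart_map|exact: chart_mapK].
have szA : msmo A (zrep d c) by move=> i j; apply: smo_sub (sz i j) => x [].
have str : msmo A (fun x => tr c c' (zrep d c x)).
  by apply: (msmo_comp oA _ szA (tr_smo noB ac ac')) => x /ovA[].
have sphi : msmo A phi.
  apply: (msmo_ext oA (F := fun x => P (tr c c' (zrep d c x)))).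
    by move=> x Ax; rewrite /phi; have [dx dx'] := Ax; rewrite EP //; have [_ ->] := ovA x Ax.
  by apply: (msmo_comp oA _ str sP) => x /ovA[h _]; have [[]] := ov_tr ac ac' h.
apply/(isometric_inP _ _ _ oA); split=> // x Ax; have [dx dx'] := Ax.
have [d'x E'] := phiA x Ax; have [ox E] := ovA x Ax.
rewrite (zmetricE cd a dx) (zmetricE cd' a' d'x).
have JE : jac phi x *m jac (zrep d' c') (phi x) = jac (zrep d c) x *m jac (tr c c') (zrep d c x).
  rewrite -!jac_comp; try exact: zrep_diff; try exact: tr_diff; last exact: msmo_differentiable.
  apply: (jac_ext oA Ax) => z Az; have [_ h] := phiA z Az.
  by rewrite /= /zrep h; have [] := ovA z Az.
rewrite !mulmxA JE -!mulmxA -trmx_mul JE trmx_mul !mulmxA.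
have -> : zrep d' c' (phi x) = tr c c' (zrep d c x) by rewrite /zrep E'.
by rewrite -[_ *m jac (tr c c') _ *m _]mulmxA -[_ *m (_ *m G c' _) *m _]mulmxA tr_iso.
Qed.

Definition zmfd : rmanifold R k.
Proof.
refine (@RManifold R k N zatlas zmetric _ _ _ _ _ _ _).
- exact: subspace_hausdorff_space (@rm_hausdorff R _ M).
- exact: subspace_second_countable (@rm_second_countable R _ M).
- by move=> d [].
- exact: zatlas_cover.
- by move=> d ad y dy; exact: zmetric_mt.
- move=> d ad i j; have [_ [c a]] := ad; apply/(smooth_onP _ (ball_chart_open a)).
  exact: zmetric_smo.
- exact: ztransition.
Defined.

Lemma zmfd_no_boundary : boundary zmfd = set0.
Proof.
apply/seteqP; split=> // q [d [cd [c a]] [dq]]; apply.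
by have od := ball_chart_open a; apply: open_nbhs_nbhs; split=> //; exact: chart_map.
Qed.

End LevelSet.

(** * The line as a space form *)

Section Hyperbolic.
Context {R : realType}.
Variable kappa : R.
Hypothesis k0 : 0 <= kappa.
Let k := Num.sqrt kappa.

(* The solutions of y'' = kappa y with y(0) = 0, y'(0) = 1, resp. y(0) = 1,
   y'(0) = 0. *)
Definition sh (t : R) : R := if kappa == 0 then t else (expR (k * t) - expR (- k * t)) / (2 * k).
Definition ch (t : R) : R := if kappa == 0 then 1 else (expR (k * t) + expR (- k * t)) / 2.
(** The inverse of [sh / ch] on [kappa a^2 < 1], that is [artanh (k a) / k], and the identity in the
    limit case [kappa = 0]. *)
Definition arth (a : R) : R := if kappa == 0 then a else ln ((1 + k * a) / (1 - k * a)) / (2 * k).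

Let kk : k * k = kappa. Proof. by rewrite -expr2 sqr_sqrtr. Qed.
Let kn : kappa != 0 -> k != 0. Proof. by move=> kap0; rewrite sqrtr_eq0 -ltNge lt_neqAle eq_sym kap0. Qed.
Let kp : kappa != 0 -> 0 < k. Proof. by move=> kap0; rewrite sqrtr_gt0 lt_neqAle eq_sym kap0. Qed.
Let ee (t : R) : expR (k * t) * expR (- k * t) = 1. Proof. by rewrite -expRD mulNr subrr expR0. Qed.

Lemma sh0 : sh 0 = 0.
Proof. by rewrite /sh; case: eqP => // _; rewrite !mulr0 subrr mul0r. Qed.

Lemma ch0 : ch 0 = 1.
Proof. by rewrite /ch; case: eqP => // _; rewrite !mulr0 expR0 divff. Qed.

Lemma shN t : sh (- t) = - sh t.
Proof. by rewrite /sh; case: eqP => // _; rewrite !mulrN !mulNr opprK; ring. Qed.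

Lemma chN t : ch (- t) = ch t.
Proof. by rewrite /ch; rewrite !mulrN !mulNr opprK addrC. Qed.

Lemma is_derive_sh (t : R) : is_derive t 1 sh (ch t).
Proof.
rewrite /sh /ch; case: eqP => [_|/eqP kap]; first exact: is_derive_id.
have d1 := is_derive_expc k t; have d2 := is_derive_expc (- k) t.
under eq_fun do rewrite mulrC.
by apply: is_derive_eq; rewrite /GRing.scale /=; field; exact: kn.
Qed.

Lemma is_derive_ch (t : R) : is_derive t 1 ch (kappa * sh t).
Proof.
rewrite /sh /ch; case: eqP => [->|/eqP kap]; first by rewrite mul0r; exact: is_derive_cst.
have d1 := is_derive_expc k t; have d2 := is_derive_expc (- k) t.
under eq_fun do rewrite mulrC.
by apply: is_derive_eq; rewrite /GRing.scale /= -kk; field; exact: kn.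
Qed.

Lemma ch_gt0 t : 0 < ch t.
Proof. by rewrite /ch; case: eqP => // _; rewrite divr_gt0 // addr_gt0 // expR_gt0. Qed.

Lemma ch_sh t : ch t ^+ 2 - kappa * sh t ^+ 2 = 1.
Proof.
rewrite /ch /sh; case: eqP => [->|/eqP kap]; first by rewrite mul0r subr0 expr1n.
have := ee t => h; rewrite -kk; have kn' := kn kap.
have -> : ((expR (k * t) + expR (- k * t)) / 2) ^+ 2 - k * k * ((expR (k * t) - expR (- k * t)) / (2 * k)) ^+ 2
  = expR (k * t) * expR (- k * t) by field.
by [].
Qed.

Lemma sh_eq0 t : sh t = 0 -> t = 0.
Proof.
have [c cI] := @MVT_closed R sh ch 0 t (fun s _ => is_derive_sh s).
rewrite sh0 !subr0 => -> /eqP; rewrite mulf_eq0 (gt_eqF (ch_gt0 c)) => /eqP //.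
Qed.

Lemma arth_dom a : kappa * a ^+ 2 < 1 -> 0 < 1 + k * a /\ 0 < 1 - k * a.
Proof.
move=> lt1; have /andP[b1 b2] : -1 < k * a < 1; last by split; lra.
by rewrite -ltr_norml -(ltr_pXn2r (n := 2)) ?nnegrE // expr1n real_normK ?num_real // exprMn expr2 kk.
Qed.

Lemma arth_sh a : kappa * a ^+ 2 < 1 -> sh (arth a) = a * ch (arth a).
Proof.
rewrite /arth /sh /ch; case: eqP => [_ _|/eqP kap lt1]; first by rewrite mulr1.
have kp' := kp kap; have kn' := kn kap.
have [p1 p2] := arth_dom lt1.
set t := ln _ / _; have E2 : expR (k * t) * expR (k * t) = (1 + k * a) / (1 - k * a).
  have -> : k * t = ln ((1 + k * a) / (1 - k * a)) / 2 by rewrite /t; field.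
  by rewrite -expRD -splitr lnK // posrE divr_gt0.
have E0 : expR (k * t) != 0 by rewrite gt_eqF // expR_gt0.
have EN : expR (- k * t) = (expR (k * t))^-1 by rewrite -[RHS]mulr1 -(ee t) mulKf.
rewrite EN; move: E2 E0; set E := expR _ => E2 E0.
have p2n : 1 - k * a != 0 by rewrite gt_eqF.
apply: (mulIf E0).
have -> : (E - E^-1) / (2 * k) * E = (E * E - 1) / (2 * k) by field; rewrite kn'.
have -> : a * ((E + E^-1) / 2) * E = a * (E * E + 1) / 2 by field.
by rewrite E2; field; rewrite p2n.
Qed.

Lemma continuous_arth a : kappa * a ^+ 2 < 1 -> {for a, continuous arth}.
Proof.
rewrite /arth; case: eqP => [_ _|/eqP kap lt1]; first exact: cvg_id.
have [p1 p2] := arth_dom lt1.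
apply: cvgMl; apply: continuous_comp; last by apply: continuous_ln; rewrite divr_gt0.
apply: cvgM; first by apply: cvgD; [exact: cvg_cst|apply: cvgMr; exact: cvg_id].
apply: cvgV; first by rewrite gt_eqF.
by apply: cvgB; [exact: cvg_cst|apply: cvgMr; exact: cvg_id].
Qed.

(* Variation of constants. *)
Lemma linear_ode (a b : R -> R) : (forall t : R, is_derive t 1 a (b t)) ->
  (forall t : R, is_derive t 1 b (kappa * a t)) ->
  forall t, a t = ch t * a 0 + sh t * b 0 /\ b t = ch t * b 0 + kappa * sh t * a 0.
Proof.
move=> da db t.
have E1 : ch t * a t - sh t * b t = a 0.
  have : ch t * a t - sh t * b t = ch 0 * a 0 - sh 0 * b 0.
    apply: (@zero_derive_eq R (fun t => ch t * a t - sh t * b t)) => s _.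
    have d1 := is_derive_ch s; have d2 := is_derive_sh s; have d3 := da s; have d4 := db s.
    apply: is_derive_eq.
    by rewrite /GRing.scale /=; ring.
  by rewrite ch0 sh0 mul1r mul0r subr0.
have E2 : ch t * b t - kappa * sh t * a t = b 0.
  have : ch t * b t - kappa * sh t * a t = ch 0 * b 0 - kappa * sh 0 * a 0.
    apply: (@zero_derive_eq R (fun t => ch t * b t - kappa * sh t * a t)) => s _.
    have d1 := is_derive_ch s; have d2 := is_derive_sh s; have d3 := da s; have d4 := db s.
    have -> : (fun t => ch t * b t - kappa * sh t * a t) = ch * b - (kappa \*: sh) * a by [].
    apply: is_derive_eq.
    by rewrite -[(kappa \*: sh) s]/(kappa * sh s) /GRing.scale /=; ring.
  by rewrite ch0 sh0 mul1r mulr0 mul0r subr0.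
have cs := ch_sh t.
split.
  have -> : ch t * a 0 + sh t * b 0 = (ch t ^+ 2 - kappa * sh t ^+ 2) * a t by rewrite -E1 -E2; ring.
  by rewrite cs mul1r.
have -> : ch t * b 0 + kappa * sh t * a 0 = (ch t ^+ 2 - kappa * sh t ^+ 2) * b t by rewrite -E1 -E2; ring.
by rewrite cs mul1r.
Qed.

(** Each function is, up to a constant, the derivative of the other, so the orders of
    differentiability are raised for both together. *)
Lemma smo_ch_sh n (j : 'I_n) A : smo A (fun y : 'rV[R]_n => ch (y 0 j)) /\ smo A (fun y : 'rV[R]_n => sh (y 0 j)).
Proof.
have dcj (y : 'rV[R]_n) : differentiable (fun y : 'rV[R]_n => y 0 j) y by exact: smo_diff (smo_coord (A := setT) j) I.
have dd (f df : R -> R) (y : 'rV[R]_n) : (forall t : R, is_derive t 1 f (df t)) ->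
    differentiable (fun y : 'rV[R]_n => f (y 0 j)) y /\
    forall i, pd i (fun y => f (y 0 j)) y = (i == j)%:R * df (y 0 j).
  move=> dff; have df1 : differentiable f (y 0 j) by apply/derivable1_diffP.
  have dfc : differentiable (fun y : 'rV[R]_n => f (y 0 j)) y by exact: differentiable_comp.
  split=> // i; rewrite pdE //.
  rewrite @diff_comp //= diff_coordE mxE /= eq_sym.
  have -> : (i == j)%:R * df (y 0 j) = (i == j)%:R *: (df (y 0 j) : R^o) by [].
  rewrite -[in RHS](derive_val (is_derive := dff (y 0 j))) deriveE // -linearZ; congr ('d f _ _).
  by rewrite /GRing.scale /= mulr1.
have H l : (forall y, dk l (fun y => ch (y 0 j)) y) /\ (forall y, dk l (fun y => sh (y 0 j)) y).
  elim: l => [|l [IH1 IH2]].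
    by split=> y; [have [] := dd _ _ y is_derive_ch|have [] := dd _ _ y is_derive_sh].
  split=> y; split; [by have [] := dd _ _ y is_derive_ch| |by have [] := dd _ _ y is_derive_sh|].
    move=> i; have -> : pd i (fun y => ch (y 0 j)) = (fun y => ((i == j)%:R * kappa) * sh (y 0 j)).
      by apply/funext => z; have [_ ->] := dd _ _ z is_derive_ch; rewrite mulrA.
    exact: (@ckZ _ _ l setT _ _ openT (fun z _ => IH2 z)).
  move=> i; have -> : pd i (fun y => sh (y 0 j)) = (fun y => (i == j)%:R * ch (y 0 j)).
    by apply/funext => z; have [_ ->] := dd _ _ z is_derive_sh.
  exact: (@ckZ _ _ l setT _ _ openT (fun z _ => IH1 z)).
by split=> l y _; have [h1 h2] := H l.
Qed.

End Hyperbolic.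

(** * The real line as fibre *)

Section Line.
Context {R : realType}.

Definition line_chart : chart R R 1 := Chart setT setT (fun t : R => t%:M : 'rV[R]_1) (fun y : 'rV[R]_1 => y 0 0).

Lemma scalar00 t : (t%:M : 'rV[R]_1) 0 0 = t.
Proof. by rewrite mxE. Qed.

Lemma scalar00K (y : 'rV[R]_1) : (y 0 0)%:M = y.
Proof. by apply/rowP => j; rewrite !ord1 scalar00. Qed.

Lemma continuous_scalar_rV1 : continuous (fun t : R => t%:M : 'rV[R]_1).
Proof.
move=> t; apply: continuous_rV => j; rewrite ord1.
have -> : (fun t => (t%:M : 'rV[R]_1) 0 0) = id by apply/funext => s; rewrite scalar00.
exact: cvg_id.
Qed.

Lemma line_chartP : is_chart line_chart.
Proof.
split=> //=; first exact: openT.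
- by exists setT; [exact: openT|left].
- by move=> t _; rewrite scalar00.
- by move=> y _; rewrite scalar00K.
- by apply: continuous_subspaceT; exact: continuous_scalar_rV1.
- by apply: continuous_subspaceT => y; exact: coord_continuous.
Qed.

Lemma R_second_countable : @second_countable R.
Proof.
exists [set (fun ab => [set x : R | ratr ab.1 < x < ratr ab.2]) ab | ab in setT].
  by apply: (card_le_trans (card_image_le _ _)); exact: countableP.
split.
  move=> _ [[a b] _ <-] /=.
  have -> : [set x : R | ratr a < x < ratr b] = [set x | ratr a < x] `&` [set x | x < ratr b].
    by apply/seteqP; split=> x /= => [/andP[]|[-> ->]].
  by apply: openI.
move=> x V /near_itv [e e0 eV].
have [a /andP[a1 a2]] : exists a : rat, x - e < ratr a < x.
  by have [a] := @rat_in_itvoo R (x - e) x ltac:(by rewrite ltrBlDr ltrDl); exists a.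
have [b /andP[b1 b2]] : exists b : rat, x < ratr b < x + e.
  by have [b] := @rat_in_itvoo R x (x + e) ltac:(by rewrite ltrDl); exists b.
exists [set y : R | ratr a < y < ratr b].
  by split; [exists (a, b)|rewrite /= a2].
by move=> y /andP[y1 y2]; apply: eV; rewrite ltr_norml; lra.
Qed.

Lemma jac_id_on y : jac (fun z : 'rV[R]_1 => (z 0 0)%:M : 'rV[R]_1) y = 1%:M.
Proof. by have -> : (fun z : 'rV[R]_1 => (z 0 0)%:M : 'rV[R]_1) = id; [apply/funext => z; rewrite scalar00K|rewrite jac_id]. Qed.

Definition line : rmanifold R 1.
Proof.
refine (@RManifold R 1 R [set line_chart] (fun _ _ => 1%:M) _ _ _ _ _ _ _).
- exact: Rhausdorff.
- exact: R_second_countable.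
- by move=> c ->; exact: line_chartP.
- by exists line_chart.
- move=> c -> x _; split; first exact: trmx1.
  move=> v v0; rewrite mulmx1 mxE big_ord1 mxE -expr2 exprn_even_gt0 //=.
  by apply: contraNneq v0 => h; apply/eqP/rowP => j; rewrite ord1 mxE.
- move=> c -> i j; apply/(smooth_onP _ openT); exact: smo_cst.
- move=> c c' -> ->; set A := [set x | _].
  have -> : A = setT by apply/seteqP.
  apply/(isometric_inP _ _ _ openT); split=> [i j|x _] /=.
    rewrite ord1 ord1.
    have -> : (fun y : 'rV[R]_1 => ((y 0 0)%:M : 'rV[R]_1) 0 0) = (fun y => y 0 0) by apply/funext => z; rewrite scalar00.
    exact: smo_coord.
  by rewrite jac_id_on mulmx1 trmx1 mul1mx.
Defined.

Lemma line_no_boundary : boundary line = set0.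
Proof. by apply/seteqP; split=> // q [d -> [_]]; apply; rewrite interiorT. Qed.

Lemma line_christoffel k i j x : christoffel (ccod line_chart) (fun=> 1%:M) k i j x = 0.
Proof.
rewrite /christoffel big1 ?mulr0 // => l _.
by rewrite !(pderivE _ _ openT) // !pd_cst addr0 subr0 mulr0.
Qed.

Lemma line_ricci x : ricci (ccod line_chart) (fun=> 1%:M) x = 0.
Proof.
apply/matrixP => j k; rewrite !mxE; apply: big1 => i _; rewrite !ord1 /riemann addrN add0r.
by apply: big1 => a _; rewrite subrr.
Qed.

Lemma line_hessian (f : 'rV[R]_1 -> R) x : hessian (ccod line_chart) (fun=> 1%:M) f x 0 0 = pd 0 (pd 0 f) x.
Proof.
rewrite mxE big1 ?subr0 => [|l _]; last by rewrite line_christoffel mul0r.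
rewrite pderivE //; last exact: openT.
by apply: (pd_ext _ openT) => // y _; rewrite pderivE //; exact: openT.
Qed.

(** In dimension 1 the Ricci term vanishes and the Hessian of the flat line is the second
    derivative. For [mu = - m kappa] the equation is [v'' = kappa v], solved by [ch] and [sh]. *)
Lemma line_WP mu m (v : line -> R) : Wspace line mu m v <->
  smo setT (fun y : 'rV[R]_1 => v (y 0 0)) /\
  forall y, pd 0 (pd 0 (fun y : 'rV[R]_1 => v (y 0 0))) y = - mu / m * v (y 0 0).
Proof.
split=> [[sv H]|[sv H]].
  split=> [|y]; first by apply/(smooth_onP _ openT); exact: (sv line_chart).
  have := H line_chart erefl y I => /matrixP/(_ 0 0).
  by rewrite line_hessian line_ricci sub0r scalemxE oppmxE scalemxE mxE /= => ->; ring.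
split=> [c ->|c -> x _]; first by apply/(smooth_onP _ openT).
apply/matrixP => i j; rewrite !ord1 line_hessian line_ricci sub0r scalemxE oppmxE scalemxE mxE eqxx.
by rewrite [LHS]H /=; ring.
Qed.

Lemma is_derive_line_fun (f : 'rV[R]_1 -> R) (t : R) : differentiable f (t%:M) ->
  is_derive t 1 (fun s : R => f s%:M) (pd 0 f t%:M).
Proof.
move=> df; have := @is_derive_curve R _ f (fun s => s%:M) t 1%:M df.
rewrite big_ord1 scalar00 mul1r; apply; apply: is_derive_rV => j; rewrite ord1 scalar00.
under eq_fun do rewrite scalar00.
exact: is_derive_id.
Qed.

Section LineSolutions.
Variables (kappa m : R).
Hypotheses (k0 : 0 <= kappa) (m0 : 0 < m).
Local Notation mu := (- (m * kappa)).

Lemma line_W_span (v : line -> R) : Wspace line mu m v ->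
  exists a b : R, forall t : R, v t = a * ch kappa t + b * sh kappa t.
Proof.
move=> /line_WP[sv Hv]; pose f (y : 'rV[R]_1) := v (y 0 0).
have d1 (t : R) : is_derive t 1 v (pd 0 f t%:M).
  have := @is_derive_line_fun f t (smo_diff sv I).
  by under eq_fun do rewrite /f scalar00.
have d2 (t : R) : is_derive t 1 (fun s : R => pd 0 f s%:M) (kappa * v t).
  have := @is_derive_line_fun (pd 0 f) t (smo_diff (smo_pd 0 sv) I).
  by rewrite Hv scalar00 opprK (_ : m * kappa / m = kappa) //; field; rewrite gt_eqF.
exists (v 0), (pd 0 f 0%:M) => t; have [-> _] := linear_ode k0 d1 d2 t.
by ring.
Qed.

Lemma line_W_comb a b : Wspace line mu m (fun t => a * ch kappa t + b * sh kappa t).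
Proof.
have [sc ss] := smo_ch_sh k0 (0 : 'I_1) setT.
have sf : smo setT (fun y : 'rV[R]_1 => a * ch kappa (y 0 0) + b * sh kappa (y 0 0)).
  by apply: smoD; [exact: openT| |]; apply: smoM => //; try exact: openT; exact: smo_cst.
apply/line_WP; split=> // y; set f := fun y => _ in sf *.
have P1 z : pd 0 f z = a * (kappa * sh kappa (z 0 0)) + b * ch kappa (z 0 0).
  have := @is_derive_line_fun f (z 0 0) (smo_diff sf I); rewrite scalar00K => h.
  apply: (is_derive_uniq h).
  under eq_fun do rewrite /f scalar00.
  have e1 := is_derive_ch k0 (z 0 0); have e2 := is_derive_sh k0 (z 0 0).
  exact: is_derive_eq.
have h := @is_derive_line_fun (pd 0 f) (y 0 0) (smo_diff (smo_pd 0 sf) I).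
rewrite scalar00K in h; rewrite opprK (_ : m * kappa / m = kappa); last by field; rewrite gt_eqF.
apply: (is_derive_uniq h).
under eq_fun do rewrite P1 scalar00 mulrA.
have e1 := is_derive_ch k0 (y 0 0); have e2 := is_derive_sh k0 (y 0 0).
by apply: is_derive_eq; rewrite /GRing.scale /=; ring.
Qed.

Lemma line_has_dim : has_dim (Wspace line mu m) 2.
Proof.
exists (pair_fun (ch kappa) (sh kappa)); split.
- move=> i; rewrite /pair_fun; case: eqP => _.
    have -> : ch kappa = (fun t => 1 * ch kappa t + 0 * sh kappa t) by apply/funext => t; ring.
    exact: line_W_comb.
  have -> : sh kappa = (fun t => 0 * ch kappa t + 1 * sh kappa t) by apply/funext => t; ring.
  exact: line_W_comb.
- apply/lin_indep2P => a b H; have := H 0; rewrite sh0 ch0 mulr1 mulr0 addr0 => a0; split=> //.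
  have := H 1; rewrite a0 mul0r add0r => /eqP; rewrite mulf_eq0 => /orP[/eqP //|/eqP h].
  by have := sh_eq0 k0 h => /eqP; rewrite oner_eq0.
- move=> v /line_W_span[a [b E]]; exists (fun i => if i == 0 then a else b) => t.
  by rewrite big_ord_recl big_ord1.
Qed.

End LineSolutions.

Lemma sqrt_rV1 (v : 'rV[R]_1) : Num.sqrt ((v *m 1%:M *m v^T) 0 0) = `|v 0 0|.
Proof. by rewrite mulmx1 mxE big_ord1 mxE sqrtr_sqr. Qed.

Lemma line_curve_le (p q : line) L : curve_length p q L -> `|(q : R) - (p : R)| <= L.
Proof.
elim=> {p q L} [p|p L c g ac gc dg cg _ IH]; first by rewrite subrr normr0.
move: ac IH; rewrite /= => -> /= IH.
have cg00 : continuous (fun t => (derive1 g t) 0 0).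
  by move=> t; apply: (@continuous_comp _ _ _ (derive1 g) (fun v => v 0 0)); [exact: cg|exact: coord_continuous].
have dg00 (t : R) : is_derive t 1 (fun t => g t 0 0) ((derive1 g t) 0 0).
  by apply: is_derive_coord; rewrite derive1E.
have E t : Num.sqrt ((derive1 g t *m 1%:M *m (derive1 g t)^T) 0 0) = `|(derive1 g t) 0 0|.
  exact: sqrt_rV1.
have ch : continuous (fun t => `|(derive1 g t) 0 0|).
  by move=> t; apply: continuous_comp; [exact: cg00|exact: norm_continuous].
have [H [H0 dH]] := primitive_ex ch.
have -> : (fun t => Num.sqrt ((derive1 g t *m 1%:M *m (derive1 g t)^T) 0 0)) = (fun t => `|(derive1 g t) 0 0|).
  by apply/funext => t.
rewrite (Rintegral01_le ch dH).
have B : `|g 1 0 0 - g 0 0 0| <= H 1 - H 0.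
  apply: (@derive_norm_le _ (fun t => g t 0 0) _ _ 0 1 ler01) => t _; split; first exact: dH.
  by exists ((derive1 g t) 0 0).
have -> : g 1 0 0 - p = (g 1 0 0 - g 0 0 0) + (g 0 0 0 - p) by ring.
by apply: (le_trans (ler_normD _ _)); rewrite addrC; exact: lerD.
Qed.

Lemma line_segment (p q : line) : curve_length p q `|(q : R) - (p : R)|.
Proof.
pose d : 'rV[R]_1 := ((q : R) - (p : R))%:M; pose g t : 'rV[R]_1 := (p : R)%:M + t *: d.
have dg (t : R) : is_derive t 1 g d.
  apply: is_derive_rV => j; rewrite ord1.
  have -> : (fun t => g t 0 0) = cst p + (fun t => d 0 0 * t).
    by apply/funext => s; rewrite addmxE scalemxE scalar00 mulrC.
  by have h := is_derive_mulc (d 0 0) t; apply: is_derive_eq; rewrite add0r.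
have E : derive1 g = cst d by apply/funext => t; rewrite derive1E; apply: derive_val.
have := @curve_lengthS R 1 line p 0 line_chart g erefl (fun _ _ => I).
rewrite E => H; have : curve_length p (g 1 0 0 : line) (0 + \int[lebesgue_measure]_(t in `[0, 1]) Num.sqrt ((d *m 1%:M *m d^T) 0 0)).
  apply: H; [by []|by exact: cst_continuous|].
  have -> : cinv line_chart (g 0) = p by rewrite /= /g scale0r addr0 scalar00.
  exact: curve_length0.
set K := Num.sqrt _.
rewrite (@Rintegral01_le R (cst K) ( *%R K) (fun t => @cst_continuous _ _ K t) (fun t => is_derive_mulc K t)).
have -> : K = `|d 0 0| by exact: sqrt_rV1.
rewrite mulr0 mulr1 subr0 add0r.
by rewrite /g scale1r addmxE !scalar00 addrC subrK.
Qed.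

(** Curves are at least as long as the distance of their ends, and segments attain it; so Riemannian
    Cauchy sequences are Cauchy sequences of reals. *)
Lemma line_complete : rcomplete line.
Proof.
move=> x Hx.
have cx : cvgn x.
  apply: cauchy_cvg; apply/cauchy_exP => e e0; have [n0 Hn] := Hx e e0.
  exists (x n0); exists n0 => // i /= hi.
  have /ereal_inf_lt[_ [L CL <-]] := Hn i n0 hi (leqnn _); rewrite lte_fin => Le.
  by apply: le_lt_trans (line_curve_le CL) _.
exists (lim (x @ \oo)) => e e0.
have /cvgrPdist_lt/(_ e e0)[n0 _ Hn] := cx; exists n0 => i hi.
apply: (@le_lt_trans _ _ (`|(lim (x @ \oo) : R) - x i|%:E)).
  by apply: ereal_inf_lbound; exists `|(lim (x @ \oo) : R) - x i| => //; exact: line_segment.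
exact: Hn.
Qed.

Lemma line_space_form : space_form line.
Proof.
split; [exact: line_no_boundary|exact: connected_R|exact: line_complete|].
exists 0 => c /= -> x _ l k i j; rewrite mul0r !ord1 /riemann addrN add0r.
by apply: big1 => a _; rewrite subrr.
Qed.

End Line.

(** * Warped products with the line *)

Section BlockDerivatives.
Context {R : realType} {n : nat}.

Lemma eq_pd i (f g : 'rV[R]_n -> R) x : (forall y, f y = g y) -> pd i f x = pd i g x.
Proof. by move=> fg; have -> : f = g by apply/funext. Qed.

Lemma mpd_block p1 p2 q1 q2 (A : 'rV[R]_n -> 'M[R]_(p1, q1)) (B : 'rV[R]_n -> 'M[R]_(p1, q2))
    (C : 'rV[R]_n -> 'M[R]_(p2, q1)) (D : 'rV[R]_n -> 'M[R]_(p2, q2)) i x :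
  mpd i (fun y => block_mx (A y) (B y) (C y) (D y)) x =
  block_mx (mpd i A x) (mpd i B x) (mpd i C x) (mpd i D x).
Proof.
apply/matrixP => a b; rewrite mpdE; case: (split_ordP a) => a' ->; case: (split_ordP b) => b' ->;
  rewrite ?(block_mxEul, block_mxEur, block_mxEdl, block_mxEdr) mpdE; apply: eq_pd => y;
  by rewrite ?(block_mxEul, block_mxEur, block_mxEdl, block_mxEdr).
Qed.

Lemma mpd_col p1 p2 q (A : 'rV[R]_n -> 'M[R]_(p1, q)) (B : 'rV[R]_n -> 'M[R]_(p2, q)) i x :
  mpd i (fun y => col_mx (A y) (B y)) x = col_mx (mpd i A x) (mpd i B x).
Proof.
apply/matrixP => a b; rewrite mpdE; case: (split_ordP a) => a' ->;
  rewrite ?(col_mxEu, col_mxEd) mpdE; apply: eq_pd => y; by rewrite ?(col_mxEu, col_mxEd).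
Qed.

Lemma msmo_block p1 p2 q1 q2 S (A : 'rV[R]_n -> 'M[R]_(p1, q1)) (B : 'rV[R]_n -> 'M[R]_(p1, q2))
    (C : 'rV[R]_n -> 'M[R]_(p2, q1)) (D : 'rV[R]_n -> 'M[R]_(p2, q2)) :
  msmo S A -> msmo S B -> msmo S C -> msmo S D -> msmo S (fun y => block_mx (A y) (B y) (C y) (D y)).
Proof.
move=> sA sB sC sD a b; case: (split_ordP a) => a' ->; case: (split_ordP b) => b' ->.
- by have -> : (fun y => block_mx (A y) (B y) (C y) (D y) (lshift p2 a') (lshift q2 b')) = (fun y => A y a' b')
    by apply/funext => y; rewrite block_mxEul.
- by have -> : (fun y => block_mx (A y) (B y) (C y) (D y) (lshift p2 a') (rshift q1 b')) = (fun y => B y a' b')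
    by apply/funext => y; rewrite block_mxEur.
- by have -> : (fun y => block_mx (A y) (B y) (C y) (D y) (rshift p1 a') (lshift q2 b')) = (fun y => C y a' b')
    by apply/funext => y; rewrite block_mxEdl.
- by have -> : (fun y => block_mx (A y) (B y) (C y) (D y) (rshift p1 a') (rshift q1 b')) = (fun y => D y a' b')
    by apply/funext => y; rewrite block_mxEdr.
Qed.

End BlockDerivatives.

(** * Curvature and Hessian of the metric [f^2 dt^2 + g] *)

Section WarpedMetric.
Context {R : realType} {k : nat}.
Variables (D : set 'rV[R]_k) (g : 'rV[R]_k -> 'M[R]_k) (f : 'rV[R]_k -> R).
Hypotheses (oD : open D) (sg : msmo D g) (mg : forall x, D x -> metric_tensor g x).
Hypotheses (sf : smo D f) (f0 : forall x, D x -> 0 < f x).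
Local Notation n := (1 + k)%N.
Local Notation l0 := (lshift k (0 : 'I_1)).

Definition wdom : set 'rV[R]_n := [set z | D (rsubmx z)].
Definition wmetric (z : 'rV[R]_n) : 'M[R]_n :=
  block_mx (f (rsubmx z) ^+ 2)%:M 0 0 (g (rsubmx z)).
Local Notation Dw := wdom.
Local Notation Gw := wmetric.

Lemma wdom_open : open Dw.
Proof.
have /continuousP H : continuous (fun z : 'rV[R]_n => rsubmx z) by exact: continuous_rsub.
exact: H.
Qed.

Lemma pd_rsub (h : 'rV[R]_k -> R) z : differentiable h (rsubmx z) ->
  pd l0 (fun z : 'rV[R]_n => h (rsubmx z)) z = 0 /\
  forall a, pd (rshift 1 a) (fun z : 'rV[R]_n => h (rsubmx z)) z = pd a h (rsubmx z).
Proof.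
move=> dh.
have dc : differentiable (fun z : 'rV[R]_n => h (rsubmx z)) z.
  apply: (@differentiable_comp _ _ _ _ (fun z => rsubmx z) h) => //.
  exact: msmo_differentiable (@msmo_rsub R 1 k setT) I.
rewrite -(tp_eta z) in dc *; split=> [|a].
  apply: (is_derive_uniq (is_derive_tp dc)).
  under eq_fun do rewrite tp_r.
  exact: is_derive_cst.
by rewrite -(pd_tp _ dc) tp_r; apply: eq_pd => y; rewrite tp_r.
Qed.

Lemma mpd_rsub p q (F : 'rV[R]_k -> 'M[R]_(p, q)) z : mdiff F (rsubmx z) ->
  mpd l0 (fun z : 'rV[R]_n => F (rsubmx z)) z = 0 /\
  forall a, mpd (rshift 1 a) (fun z : 'rV[R]_n => F (rsubmx z)) z = mpd a F (rsubmx z).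
Proof.
move=> dF; split=> [|a]; apply/matrixP => i j; rewrite !mpdE ?mxE.
  exact: (pd_rsub (dF i j)).1.
exact: (pd_rsub (h := fun y => F y i j) (dF i j)).2.
Qed.

Lemma msmo_comp_rsub p q (F : 'rV[R]_k -> 'M[R]_(p, q)) : msmo D F -> msmo Dw (fun z => F (rsubmx z)).
Proof.
move=> sF; apply: (@msmo_comp R n k p q Dw D F (fun z => rsubmx z)) => //; first exact: wdom_open.
exact: msmo_rsub.
Qed.

Definition wgrad (x : 'rV[R]_k) : 'rV[R]_k := (dcol f x)^T *m invmx (g x).

(** The connection of the warped metric in the fibre direction, and below in the base directions;
    [wGamE] confirms them by uniqueness of the Levi-Civita connection. *)
Definition wGamT (z : 'rV[R]_n) : 'M[R]_n :=
  block_mx (0 : 'M[R]_1) ((- f (rsubmx z)) *: wgrad (rsubmx z)) ((f (rsubmx z))^-1 *: dcol f (rsubmx z)) 0.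
Definition wGamN a (z : 'rV[R]_n) : 'M[R]_n :=
  block_mx (pd a f (rsubmx z) / f (rsubmx z))%:M 0 0 (Gam D g a (rsubmx z)).

Lemma wmetric_mt z : Dw z -> metric_tensor Gw z.
Proof.
move=> Dz; have [sgx pg] := mg Dz; rewrite /Gw; split.
  by rewrite tr_block_mx !trmx0 sgx tr_scalar_mx.
move=> v v0; rewrite -(hsubmxK v) mul_row_block !mulmx0 addr0 add0r tr_row_mx mul_row_col addmxE.
have -> : (lsubmx v *m (f (rsubmx z) ^+ 2)%:M *m (lsubmx v)^T) 0 0 = (f (rsubmx z) * lsubmx v 0 0) ^+ 2.
  by rewrite mul_mx_scalar mxE big_ord1 trmxE scalemxE; ring.
have [r0|r0] := eqVneq (rsubmx v) 0.
  rewrite r0 !mul0mx [X in _ + X]mxE addr0 exprn_even_gt0 //=; apply: mulf_neq0; first by rewrite gt_eqF ?f0.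
  apply: contraNneq v0 => l00; rewrite -(hsubmxK v) r0.
  have -> : lsubmx v = 0 by apply/matrixP => i j; rewrite !ord1 l00 mxE.
  by rewrite row_mx0.
by have := pg _ r0; have := sqr_ge0 (f (rsubmx z) * lsubmx v 0 0) => h1 h2; lra.
Qed.

Lemma wmetric_smo : msmo Dw Gw.
Proof.
apply: msmo_block; try exact: msmo_cst; last exact: msmo_comp_rsub.
apply: (@msmo_comp_rsub 1 1 (fun x => (f x ^+ 2)%:M)) => i j; rewrite !ord1.
under eq_fun do rewrite scalar00.
exact: smoM.
Qed.

Let df x : D x -> differentiable f x. Proof. exact: smo_diff. Qed.
Let ddf x : D x -> mdiff (dcol f) x. Proof. exact: msmo_mdiff (dcol_smo sf). Qed.
Let fn x : D x -> f x != 0. Proof. by move=> /f0 h; rewrite gt_eqF. Qed.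

Lemma wGamE z : Dw z -> Gam Dw Gw l0 z = wGamT z /\ forall a, Gam Dw Gw (rshift 1 a) z = wGamN a z.
Proof.
move=> Dz; pose C (i : 'I_n) : 'M[R]_n := match fintype.split i with inl _ => wGamT z | inr a => wGamN a z end.
have CT : C l0 = wGamT z by rewrite /C (unsplitK (inl _)).
have CN a : C (rshift 1 a) = wGamN a z by rewrite /C (unsplitK (inr _)).
have [sgx _] := mg Dz; set x := rsubmx z in sgx *; have Dx : D x by [].
have gu : g x \in unitmx by exact: metric_unit (mg Dx).
suff E i : C i = Gam Dw Gw i z by split=> [|a]; rewrite -E.
apply: (levi_civita_unique wdom_open wmetric_mt Dz) => {i} [i|i j l].
  rewrite /Gw mpd_block !mpd_cst.
  have dF2 : mdiff (fun x => (f x ^+ 2)%:M : 'M[R]_1) x.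
    move=> a b; rewrite !ord1; have -> : (fun x => (f x ^+ 2)%:M 0 (0 : 'I_1)) = (fun x => f x * f x) by apply/funext => y; rewrite scalar00.
    by apply: differentiableM; exact: df.
  have [f1 f2] := mpd_rsub dF2; have [g1 g2] := mpd_rsub (msmo_mdiff sg Dx).
  case: (split_ordP i) => a ->.
    rewrite !ord1 f1 g1 CT tr_block_mx !mulmx_block !mul0mx !trmx0 !mulmx0 !add0r !addr0 add_block_mx.
    rewrite !addr0 /wgrad -/x !trmxZ trmx_mul trmx_inv sgx trmxK; have fx := fn Dx; congr block_mx.
      rewrite -scalemxAl mulmxKV // mul_scalar_mx scalerA -scalerDl (_ : _ + _ = 0) ?scale0r //.
      by field.
    rewrite mul_mx_scalar -scalemxAr mulKVmx // scalerA -scalerDl (_ : _ + _ = 0) ?scale0r //.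
    by field.
  rewrite f2 g2 CN tr_block_mx !mulmx_block !trmx0 !mulmx0 !add0r ?mul0mx add_block_mx !addr0.
  congr block_mx; last by rewrite (metric_compat oD mg _ Dx).
  apply/matrixP => b c; rewrite !ord1 mpdE addmxE tr_scalar_mx -!scalar_mxM !scalar00.
  rewrite (@eq_pd _ _ a (fun y => (f y ^+ 2)%:M 0 0) (fun x => f x * f x)); last by move=> y; rewrite scalar00.
  by rewrite pdM; [field; exact: fn|exact: df|exact: df].
case: (split_ordP i) => a ->; case: (split_ordP j) => b ->; case: (split_ordP l) => c ->;
  rewrite ?ord1 ?CT ?CN ?(block_mxEul, block_mxEur, block_mxEdl, block_mxEdr) //.
- by rewrite scalar00 scalemxE dcolE mulrC.
- by rewrite !mxE.
- by rewrite scalar00 scalemxE dcolE mulrC.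
- by rewrite !mxE.
- by rewrite !mxE.
- exact: Gam_torsion.
Qed.

Lemma wCurvN a b c d z : Dw z ->
  Curv Dw Gw (rshift 1 a) (rshift 1 b) z (rshift 1 c) (rshift 1 d) = Curv D g a b (rsubmx z) c d.
Proof.
move=> Dz; have Dx : D (rsubmx z) by []; rewrite /Curv.
have [_ GN] := wGamE Dz.
have dG e : mdiff (Gam D g e) (rsubmx z) by exact: msmo_mdiff (Gam_smo oD sg mg e) _.
have E e e' : mpd (rshift 1 e) (Gam Dw Gw (rshift 1 e')) z (rshift 1 c) (rshift 1 d) = mpd e (Gam D g e') (rsubmx z) c d.
  rewrite (mpd_ext _ wdom_open Dz (G := wGamN e')); last by move=> y Dy; have [_ ->] := wGamE Dy.
  by rewrite mpd_block block_mxEdr (mpd_rsub (dG e')).2.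
have P e e' : (wGamN e z *m wGamN e' z) (rshift 1 c) (rshift 1 d) = (Gam D g e (rsubmx z) *m Gam D g e' (rsubmx z)) c d.
  by rewrite mulmx_block block_mxEdr mul0mx add0r.
by rewrite !(addmxE, oppmxE) !E !GN !P.
Qed.

Lemma wCurvT b c z : Dw z ->
  Curv Dw Gw (rshift 1 b) l0 z (rshift 1 c) l0 = hessian D g f (rsubmx z) b c / f (rsubmx z).
Proof.
move=> Dz; have Dx : D (rsubmx z) by []; rewrite /Curv.
have [GT GN] := wGamE Dz.
have df1 : differentiable (fun x => (f x)^-1) (rsubmx z) by apply: differentiableV; [exact: df|exact: fn].
have dF : mdiff (fun x => (f x)^-1 *: dcol f x) (rsubmx z).
  apply: msmo_mdiff Dx; apply: msmoZ => //; last exact: dcol_smo.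
  by apply: smoV => // x Dx'.
rewrite [LHS]addmxE [in LHS]addmxE oppmxE.
have -> : mpd (rshift 1 b) (Gam Dw Gw l0) z (rshift 1 c) l0 =
   ((f (rsubmx z))^-1 *: mpd b (dcol f) (rsubmx z) - (pd b f (rsubmx z) / f (rsubmx z) ^+ 2) *: dcol f (rsubmx z)) c 0.
  rewrite (mpd_ext _ wdom_open Dz (G := wGamT)); last by move=> y Dy; have [-> _] := wGamE Dy.
  rewrite mpd_block block_mxEdl (mpd_rsub dF).2 mpdZ //; last exact: ddf.
  by rewrite pdV ?fn //; [rewrite mulNr scaleNr addrC|exact: df].
have -> : mpd l0 (Gam Dw Gw (rshift 1 b)) z (rshift 1 c) l0 = 0.
  rewrite (mpd_ext _ wdom_open Dz (G := wGamN b)); last by move=> y Dy; have [_ ->] := wGamE Dy.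
  by rewrite mpd_block block_mxEdl mpd_cst mxE.
rewrite subr0 [X in _ + X]addmxE oppmxE GT GN !mulmx_block !mul0mx !add0r !addr0 !block_mxEdl.
rewrite hessianE // mul_mx_scalar -scalemxAr !(addmxE, oppmxE, scalemxE) !dcolE.
by field; exact: fn.
Qed.

(** The trace over base directions is that of the base; the fibre direction contributes
    [- Hess f / f] by [wCurvT]. *)
Lemma wricciN b c z : Dw z ->
  ricci Dw Gw z (rshift 1 b) (rshift 1 c) = ricci D g (rsubmx z) b c - hessian D g f (rsubmx z) b c / f (rsubmx z).
Proof.
move=> Dz; have Dx : D (rsubmx z) by [].
rewrite !ricciE //; last exact: wdom_open.
rewrite big_split_ord /= big_ord1 addrC; congr (_ + _); last by rewrite Curv_anti oppmxE wCurvT.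
by apply: eq_bigr => a _; rewrite wCurvN.
Qed.

(** The curvature component required here is the transpose of that in [wCurvT]; skewness of the
    lowered curvature converts one into the other with the factor [- f^2], and tracing with the
    inverse metric gives the Laplacian. *)
Lemma wricciT z : Dw z ->
  ricci Dw Gw z l0 l0 = - f (rsubmx z) * laplacian D g f (rsubmx z).
Proof.
move=> Dz; have Dx : D (rsubmx z) by []; have gu : g (rsubmx z) \in unitmx by exact: metric_unit (mg Dx).
rewrite ricciE //; last exact: wdom_open.
rewrite big_split_ord /= big_ord1.
have -> : Curv Dw Gw l0 l0 z l0 l0 = 0 by rewrite /Curv !subrr addr0 mxE.
rewrite add0r /laplacian mxtrace_mulC mulr_sumr; apply: eq_bigr => a _.
pose Q := ursubmx (Curv Dw Gw (rshift 1 a) l0 z : 'M[R]_(1 + k)).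
have E : Q *m g (rsubmx z) = (- f (rsubmx z)) *: row a (hessian D g f (rsubmx z)).
  apply/rowP => b; have := Curv_lower_anti wdom_open wmetric_smo wmetric_mt (rshift 1 a) l0 Dz.
  move=> /matrixP/(_ l0 (rshift 1 b)); rewrite addmxE [RHS]mxE.
  rewrite mxE big_split_ord /= big_ord1 block_mxEur [X in _ * X]mxE mulr0 add0r.
  rewrite [X in _ + X]mxE big_split_ord /= big_ord1 block_mxEul scalar00 trmxE wCurvT //.
  rewrite [X in _ + (_ + X)]big1 ?addr0 => [|i _]; last by rewrite block_mxEur mxE mul0r.
  move=> /eqP; rewrite addr_eq0 => /eqP h; rewrite mxE scalemxE [in RHS]mxE -[RHS](_ : - (f (rsubmx z) ^+ 2 * (hessian D g f (rsubmx z) a b / f (rsubmx z))) = _).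
    by rewrite -h; apply: eq_bigr => i _; rewrite block_mxEdr !mxE.
  by field; exact: fn.
have -> : Curv Dw Gw (rshift 1 a) l0 z l0 (rshift 1 a) = Q 0 a by rewrite !mxE.
rewrite -[Q](mulmxK gu) E -scalemxAl scalemxE; congr (_ * _).
by rewrite -row_mul mxE.
Qed.

Section CoshSolution.
Variables (kappa lambda m : R).
Hypotheses (k0 : 0 <= kappa) (m0 : 0 < m).
Local Notation c := (ch kappa).
Local Notation s := (sh kappa).
(** The positive solution u in product coordinates: along the flow it is [ch kappa t] times its
    value f on the slice. *)
Definition wfun (z : 'rV[R]_n) : R := f (rsubmx z) * c (z 0 l0).

Lemma smo_comp_rsub (h : 'rV[R]_k -> R) : smo D h -> smo Dw (fun z => h (rsubmx z)).
Proof.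
move=> sh; apply: (@smo_comp R n k Dw D h (fun z => rsubmx z)) => //; first exact: wdom_open.
exact: msmo_rsub.
Qed.

Lemma pd_time (h dh : R -> R) z : (forall t : R, is_derive t 1 h (dh t)) ->
    differentiable (fun z : 'rV[R]_n => h (z 0 l0)) z ->
  pd l0 (fun z : 'rV[R]_n => h (z 0 l0)) z = dh (z 0 l0) /\
  forall a, pd (rshift 1 a) (fun z : 'rV[R]_n => h (z 0 l0)) z = 0.
Proof.
move=> dhh; rewrite -{1 2 3 4 5}(tp_eta z) => dz; split=> [|a].
  apply: (is_derive_uniq (is_derive_tp dz)); rewrite tp_el.
  by under eq_fun do rewrite tp_el.
rewrite -(pd_tp _ dz); rewrite -[RHS](pd_cst a (h (lsubmx z 0 0)) (rsubmx z)).
by apply: eq_pd => y; rewrite tp_el.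
Qed.

Lemma whessian z : Dw z -> hessian Dw Gw wfun z =
  block_mx (c (z 0 l0) * f (rsubmx z) * (kappa + grad_sqnorm D g f (rsubmx z)))%:M 0 0
    (c (z 0 l0) *: hessian D g f (rsubmx z)).
Proof.
move=> Dz; set x := rsubmx z; have Dx : D x by [].
have [sc ss] := smo_ch_sh k0 l0 Dw.
have gu : g x \in unitmx by exact: metric_unit (mg Dx).
have sfr := smo_comp_rsub sf.
have dcz y : Dw y -> differentiable (fun z : 'rV[R]_n => c (z 0 l0)) y by exact: smo_diff.
have dsz y : Dw y -> differentiable (fun z : 'rV[R]_n => s (z 0 l0)) y by exact: smo_diff.
have dfr y : Dw y -> differentiable (fun z : 'rV[R]_n => f (rsubmx z)) y by exact: smo_diff.
have swf : smo Dw wfun by apply: smoM => //; exact: wdom_open.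
have E y : Dw y -> dcol wfun y = col_mx ((kappa * s (y 0 l0)) *: (f (rsubmx y))%:M : 'cV[R]_1) (c (y 0 l0) *: dcol f (rsubmx y)).
  move=> Dy; have [f1 f2] := pd_rsub (df (x := rsubmx y) Dy).
  have [c1 c2] := pd_time (is_derive_ch k0) (dcz y Dy).
  apply/colP => i; rewrite dcolE pdM; [|exact: dfr|exact: dcz].
  case: (split_ordP i) => a ->.
    by rewrite !ord1 f1 c1 mul0r add0r col_mxEu scalemxE scalar00 mulrC.
  by rewrite f2 c2 mulr0 addr0 col_mxEd scalemxE dcolE mulrC.
have sdf := dcol_smo sf.
have dA : mdiff (fun z => (f (rsubmx z))%:M : 'cV[R]_1) z.
  move=> a b; rewrite !ord1; have -> : (fun z : 'rV[R]_n => ((f (rsubmx z))%:M : 'cV[R]_1) 0 0) = (fun z => f (rsubmx z)).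
    by apply/funext => y; rewrite scalar00.
  exact: dfr.
have dB : mdiff (fun z => dcol f (rsubmx z)) z.
  by apply: msmo_mdiff Dz; exact: msmo_comp_rsub.
have dks : differentiable (fun z : 'rV[R]_n => kappa * s (z 0 l0)) z.
  by apply: differentiableM; [exact: differentiable_cst|exact: dsz].
have [f1 f2] := mpd_rsub (ddf Dx).
have [c1 c2] := pd_time (is_derive_ch k0) (dcz z Dz).
have [s1 s2] := pd_time (is_derive_sh k0) (dsz z Dz).
have [F1 F2] := pd_rsub (df Dx).
have [GT GN] := wGamE Dz.
have HI i : mpd i (dcol wfun) z = col_mx ((kappa * pd i (fun z => s (z 0 l0)) z) *: (f x)%:M + (kappa * s (z 0 l0)) *: (pd i (fun z => f (rsubmx z)) z)%:M : 'cV[R]_1)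
    (pd i (fun z => c (z 0 l0)) z *: dcol f x + c (z 0 l0) *: mpd i (fun z => dcol f (rsubmx z)) z).
  rewrite (mpd_ext _ wdom_open Dz E) mpd_col; congr col_mx; last by rewrite mpdZ //; exact: dcz.
  rewrite mpdZ // pdZ; last exact: dsz.
  congr (_ + _ *: _); apply/matrixP => a b; rewrite !ord1 mpdE scalar00; apply: eq_pd => y; by rewrite scalar00.
apply/matrixP => i j; rewrite hessianE //; last exact: wdom_open.
rewrite HI (E z Dz); case: (split_ordP i) => a ->.
  rewrite !ord1 GT c1 s1 f1 F1 mul_block_col !mul0mx ?add0r ?addr0 -/x.
  case: (split_ordP j) => b ->; rewrite addmxE oppmxE ?(col_mxEu, col_mxEd) ?(row_mxEl, row_mxEr).
    rewrite !ord1 !(addmxE, oppmxE, scalemxE) !scalar00 -scalemxAl -scalemxAr !scalemxE /grad_sqnorm.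
    have -> : (wgrad x *m dcol f x) 0 0 = ((\row_i pderiv D i f x) *m invmx (g x) *m (\row_i pderiv D i f x)^T) 0 0.
      have -> : \row_i pderiv D i f x = (dcol f x)^T by apply/rowP => l; rewrite !mxE dcolE pderivE.
      by rewrite trmxK.
    ring.
  rewrite -scalemxAr mul_mx_scalar !(addmxE, oppmxE, scalemxE) [RHS]mxE.
  have := fn Dx => fx; have -> : (0 : 'cV[R]_k) b 0 = 0 by rewrite mxE.
  by field.
rewrite GN c2 s2 f2 F2 mul_block_col !mul0mx ?add0r ?addr0 -/x.
case: (split_ordP j) => b ->; rewrite addmxE oppmxE ?(col_mxEu, col_mxEd) ?(row_mxEl, row_mxEr).
  rewrite !ord1 !(addmxE, oppmxE, scalemxE) mul_scalar_mx !scalemxE !scalar00 [RHS]mxE.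
  by have := fn Dx => fx; field.
by rewrite -scalemxAr !(addmxE, oppmxE, scalemxE) hessianE // !(addmxE, oppmxE, scalemxE); ring.
Qed.

(** The blocks of the equation at time 0. In the base block, [- Hess f / f] from the Ricci tensor
    moves to the left and turns m into [m + 1]; the fibre block is the value of [mu]. *)
Lemma warped_equation x : D x ->
  hessian Dw Gw wfun (tp 0 x) = (wfun (tp 0 x) / m) *: (ricci Dw Gw (tp 0 x) - lambda *: Gw (tp 0 x)) ->
  hessian D g f x = (f x / (m + 1)) *: (ricci D g x - lambda *: g x) /\
  f x * laplacian D g f x + m * grad_sqnorm D g f x + lambda * f x ^+ 2 = - (m * kappa).
Proof.
move=> Dx; have Dz : Dw (tp 0 x) by rewrite /wdom /= tp_r.
have w0 : wfun (tp 0 x) = f x by rewrite /wfun tp_r tp_el ch0 mulr1.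
have fx := fn Dx; have mn : m != 0 by rewrite gt_eqF.
rewrite whessian // w0 tp_el tp_r ch0 mul1r scale1r => H; split.
  apply/matrixP => i j; move/matrixP/(_ (rshift 1 i) (rshift 1 j)): H.
  rewrite block_mxEdr !(scalemxE, addmxE, oppmxE) wricciN // /Gw tp_r block_mxEdr => H.
  have m1 : m + 1 != 0 by rewrite gt_eqF // addr_gt0.
  have -> : hessian D g f x i j = (m * hessian D g f x i j + hessian D g f x i j) / (m + 1) by field.
  by rewrite {1}H; field; rewrite fx m1.
move/matrixP/(_ l0 l0): H; rewrite block_mxEul scalar00 !(scalemxE, addmxE, oppmxE) wricciT // /Gw tp_r.
rewrite block_mxEul scalar00; move: (laplacian _ _ _ _) (grad_sqnorm _ _ _ _) => L Gr H.
apply: (mulfI fx); apply/eqP; rewrite -subr_eq0; apply/eqP.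
have -> : f x * (f x * L + m * Gr + lambda * f x ^+ 2) - f x * - (m * kappa) =
  m * (f x * (kappa + Gr)) + f x * (f x * L + lambda * f x ^+ 2) by ring.
by rewrite H; field.
Qed.

(** The trace of the hypothesis on [Hess f] gives the Laplacian, and then [mu] gives [|grad f|^2];
    with these, both blocks of [whessian] are the same multiple of the metric, and so is the Ricci
    tensor. *)
Lemma warped_einstein z : Dw z ->
  hessian Dw Gw wfun z = (wfun z / m) *: (ricci Dw Gw z - lambda *: Gw z) ->
  hessian D g f (rsubmx z) = (- (lambda * f (rsubmx z) / (m + k%:R))) *: g (rsubmx z) ->
  f (rsubmx z) * laplacian D g f (rsubmx z) + m * grad_sqnorm D g f (rsubmx z) + lambda * f (rsubmx z) ^+ 2 = - (m * kappa) ->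
  ricci Dw Gw z = (k%:R * lambda / (m + k%:R)) *: Gw z.
Proof.
move=> Dz HW HN mu; set x := rsubmx z in HN mu *; have Dx : D x by [].
have fx := fn Dx; have mn : m != 0 by rewrite gt_eqF.
have mk : m + k%:R != 0 by rewrite gt_eqF // ltr_wpDr.
have cn : c (z 0 l0) != 0 by rewrite gt_eqF // ch_gt0.
have gu : g x \in unitmx by exact: metric_unit (mg Dx).
have lap : laplacian D g f x = - (k%:R * lambda * f x / (m + k%:R)).
  by rewrite /laplacian HN -scalemxAr mulVmx // mxtraceZ mxtrace1; field.
have wn : wfun z / m != 0 by rewrite mulf_neq0 ?invr_eq0 // mulf_neq0.
have -> : ricci Dw Gw z = (wfun z / m)^-1 *: hessian Dw Gw wfun z + lambda *: Gw z.
  by rewrite HW scalerA mulVf // scale1r subrK.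
rewrite whessian // HN /Gw /wfun -/x; move: mu lap.
move: (laplacian _ _ _ _) (grad_sqnorm _ _ _ _) (c _) cn (g x) {wn} => L Gr cz cn gx mu lap.
have EG : m * (kappa + Gr) = k%:R * lambda * f x ^+ 2 / (m + k%:R) - lambda * f x ^+ 2.
  have -> : m * (kappa + Gr) = m * kappa + (f x * L + m * Gr + lambda * f x ^+ 2) - f x * L - lambda * f x ^+ 2 by ring.
  by rewrite mu lap; field.
apply/matrixP => i j; rewrite addmxE !scalemxE.
case: (split_ordP i) => a ->; case: (split_ordP j) => b ->; rewrite ?ord1 ?(block_mxEul, block_mxEur, block_mxEdl, block_mxEdr) ?scalar00.
- have -> : (f x * cz / m)^-1 * (cz * f x * (kappa + Gr)) = m * (kappa + Gr) by field; rewrite cn mn.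
  by rewrite EG; field.
- by rewrite !mxE !mulr0 addr0.
- by rewrite !mxE !mulr0 addr0.
- by rewrite !scalemxE; field; rewrite mk mn cn.
Qed.

End CoshSolution.
End WarpedMetric.

Lemma continuous_pair (T U V : topologicalType) (f : T -> U) (g : T -> V) x :
  {for x, continuous f} -> {for x, continuous g} -> {for x, continuous (fun y => (f y, g y))}.
Proof. exact: cvg_pair. Qed.

(** * The product structure swept out by the flow *)

Section Slice.
Context {R : realType} {k : nat}.
Variable M : rmanifold R (1 + k).
Hypotheses (noB : boundary M = set0) (complete : rcomplete M) (conn : connected [set: M]).
Variables (lambda m kappa : R) (X : chart R M (1 + k) -> 'rV[R]_(1 + k) -> 'rV[R]_(1 + k)) (u w : M -> R).
Hypotheses (m0 : 0 < m) (k0 : 0 <= kappa) (KX : killing_field X).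
Local Notation W := (Wspace M lambda m).
Local Notation G := (@metric R (1 + k) M).
Local Notation Th := (Theta X).
Local Notation C := (ch kappa).
Local Notation S := (sh kappa).
Hypotheses (Wu : W u) (Ww : W w) (u0 : forall p, 0 < u p).
Hypothesis XG : forall c x, atlas c -> ccod c x -> X c x *m G c x = (xi u w c x)^T.
Hypotheses (Dw : forall p, XD X w p = u p) (Du : forall p, XD X u p = kappa * w p).
Hypothesis q0 : forall p, 0 < u p ^+ 2 - kappa * w p ^+ 2.
Hypothesis span : forall f, W f -> exists al be : R, forall p, f p = al * u p + be * w p.

Lemma slice_flow p t : w (Th t p) = C t * w p + S t * u p /\ u (Th t p) = C t * u p + kappa * S t * w p.
Proof.
have dw (s : R) : is_derive s 1 (fun s => w (Th s p)) (u (Th s p)).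
  by rewrite -Dw; apply: XD_derive => //; exact: Ww.1.
have du (s : R) : is_derive s 1 (fun s => u (Th s p)) (kappa * w (Th s p)).
  by rewrite -Du; apply: XD_derive => //; exact: Wu.1.
by have := linear_ode k0 dw du t; rewrite Theta0.
Qed.

Lemma slice_regular c p : atlas c -> cdom c p -> w p = 0 -> dcol (w \o cinv c) (cmap c p) != 0.
Proof.
move=> ac cp _; apply/eqP => h; have := XDE noB complete KX Ww.1 ac cp.
by rewrite Dw h mulmx0 mxE => h2; have := u0 p; rewrite h2 ltxx.
Qed.

Definition slice : rmanifold R k := zmfd noB Ww.1 slice_regular.
Local Notation N := slice.
Local Notation pt := (fun b : N => val (b : zeros w) : M).

Lemma slice_no_boundary : boundary N = set0.
Proof. exact: zmfd_no_boundary. Qed.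

Lemma slice_flow0 (b : N) t : w (Th t (pt b)) = S t * u (pt b) /\ u (Th t (pt b)) = C t * u (pt b).
Proof.
have [-> ->] := slice_flow (pt b) t; have wb : w (pt b) = 0 by exact: zerosP.
by rewrite wb !mulr0 addr0 add0r.
Qed.

Lemma Theta_continuous : continuous (fun z : R * M => Th z.1 z.2).
Proof.
move=> [t p]; have [c ac cp] := rm_cover p; have [e ae ep] := rm_cover (Th t p).
pose h z : 'rV[R]_(1 + (1 + k)) := tp z.1 (cmap c z.2).
have ch : {for (t, p), continuous h}.
  apply: continuous_rV => j; case: (split_ordP j) => i ->.
    rewrite ord1; have -> : (fun z => h z 0 (lshift (1 + k) 0)) = fst by apply/funext => z; rewrite tp_el.
    exact: cvg_fst.
  have -> : (fun z => h z 0 (rshift 1 i)) = (fun v : 'rV[R]_(1 + k) => v 0 i) \o (cmap c \o snd).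
    by apply/funext => z; rewrite tp_er.
  apply: continuous_comp; last exact: coord_continuous.
  by apply: continuous_comp; [exact: cvg_snd|exact: cmap_cts].
have fd : fdom X c e (h (t, p)) by split; rewrite ?tp_r ?tp_l ?cmapK //; exact: cmapP.
have nD : \forall z \near (t, p), fdom X c e (h z).
  by apply: (cts_near ch); apply: open_nbhs_nbhs; split=> //; exact: fdom_open.
have nc : \forall z \near (t, p), cdom c z.2.
  by apply: cts_near; [exact: cvg_snd|exact: cdom_near].
apply: (@continuous_near_eq _ _ (cinv e \o (frep X c e \o h))).
  apply: filterS2 nD nc => z fz cz; rewrite /= cinv_frep // tp_l tp_r cmapK //.
apply: continuous_comp; last by apply: cinv_cts => //; exact: frep_dom.
apply: continuous_comp => //; have sm := frep_smo noB complete KX ac ae.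
by exact: msmo_continuous.
Qed.

(** Flowing p backwards by t changes w into [C t * w p - S t * u p], which is 0 when [S t / C t] is
    [w p / u p]; the hypothesis [q0] places this quotient in the domain of [arth]. *)
Definition slice_time p := arth kappa (w p / u p).

Lemma slice_time_w p : w (Th (- slice_time p) p) = 0.
Proof.
have [-> _] := slice_flow p (- slice_time p); rewrite shN chN.
have up : u p != 0 by rewrite gt_eqF.
have := @arth_sh R kappa k0 (w p / u p); rewrite -/slice_time => ->; first by field.
rewrite exprMn exprVn mulrA ltr_pdivrMr ?exprn_gt0 // mul1r -subr_gt0; exact: q0.
Qed.

Lemma slice_time_uniq p s t : w (Th s p) = 0 -> w (Th t p) = 0 -> s = t.
Proof.
move=> ws wt; have [] := slice_flow (Th s p) (t - s); rewrite -ThetaD // subrK wt ws mulr0 add0r.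
move=> /esym/eqP; rewrite mulf_eq0 (gt_eqF (u0 _)) orbF => /eqP h _.
by have := sh_eq0 k0 h => /eqP; rewrite subr_eq0 => /eqP.
Qed.

Definition slice_proj (p : M) : N := exist _ (Th (- slice_time p) p) (mem_set (slice_time_w p)) : zeros w.

Definition slice_map (z : N * line) : M := Th (z.2 : R) (pt z.1).

Lemma slice_mapK (b : N) (t : R) : slice_proj (slice_map (b, t)) = b /\ slice_time (slice_map (b, t)) = t.
Proof.
have wb : w (pt b) = 0 by exact: zerosP.
have E : slice_time (slice_map (b, t)) = t.
  apply: oppr_inj; apply: slice_time_uniq; first exact: slice_time_w.
  by rewrite ThetaNK.
by split=> //; apply: val_inj; rewrite /= E ThetaNK.
Qed.

Lemma slice_projK p : slice_map (slice_proj p, slice_time p) = p.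
Proof. by rewrite /slice_map -ThetaD // subrr Theta0. Qed.

Lemma slice_time_continuous : continuous slice_time.
Proof.
move=> p; apply: (@continuous_comp _ _ _ (fun p => w p / u p) (arth kappa)).
  apply: continuousM; first exact: (smooth_fun_cts noB Ww.1).
  by apply: cvgV; [rewrite gt_eqF|exact: (smooth_fun_cts noB Wu.1)].
apply: continuous_arth => //.
by rewrite exprMn exprVn mulrA ltr_pdivrMr ?exprn_gt0 // mul1r -subr_gt0.
Qed.

Lemma slice_proj_continuous : continuous slice_proj.
Proof.
move=> p; apply: continuous_to_subspace.
apply: (@continuous_comp _ _ _ (fun p => (- slice_time p, p)) (fun z => Th z.1 z.2)); last exact: Theta_continuous.
by apply: continuous_pair; [apply: cvgN; exact: slice_time_continuous|exact: cvg_id].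
Qed.

Lemma slice_map_continuous : continuous slice_map.
Proof.
move=> z; apply: (@continuous_comp _ _ _ (fun z : N * line => ((z.2 : R), pt z.1)) (fun z => Th z.1 z.2)); last exact: Theta_continuous.
apply: continuous_pair; first exact: cvg_snd.
apply: (@continuous_comp _ _ _ fst (fun b : zeros w => val b)); first exact: cvg_fst.
exact: subspace_val_continuous.
Qed.

Lemma slice_connected : connected [set: N].
Proof.
have -> : [set: N] = slice_proj @` [set: M].
  apply/seteqP; split=> // b _; exists (slice_map (b, 0)) => //.
  by have [] := slice_mapK b 0.
apply: connected_continuous_connected => //; apply: continuous_subspaceT.
exact: slice_proj_continuous.
Qed.

Definition slice_fun (b : N) : R := u (pt b).
Local Notation f := slice_fun.

Lemma slice_map_quotient : quotient_map slice_map.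
Proof.
split=> [p|V]; first by exists (slice_proj p, slice_time p); exact: slice_projK.
split; first by have /continuousP := slice_map_continuous; apply.
move=> oV; have -> : V = (fun p => (slice_proj p, slice_time p) : N * line) @^-1` (slice_map @^-1` V).
  by apply/seteqP; split=> p /=; rewrite slice_projK.
have /continuousP : continuous (fun p => (slice_proj p, slice_time p) : N * line); last by apply.
by move=> p; apply: continuous_pair; [exact: slice_proj_continuous|exact: slice_time_continuous].
Qed.

Section Local.
Variables (d : chart R N k) (c e : chart R M (1 + k)).
Hypotheses (ad : atlas d) (a : adapted d c) (ae : atlas e).
Let cd : is_chart d. Proof. by case: ad. Qed.
Let ac : atlas c. Proof. by case: a. Qed.
Local Notation phi := (zrep d c).
Local Notation fd := (fun x => f (cinv d x)).

Definition sdom : set 'rV[R]_(1 + k) :=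
  [set z | ccod d (rsubmx z) /\ cdom e (Th (lsubmx z 0 0) (pt (cinv d (rsubmx z))))].
Definition smap (z : 'rV[R]_(1 + k)) : 'rV[R]_(1 + k) := cmap e (Th (lsubmx z 0 0) (pt (cinv d (rsubmx z)))).

Let zt (z : 'rV[R]_(1 + k)) : 'rV[R]_(1 + (1 + k)) := tp (lsubmx z 0 0) (phi (rsubmx z)).

Lemma smapE z : sdom z -> fdom X c e (zt z) /\ smap z = frep X c e (zt z).
Proof.
move=> [dz ez]; have [h1 h2 _] := zrepP cd a dz.
by rewrite /frep /fdom /= tp_l tp_r h2.
Qed.

Let zt_smo : msmo (wdom (ccod d)) zt.
Proof.
apply: msmo_tp; first exact: smo_lsub00.
by apply: msmo_comp_rsub; [exact: ball_chart_open a|case: a].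
Qed.

Lemma sdom_open : open sdom.
Proof.
have oD : open (wdom (ccod d)) by apply: wdom_open; exact: ball_chart_open a.
have -> : sdom = wdom (ccod d) `&` zt @^-1` (fdom X c e).
  apply/seteqP; split=> z; first by move=> sz; split; [case: sz|have [] := smapE sz].
  move=> [dz [h1 h2]]; split=> //; move: h1 h2; rewrite tp_l tp_r.
  by have [_ -> _] := zrepP cd a dz.
apply: open_preimage_in => //; first exact: fdom_open.
by move=> z Dz; exact: msmo_continuous.
Qed.

Lemma smap_smo : msmo sdom smap.
Proof.
apply: (msmo_ext sdom_open (F := fun z => frep X c e (zt z))); first by move=> z /smapE[_ ->].
apply: (@msmo_comp R _ _ _ _ sdom (fdom X c e) (frep X c e) zt sdom_open).
- by move=> z /smapE[].
- by move=> i j; apply: smo_sub (zt_smo i j) => z [].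
- exact: frep_smo.
Qed.

Lemma smap_cod z : sdom z -> ccod e (smap z).
Proof. by move=> [_ ez]; exact: cmapP. Qed.

Lemma cinv_smap z : sdom z -> cinv e (smap z) = Th (lsubmx z 0 0) (pt (cinv d (rsubmx z))).
Proof. by move=> [_ ez]; rewrite cmapK. Qed.

Lemma dcol_compose p q (h : 'rV[R]_q -> R) (psi : 'rV[R]_p -> 'rV[R]_q) x : differentiable h (psi x) ->
  differentiable psi x -> dcol (h \o psi) x = jac psi x *m dcol h (psi x).
Proof.
move=> dh dp; apply/colP => i; rewrite dcolE (pd_comp _ dh dp) mxE.
by apply: eq_bigr => j _; rewrite jacE dcolE.
Qed.

Let fx (t : R) x : ccod d x -> cdom e (Th t (pt (cinv d x))) -> sdom (tp t x).
Proof. by rewrite /sdom /= tp_r tp_l. Qed.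

Let fd_smo : smo (ccod d) fd.
Proof.
have od := ball_chart_open a; have [_ _ sz _ _] := a.
apply: (smo_ext od (f := (u \o cinv c) \o phi)).
  by move=> x dx; have [_ h _] := zrepP cd a dx; rewrite /= h.
apply: (smo_comp od (B := ccod c)) => [x dx|j|]; [by have [] := zrepP cd a dx|exact: sz|exact: (W_smo noB Wu ac)].
Qed.

(** The fibre block is [|X|^2 = u Xw - w Xu = (C^2 - kappa S^2) f^2 = f^2], the mixed blocks vanish
    because [X] is orthogonal to slices, and the base block is the induced metric because the flow
    is isometric. *)
Lemma smap_iso z : sdom z -> jac smap z *m G e (smap z) *m (jac smap z)^T = wmetric (zmetric d) fd z.
Proof.
move=> sz; have [dz ez] := sz; have [_ _ szr _ _] := a; have od := ball_chart_open a.
set t := lsubmx z 0 0 in ez; set x := rsubmx z in dz ez.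
have zE : z = tp t x by rewrite tp_eta.
have [fz psE] := smapE sz; have ytE : zt z = tp t (phi x) by [].
have dsm : differentiable smap z by exact: msmo_differentiable smap_smo _.
have dsj j : differentiable (fun y => smap y 0 j) z by exact: differentiable_coordE.
have dfr : differentiable (frep X c e) (zt z) by exact: msmo_differentiable (frep_smo noB complete KX ac ae) _.
have dfj j : differentiable (fun y => frep X c e y 0 j) (zt z) by exact: differentiable_coordE.
have dph : differentiable phi x by exact: zrep_diff.
have ctp : continuous (fun y => tp t y : 'rV[R]_(1 + k)).
  have s1 : msmo setT (fun y : 'rV[R]_k => tp t y) by apply: msmo_tp; [exact: smo_cst|exact: msmo_id].
  by move=> y; exact: msmo_continuous.
pose D := [set y : 'rV[R]_k | sdom (tp t y)].
have oD : open D by move/continuousP: ctp; apply; exact: sdom_open.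
have Dx : D x by rewrite /D /= -zE.
pose psi y := smap (tp t y).
have dpsi : differentiable psi x.
  have s1 : msmo D (fun y => tp t y) by apply: msmo_tp; [exact: smo_cst|exact: msmo_id].
  have s2 : msmo D psi := @msmo_comp R k (1 + k) 1 (1 + k) D sdom smap (fun y => tp t y) oD (fun _ h => h) s1 smap_smo.
  exact: msmo_differentiable.
set Jf := jac (fun y => frep X c e (tp t y)) (phi x); pose B := jac phi x *m Jf.
have fzt : fdom X c e (tp t (phi x)) by [].
have psiB : jac psi x = B.
  have E : {in D, psi =1 (fun y => frep X c e (tp t y)) \o phi}.
    by move=> y; rewrite inE => Dy; rewrite /psi (smapE Dy).2 /zt tp_l tp_r.
  rewrite (jac_ext oD Dx (fun y Dy => E y (mem_set Dy))) jac_comp //.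
  have [q1 s1 _] := Theta_local noB complete KX t ac ae.
  exact: msmo_differentiable.
have JE : jac smap z = col_mx (X e (smap z)) B.
  apply/matrixP => i j; case: (split_ordP i) => b ->; rewrite ?(col_mxEu, col_mxEd) jacE.
    rewrite !ord1; have h1 := is_derive_tp (f := fun y => smap y 0 j) (t := t) (x := x); rewrite -zE in h1.
    have h2 := is_derive_tp (f := fun y => frep X c e y 0 j) (t := t) (x := phi x); rewrite -ytE in h2.
    have := h2 (dfj j); rewrite (frep_vel noB complete KX j ac ae fz) -psE => h3.
    apply: (is_derive_uniq (h1 (dsj j))); apply: near_eq_is_derive h3.
    have cs : {for t, continuous (fun s => tp s x : 'rV[R]_(1 + k))}.
      apply: continuous_rV => l; case: (split_ordP l) => l' ->.
        rewrite ord1; have -> : (fun s => tp s x 0 (lshift k 0)) = id by apply/funext => s; rewrite tp_el.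
        exact: cvg_id.
      have -> : (fun s => tp s x 0 (rshift 1 l')) = cst (x 0 l') by apply/funext => s; rewrite tp_er.
      exact: cst_continuous.
    have nD : \forall s \near t, sdom (tp s x).
      by apply: (cts_near cs); apply: open_nbhs_nbhs; split=> //; exact: sdom_open.
    by apply: filterS nD => s Ds; rewrite (smapE Ds).2 /zt tp_l tp_r.
  rewrite -psiB jacE; have := @pd_tp R k (fun y => smap y 0 j) t x b; rewrite -zE => <- //.
have es : ccod e (smap z) by exact: smap_cod.
have [sG _] := metric_mt ae es.
(* On the slice at time t, [u = C t f] and [w = S t f] are proportional, so the form [u dw - w du]
   vanishes on its tangent vectors. *)
have BX : B *m xi u w e (smap z) = 0.
  have H h al : smo (ccod e) (h \o cinv e) -> (forall y, D y -> h (Th t (pt (cinv d y))) = al * fd y) ->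
      B *m dcol (h \o cinv e) (smap z) = al *: dcol fd x.
    move=> sh hE; rewrite -psiB {1}zE -dcol_compose //; last by rewrite /psi -zE; exact: smo_diff.
    have -> : dcol ((h \o cinv e) \o psi) x = dcol (fun y => al * fd y + 0 * fd y) x.
      apply/colP => i; rewrite !dcolE; apply: (pd_ext _ oD Dx) => y Dy.
      by rewrite /= cinv_smap // tp_l tp_r hE // mul0r addr0.
    by rewrite dcol_comb ?scale0r ?addr0 //; exact: smo_diff.
  have Hu : B *m dcol (u \o cinv e) (smap z) = C t *: dcol fd x.
    by apply: H => [|y _]; [exact: (W_smo noB Wu ae)|have [_ ->] := slice_flow0 (cinv d y) t].
  have Hw : B *m dcol (w \o cinv e) (smap z) = S t *: dcol fd x.
    by apply: H => [|y _]; [exact: (W_smo noB Ww ae)|have [-> _] := slice_flow0 (cinv d y) t].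
  rewrite mulmxBr -!scalemxAr Hu Hw cinv_smap //; have [-> ->] := slice_flow0 (cinv d x) t.
  by rewrite !scalerA -scalerBl (_ : _ - _ = 0) ?scale0r //; ring.
rewrite JE mul_col_mx tr_col_mx mul_col_row XG // /wmetric -/x.
have BG : B *m G e (smap z) *m (X e (smap z))^T = 0.
  by rewrite -mulmxA -{1}sG -trmx_mul XG // trmxK.
congr block_mx => //.
- have Xu h : W h -> (X e (smap z) *m dcol (h \o cinv e) (smap z)) 0 0 = XD X h (cinv e (smap z)).
    by move=> Wh; rewrite (XDE noB complete KX Wh.1 ae) ?cinvK //; exact: cinvP.
  rewrite -trmx_mul mulmxBr -!scalemxAr; apply/matrixP => i j.
  rewrite !ord1 scalar00 trmxE !(addmxE, oppmxE, scalemxE) !Xu // Dw Du cinv_smap // -/t -/x.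
  have [-> ->] := slice_flow0 (cinv d x) t; have := ch_sh k0 t => h.
  have -> : forall v, C t * v * (C t * v) - S t * v * (kappa * (S t * v)) = (C t ^+ 2 - kappa * S t ^+ 2) * v ^+ 2 by move=> v; ring.
  by rewrite h mul1r.
- by rewrite -trmx_mul BX trmx0.
- rewrite (zmetricE noB cd a dz) -(flow_iso noB complete KX ac ae fzt) -/Jf psE ytE.
  by rewrite trmx_mul !mulmxA.
Qed.

Lemma slice_wfun z : sdom z -> wfun fd kappa z = ((u \o cinv e) \o smap) z.
Proof.
move=> sz; rewrite /= cinv_smap // (slice_flow0 _ _).2 /wfun mulrC; congr (C _ * _).
by rewrite mxE.
Qed.

Let mgd y : ccod d y -> metric_tensor (zmetric d) y. Proof. exact: zmetric_mt. Qed.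
Let fd0 y : ccod d y -> 0 < fd y. Proof. by move=> _; exact: u0. Qed.
Let mgw y : sdom y -> metric_tensor (wmetric (zmetric d) fd) y.
Proof. by move=> [dy _]; exact: (wmetric_mt mgd fd0 dy). Qed.
Let sgw : msmo sdom (wmetric (zmetric d) fd).
Proof.
have sm := wmetric_smo (ball_chart_open a) (zmetric_smo noB ad) fd_smo.
by move=> i j; apply: smo_sub (sm i j) => y [].
Qed.
Let wDw : open (wdom (ccod d)). Proof. exact: wdom_open (ball_chart_open a). Qed.
Let sub : sdom `<=` wdom (ccod d). Proof. by move=> y []. Qed.

(** The equation of u on M carried to product coordinates by naturality of Hessian and Ricci tensor,
    in order to be split into blocks. *)
Lemma slice_W z : sdom z -> hessian (wdom (ccod d)) (wmetric (zmetric d) fd) (wfun fd kappa) z =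
  (wfun fd kappa z / m) *: (ricci (wdom (ccod d)) (wmetric (zmetric d) fd) z - lambda *: wmetric (zmetric d) fd z).
Proof.
move=> sz; have oe := ccod_open noB ae; have mge y : ccod e y -> metric_tensor (G e) y by exact: metric_mt.
have ez := smap_cod sz; have sue := W_smo noB Wu ae.
rewrite (hessian_loc _ wDw sdom_open sub sz slice_wfun) (ricci_loc _ wDw sdom_open sub sz).
rewrite (hessian_pull sdom_open oe (metric_smo noB ae) mgw mge smap_cod smap_smo smap_iso sz sue).
rewrite (ricci_pull sdom_open oe sgw (metric_smo noB ae) mgw mge smap_cod smap_smo smap_iso sz).
rewrite (W_hess Wu ae ez) -(smap_iso sz) slice_wfun // scalerA -scalemxAr -scalemxAl; congr (_ *: _).
by rewrite mulmxBr mulmxBl -scalemxAr -scalemxAl.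
Qed.

Lemma slice_equation x : ccod d x -> sdom (tp 0 x) ->
  hessian (ccod d) (zmetric d) fd x = (fd x / (m + 1)) *: (ricci (ccod d) (zmetric d) x - lambda *: zmetric d x) /\
  fd x * laplacian (ccod d) (zmetric d) fd x + m * grad_sqnorm (ccod d) (zmetric d) fd x + lambda * fd x ^+ 2 = - (m * kappa).
Proof.
move=> dx sx; apply: (warped_equation (ball_chart_open a) (zmetric_smo noB ad) mgd fd_smo fd0 k0 m0 dx).
exact: slice_W.
Qed.

Lemma slice_einstein_at z : sdom z -> let x := rsubmx z in
  hessian (ccod d) (zmetric d) fd x = (- (lambda * fd x / (m + k%:R))) *: zmetric d x ->
  fd x * laplacian (ccod d) (zmetric d) fd x + m * grad_sqnorm (ccod d) (zmetric d) fd x + lambda * fd x ^+ 2 = - (m * kappa) ->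
  ricci (ccod e) (G e) (smap z) = (k%:R * lambda / (m + k%:R)) *: G e (smap z).
Proof.
move=> sz x Hx mux; have oe := ccod_open noB ae; have mge y : ccod e y -> metric_tensor (G e) y by exact: metric_mt.
have := warped_einstein (ball_chart_open a) (zmetric_smo noB ad) mgd fd_smo fd0 k0 m0 (sub sz) (slice_W sz) Hx mux.
rewrite (ricci_loc _ wDw sdom_open sub sz) -(smap_iso sz).
rewrite (ricci_pull sdom_open oe sgw (metric_smo noB ae) mgw mge smap_cod smap_smo smap_iso sz).
rewrite scalemxAl scalemxAr => E; have uJ := Jac_unit mgw smap_iso sz.
have uJt : (jac smap z)^T \in unitmx by rewrite unitmx_tr.
by apply: (can_inj (mulKmx uJ)); apply: (can_inj (mulmxK uJt)).
Qed.

Lemma slice_fun_smo : smo (ccod d) fd. Proof. exact: fd_smo. Qed.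

(* The coordinates of N x R with R first are those of the block matrices
   above; the last block comes first in warped_product. *)
Lemma smap_swap_iso : isometric_in
  [set z : 'rV[R]_(k + 1) | ccod d (lsubmx z) /\ cdom e (slice_map (cinv d (lsubmx z), (rsubmx z) 0 0))]
  (fun z => cmap e (slice_map (cinv d (lsubmx z), (rsubmx z) 0 0)))
  (fun z => block_mx (zmetric d (lsubmx z)) 0 0 (f (cinv d (lsubmx z)) ^+ 2 *: (1%:M : 'M[R]_1))) (G e).
Proof.
pose sw (z : 'rV[R]_(k + 1)) : 'rV[R]_(1 + k) := tp ((rsubmx z) 0 0) (lsubmx z).
have ssw A : msmo A sw.
  apply: msmo_tp; last exact: msmo_lsub.
  by have := @msmo_rsub R k 1 A 0 0.
set A := [set z | _].
have AE : A = sw @^-1` sdom by apply/seteqP; split=> z; rewrite /sdom /= tp_l tp_r.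
have oA : open A.
  have /continuousP H : continuous sw by move=> z; exact: msmo_continuous.
  by rewrite AE; apply: H; exact: sdom_open.
have Ez z : cmap e (slice_map (cinv d (lsubmx z), (rsubmx z) 0 0)) = smap (sw z).
  by rewrite /smap tp_l tp_r.
have E : (fun z => cmap e (slice_map (cinv d (lsubmx z), (rsubmx z) 0 0))) = smap \o sw by apply/funext.
apply/(isometric_inP _ _ _ oA); rewrite E; split.
  by apply: (msmo_comp oA _ (ssw A) smap_smo) => z; rewrite AE.
move=> z; rewrite AE => sz.
have dsw : differentiable sw z by exact: msmo_differentiable.
rewrite jac_comp //; last exact: msmo_differentiable smap_smo _.
rewrite Ez trmx_mul !mulmxA -[_ *m jac smap _ *m _]mulmxA -[_ *m (_ *m G e _) *m _]mulmxA (smap_iso sz).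
have -> : jac sw z = block_mx 0 1%:M 1%:M 0.
  apply/matrixP => i j; rewrite jacE.
  case: (split_ordP j) => j' ->.
    have -> : (fun y => sw y 0 (lshift k j')) = (fun y => y 0 (rshift k 0)).
      by apply/funext => y; rewrite ord1 tp_el mxE.
    rewrite pd_coord; case: (split_ordP i) => i' ->; rewrite ?(block_mxEul, block_mxEdl) ord1 ?eq_lrshift mxE ?eqxx //.
    by rewrite ord1.
  under eq_fun do rewrite tp_er mxE.
  by rewrite pd_coord; case: (split_ordP i) => i' ->; rewrite ?(block_mxEur, block_mxEdr) ?eq_rlshift mxE.
rewrite tr_block_mx !trmx0 !trmx1 !mulmx_block !mulmx0 !mul0mx !mul1mx !mulmx1 !add0r !addr0 tp_r.
by rewrite scalemx1.
Qed.

End Local.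

Lemma slice_sdom0 (d : chart R N k) x : atlas d -> ccod d x ->
  exists c e, [/\ adapted d c, atlas e & sdom d e (tp 0 x)].
Proof.
move=> [_ [c a]] dx; have [e ae ex] := rm_cover (pt (cinv d x)).
by exists c, e; split=> //; split; rewrite ?tp_r ?tp_l ?Theta0.
Qed.

Lemma slice_fun_W : Wspace N lambda (m + 1) f.
Proof.
split=> [d ad|d ad x dx]; first by have [_ [c a]] := ad; apply/(smooth_onP _ (ball_chart_open a)); exact: slice_fun_smo _ a.
by have [c [e [a ae sx]]] := slice_sdom0 ad dx; have [] := slice_equation ad a ae dx sx.
Qed.

Lemma slice_mu : mu_const lambda (m + 1) f (- (m * kappa)).
Proof.
move=> d ad x dx; have [c [e [a ae sx]]] := slice_sdom0 ad dx.
by have [_ h] := slice_equation ad a ae dx sx; rewrite addrK.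
Qed.

(** With this Ricci constant on N the equation of f becomes [Hess f = - lambda f / (m + k) g], the
    hypothesis of [warped_einstein]; every point of M lies over some point of N. *)
Lemma slice_einstein : (forall d, atlas d -> forall x, ccod d x ->
  ricci (ccod d) (@metric R k N d) x = ((k%:R - 1) * lambda / (m + k%:R)) *: @metric R k N d x) -> einstein M.
Proof.
move=> RN; exists (k%:R * lambda / (m + k%:R)) => e ae x ex.
pose b := slice_proj (cinv e x); have [d ad db] := @rm_cover R k N b; have [cd [c a]] := ad.
pose z : 'rV[R]_(1 + k) := tp (slice_time (cinv e x)) (cmap d b).
have E : Th (slice_time (cinv e x)) (pt b) = cinv e x := slice_projK (cinv e x).
have dz : ccod d (cmap d b) by exact: chart_map.
have bK : cinv d (cmap d b) = b by exact: chart_mapK.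
have sz : sdom d e z by split; rewrite ?tp_r ?tp_l ?bK ?E //; exact: cinvP.
have <- : smap d e z = x by rewrite /smap tp_l tp_r bK E cinvK.
have [c' [e' [a' ae' sx]]] := slice_sdom0 ad dz; have [Hf mu] := slice_equation ad a' ae' dz sx.
apply: (slice_einstein_at ad a ae sz); rewrite tp_r //.
rewrite Hf (RN d ad _ dz) -scalerBl scalerA; congr (_ *: _).
have m1 : m + 1 != 0 by rewrite gt_eqF // addr_gt0.
have mk : m + k%:R != 0 by rewrite gt_eqF // ltr_wpDr.
by field; rewrite mk.
Qed.

(** On the flow line of b, u and w are [f b] times [C] and [S], a basis of the solutions on the
    line; a function on M is determined by its values on flow lines. *)
Lemma slice_W_factor : W = [set h | exists2 v : line -> R, Wspace line (- (m * kappa)) m v &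
  forall b y, h (slice_map (b, y)) = f b * v y].
Proof.
apply/seteqP; split=> [h /span[al [be E]]|h [v Wv E]].
  exists (fun t => al * C t + be * S t); first exact: line_W_comb.
  by move=> b y; rewrite E; have [-> ->] := slice_flow0 b y; rewrite /f; ring.
have [al [be Ev]] := line_W_span k0 m0 Wv.
have -> : h = (fun p => al * u p + be * w p); last exact: W_comb.
apply/funext => p; rewrite -[p]slice_projK E Ev; have [-> ->] := slice_flow0 (slice_proj p) (slice_time p).
by rewrite /f; ring.
Qed.

End Slice.

(** * Homotopy classes of paths *)

Section Paths.
Context {R : realType} {T : topologicalType}.

Lemma ccomp (S U V : topologicalType) (f : S -> U) (g : U -> V) : continuous f -> continuous g -> continuous (fun x => g (f x)).
Proof. by move=> cf cg x; exact: (continuous_comp (cf x) (cg _)). Qed.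

Lemma caff (S : topologicalType) (f : S -> R) (a b : R) : continuous f -> continuous (fun x => a * f x + b).
Proof. by move=> cf x; apply: cvgD; [apply: cvgMr; exact: cf|exact: cvg_cst]. Qed.

Lemma cmin (S : topologicalType) (f g : S -> R) : continuous f -> continuous g -> continuous (fun x => Num.min (f x) (g x)).
Proof. by move=> cf cg x; exact: (continuous_min (cf x) (cg x)). Qed.

Lemma cmax (S : topologicalType) (f g : S -> R) : continuous f -> continuous g -> continuous (fun x => Num.max (f x) (g x)).
Proof. by move=> cf cg x; exact: (continuous_max (cf x) (cg x)). Qed.

Lemma cid1 : continuous (fun t : R => t). Proof. by move=> t. Qed.
Lemma cfst (U V : topologicalType) : continuous (fun z : U * V => z.1). Proof. by move=> t; exact: cvg_fst. Qed.
Lemma csnd (U V : topologicalType) : continuous (fun z : U * V => z.2). Proof. by move=> t; exact: cvg_snd. Qed.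
Lemma csubr (S : topologicalType) (f : S -> R) d : continuous f -> continuous (fun x => f x - d).
Proof. by move=> cf x; apply: cvgB; [exact: cf|exact: cvg_cst]. Qed.
Lemma crsub (S : topologicalType) (f : S -> R) d : continuous f -> continuous (fun x => d - f x).
Proof. by move=> cf x; apply: cvgB; [exact: cvg_cst|exact: cf]. Qed.

Lemma continuous_paste (S U : topologicalType) (h : S -> R) (f g : S -> U) : continuous h -> continuous f -> continuous g ->
  (forall z, h z = 0 -> f z = g z) -> continuous (fun z => if h z <= 0 then f z else g z).
Proof.
move=> ch cf cg fg z; have chz : {for z, continuous h} := ch z; have [hz|hz|hz] := ltgtP (h z) 0.
- apply: (@continuous_near_eq _ _ f) (cf z).
  have n0 : \forall v \near h z, v < 0 by apply: open_nbhs_nbhs.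
  have := cts_near chz n0; by apply: filterS => y /ltW ->.
- apply: (@continuous_near_eq _ _ g) (cg z).
  have n0 : \forall v \near h z, 0 < v by apply: open_nbhs_nbhs.
  have := cts_near chz n0; by apply: filterS => y; rewrite ltNge => /negbTE ->.
- move=> V; rewrite hz lexx => nV; have nV2 := nV; rewrite fg // in nV2.
  have n1 : \forall y \near z, V (f y) by exact: cf.
  have n2 : \forall y \near z, V (g y) by exact: cg.
  have n3 : \forall y \near z, V (if h y <= 0 then f y else g y) by apply: filterS2 n1 n2 => y v1 v2; case: ifP.
  exact: n3.
Qed.

Definition cl (t : R) : R := Num.max 0 (Num.min 1 t).

Lemma cl_continuous : continuous cl.
Proof. by apply: cmax; [exact: cst_continuous|apply: cmin; [exact: cst_continuous|exact: cid1]]. Qed.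

Lemma cl_in t : 0 <= cl t <= 1.
Proof. by rewrite le_max lexx ge_max ler01 ge_min lexx. Qed.

Lemma cl_id t : 0 <= t <= 1 -> cl t = t.
Proof. by move=> /andP[t0 t1]; rewrite /cl (min_idPr t1) (max_idPr t0). Qed.

Lemma cl_le0 t : t <= 0 -> cl t = 0.
Proof. by move=> t0; rewrite /cl (min_idPr _) ?(max_idPl _); lra. Qed.

Lemma cl_ge1 t : 1 <= t -> cl t = 1.
Proof. by move=> t0; rewrite /cl (min_idPl _) // (max_idPr _). Qed.

(** Paths are extended by constants to the whole line, so that continuity, pasting and homotopies
    are statements about total functions instead of subspaces. *)
Record tpath (x y : T) := Path {
  pf :> R -> T;
  pf_cts : continuous pf;
  pf_l : forall t, t <= 0 -> pf t = x;
  pf_r : forall t, 1 <= t -> pf t = y }.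

Lemma path_cl x y (g : tpath x y) t : g (cl t) = g t.
Proof.
have [t0|t0] := leP t 0; first by rewrite cl_le0 // !pf_l.
have [t1|t1] := leP 1 t; first by rewrite cl_ge1 // !pf_r.
by rewrite cl_id // !ltW.
Qed.

Lemma path_of x y (f : R -> T) : continuous f -> f 0 = x -> f 1 = y -> exists g : tpath x y, forall t, g t = f (cl t).
Proof.
move=> cf f0 f1; unshelve eexists (@Path x y (f \o cl) _ _ _) => //.
- exact: ccomp cl_continuous _.
- by move=> t t0; rewrite /= cl_le0.
- by move=> t t1; rewrite /= cl_ge1.
Qed.

Definition hom x y (g h : tpath x y) := exists H : R * R -> T,
  [/\ continuous H, forall t, H (0, t) = g t, forall t, H (1, t) = h t,
      forall s t, t <= 0 -> H (s, t) = x & forall s t, 1 <= t -> H (s, t) = y].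

Lemma continuous_prod_fun (S U V : topologicalType) (f : S -> U) (g : S -> V) :
  continuous f -> continuous g -> continuous (fun y => (f y, g y)).
Proof. by move=> cf cg y; apply: continuous_pair; [exact: cf|exact: cg]. Qed.

Lemma hom_intro x y (g h : tpath x y) (K : R * R -> T) : continuous (fun z : R * R => K (cl z.1, cl z.2)) ->
  (forall t, 0 <= t <= 1 -> K (0, t) = g t /\ K (1, t) = h t) ->
  (forall s, 0 <= s <= 1 -> K (s, 0) = x /\ K (s, 1) = y) -> hom g h.
Proof.
move=> cK gh ends; exists (fun z => K (cl z.1, cl z.2)); split=> //= [t|t|s t t0|s t t1].
- by rewrite cl_le0 // (gh _ (cl_in t)).1 path_cl.
- by rewrite cl_ge1 // (gh _ (cl_in t)).2 path_cl.
- by rewrite (cl_le0 t0) (ends _ (cl_in s)).1.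
- by rewrite (cl_ge1 t1) (ends _ (cl_in s)).2.
Qed.

Lemma continuous_clcl (U : topologicalType) (K : R * R -> U) : continuous K -> continuous (fun z : R * R => K (cl z.1, cl z.2)).
Proof.
move=> cK; apply: (ccomp (f := fun z : R * R => (cl z.1, cl z.2)) _ cK).
by apply: continuous_prod_fun; [exact: ccomp (@cfst _ _) cl_continuous|exact: ccomp (@csnd _ _) cl_continuous].
Qed.

Lemma hom_refl x y (g : tpath x y) : hom g g.
Proof.
exists (fun z => g z.2); split=> //=; [|by move=> _ t; exact: pf_l|by move=> _ t; exact: pf_r].
by apply: (ccomp (@csnd _ _)); exact: pf_cts.
Qed.

Lemma hom_sym x y (g h : tpath x y) : hom g h -> hom h g.
Proof.
move=> [H [cH h0 h1 hl hr]]; exists (fun z => H (1 - z.1, z.2)); split=> /= [|t|t|s t|s t].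
- apply: (ccomp (f := fun z : R * R => (1 - z.1, z.2)) _ cH).
  by apply: continuous_prod_fun; [apply: crsub; exact: cfst|exact: csnd].
- by rewrite subr0.
- by rewrite subrr.
- exact: hl.
- exact: hr.
Qed.

Lemma hom_trans x y (g h k : tpath x y) : hom g h -> hom h k -> hom g k.
Proof.
move=> [H [cH h0 h1 hl hr]] [H' [cH' h0' h1' hl' hr']].
exists (fun z => if z.1 - 2^-1 <= 0 then H (cl (2 * z.1 + 0), z.2) else H' (cl (2 * z.1 + -1), z.2)); split=> /= [|t|t|s t t0|s t t0].
- have clc (U : topologicalType) (K : R * R -> U) (a b : R) : continuous K -> continuous (fun z : R * R => K (cl (a * z.1 + b), z.2)).
    move=> cK; apply: (ccomp (f := fun z : R * R => (cl (a * z.1 + b), z.2)) _ cK).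
    apply: continuous_prod_fun; last exact: csnd.
    by apply: (ccomp (f := fun z => a * z.1 + b) _ cl_continuous); apply: caff; exact: cfst.
  apply: (@continuous_paste _ _ (fun z : R * R => z.1 - 2^-1)); [|exact: clc|exact: clc|].
    by apply: csubr; exact: cfst.
  move=> [s t] /= /eqP; rewrite subr_eq0 => /eqP ->.
  by rewrite addr0 divff // cl_ge1 // cl_le0 // h0'.
- by rewrite sub0r oppr_le0 invr_ge0 ler0n cl_le0.
- by rewrite ifF ?cl_ge1 //; [lra|apply/negbTE; lra].
- by case: ifP => _; [exact: hl|exact: hl'].
- by case: ifP => _; [exact: hr|exact: hr'].
Qed.

Lemma hom_ext x y (g h : tpath x y) : (forall t, g t = h t) -> hom g h.
Proof.
move=> gh; have [H [cH h0 h1 hl hr]] := hom_refl g; exists H; split=> // t; by rewrite h1.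
Qed.

(** Two paths that are reparametrisations of one map [F] of the line are homotopic through the
    convex combinations of the parameters; the next lemmas are instances. *)
Lemma hom_straight x y (F : R -> T) (g h : tpath x y) (a b : R -> R) : continuous F -> continuous a -> continuous b ->
  (forall s, 0 <= s <= 1 -> F ((1 - s) * a 0 + s * b 0) = x /\ F ((1 - s) * a 1 + s * b 1) = y) ->
  (forall t, 0 <= t <= 1 -> g t = F (a t)) -> (forall t, 0 <= t <= 1 -> h t = F (b t)) -> hom g h.
Proof.
move=> cF ca cb ends ga hb.
apply: (@hom_intro _ _ _ _ (fun z => F ((1 - z.1) * a z.2 + z.1 * b z.2))) => [|t tI|//].
- apply: (@continuous_clcl _ (fun z => F ((1 - z.1) * a z.2 + z.1 * b z.2))).
  apply: (ccomp (f := fun z : R * R => (1 - z.1) * a z.2 + z.1 * b z.2) _ cF).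
  have c1 := @cfst R R; have c2 := ccomp (@csnd R R) ca; have c3 := ccomp (@csnd R R) cb; have c4 := crsub (d := 1) c1.
  by move=> z; apply: cvgD; apply: cvgM; [exact: c4|exact: c2|exact: c1|exact: c3].
- by rewrite subr0 mul1r mul0r addr0 subrr mul0r add0r mul1r ga // hb.
Qed.

Lemma hom_reparam x y (f g h : tpath x y) (a b : R -> R) : continuous a -> continuous b ->
  a 0 <= 0 -> b 0 <= 0 -> 1 <= a 1 -> 1 <= b 1 ->
  (forall t, 0 <= t <= 1 -> g t = f (a t)) -> (forall t, 0 <= t <= 1 -> h t = f (b t)) -> hom g h.
Proof.
move=> ca cb a0 b0 a1 b1; apply: hom_straight => //; first exact: pf_cts.
move=> s /andP[s0 s1]; split; [apply: pf_l|apply: pf_r].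
  have := mulr_ge0_le0 s0 b0; have : (1 - s) * a 0 <= 0 by rewrite mulr_ge0_le0 // subr_ge0.
  by lra.
have h1 : (1 - s) * 1 <= (1 - s) * a 1 by rewrite ler_wpM2l // subr_ge0.
have h2 : s * 1 <= s * b 1 by rewrite ler_wpM2l.
by lra.
Qed.

Lemma concat_ex x y z (g : tpath x y) (h : tpath y z) : exists k : tpath x z, forall t, k t = loop_concat g h t.
Proof.
have half : (0 : R) < 2^-1 by [].
unshelve eexists (@Path x z (loop_concat g h) _ _ _) => //.
- have -> : loop_concat g h = (fun t => if t - 2^-1 <= 0 then g (2 * t) else h (2 * t - 1)).
    by apply/funext => t; rewrite subr_le0.
  apply: continuous_paste.
  + by apply: csubr; exact: cid1.
  + apply: (ccomp (f := fun t : R => 2 * t)); last exact: pf_cts.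
    by move=> t; apply: cvgMr.
  + by apply: ccomp; [apply: caff; exact: cid1|exact: pf_cts].
  + by move=> t /eqP; rewrite subr_eq0 => /eqP ->; rewrite divff // (pf_r g (lexx 1)) pf_l.
- by move=> t t0; rewrite /loop_concat ifT ?pf_l //; lra.
- by move=> t t1; rewrite /loop_concat ifF ?pf_r //; [lra|apply/negbTE; lra].
Qed.

Definition concat x y z (g : tpath x y) (h : tpath y z) : tpath x z := projT1 (cid (concat_ex g h)).
Lemma concatE x y z (g : tpath x y) (h : tpath y z) t : concat g h t = loop_concat g h t.
Proof. exact: (projT2 (cid (concat_ex g h))). Qed.

Definition const_path x : tpath x x := @Path x x (fun=> x) (fun t => @cst_continuous _ _ x t) (fun _ _ => erefl) (fun _ _ => erefl).

Lemma reverse_ex x y (g : tpath x y) : exists k : tpath y x, forall t, k t = g (1 - t).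
Proof.
unshelve eexists (@Path y x (fun t => g (1 - t)) _ _ _) => //.
- by apply: ccomp; [apply: crsub; exact: cid1|exact: pf_cts].
- by move=> t t0; apply: pf_r; lra.
- by move=> t t0; apply: pf_l; lra.
Qed.

Definition reverse x y (g : tpath x y) : tpath y x := projT1 (cid (reverse_ex g)).
Lemma reverseE x y (g : tpath x y) t : reverse g t = g (1 - t).
Proof. exact: (projT2 (cid (reverse_ex g))). Qed.

Lemma hom_concat x y z (g g' : tpath x y) (h h' : tpath y z) : hom g g' -> hom h h' -> hom (concat g h) (concat g' h').
Proof.
move=> [H [cH h0 h1 hl hr]] [H' [cH' h0' h1' hl' hr']].
have aff (U : topologicalType) (K : R * R -> U) (a b : R) : continuous K -> continuous (fun z : R * R => K (z.1, a * z.2 + b)).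
  move=> cK; apply: (ccomp (f := fun z : R * R => (z.1, a * z.2 + b)) _ cK).
  by apply: continuous_prod_fun; [exact: cfst|apply: caff; exact: csnd].
exists (fun z => if z.2 - 2^-1 <= 0 then H (z.1, 2 * z.2 + 0) else H' (z.1, 2 * z.2 + -1)); split=> /= [|t|t|s t t0|s t t1].
- apply: (@continuous_paste _ _ (fun z : R * R => z.2 - 2^-1)); [|exact: aff|exact: aff|].
    by apply: csubr; exact: csnd.
  move=> [s t] /= /eqP; rewrite subr_eq0 => /eqP ->.
  by rewrite addr0 divff // hr // hl'.
- by rewrite concatE subr_le0 addr0 h0 h0'.
- by rewrite concatE subr_le0 addr0 h1 h1'.
- by rewrite ifT ?hl //; lra.
- by rewrite ifF ?hr' //; [lra|apply/negbTE; lra].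
Qed.

Lemma hom_concatA x y z w (a : tpath x y) (b : tpath y z) (c : tpath z w) :
  hom (concat (concat a b) c) (concat a (concat b c)).
Proof.
(* The piecewise linear change of parameter from one bracketing to the other, with slopes 2, 1, 1/2
   and breaks at 1/4 and 1/2; as it is concave, it is the minimum of its three pieces. *)
pose phi (t : R) := Num.min (2 * t + 0) (Num.min (1 * t + 4^-1) (2^-1 * t + 2^-1)).
apply: (@hom_reparam _ _ (concat a (concat b c)) _ _ phi id) => //.
- by apply: cmin; [|apply: cmin]; apply: caff; exact: cid1.
- exact: cid1.
- by rewrite ge_min mulr0 addr0 lexx.
- by rewrite /phi !le_min; apply/and3P; split; lra.
move=> t /andP[t0 t1]; rewrite !concatE /loop_concat; case: (leP t 2^-1) => th.
  rewrite concatE /loop_concat; case: (leP (2 * t) 2^-1) => th2.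
    have -> : phi t = 2 * t by rewrite /phi (min_idPl _) ?addr0 // le_min; apply/andP; split; lra.
    by rewrite th2.
  have -> : phi t = t + 4^-1 by rewrite /phi (min_idPr _) ?ge_min ?(min_idPl _) ?mul1r //; lra.
  rewrite ifF; last by apply/negbTE; rewrite -ltNge; lra.
  by rewrite concatE /loop_concat ifT; [congr (b _); field|lra].
have -> : phi t = 2^-1 * t + 2^-1 by rewrite /phi; case: (leP (1 * t + _)) => h1; case: leP => h2; lra.
rewrite ifF; last by apply/negbTE; rewrite -ltNge; lra.
by rewrite concatE /loop_concat ifF; [congr (c _); field|apply/negbTE; rewrite -ltNge; lra].
Qed.

Lemma hom_const_concat x y (g : tpath x y) : hom (concat (const_path x) g) g.
Proof.
apply: (@hom_reparam _ _ g _ _ (fun t => 2 * t - 1) id) => //; try lra.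
- by apply: caff; exact: cid1.
- exact: cid1.
- by move=> t _; rewrite concatE /loop_concat; case: (leP t 2^-1) => // h; rewrite (pf_l g) //; lra.
Qed.

Lemma hom_concat_const x y (g : tpath x y) : hom (concat g (const_path y)) g.
Proof.
apply: (@hom_reparam _ _ g _ _ (fun t => 2 * t) id) => //; try lra.
- by move=> t; apply: cvgMr.
- exact: cid1.
- by move=> t _; rewrite concatE /loop_concat; case: (leP t 2^-1) => // h; rewrite (pf_r g) //; lra.
Qed.

(** At stage s the path runs along g up to the parameter [1 - s] and then back. *)
Lemma hom_reverse x y (g : tpath x y) : hom (concat g (reverse g)) (const_path x).
Proof.
apply: (@hom_intro _ _ _ _ (fun z => g ((1 - z.1) * Num.min (2 * z.2) (2 - 2 * z.2)))).
- apply: (@continuous_clcl _ (fun z => g ((1 - z.1) * Num.min (2 * z.2) (2 - 2 * z.2)))).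
  apply: (ccomp (f := fun z : R * R => (1 - z.1) * Num.min (2 * z.2) (2 - 2 * z.2))); last exact: pf_cts.
  have c2 : continuous (fun z : R * R => 2 * z.2) by move=> z; apply: cvgMr; exact: cvg_snd.
  have c1 := crsub (d := 1) (@cfst R R); have c3 := cmin c2 (crsub (d := 2) c2).
  by move=> z; apply: cvgM; [exact: c1|exact: c3].
- move=> t _ /=; rewrite subr0 mul1r subrr mul0r (pf_l g (lexx 0)); split=> //.
  rewrite concatE /loop_concat; case: (leP t 2^-1) => h; first by rewrite (min_idPl _) //; lra.
  by rewrite (min_idPr _) ?reverseE; [congr (g _); ring|lra].
- move=> s _ /=; split; apply: pf_l; first by rewrite (min_idPl _); lra.
  by rewrite (min_idPr _); lra.
Qed.

(** Homotopy classes as sets of paths, so that homotopy becomes equality; with [amul] they form the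
    fundamental groupoid. *)
Definition arrow (x y : T) := {C : set (tpath x y) | exists g, C = [set h | hom g h]}.

Definition cls x y (g : tpath x y) : arrow x y := exist _ [set h | hom g h] (ex_intro _ g erefl).

Lemma cls_eq x y (g h : tpath x y) : cls g = cls h <-> hom g h.
Proof.
split=> [E|gh].
  by have : sval (cls g) = sval (cls h) by [rewrite E]; move=> /seteqP[_ H]; exact: (H h (hom_refl h)).
apply: eq_exist => /=; apply/seteqP; split=> k hk; [exact: hom_trans (hom_sym gh) _|exact: hom_trans _ hk].
Qed.

Lemma cls_ex x y (X : arrow x y) : exists g, X = cls g.
Proof. by case: X => C [g E]; exists g; exact: eq_exist. Qed.

Definition rep x y (X : arrow x y) : tpath x y := projT1 (cid (cls_ex X)).
Lemma repK x y (X : arrow x y) : cls (rep X) = X.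
Proof. by rewrite -(projT2 (cid (cls_ex X))). Qed.
Lemma rep_cls x y (g : tpath x y) : hom (rep (cls g)) g.
Proof. by apply/cls_eq; exact: repK. Qed.

Definition amul x y z (X : arrow x y) (Y : arrow y z) : arrow x z := cls (concat (rep X) (rep Y)).
Definition aone x : arrow x x := cls (const_path x).
Definition ainv x y (X : arrow x y) : arrow y x := cls (reverse (rep X)).

Lemma amul_cls x y z (g : tpath x y) (h : tpath y z) : amul (cls g) (cls h) = cls (concat g h).
Proof. by apply/cls_eq; apply: hom_concat; exact: rep_cls. Qed.

Lemma amulA x y z w (X : arrow x y) (Y : arrow y z) (Z : arrow z w) : amul (amul X Y) Z = amul X (amul Y Z).
Proof. by rewrite -(repK X) -(repK Y) -(repK Z) !amul_cls; apply/cls_eq; exact: hom_concatA. Qed.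

Lemma amul1 x y (X : arrow x y) : amul (aone x) X = X.
Proof. by rewrite -(repK X) amul_cls; apply/cls_eq; exact: hom_const_concat. Qed.

Lemma amulX1 x y (X : arrow x y) : amul X (aone y) = X.
Proof. by rewrite -(repK X) amul_cls; apply/cls_eq; exact: hom_concat_const. Qed.

Lemma amulV x y (X : arrow x y) : amul X (ainv X) = aone x.
Proof. by rewrite -{1}(repK X) amul_cls; apply/cls_eq; exact: hom_reverse. Qed.

Lemma amulVX x y (X : arrow x y) : amul (ainv X) X = aone y.
Proof.
have := amulV (ainv X) => h; rewrite -[LHS]amulX1 -h amulA -[amul X _]amulA amulV amul1.
by [].
Qed.

End Paths.

(** * Coverings *)

(* B carries the topology in which the local sections L d x of p : B -> N,
   defined on the domain of the chart d, are local inverses of p. *)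
Definition sheeted (R : realType) (k : nat) (N : rmanifold R k) (B : Type) (p : B -> N)
  (L : chart R N k -> B -> N -> B) : Type := B.

Section SheetedTopology.
Context {R : realType} {k : nat} {N : rmanifold R k} {B : Type}.
Variables (p : B -> N) (L : chart R N k -> B -> N -> B).
HB.instance Definition _ := gen_eqMixin (sheeted p L).
HB.instance Definition _ := gen_choiceMixin (sheeted p L).

Definition sopen (O : set (sheeted p L)) := forall x, O x -> forall d, atlas d -> cdom d (p x) ->
  \forall q \near p x, O (L d x q).

Lemma sopenT : sopen setT.
Proof. by move=> x _ d _ _; apply: filterE. Qed.

Lemma sopenI : setI_closed sopen.
Proof.
move=> U V oU oV x [Ux Vx] d ad dx.
by apply: filterS2 (oU x Ux d ad dx) (oV x Vx d ad dx) => q.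
Qed.

Lemma sopen_bigU (I : Type) (g : I -> set (sheeted p L)) : (forall i, sopen (g i)) -> sopen (\bigcup_i g i).
Proof.
move=> og x [i _ gx] d ad dx; apply: filterS (og i x gx d ad dx) => q h.
by exists i.
Qed.

HB.instance Definition _ := isOpenTopological.Build (sheeted p L) sopenT sopenI sopen_bigU.

End SheetedTopology.

(** * The manifold structure on a covering *)

Section Sheeted.
Context {R : realType} {k : nat} {N : rmanifold R k} {B : Type}.
Variables (p : B -> N) (L : chart R N k -> B -> N -> B) (b0 : B).
Hypothesis noB : boundary N = set0.
(** [L d x q] is meant as the point over q on the sheet through x above the chart domain of [d]. The
    four conditions say that it is a section, that it passes through x, that it depends only on the
    sheet, and that sheets of different charts agree locally. *)
Hypothesis L1 : forall d x q, atlas d -> cdom d (p x) -> cdom d q -> p (L d x q) = q.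
Hypothesis L2 : forall d x, atlas d -> cdom d (p x) -> L d x (p x) = x.
Hypothesis L3 : forall d x q r, atlas d -> cdom d (p x) -> cdom d q -> cdom d r -> L d (L d x q) r = L d x r.
Hypothesis L4 : forall d e x, atlas d -> atlas e -> cdom d (p x) -> cdom e (p x) ->
  \forall q \near p x, L d x q = L e x q.
Local Notation S := (sheeted p L).
Hypothesis conn : connected [set: S].
Local Notation pS := (p : S -> N).

Lemma sopenE (O : set S) : open O = sopen O. Proof. by []. Qed.

Lemma sproj_continuous : continuous pS.
Proof.
apply/continuousP => V oV; rewrite sopenE => x Vx d ad dx.
have n1 : \forall q \near p x, V q by apply: open_nbhs_nbhs.
by apply: filterS2 n1 (cdom_near ad dx) => q Vq dq; rewrite /= L1.
Qed.

Lemma sheet_open d x (V : set N) : atlas d -> cdom d (p x) -> open V ->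
  open [set y : S | [/\ cdom d (p y), L d x (p y) = y & V (p y)]].
Proof.
move=> ad dx oV; rewrite sopenE => y [dy Ey Vy] e ae ey.
have n1 : \forall q \near p y, V q by apply: open_nbhs_nbhs.
have n2 := @filterI _ _ (nbhs_filter (p y)) _ _ (cdom_near ad dy) (cdom_near ae ey).
apply: filterS3 n1 n2 (L4 ad ae dy ey) => q Vq [dq eq1] E.
have pq : p (L e y q) = q by exact: L1.
split; rewrite pq // -E -Ey L3 //.
Qed.

Lemma ssection_continuous d x q : atlas d -> cdom d (p x) -> cdom d q -> {for q, continuous (L d x : N -> S)}.
Proof.
move=> ad dx dq V; rewrite nbhsE => -[W [oW Wx] WV].
have py : p (L d x q) = q by exact: L1.
have := oW (L d x q) Wx d ad; rewrite py => /(_ dq) nW.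
have n2 : \forall r \near q, V (L d x r).
  by apply: filterS2 nW (cdom_near ad dq) => r + dr; rewrite L3 // => Wr; exact: WV.
exact: n2.
Qed.

Definition schart d x : chart R S k :=
  @Chart R S k [set y | cdom d (p y) /\ L d x (p y) = y] (ccod d) (fun y => cmap d (p y)) (fun v => L d x (cinv d v)).

Definition satlas : set (chart R S k) :=
  [set c | exists dx : chart R N k * B, [/\ atlas dx.1, cdom dx.1 (p dx.2) & c = schart dx.1 dx.2]].

Definition smetric (c : chart R S k) : 'rV[R]_k -> 'M[R]_k :=
  if pselect (satlas c) is left h then @metric R k N (projT1 (cid h)).1 else fun=> 0.

Lemma satlasP c : satlas c -> exists d x, [/\ atlas d, cdom d (p x), c = schart d x & smetric c = @metric R k N d].
Proof.
move=> ac; rewrite /smetric; case: pselect => // h; case: (cid h) => -[d x] /= [ad dx E].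
by exists d, x.
Qed.

Lemma schartP c : satlas c -> is_chart c.
Proof.
move=> /satlasP[d [x [ad dx -> _]]]; have cd := rm_chart ad; split=> //=.
- have -> : [set y : S | cdom d (p y) /\ L d x (p y) = y] = [set y | [/\ cdom d (p y), L d x (p y) = y & setT (p y)]].
    by apply/seteqP; split=> y [].
  exact: sheet_open _ _ openT.
- exact: chart_cod.
- by move=> y [dy _]; exact: chart_map.
- by move=> v dv; have dc := cinvP ad dv; rewrite L1.
- by move=> y [dy Ey]; rewrite cmapK.
- by move=> v dv; rewrite L1 ?cinvK //; exact: cinvP.
- apply: continuous_in_subspaceT => y; rewrite inE => -[dy _].
  by apply: continuous_comp; [exact: sproj_continuous|exact: cmap_cts].
- apply: continuous_in_subspaceT => v; rewrite inE => dv.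
  apply: continuous_comp; first exact: cinv_cts.
  by apply: ssection_continuous => //; exact: cinvP.
Qed.

(** Charts of the covering are charts of N read through p, so any continuous map over N has
    transition maps of N as its coordinate expressions. This serves for the atlas, with [g] the
    identity, and for deck transformations. *)
Lemma iso_over (g : S -> S) c c' : continuous g -> (forall y, p (g y) = p y) -> satlas c -> satlas c' ->
  isometric_in [set v | ccod c v /\ cdom c' (g (cinv c v))] (fun v => cmap c' (g (cinv c v))) (smetric c) (smetric c').
Proof.
move=> cg pg ac ac'; have oc : open (ccod c).
  by have [d [x [ad _ -> _]]] := satlasP ac; exact: ccod_open.
have oA : open [set v | ccod c v /\ cdom c' (g (cinv c v))].
  apply: (@open_preimage_in _ _ (g \o cinv c) (ccod c) (cdom c')) => //; first exact: chart_open_dom (schartP ac').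
  move=> v cv; apply: continuous_comp; last exact: cg.
  exact: (within_open_continuous oc cv (chart_inv_cts (schartP ac))).
apply/(isometric_inP _ _ _ oA).
have [d [x [ad dx Ec ->]]] := satlasP ac; have [e [x' [ae ex Ec' ->]]] := satlasP ac'.
have E v : ccod c v /\ cdom c' (g (cinv c v)) -> ov d e v /\ tr d e v = cmap c' (g (cinv c v)).
  rewrite Ec Ec' /= => -[dv []]; rewrite pg L1 //; last exact: cinvP.
have sub : [set v | ccod c v /\ cdom c' (g (cinv c v))] `<=` ov d e by move=> v /E[].
have [s i] := tr_isoP noB ad ae; split.
  by apply: (msmo_ext oA (F := tr d e)) => [v /E[]|a b] //; exact: smo_sub _ (s a b).
move=> v Av; have [ov1 <-] := E v Av; rewrite -(i v ov1); congr (_ *m _ *m _); last congr (_^T);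
  by apply: (jac_ext oA Av) => y /E[_ ->].
Qed.

Lemma sheeted_hausdorff : hausdorff_space S.
Proof.
rewrite open_hausdorff => x y xy; have [pxy|pxy] := eqVneq (p x) (p y).
  have [d ad dx] := rm_cover (p x); have dy : cdom d (p y) by rewrite -pxy.
  have oT (z : S) : cdom d (p z) -> open [set y : S | cdom d (p y) /\ L d z (p y) = y].
    move=> dz; apply: (chart_open_dom (schartP (c := schart d z) _)).
    by exists (d, z).
  exists ([set z : S | cdom d (p z) /\ L d x (p z) = z], [set z : S | cdom d (p z) /\ L d y (p z) = z]).
    by rewrite !inE; split; split=> //; exact: L2.
  split; [exact: oT|exact: oT|]; apply/eqP/seteqP; split=> // z [[dz E1] [_ E2]].
  move/eqP: xy; apply; rewrite -(L2 ad dx) -(L2 ad dy) -pxy.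
  by rewrite -(L3 (q := p z) ad dx) // -(L3 (x := y) (q := p z) ad dy) // E1 E2.
have := @rm_hausdorff R k N; rewrite open_hausdorff => /(_ _ _ pxy)[[U V] /= [Ux Vy] [oU oV d]].
have /continuousP cp := sproj_continuous.
exists (pS @^-1` U, pS @^-1` V) => /= => //.
split; [exact: cp|exact: cp|]; apply/eqP/seteqP; split=> // z [Uz Vz].
by move/eqP: d => /seteqP[/(_ (p z) (conj Uz Vz))].
Qed.

(* Poincare-Volterra: every point is reached from b0 by a finite chain of
   sections over countably many charts, through countably many points. *)
Lemma sheeted_second_countable : @second_countable S.
Proof.
have [Bs cBs [oBs bBs]] := @rm_second_countable R k N.
have [e eP] : exists e : nat -> set N, forall b, Bs b -> exists n, e n = b.
  have /pfcard_geP[B0|/surjfunPex[f Ef]] := cBs; first by exists (fun=> set0) => b; rewrite B0.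
  by exists f => b; rewrite Ef => -[n _ <-]; exists n.
have pick q V : nbhs q V -> exists l, [/\ open (e l), e l q & e l `<=` V].
  move=> /(bBs q)[b [Bb bq] bV]; have [l El] := eP b Bb.
  by exists l; rewrite El; split=> //; exact: oBs.
have [d0 ad0 _] := rm_cover (p b0).
pose dch n := if pselect (exists d, atlas d /\ e n `<=` cdom d) is left h then projT1 (cid h) else d0.
have dchP q : exists n, [/\ atlas (dch n) & cdom (dch n) q].
  have [d ad dq] := rm_cover q; have [l [_ lq ld]] := pick q (cdom d) (cdom_near ad dq).
  exists l; rewrite /dch; case: pselect => [h|[]]; last by exists d.
  by case: (cid h) => d' [ad' sd']; split=> //; exact: sd'.
pose qch n := if pselect (exists q, e n q) is left h then projT1 (cid h) else p b0.
have qchP n q : e n q -> e n (qch n).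
  move=> nq; rewrite /qch; case: pselect => [h|[]]; last by exists q.
  by case: (cid h).
pose chain s : B := foldl (fun x nm => L (dch nm.1) x (qch nm.2)) b0 s.
pose A (y : S) := exists n s, [/\ atlas (dch n), cdom (dch n) (p (chain s)), cdom (dch n) (p y) & L (dch n) (chain s) (p y) = y].
have HA y : A y.
  apply: (@connected_ind S setT A b0) => //; first exact: openT.
    by have [n [an nb]] := dchP (p b0); exists n, [::]; split=> //; exact: L2.
  move=> x _; have [n [an nx]] := dchP (p x); set d := dch n in an nx *.
  exists [set y : S | cdom d (p y) /\ L d x (p y) = y].
    apply: open_nbhs_nbhs; split; last by split=> //; exact: L2.
    by apply: (chart_open_dom (schartP (c := schart d x) _)); exists (d, x).
  move=> y' z _ _ [dy Ey] [dz Ez] [n1 [s [a1 d1s d1y E1]]]; set d1 := dch n1 in a1 d1s d1y E1.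
  have [l [_ ly lV]] := pick (p y') _ (filterI (filterI (cdom_near an dy) (cdom_near a1 d1y)) (L4 an a1 dy d1y)).
  have [[dq d1q] Eq] := lV _ (qchP l _ ly).
  have cE : chain (rcons s (n1, l)) = L d y' (qch l).
    by rewrite /chain foldl_rcons Eq -{1}E1 L3.
  exists n, (rcons s (n1, l)); rewrite -/d cE L1 //; split=> //.
  by rewrite L3 // -Ey L3.
(* The sheet of a chart through the end of a chain, restricted to a base set; the index set of
   charts, chains and base sets is countable. *)
pose St nsl : set S := [set y | [/\ cdom (dch nsl.1.1) (p y), L (dch nsl.1.1) (chain nsl.1.2) (p y) = y & e nsl.2 (p y)]].
exists (open `&` [set St nsl | nsl in [set: (nat * seq (nat * nat)) * nat]]).
  apply: (@sub_countable _ _ _ [set St nsl | nsl in setT]); first by apply: subset_card_le => U [].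
  by apply: (card_le_trans (card_image_le _ _)); exact: countableP.
split=> [U [] //|y V]; rewrite nbhsE => -[Q [oQ yQ] QV].
have [n [s [an ns ny Ey]]] := HA y; set d := dch n in an ns ny Ey.
have [l [ol ly lV]] := pick (p y) _ (oQ y yQ d an ny).
exists (St ((n, s), l)); first split; first split.
- exact: sheet_open.
- by [].
- by [].
- by move=> z [dz Ez lz]; apply: QV; rewrite -Ez -(L3 (q := p y)) // Ey; exact: lV.
Qed.

Definition scover : rmanifold R k.
Proof.
refine (@RManifold R k S satlas smetric sheeted_hausdorff sheeted_second_countable schartP _ _ _ _).
- by move=> x; have [d ad dx] := rm_cover (p x); exists (schart d x); [exists (d, x)|split=> //; exact: L2].
- by move=> c /satlasP[d [x [ad dx -> ->]]] v dv; exact: rm_metric.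
- by move=> c /satlasP[d [x [ad dx -> ->]]] i j; exact: rm_metric_smooth.
- by move=> c c' ac ac'; apply: (@iso_over id) => // y.
Defined.

Lemma equivariant_continuous (g : S -> S) : (forall y, p (g y) = p y) ->
  (forall d y q, L d (g y) q = g (L d y q)) -> continuous g.
Proof.
move=> pg gL; apply/continuousP => V; rewrite !sopenE => oV y Vy d ad dy.
by have := oV (g y) Vy d ad; rewrite pg => /(_ dy); apply: filterS => q; rewrite gL.
Qed.

Lemma scover_iso_over (g : scover -> scover) : continuous g -> (forall y, p (g y) = p y) -> isometric_map g.
Proof. by split=> // c c' ac ac'; exact: iso_over. Qed.

Lemma scover_proj_iso : isometric_map (p : scover -> N).
Proof.
split; first exact: sproj_continuous.
move=> c e ac ae; have [d [x [ad dx Ec Em]]] := satlasP ac.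
rewrite -[@metric R k scover c]/(smetric c) Em {ac Em} Ec /=.
have -> : [set v | ccod d v /\ cdom e (p (L d x (cinv d v)))] = ov d e.
  by apply/seteqP; split=> v [dv h]; have dc := cinvP ad dv; move: h; rewrite /= L1.
apply/(isometric_inP _ _ _ (ov_open noB ad ae)); have [s i] := tr_isoP noB ad ae.
have E v : ov d e v -> tr d e v = cmap e (p (L d x (cinv d v))).
  by move=> [dv _]; rewrite L1 //; exact: cinvP.
split; first exact: (msmo_ext (ov_open noB ad ae) E s).
move=> v Av; rewrite -(i v Av) -(E v Av); congr (_ *m _ *m _); last congr (_^T);
  by apply: (jac_ext (ov_open noB ad ae) Av) => y Ay; rewrite E.
Qed.

End Sheeted.

Section PathConnected.
Context {R : realType} {k : nat} {T : topologicalType}.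
Variable N : rmanifold R k.
Local Notation tpathR := (@tpath R _).
Hypothesis noB : boundary N = set0.

Lemma line_ex (i : N -> T) (d : chart R N k) (y : 'rV[R]_k) e q q' : continuous i -> atlas d -> ball y e `<=` ccod d ->
  cdom d q -> cdom d q' -> ball y e (cmap d q) -> ball y e (cmap d q') ->
  exists g : tpathR (i q) (i q'), forall t, exists v, ball y e v /\ g t = i (cinv d v).
Proof.
move=> ci ad sub dq dq' bq bq'; pose c t := cmap d q + cl t *: (cmap d q' - cmap d q).
have bc t : ball y e (c t).
  by apply: ball_segment bq _ (cl_in t); rewrite addrC subrK.
have cc : continuous c.
  by move=> t; apply: cvgD; [exact: cvg_cst|apply: cvgZr_tmp; exact: cl_continuous].
have cg : continuous (fun t => i (cinv d (c t))).
  by apply: (ccomp (f := fun t => cinv d (c t)) _ ci) => t; apply: (continuous_comp (cc t)); apply: cinv_cts => //; exact: sub.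
have [||g gE] := @path_of _ _ (i q) (i q') _ cg.
- by rewrite /c cl_le0 // scale0r addr0 cmapK.
- by rewrite /c cl_ge1 // scale1r addrC subrK cmapK.
- by exists g => t; exists (c (cl t)).
Qed.

End PathConnected.

Lemma manifold_paths (R : realType) (k : nat) (M : rmanifold R k) : boundary M = set0 -> connected [set: M] ->
  forall x y : M, exists g : @tpath R M x y, True.
Proof.
move=> noB conn x y; apply: (@connected_ind M setT (fun y => exists g : @tpath R M x y, True) x) => //; first exact: openT.
  by exists (const_path x).
move=> z _; have [d ad dz] := rm_cover z.
have /nbhs_ballP[e /= e0 sub] := ccod_near noB ad (cmapP ad dz).
exists [set q | cdom d q /\ ball (cmap d z) e (cmap d q)].
  apply: filterI; first exact: cdom_near.
  by apply: (cts_near (cmap_cts ad dz)); exact: nbhsx_ballx.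
move=> p q _ _ [dp bp] [dq bq] [g _].
have [h _] := line_ex noB (i := idfun) (fun x => @cvg_id _ _) ad sub dp dq bp bq.
by exists (concat g h).
Qed.

(** * The covering from homotopy classes and the action of the fundamental group *)

Section Cover.
Context {R : realType} {k : nat} {M : topologicalType}.
Implicit Types t : R.
Local Notation tpathR := (@tpath R _).
Local Notation arrowR := (@arrow R _).
Local Notation aoneR := (@aone R _).
Variables (N : rmanifold R k) (i : N -> M) (r : M -> N) (H : R * M -> M) (z0 : N).
Hypotheses (noB : boundary N = set0) (ci : continuous i) (cr : continuous r) (ri : forall q, r (i q) = q).
Hypothesis balls : forall d : chart R N k, atlas d -> exists (y : 'rV[R]_k) (e : R), 0 < e /\ ccod d = ball y e.
Hypotheses (cH : continuous H) (H0 : forall p, H (0, p) = p) (H1 : forall p, H (1, p) = i (r p))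
  (Hi : forall s q, H (s, i q) = i q).
Hypothesis paths : forall x y : M, exists g : tpathR x y, True.

Implicit Types (d e : chart R N k) (q : N).

Definition anyp x y : tpathR x y := projT1 (cid (paths x y)).

Definition stays d x y (g : tpathR x y) := forall t, cdom d (r (g t)) /\ i (r (g t)) = g t.

(** Both paths are seen in the chart [d], whose image is a convex ball, and the straight homotopy in
    coordinates joins them. *)
Lemma stays_uniq d x y (g h : tpathR x y) : atlas d -> stays d g -> stays d h -> cls g = cls h.
Proof.
move=> ad sg sh; apply/cls_eq; have [y0 [e [e0 cE]]] := balls ad.
pose co (g : tpathR x y) t := cmap d (r (g t)).
have cco g' : stays d g' -> continuous (co g').
  move=> s t; apply: continuous_comp; first exact: (ccomp (@pf_cts _ _ _ _ g') cr).
  by apply: cmap_cts; have [] := s t.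
have bco g' t : stays d g' -> ball y0 e (co g' t).
  by move=> s; rewrite -cE; apply: cmapP; have [] := s t.
pose K z := co g z.2 + z.1 *: (co h z.2 - co g z.2).
have bK z : ball y0 e (K (cl z.1, cl z.2)).
  by apply: ball_segment (cl_in _); rewrite ?[_ + (_ - _)]addrC ?subrK; exact: bco.
have coE g' t : stays d g' -> i (cinv d (co g' t)) = g' t.
  by move=> s; have [h1 h2] := s t; rewrite cmapK.
apply: (@hom_intro _ _ _ _ _ _ (fun z => i (cinv d (K z)))).
- apply: (ccomp (f := fun z : R * R => cinv d (K (cl z.1, cl z.2))) _ ci) => z.
  apply: (@continuous_comp _ _ _ (fun z : R * R => K (cl z.1, cl z.2)) (cinv d)); last by apply: cinv_cts => //; rewrite cE.
  move: z; apply: continuous_clcl; have c1 := ccomp (@csnd R R) (cco g sg); have c2 := ccomp (@csnd R R) (cco h sh).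
  by move=> z; apply: cvgD; [exact: c1|apply: cvgZ; [exact: cvg_fst|apply: cvgB; [exact: c2|exact: c1]]].
- by move=> t _; rewrite /K scale0r addr0 scale1r [_ + (_ - _)]addrC subrK !coE.
- move=> s _; rewrite /K /co (pf_l g (lexx 0)) (pf_l h (lexx 0)) (pf_r g (lexx 1)) (pf_r h (lexx 1)) !subrr !scaler0 !addr0.
  have [a1 a2] := sg 0; have [b1 b2] := sg 1; rewrite (pf_l g (lexx 0)) in a1 a2; rewrite (pf_r g (lexx 1)) in b1 b2.
  by rewrite !cmapK.
Qed.

(** The class of the paths within the domain of [d], unique by [stays_uniq]; the default occurs only
    for points that no such path joins. *)
Definition lin d q q' : arrowR (i q) (i q') :=
  if pselect (exists g : tpathR (i q) (i q'), stays d g) is left h then cls (projT1 (cid h)) else cls (anyp _ _).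

Lemma linE d q q' (g : tpathR (i q) (i q')) : atlas d -> stays d g -> lin d q q' = cls g.
Proof.
move=> ad sg; rewrite /lin; case: pselect => [h|[]]; last by exists g.
exact: stays_uniq _ (projT2 (cid h)) _.
Qed.

Lemma stays_ex d q q' : atlas d -> cdom d q -> cdom d q' -> exists g : tpathR (i q) (i q'), stays d g.
Proof.
move=> ad dq dq'; have [y [e [e0 cE]]] := balls ad.
have sub : ball y e `<=` ccod d by rewrite cE.
have bq p : cdom d p -> ball y e (cmap d p) by rewrite -cE; exact: cmapP.
have [g gP] := line_ex noB ci ad sub dq dq' (bq _ dq) (bq _ dq').
by exists g => t; have [v [bv ->]] := gP t; rewrite ri; split=> //; apply: cinvP => //; exact: sub.
Qed.

Lemma stays_near d e q : atlas d -> atlas e -> cdom d q -> cdom e q ->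
  \forall q' \near q, exists g : tpathR (i q) (i q'), stays d g /\ stays e g.
Proof.
move=> ad ae dq eq1; have vq := cmapP ad dq.
have : \forall v \near cmap d q, ccod d v /\ cdom e (cinv d v).
  apply: filterI; first exact: ccod_near.
  by apply: (cts_near (cinv_cts noB ad vq)); rewrite cmapK //; exact: cdom_near.
case/nbhs_ballP => dl /= dl0 sub.
have n2 : \forall q' \near q, ball (cmap d q) dl (cmap d q').
  by apply: (cts_near (cmap_cts ad dq)); exact: nbhsx_ballx.
apply: filterS2 (cdom_near ad dq) n2 => q' dq' bq'.
have [g gP] := line_ex noB ci ad (fun v bv => (sub v bv).1) dq dq' (ballxx _ dl0) bq'.
by exists g; split=> t; have [v [bv ->]] := gP t; rewrite ri; have [h1 h2] := sub v bv; split=> //; exact: cinvP.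
Qed.

Definition ctype := {q : N & arrowR (i z0) (i q)}.
Definition cproj (x : ctype) : N := projT1 x.
Definition clift d (x : ctype) q : ctype := existT _ q (amul (projT2 x) (lin d (cproj x) q)).

Lemma clift1 d x q : atlas d -> cdom d (cproj x) -> cdom d q -> cproj (clift d x q) = q.
Proof. by []. Qed.

Lemma clift2 d x : atlas d -> cdom d (cproj x) -> clift d x (cproj x) = x.
Proof.
case: x => q A ad dq; rewrite /clift (@linE d q q (const_path (i q))) ?amulX1 //.
by move=> t; rewrite ri.
Qed.

Lemma clift3 d x q q' : atlas d -> cdom d (cproj x) -> cdom d q -> cdom d q' -> clift d (clift d x q) q' = clift d x q'.
Proof.
case: x => q0 A ad d0 dq dq'; rewrite /clift /= amulA.
suff -> : amul (lin d q0 q) (lin d q q') = lin d q0 q' by [].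
have [g sg] := stays_ex ad d0 dq; have [h sh] := stays_ex ad dq dq'.
rewrite (linE ad sg) (linE ad sh) amul_cls -(linE ad) // => t; rewrite concatE /loop_concat.
by case: ifP.
Qed.

Lemma clift4 d e x : atlas d -> atlas e -> cdom d (cproj x) -> cdom e (cproj x) ->
  \forall q \near cproj x, clift d x q = clift e x q.
Proof.
move=> ad ae dx ex; apply: filterS (stays_near ad ae dx ex) => q [g [sd se]].
by rewrite /clift (linE ad sd) (linE ae se).
Qed.

Local Notation S := (sheeted cproj clift).
Definition cbase : ctype := existT _ z0 (aoneR (i z0)).

Lemma ctype_ext q q' (g : tpathR (i z0) (i q)) (h : tpathR (i z0) (i q')) : q = q' -> (forall t, g t = h t) ->
  existT _ q (cls g) = existT _ q' (cls h) :> ctype.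
Proof. by move=> E; case: q' / E h => h gh; congr existT; apply/cls_eq; exact: hom_ext. Qed.

(** A class is joined to the base point by the curve of classes of its initial segments. These must
    end in N, so the path is first replaced by its retraction to N, which H shows to be homotopic to
    it. *)
Lemma cover_connected : connected [set: S].
Proof.
suff HC x : exists A : set S, [/\ connected A, A cbase & A x].
  have -> : [set: S] = \bigcup_(x in [set: S]) projT1 (cid (HC x)).
    by apply/seteqP; split=> // x _; exists x; have [] := projT2 (cid (HC x)).
  apply: bigcup_connected => [|x _]; last by have [] := projT2 (cid (HC x)).
  by exists cbase => x _; have [] := projT2 (cid (HC x)).
case: x => q A0; have [g0 ->] := cls_ex A0.
have cir : continuous (fun t => i (r (g0 t))) by exact: ccomp (ccomp (@pf_cts _ _ _ _ g0) cr) _.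
have [||g gE] := @path_of _ _ (i z0) (i q) _ cir; [by rewrite pf_l // ri|by rewrite pf_r // ri|].
have gg t : g t = i (r (g0 t)) by rewrite gE path_cl.
have irg t : i (r (g t)) = g t by rewrite gg ri.
have -> : cls g0 = cls g.
  apply/cls_eq; exists (fun z => H (z.1, g0 z.2)); split=> [|t|t|s t t0|s t t1] /=; rewrite ?gg //.
  - by apply: (ccomp (f := fun z => (z.1, g0 z.2)) _ cH); apply: continuous_prod_fun; [exact: cfst|exact: ccomp (@csnd _ _) (@pf_cts _ _ _ _ g0)].
  - by rewrite pf_l.
  - by rewrite pf_r.
have seg s t x y : g s = x -> g t = y -> exists h : tpathR x y, forall u, h u = g (s + (t - s) * cl u).
  move=> gsx gty.
  have cs : continuous (fun u : R => g ((t - s) * u + s)) by apply: ccomp; [apply: caff; exact: cid1|exact: pf_cts].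
  have [||h hE] := @path_of _ _ x y _ cs; [by rewrite mulr0 add0r|by rewrite mulr1 subrK|].
  by exists h => u; rewrite addrC.
have part s : exists h : tpathR (i z0) (i (r (g s))), forall u, h u = g (s * cl u).
  have cs : continuous (fun u : R => g (s * u + 0)) by apply: ccomp; [apply: caff; exact: cid1|exact: pf_cts].
  have [||h hE] := @path_of _ _ (i z0) (i (r (g s))) _ cs; [by rewrite mulr0 pf_l|by rewrite mulr1 addr0|].
  by exists h => u; rewrite hE addr0.
pose gs s := projT1 (cid (part s)); have gsE s u : gs s u = g (s * cl u) := projT2 (cid (part s)) u.
pose c s : S := existT _ (r (g s)) (cls (gs s)).
(* For t near s, the part of g between them stays in one chart, so that [c t] is the lift of [c s]
   along the sheet; this is continuity in the sheeted topology. *)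
have cc : continuous c.
  move=> s V; rewrite nbhsE => -[W [oW Ws] WV]; have [d ad ds] := rm_cover (r (g s)).
  have crg0 : continuous (fun t => r (g t)) := ccomp (@pf_cts _ _ _ _ g) cr.
  have crg : {for s, continuous (fun t => r (g t))} by exact: crg0.
  have nW : \forall q' \near r (g s), W (clift d (c s) q') by exact: (oW (c s) Ws d ad ds).
  have n1 : \forall t \near s, W (clift d (c s) (r (g t))) by exact: cts_near _ nW.
  have /near_itv[e e0 He] : \forall t \near s, cdom d (r (g t)) by exact: cts_near _ (cdom_near ad ds).
  have n2 := near_norm s e0.
  have n3 : \forall t \near s, V (c t).
    apply: filterS2 n1 n2 => t Wt st; apply: WV; move: Wt; congr (W _).
    rewrite /clift /=; congr existT.
    have [h hE] := seg s t _ _ (esym (irg s)) (esym (irg t)).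
    rewrite (@linE d _ _ h) // => [|u]; last first.
      rewrite hE; split=> //; apply: He; rewrite opprD addrA subrr add0r normrN normrM.
      apply: le_lt_trans st; rewrite distrC ler_piMr // ger0_norm; by have /andP[] := cl_in u.
    rewrite amul_cls; apply/cls_eq.
    (* The concatenation of g up to s with g from s to t, as a parameter of g; it has the same ends
       as the direct parameter from 0 to t and is deformed to it. *)
    pose a u := s * cl (2 * u + 0) + (t - s) * cl (2 * u + -1).
    apply: (@hom_straight _ _ _ _ g _ _ a (fun u => t * u + 0)); first exact: pf_cts.
    + have c1 b : continuous (fun u : R => cl (2 * u + b)) by apply: ccomp; [apply: caff; exact: cid1|exact: cl_continuous].
      by move=> u; apply: cvgD; apply: cvgMr; exact: c1.
    + by apply: caff; exact: cid1.
    + move=> u _; rewrite /a !mulr1 !addr0 !mulr0 (cl_le0 (lexx 0)) cl_le0 // cl_ge1 ?ler1n // cl_ge1; last by lra.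
      rewrite !mulr0 !addr0 mulr0 pf_l // irg; split=> //; congr (g _); ring.
    + move=> u /andP[u0 u1]; rewrite concatE /loop_concat /a; case: (leP u 2^-1) => hu.
        rewrite (cl_le0 (t := 2 * u + -1)) ?mulr0 ?addr0 //; lra.
      by rewrite cl_ge1 ?mulr1 //; lra.
    + by move=> u uI; rewrite gsE addr0 cl_id.
  exact: n3.
exists (range c); split.
- by apply: connected_continuous_connected; [exact: connected_R|exact: continuous_subspaceT].
- exists 0 => //; apply: ctype_ext => [|t]; first by rewrite pf_l.
  by rewrite gsE mul0r pf_l.
- exists 1 => //; apply: ctype_ext => [|t]; first by rewrite pf_r.
  by rewrite gsE mul1r path_cl.
Qed.

Definition pi1_cover : rmanifold R k := scover cbase noB clift1 clift2 clift3 clift4 cover_connected.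

Section Action.
Variable x0 : M.
Definition sg : arrowR x0 (i z0) := cls (anyp _ _).

Definition larr (a : R -> M) : arrowR x0 x0 :=
  if pselect (exists g : tpathR x0 x0, forall t, g t = a (cl t)) is left h then cls (projT1 (cid h)) else aoneR x0.

Lemma larrE (a : R -> M) (g : tpathR x0 x0) : (forall t, g t = a (cl t)) -> larr a = cls g.
Proof.
move=> ga; rewrite /larr; case: pselect => [h|[]]; last by exists g.
by apply/cls_eq; apply: hom_ext => t; rewrite (projT2 (cid h)).
Qed.

Lemma within_comp (S1 S2 S3 : topologicalType) (A : set S2) (f : S1 -> S2) (g : S2 -> S3) :
  continuous f -> (forall x, A (f x)) -> {within A, continuous g} -> continuous (fun x => g (f x)).
Proof.
move=> cf Af /subspace_continuousP cg x V nV; have h := cg (f x) (Af x) V nV.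
have h2 : \forall y \near x, A (f y) -> V (g (f y)) by exact: cf x _ h.
have h3 : \forall y \near x, V (g (f y)) by apply: filterS h2 => y; apply.
exact: h3.
Qed.

Lemma loop_path (a : R -> M) : is_loop x0 a -> exists g : tpathR x0 x0, forall t, g t = a (cl t).
Proof.
move=> [ca a0 a1].
have cac : continuous (fun t => a (cl t)).
  by apply: within_comp cl_continuous _ ca => t; exact: cl_in.
have [||g gE] := @path_of _ _ x0 x0 _ cac; [by rewrite cl_le0|by rewrite cl_ge1|].
by exists g => t; rewrite gE (cl_id (cl_in t)).
Qed.

(** The class of a loop at x0, moved to the base point of the covering along a fixed path; since it
    multiplies from the left, the end point, and hence the projection, is preserved. *)
Definition conj (a : R -> M) : arrowR (i z0) (i z0) := amul (ainv sg) (amul (larr a) sg).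
Definition act (a : R -> M) (x : ctype) : ctype := existT _ (cproj x) (amul (conj a) (projT2 x)).

Lemma cover_pi1_quotient : pi1_quotient x0 (act : (R -> M) -> pi1_cover -> pi1_cover) (cproj : pi1_cover -> N).
Proof.
have homE a b : is_loop x0 a -> is_loop x0 b -> loop_homotopic x0 a b <-> larr a = larr b.
  move=> la lb; have [g ga] := loop_path la; have [h hb] := loop_path lb.
  rewrite (larrE ga) (larrE hb) cls_eq; split=> [[K [cK K0 K1]]|[K [cK K0 K1 Kl Kr]]].
    apply: (@hom_intro _ _ _ _ _ _ K) => [|t tI|//]; last by rewrite ga hb cl_id //; exact: K0.
    have cc : continuous (fun z : R * R => (cl z.1, cl z.2)).
      by apply: continuous_prod_fun; [exact: ccomp (@cfst _ _) cl_continuous|exact: ccomp (@csnd _ _) cl_continuous].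
    by apply: (within_comp cc _ cK) => z; split; exact: cl_in.
  exists K; split=> [|t tI|s _]; first exact: continuous_subspaceT.
    by rewrite K0 K1 ga hb cl_id.
  by rewrite Kl // Kr.
have cst_loop : is_loop x0 ((fun=> x0) : R -> M) by split=> //; exact: cst_continuous.
have larr1 : larr (fun=> x0) = aoneR x0 by apply: larrE.
have larrM a b : is_loop x0 a -> is_loop x0 b -> larr (loop_concat a b) = amul (larr a) (larr b).
  move=> la lb; have [g ga] := loop_path la; have [h hb] := loop_path lb.
  rewrite (larrE ga) (larrE hb) amul_cls; apply: larrE => t.
  rewrite -path_cl concatE /loop_concat; have /andP[t0 t1] := cl_in t.
  by case: (leP (cl t) 2^-1) => ht; rewrite ?ga ?hb cl_id //; lra.
(* Freeness: a class can be cancelled from the right, so a fixed point forces the loop to be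
   trivial. *)
have act_eq a x : act a x = x -> larr a = aoneR x0.
  case: x => q A E; have := projT2_eq E; rewrite (Prop_irrelevance (projT1_eq E) erefl) /= => EA.
  have cj : conj a = aoneR (i z0) by rewrite -[LHS]amulX1 -(amulV A) -amulA EA.
  have -> : larr a = amul sg (amul (conj a) (ainv sg)).
    by rewrite !amulA amulV amulX1 -amulA amulV amul1.
  by rewrite cj amul1 amulV.
have act_cts a : continuous (act a : S -> S).
  apply: equivariant_continuous => // d y q; rewrite /act /clift /cproj /=.
  by rewrite amulA.
split.
- split; last by move=> a _; exact: scover_iso_over.
  split=> [a b la lb /(homE a b la lb) E x|x|a b la lb x]; first by rewrite /act /conj E.
    by case: x => q A; rewrite /act /conj larr1 amul1 amulVX amul1.
  rewrite /act /conj larrM //=; congr existT; rewrite !amulA; congr (amul _ (amul _ _)).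
  by rewrite -[RHS]amulA amulV amul1.
- move=> x; have [d ad dx] := rm_cover (cproj x).
  exists [set y | cdom d (cproj y) /\ clift d x (cproj y) = y]; split.
  + have ac : @atlas R k pi1_cover (schart cproj clift d x) by exists (d, x).
    exact: chart_open_dom (rm_chart ac).
  + by split=> //; exact: clift2.
  + move=> a la [y [_ Ey] [_ Eay]].
    have E : act a y = y by exact: etrans _ Ey.
    have [_ h] := homE a ((fun=> x0) : R -> M) la cst_loop; apply: h; rewrite larr1; exact: act_eq E.
- split=> [q|V]; first by exists (existT _ q (cls (anyp _ _))).
  have cp : continuous (cproj : S -> N) by exact: sproj_continuous.
  split=> [oV|oV]; first by move/continuousP: cp; apply.
  rewrite openE => q Vq; have [d ad dq] := rm_cover q.
  exact: (oV (existT _ q (cls (anyp _ _)) : S) Vq d ad dq).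
- move=> [q A] [q' A']; split=> [E|[a _ <-]] //; rewrite /= in E; case: q' / E A' => A'.
  (* The class that carries A to A': their quotient, a loop at the base point of the covering, moved
     back to x0. *)
  pose X := amul sg (amul A' (amul (ainv A) (ainv sg))).
  have lX : larr (rep X) = X by rewrite -[RHS]repK; apply: larrE => t; rewrite path_cl.
  exists (rep X); first by split; [apply: continuous_subspaceT; exact: pf_cts|exact: pf_l|exact: pf_r].
  rewrite /act /conj lX /=; congr existT; rewrite !amulA -[amul (ainv sg) (amul sg _)]amulA amulVX amul1.
  by rewrite -[amul (ainv sg) (amul sg A)]amulA amulVX amul1 amulVX amulX1.
- exact: scover_proj_iso.
Qed.

End Action.
End Cover.

(** * The splitting *)

Section Splitting.
Context {R : realType}.
Variable M : rmanifold R (1 + 2).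
Hypotheses (noB : boundary M = set0) (complete : rcomplete M) (conn : connected [set: M]).
Variables (lambda m kappa : R) (X : chart R M (1 + 2) -> 'rV[R]_(1 + 2) -> 'rV[R]_(1 + 2)) (u w : M -> R).
Hypotheses (m0 : 0 < m) (k0 : 0 <= kappa) (KX : killing_field X).
Hypotheses (Wu : Wspace M lambda m u) (Ww : Wspace M lambda m w) (u0 : forall p, 0 < u p).
Hypothesis XG : forall c x, atlas c -> ccod c x -> X c x *m @metric R (1 + 2) M c x = (xi u w c x)^T.
Hypotheses (Dw : forall p, XD X w p = u p) (Du : forall p, XD X u p = kappa * w p).
Hypothesis q0 : forall p, 0 < u p ^+ 2 - kappa * w p ^+ 2.

Local Notation N := (slice noB complete KX Ww u0 Dw).
Local Notation f := (@slice_fun _ _ _ noB complete _ _ _ _ _ KX Ww u0 Dw).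
Local Notation Phi := (@slice_map _ _ _ noB complete _ _ _ _ _ KX Ww u0 Dw).
Local Notation r := (slice_proj noB complete k0 KX Wu Ww u0 Dw Du q0).
Local Notation tau := (slice_time kappa u w).

Lemma slice_warped_product : @warped_product R 2 1 N f line M Phi.
Proof.
split; first exact: slice_map_quotient _ _ _ _ _ _ _ q0.
- move=> b y b' y'; split=> [E|[<- [f0|<-]]] //.
    have [r1 t1] := slice_mapK k0 Wu Du q0 b y; have [r2 t2] := slice_mapK k0 Wu Du q0 b' y'.
    by split; [rewrite -r1 E|right; rewrite -t1 E].
  by have := u0 (val b); rewrite -[u _]/(f b) f0 ltxx.
- move=> d l e ad /= -> ae; have [_ [c a]] := ad.
  have := smap_swap_iso k0 Wu XG Du ad a ae.
  congr (isometric_in _ _ _ _); apply/seteqP; split=> [z [dz ez]|z [dz _ _ ez]]; split=> //.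
  by rewrite gt_eqF //; exact: u0.
Qed.

(** For a surface with [m + 1] in place of m, two independent solutions give the Ricci constant
    [lambda / (m + 2)], which is the one assumed in [slice_einstein] for [k = 2]. *)
Lemma slice_W_line : ~ einstein M ->
  Wspace N lambda (m + 1) = [set (fun b => a * f b) | a in [set: R]].
Proof.
move=> nE; have noBN := slice_no_boundary noB complete KX Ww u0 Dw.
have m10 : 0 < m + 1 by rewrite addr_gt0.
have Wf := slice_fun_W noB complete m0 k0 KX Wu Ww u0 XG Dw Du.
have f0 b : 0 < f b by exact: u0.
apply/seteqP; split=> [g Wg|g [a _ <-]]; last first.
  have := W_comb noBN a 0 Wf Wf; congr (Wspace _ _ _ _).
  by apply/funext => b; rewrite mul0r addr0.
(* On an empty N all functions are equal and any multiple of f serves. *)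
have [[b _]|nb] := pselect (exists b : N, True); last first.
  by exists 0 => //; apply/funext => b; case: nb.
have [||a Ea] := @not_indep2 _ _ f g; first by exists b; rewrite gt_eqF.
  move=> ind; apply: nE; apply: (slice_einstein m0 k0 Wu XG Du q0) => d ad x dx.
  have connN : connected [set: N] by exact: (slice_connected conn k0 Wu Du q0).
  rewrite (@einstein_of_independent _ 1 N noBN connN lambda (m + 1) f m10 Wf f0 (pair_fun f g) isT _ ind d x ad dx).
    by congr (_ *: _); rewrite -?addrA; ring.
  by move=> i; rewrite /pair_fun; case: eqP.
by exists a => //; apply/funext => b'.
Qed.

Lemma slice_pi1_quotient (p0 : M) : exists (B : rmanifold R 2) (p : B -> N), connected [set: B] /\
  (forall x0 : M, exists act : (R -> M) -> B -> B, pi1_quotient x0 act p).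
Proof.
pose i (b : N) : M := val (b : zeros w).
(* The deformation retraction flows each point back to the slice in unit time; points of the slice
   have [tau = 0] and rest. *)
pose H z : M := Theta X (- (z.1 * tau z.2)) z.2.
have noBN := slice_no_boundary noB complete KX Ww u0 Dw.
have ri b : r (i b) = b.
  have [h _] := slice_mapK k0 Wu Du q0 b 0.
  by rewrite -[RHS]h /slice_map Theta0.
have ti b : tau (i b) = 0.
  by have [_ h] := slice_mapK k0 Wu Du q0 b 0; move: h; rewrite /slice_map Theta0.
have ci : continuous i by exact: subspace_val_continuous.
have cr : continuous r by exact: slice_proj_continuous.
have cH : continuous H.
  move=> z; have ct : continuous tau by exact: (slice_time_continuous noB k0 Wu Ww u0 q0).
  apply: (@continuous_comp _ _ _ (fun z : R * M => (- (z.1 * tau z.2), z.2)) (fun z => Theta X z.1 z.2)).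
    apply: continuous_pair; last exact: cvg_snd.
    apply: cvgN; apply: cvgM; first exact: cvg_fst.
    by apply: continuous_comp; [exact: cvg_snd|exact: ct].
  exact: Theta_continuous.
have H0 p : H (0, p) = p by rewrite /H mul0r oppr0 Theta0.
have H1 p : H (1, p) = i (r p) by rewrite /H mul1r.
have Hi s q : H (s, i q) = i q by rewrite /H ti mulr0 oppr0 Theta0.
have balls (d : chart R N 2) : atlas d -> exists (y : 'rV[R]_2) (e : R), 0 < e /\ ccod d = ball y e.
  by move=> [_ [c [_ [y [e [e0 E]]] _ _ _]]]; exists y, e.
have paths := manifold_paths noB conn.
exists (pi1_cover (r p0) noBN ci cr ri balls cH H0 H1 Hi paths), (@cproj _ _ _ _ _ _); split.
  exact: cover_connected.
move=> x0; exists (act paths x0); exact: cover_pi1_quotient.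
Qed.

End Splitting.

Theorem corollary1 (R : realType) (lambda m : R) (hm : 0 < m)
    (M : rmanifold R 3)
    (M_no_boundary : boundary M = set0)
    (M_conn : connected [set: M])
    (M_complete : rcomplete M)
    (hu : exists2 u : M -> R, Wspace M lambda m u & forall x, 0 < u x)
    (M_nEinstein : ~ einstein M) :
  (exists2 d : nat, (d <= 2)%N & has_dim (Wspace M lambda m) d) /\
  (has_dim (Wspace M lambda m) 2 ->
   exists (B N : rmanifold R 2) (F : rmanifold R 1) (p : B -> N)
     (f : N -> R) (Phi : N * F -> M) (mu : R),
     [/\ connected [set: B] /\
           (forall x0 : M, exists act : (R -> M) -> B -> B,
              pi1_quotient x0 act p),
         warped_product f Phi,
         [/\ Wspace N lambda (m + 1) f, forall b, 0 <= f b &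
             [set b | f b = 0] = boundary N],
         Wspace N lambda (m + 1) =
           [set (fun b => a * f b) | a in [set: R]] &
         [/\ mu_const lambda (m + 1) f mu,
             space_form F,
             has_dim (Wspace F mu m) 2 &
             Wspace M lambda m =
               [set w | exists2 v : F -> R, Wspace F mu m v &
                  forall b y, w (Phi (b, y)) = f b * v y]]]).
Proof.
have [u0 Wu0 u0p] := hu; split.
  apply: (has_dim_le2 (W_zero M_no_boundary Wu0)) => w Ww ind.
  apply: M_nEinstein; exists (2%:R * lambda / (m + 2%:R)) => c ac x cx.
  exact: (@einstein_of_independent _ 2 M M_no_boundary M_conn _ _ _ hm Wu0 u0p w isT Ww ind).
case=> b [Wb ind sp].
have span w : Wspace M lambda m w -> exists al be : R, forall p, w p = al * b 0 p + be * b 1 p.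
  move=> /sp[a E]; exists (a 0), (a 1) => p; rewrite E !big_ord_recl big_ord0 addr0.
  by congr (_ + a _ * b _ p); exact: val_inj.
have ind2 al be : (forall p, al * b 0 p + be * b 1 p = 0) -> al = 0 /\ be = 0.
  move=> h; have K := ind (fun i => if i == 0 then al else be) _.
  split; [apply: (K _ 0)|apply: (K _ 1)] => p; rewrite !big_ord_recl big_ord0 addr0 -(h p);
    by congr (_ + _ * b _ p); exact: val_inj.
(* An empty manifold is Einstein vacuously, so M has a point. *)
have [p0 _] : exists p : M, True.
  apply: contrapT => nM; apply: M_nEinstein; exists 0 => c ac x cx.
  by case: nM; exists (cinv c x).
have KX := Xf_killing M_no_boundary (Wb 0) (Wb 1).
have [kappa [u [w [[Wu Ww k0 up] [Dw Du J xiE sp2]]]]] :=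
  adapted_basis M_no_boundary M_complete M_conn (Wb 0) (Wb 1) Wu0 u0p span ind2 p0.
have XG c x : atlas c -> ccod c x -> Xf (b 0) (b 1) c x *m @metric R 3 M c x = (xi u w c x)^T.
  by move=> ac cx; rewrite Xf_G // xiE.
have q0 p : 0 < u p ^+ 2 - kappa * w p ^+ 2.
  rewrite J.
  have hW := Wr_gt0 M_no_boundary M_complete M_conn (Wb 0) (Wb 1) Wu0 u0p span ind2.
  exact: hW.
have [B [pi [cB qB]]] := @slice_pi1_quotient _ M M_no_boundary M_complete M_conn _ _ _ _ _ _ k0 KX Wu Ww up Dw Du q0 p0.
pose N := @slice R 2 M M_no_boundary M_complete _ _ _ _ _ KX Ww up Dw.
pose f : N -> R := @slice_fun R 2 M M_no_boundary M_complete _ _ _ _ _ KX Ww up Dw.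
(* The constant [- (m * kappa)] is the value of [mu] that turns the fibre equation into
   [v'' = kappa v]. *)
exists B, N, line, pi, f, (@slice_map R 2 M M_no_boundary M_complete _ _ _ _ _ KX Ww up Dw), (- (m * kappa)).
split.
- by [].
- exact: (@slice_warped_product _ M M_no_boundary M_complete _ _ _ _ _ _ k0 KX Wu Ww up XG Dw Du q0).
- split; first exact: (@slice_fun_W _ 2 M M_no_boundary M_complete _ _ _ _ _ _ hm k0 KX Wu Ww up XG Dw Du).
    by move=> y; apply: ltW; exact: up.
  rewrite slice_no_boundary; apply/seteqP; split=> // y /= fy.
  by have := up (val y); rewrite -[u _]/(f y) fy ltxx.
- exact: (@slice_W_line _ M M_no_boundary M_complete M_conn _ _ _ _ _ _ hm k0 KX Wu Ww up XG Dw Du q0).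
- split; [|exact: line_space_form|exact: line_has_dim|].
    exact: slice_mu.
  exact: slice_W_factor.
Qed.
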